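(* Let $(H,\langle\cdot,\cdot\rangle_H,\|\cdot\|_H)$ and $(U,\langle\cdot,\cdot\rangle_U,\|\cdot\|_U)$ be separable $\mathbb R$-Hilbert spaces, let $\mathbb H\subseteq H$ be a non-empty orthonormal basis of $H$, let $T,\iota\in(0,\infty)$, let $(\Omega,\mathcal F,\mathbb P)$ be a probability space with a normal filtration $(\mathcal F_t)_{t\in[0,T]}$, let $(W_t)_{t\in[0,T]}$ be an $\operatorname{Id}_U$-cylindrical $(\Omega,\mathcal F,\mathbb P,(\mathcal F_t)_{t\in[0,T]})$-Wiener process, let $\lambda\colon\mathbb H\to\mathbb R$ satisfy $\sup_{h\in\mathbb H}\lambda_h<0$, let $A\colon D(A)\subseteq H\to H$ be the linear operator with $D(A)=\{v\in H\colon\sum_{h\in\mathbb H}|\lambda_h\langle h,v\rangle_H|^2<\infty\}$ and $Av=\sum_{h\in\mathbb H}\lambda_h\langle h,v\rangle_Hh$ for $v\in D(A)$, let $(H_r,\langle\cdot,\cdot\rangle_{H_r},\|\cdot\|_{H_r})$, $r\in\mathbb R$, be a family of interpolation spaces associated to $-A$, let $\gamma\in\mathbb R$, $\alpha\in[0,1)$, $\beta\in[0,\frac12)$, $\chi\in[\beta,\frac12)$, $F\in C(H_\gamma,H_{\gamma-\alpha})$, $B\in C(H_\gamma,\mathrm{HS}(U,H_{\gamma-\beta}))$ satisfy for all bounded sets $S\subseteq H_\gamma$ that $|F|_S|_{\mathcal C^1(S,\|\cdot\|_{H_{\gamma-\alpha}})}+|B|_S|_{\mathcal C^1(S,\|\cdot\|_{\mathrm{HS}(U,H_{\gamma-\beta})})}<\infty$,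 let $\mathbb H_N\subseteq\mathbb H$, $N\in\mathbb N_0$, be sets which satisfy $\mathbb H_0=\mathbb H$ and $\sup_{N\in\mathbb N}N^\iota\sup(\{1/|\lambda_h|\colon h\in\mathbb H\setminus\mathbb H_N\}\cup\{0\})<\infty$, let $P_N\in L(H_{\min\{0,\gamma-1\}})$, $N\in\mathbb N_0$, and $\mathscr P_N\in L(U)$, $N\in\mathbb N_0$, be bounded linear operators which satisfy for all $N\in\mathbb N_0$, $v\in H$ that $P_N(v)=\sum_{h\in\mathbb H_N}\langle h,v\rangle_Hh$, and let $X^N\colon[0,T]\times\Omega\to H_\gamma$, $N\in\mathbb N_0$, be $(\mathcal F_t)_{t\in[0,T]}$-adapted stochastic processes with continuous sample paths which satisfy for all $N\in\mathbb N_0$, $t\in[0,T]$ that $\mathbb P$-a.s. $$X^N_t=e^{tA}P_NX^0_0+\int_0^te^{(t-s)A}P_NF(X^N_s)\,ds+\int_0^te^{(t-s)A}P_NB(X^N_s)\mathscr P_N\,dW_s.$$ Let $\vartheta\in(0,\min\{1-\alpha,\frac12-\beta\})$, assume that $\mathbb P(X^0_0\in H_{\gamma+\vartheta})=1$, and assume for all non-empty bounded sets $S\subseteq H_\gamma$ that $$\sup_{N\in\mathbb N}\sup_{v\in S}\Bigl[\frac{\|B(v)\mathscr P_N\|_{\mathrm{HS}(U,H_{\gamma-\beta})}+N^{\iota\vartheta}\|B(v)(\mathscr P_0-\mathscr P_N)\|_{\mathrm{HS}(U,H_{\gamma-\chi})}}{1+\|v\|_{H_\gamma}}\Bigr]<\infty.$$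 Then for all $\delta\in[0,\vartheta)$, $\varepsilon\in(0,\infty)$ it holds that $$\mathbb P\Bigl(\sup_{N\in\mathbb N}\bigl[N^{\iota(\vartheta-\delta-\varepsilon)}\|X^0-X^N\|_{\mathcal C^\delta([0,T],\|\cdot\|_{H_\gamma})}\bigr]<\infty\Bigr)=1.$$
   Context: $\mathbb N=\{1,2,\dots\}$, $\mathbb N_0=\mathbb N\cup\{0\}$. Interpolation spaces associated to $-A$: for $r\ge0$, $H_r=D((-A)^r)$ with $\langle u,v\rangle_{H_r}=\langle(-A)^ru,(-A)^rv\rangle_H$; for $r<0$, $H_r$ is the completion of $H$ with respect to the norm $\|(-A)^rv\|_H$. Thus $H_r\subseteq H_s$ for $r\ge s$, and the semigroup $e^{tA}$, $t\ge0$, acts on every $H_r$ (by restriction/extension). $\mathrm{HS}(U,V)$ is the Hilbert space of Hilbert-Schmidt operators from $U$ to $V$; $L(V)$ denotes the bounded linear operators on $V$; $C(V_1,V_2)$ denotes the continuous functions from $V_1$ to $V_2$. A normal filtration is right-continuous with $\mathcal F_0$ containing all $\mathbb P$-null sets of $\mathcal F$. For a metric space $(M,d)$, a normed space $(V,\|\cdot\|)$, $r\in[0,1]$, $f\colon M\to V$: $|f|_{\mathcal C^r(M,\|\cdot\|)}=\sup(\{\|f(x)-f(y)\|/d(x,y)^r\colon x\ne y\}\cup\{0\})\in[0,\infty]$ and $\|f\|_{\mathcal C^r(M,\|\cdot\|)}=\sup(\{\|f(x)\|\colon x\in M\}\cup\{0\})+|f|_{\mathcal C^r(M,\|\cdot\|)}$.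 Subsets of $H_\gamma$ carry the metric induced by $\|\cdot\|_{H_\gamma}$, so $|\cdot|_{\mathcal C^1}$ is the Lipschitz seminorm. Norms of processes in $\mathcal C^\delta([0,T],\|\cdot\|_{H_\gamma})$ are taken for each sample path. *)

(* Defs.v *)
From HB Require Import structures.
From mathcomp Require Export all_boot all_order all_algebra.
From mathcomp Require Export all_classical all_reals all_analysis.
From mathcomp Require Export measurable_realfun.
Export Order.TTheory GRing.Theory Num.Theory.
Export numFieldNormedType.Exports.

Set Implicit Arguments.
Unset Strict Implicit.
Unset Printing Implicit Defensive.

#[global] Open Scope classical_set_scope.
#[global] Open Scope ring_scope.

HB.mixin Record NormedModule_isHilbert (R : realType) V
    of CompleteNormedModule R V := {
  inner : V -> V -> R;
  innerC : forall x y, inner x y = inner y x;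
  inner_linear : forall (a : R) x y z,
    inner (a *: x + y) z = a * inner x z + inner y z;
  inner_norm : forall x, inner x x = `|x| ^+ 2 }.

#[short(type="hilbertType")]
HB.structure Definition Hilbert (R : realType) :=
  {V of NormedModule_isHilbert R V & CompleteNormedModule R V}.

Definition separable (V : topologicalType) :=
  exists2 D : set V, countable D & dense D.

Definition bounded_operator (R : realType) (V V' : normedModType R)
  (L : V -> V') := linear L /\ continuous L.

(* Unconditional convergence of the sum of [f] over [I] to [l]. *)
Definition has_sum (R : realType) (T : choiceType) (V : normedModType R)
    (I : set T) (f : T -> V) (l : V) :=
  forall e : R, 0 < e ->
    exists2 F0, fsets I F0 &
      forall F, fsets I F -> F0 `<=` F -> `|l - \sum_(i \in F) f i| < e.

Definition orthonormal_basis (R : realType) (V : hilbertType R) (b : set V) :=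
  (forall h k, b h -> b k -> inner h k = (h == k)%:R) /\
  (forall v, has_sum b (fun h => inner h v *: h) v).

(* The diagonal operator [v |-> \sum_(h in HH) phi h <h, v> h] and its domain;
   for [phi = (- lam) `^ r] it is the fractional power [(-A)^r] of the
   diagonal operator [A] with eigenvalues [lam]. *)
Definition diag_dom (R : realType) (V : hilbertType R) (HH : set V)
    (phi : V -> R) : set V :=
  [set v | (\esum_(h in HH) (`|phi h * inner h v| ^+ 2)%:E < +oo)%E].

Definition diag_op (R : realType) (V : hilbertType R) (HH : set V)
    (phi : V -> R) (v : V) : V :=
  get [set w | has_sum HH (fun h => (phi h * inner h v) *: h) w].

(* The set-theoretic inclusions between the spaces [Hr r] are represented by
   maps [emb r s : Hr r -> Hr s], relevant only for [s <= r].  The space [H]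
   itself is [Hr 0], since [D((-A)^0) = H]. *)
Definition interpolation_family (R : realType) (Hr : R -> hilbertType R)
    (emb : forall r s : R, Hr r -> Hr s) (HH : set (Hr 0)) (lam : Hr 0 -> R) :=
  let frac r := fun h => (- lam h) `^ r in
  [/\ (forall r s, s <= r -> bounded_operator (emb r s)),
      (forall r x, emb r r x = x),
      (forall r s q x, s <= r -> q <= s -> emb s q (emb r s x) = emb r q x),
      (* for 0 <= r: the domain of (-A)^r with its graph inner product *)
      (forall r, 0 <= r ->
         [/\ injective (emb r 0),
             range (emb r 0) = diag_dom HH (frac r) &
             forall u v, inner u v =
               inner (diag_op HH (frac r) (emb r 0 u))
                     (diag_op HH (frac r) (emb r 0 v))]) &
      (* for r < 0: the completion of H *)
      (forall r, r < 0 ->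
         dense (range (emb 0 r)) /\
         forall v, `|emb 0 r v| = `|diag_op HH (frac r) v|)].

(* [y], an element of [Hr s] that happens to lie in the subspace [Hr r],
   viewed as an element of [Hr r]. *)
Definition restr (R : realType) (Hr : R -> hilbertType R)
    (emb : forall r s : R, Hr r -> Hr s) (r s : R) (y : Hr s) : Hr r :=
  get [set x | emb r s x = y].

Definition generates_C0_semigroup (R : realType) (V : normedModType R)
    (DA : set V) (A : V -> V) (S : R -> V -> V) :=
  [/\ (forall t, 0 <= t -> bounded_operator (S t)),
      (forall v, S 0 v = v),
      (forall s t v, 0 <= s -> 0 <= t -> S (s + t) v = S s (S t v)),
      (forall v, S t v @[t --> 0^'+] --> v) &
      (forall v w, (t^-1 *: (S t v - v) @[t --> 0^'+] --> w) <->
                   (DA v /\ w = A v))].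

(* [S r t] is [e^{tA}] acting on [Hr r]: it is the semigroup generated by [A]
   on [H = Hr 0], restricted to [Hr r] for [0 <= r], extended continuously to
   [Hr r] for [r < 0]. *)
Definition semigroup_family (R : realType) (Hr : R -> hilbertType R)
    (emb : forall r s : R, Hr r -> Hr s) (DA : set (Hr 0))
    (A : Hr 0 -> Hr 0) (S : forall r : R, R -> Hr r -> Hr r) :=
  [/\ generates_C0_semigroup DA A (S 0),
      (forall r t, 0 <= t -> bounded_operator (S r t)) &
      (forall r s t x, s <= r -> 0 <= t ->
         S s t (emb r s x) = emb r s (S r t x))].

(* The Hilbert-Schmidt norm does not depend on the orthonormal basis. *)
Definition hs_norm (R : realType) (U V : hilbertType R) (L : U -> V) : \bar R :=
  sqrte (\esum_(u in get (@orthonormal_basis R U)) (`|L u| ^+ 2)%:E)%E.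

Definition hilbert_schmidt (R : realType) (U V : hilbertType R) (L : U -> V) :=
  bounded_operator L /\ (hs_norm L < +oo)%E.

(* [dV x y] stands for the distance [|| f x - f y ||] of the values of [f]. *)
Definition holder_seminorm (R : realType) (M : normedModType R) (D : set M)
    (r : R) (dV : M -> M -> \bar R) : \bar R :=
  ereal_sup ([set (dV p.1 p.2 * (`|p.1 - p.2| `^ r)^-1%:E)%E
              | p in [set p : M * M | [/\ D p.1, D p.2 & p.1 != p.2]]]
             `|` [set 0%E]).

Definition holder_norm (R : realType) (M V : normedModType R) (D : set M)
    (r : R) (f : M -> V) : \bar R :=
  (ereal_sup ([set `|f x|%:E | x in D] `|` [set 0%E]) +
   holder_seminorm D r (fun x y => `|f x - f y|%:E))%E.

Definition normal_filtration (R : realType) (d : measure_display)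
    (Om : measurableType d) (P : probability Om R) (T : R)
    (Fl : R -> set (set Om)) :=
  [/\ (forall t, 0 <= t <= T ->
         sigma_algebra setT (Fl t) /\ Fl t `<=` measurable),
      (forall s t, 0 <= s -> s <= t -> t <= T -> Fl s `<=` Fl t),
      (forall t, 0 <= t < T -> Fl t = \bigcap_(s in `]t, T]) Fl s) &
      (forall E, measurable E -> P E = 0%E -> Fl 0 E)].

Definition adapted (R : realType) (Om : Type) (V : topologicalType) (T : R)
    (Fl : R -> set (set Om)) (X : R -> Om -> V) :=
  forall t, 0 <= t <= T ->
    forall C, <<s open >> C -> Fl t (X t @^-1` C).

(* [W t u] is the real random variable [<u, W_t>]. *)
Definition cylindrical_wiener (R : realType) (d : measure_display)
    (Om : measurableType d) (P : probability Om R) (T : R)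
    (Fl : R -> set (set Om)) (U : hilbertType R) (W : R -> U -> Om -> R) :=
  [/\ (forall u, adapted T Fl (fun t => W t u)),
      (forall t a u v, 0 <= t <= T ->
         {ae P, forall w, W t (a *: u + v) w = a * W t u w + W t v w}),
      (forall u, {ae P, forall w, W 0 u w = 0}),
      (forall u, {ae P, forall w,
         {within `[0, T], continuous (fun t => W t u w)}}) &
      (forall s t u, 0 <= s -> s < t -> t <= T -> u != 0 ->
         forall C : set R, measurable C ->
         let incr := [set w | C (W t u w - W s u w)] in
         P incr = normal_prob 0 (Num.sqrt (t - s) * `|u|) C /\
         forall E, Fl s E -> P (E `&` incr) = (P E * P incr)%E)].

(* The Bochner integral over [D] (Lebesgue measure): limit of the integrals of
   simple functions, listed as pairs (measurable set, value), that converge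
   to [f] in L^1. *)
Definition simple_fun (R : realType) (V : normedModType R)
    (g : seq (set R * V)) (s : R) : V :=
  \sum_(p <- g) (\1_(p.1) s : R) *: p.2.

Definition simple_fun_int (R : realType) (V : normedModType R)
    (g : seq (set R * V)) : V :=
  \sum_(p <- g) fine (lebesgue_measure p.1) *: p.2.

Definition simple_fun_on (R : realType) (V : normedModType R) (D : set R)
    (g : seq (set R * V)) :=
  all (fun p => `[< [/\ measurable p.1, p.1 `<=` D &
                        (lebesgue_measure p.1 < +oo)%E] >]) g.

Definition is_bochner_integral (R : realType) (V : normedModType R)
    (D : set R) (f : R -> V) (l : V) :=
  exists g : nat -> seq (set R * V),
    [/\ (forall n, simple_fun_on D (g n)),
        (forall n, measurable_fun D (fun s => `|f s - simple_fun (g n) s|)),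
        (\int[lebesgue_measure]_(s in D) `|f s - simple_fun (g n) s|%:E
           @[n --> \oo] --> 0)%E &
        simple_fun_int (g n) @[n --> \oo] --> l].

Definition cvg_to0_in_probability (R : realType) (d : measure_display)
    (Om : measurableType d) (P : probability Om R) (Y : nat -> Om -> \bar R) :=
  forall e : R, 0 < e ->
    (forall n, measurable [set w | (e%:E < Y n w)%E]) /\
    (P [set w | (e%:E < Y n w)%E] @[n --> \oo] --> 0%E).

(* The process [(s, w) |-> 1_{]lo, hi]}(s) 1_{ev}(w) <src, .> dst] with values
   in the rank-one operators; sums of these, with [ev] in [F_lo], are the
   simple integrands. *)
Record rank1_term (R : realType) (Om : Type) (U V : Type) := Rank1Term {
  lo : R; hi : R; ev : set Om; src : U; dst : V }.

Definition simple_process (R : realType) (Om : Type) (U V : hilbertType R)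
    (g : seq (rank1_term R Om U V)) (s : R) (w : Om) (u : U) : V :=
  \sum_(e <- g) (\1_(`]lo e, hi e]) s * \1_(ev e) w * inner (src e) u) *: dst e.

Definition simple_process_int (R : realType) (Om : Type) (U V : hilbertType R)
    (W : R -> U -> Om -> R) (g : seq (rank1_term R Om U V)) (w : Om) : V :=
  \sum_(e <- g)
    (\1_(ev e) w * (W (hi e) (src e) w - W (lo e) (src e) w)) *: dst e.

Definition simple_process_on (R : realType) (Om : Type) (U V : hilbertType R)
    (Fl : R -> set (set Om)) (t : R) (g : seq (rank1_term R Om U V)) :=
  all (fun e => `[< [/\ 0 <= lo e, lo e <= hi e, hi e <= t &
                        Fl (lo e) (ev e)] >]) g.

(* [I] is the Ito integral [\int_0^t Phi_s dW_s]: the stochastic integral is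
   the continuous extension of the elementary one from simple integrands to
   adapted integrands with [\int_0^t || Phi_s ||_HS^2 ds < oo] a.s., both
   sides carrying convergence in probability. *)
Definition is_ito_integral (R : realType) (d : measure_display)
    (Om : measurableType d) (P : probability Om R) (Fl : R -> set (set Om))
    (U V : hilbertType R) (W : R -> U -> Om -> R) (t : R)
    (Phi : R -> Om -> U -> V) (I : Om -> V) :=
  exists g : nat -> seq (rank1_term R Om U V),
    [/\ (forall n, simple_process_on Fl t (g n)),
        (forall n, measurable_fun (`[0%R, t[ `*` setT)
           (fun p : R * Om =>
              hs_norm (Phi p.1 p.2 \- simple_process (g n) p.1 p.2)%R)),
        cvg_to0_in_probability P (fun n w =>
          (\int[lebesgue_measure]_(s in `[0%R, t[)
             hs_norm (Phi s w \- simple_process (g n) s w)%R ^+ 2)%E) &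
        cvg_to0_in_probability P (fun n w =>
          `|I w - simple_process_int W (g n) w|%:E)].

(* Main.v *)
(** Fix a ball of radius n and stop when X^0 or X^N leaves it.  On the ball the
    coefficients are Lipschitz and replacing (P_N, scriptP_N) by (P_0, scriptP_0)
    costs N^(-iota theta).  A Burkholder inequality for even moments, proved
    for simple integrands by discretised Ito calculus and extended by Fatou, turns the
    mild equations of X^0 - X^N and of its time increments into singular Volterra
    inequalities; Gronwall and interpolation bound the 2m-th moment of the increment
    over [s, t] of the stopped difference by a multiple of
    N^(-2m iota r) (t - s)^(2m d) for r + d < theta.  For large m these bounds are summable
    over N and the dyadic grids, so Kolmogorov's chaining argument gives an almost surely
    finite constant that is uniform in N.  Once the difference is small on the stopped
    interval, X^N cannot leave a ball slightly larger than the range of X^0: for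
    large N no stopping occurs, and finitely many N only change the constant. *)

From HB Require Import structures.
Require Import Defs.
From mathcomp Require Import ring lra zify.

Set Implicit Arguments.
Unset Strict Implicit.
Unset Printing Implicit Defensive.

(** Two obstacles shape the argument: the coefficients are Lipschitz on balls only, and the Ito
    integral is known solely as a limit in probability of elementary integrals. Stopping is
    therefore expressed by adapted events that decrease in time (both paths have stayed in the ball
    so far) and is imposed on the elementary integrals, cell by cell on a grid. No stopping time is
    formed, and the moments in question are finite a priori because the radius bounds them. The
    initial value is localised as well: its norm in H_(gamma+theta) is only almost surely finite, so
    it is confined to balls of that space, which are closed in H_gamma and hence give events of F_0.
    A, the projections and the embeddings of the scale are all diagonal in the eigenvectors. A
    coordinate that does not change along the scale reduces each smoothing estimate to an inequality
    between real multipliers. A factor N^(-iota theta) is bought with theta more in the exponent of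
    the singularity; after squaring the stochastic terms the exponents are alpha + theta, 2 (beta +
    theta) and 2 chi, all below one. *)

Section hilbert_algebra.
Context {R : realType} {V : hilbertType R}.
Implicit Types (x y z : V) (a : R).

Lemma innerDl x y z : inner (x + y) z = inner x z + inner y z.
Proof. by have := inner_linear 1 x y z; rewrite scale1r mul1r. Qed.

Lemma inner0l z : inner 0 z = 0 :> R.
Proof. by have := innerDl 0 0 z; rewrite addr0 => /eqP; rewrite -subr_eq0 opprD addrA subrr sub0r oppr_eq0 => /eqP. Qed.

Lemma innerZl a x z : inner (a *: x) z = a * inner x z.
Proof. by have := inner_linear a x 0 z; rewrite addr0 inner0l addr0. Qed.

Lemma innerNl x z : inner (- x) z = - inner x z.
Proof. by rewrite -scaleN1r innerZl mulN1r. Qed.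

Lemma innerDr x y z : inner z (x + y) = inner z x + inner z y.
Proof. by rewrite innerC innerDl !(innerC z). Qed.

Lemma inner0r z : inner z 0 = 0 :> R.
Proof. by rewrite innerC inner0l. Qed.

Lemma innerZr a x z : inner z (a *: x) = a * inner z x.
Proof. by rewrite innerC innerZl (innerC z). Qed.

Lemma innerNr x z : inner z (- x) = - inner z x.
Proof. by rewrite innerC innerNl (innerC z). Qed.

Lemma innerBr x y z : inner z (x - y) = inner z x - inner z y.
Proof. by rewrite innerDr innerNr. Qed.

Lemma inner_suml (I : Type) (r : seq I) (P : pred I) (f : I -> V) z :
  inner (\sum_(i <- r | P i) f i) z = \sum_(i <- r | P i) inner (f i) z.
Proof.
elim: r => [|i r ih]; first by rewrite !big_nil inner0l.
by rewrite !big_cons; case: (P i) => //; rewrite innerDl ih.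
Qed.

Lemma inner_sumr (I : Type) (r : seq I) (P : pred I) (f : I -> V) z :
  inner z (\sum_(i <- r | P i) f i) = \sum_(i <- r | P i) inner z (f i).
Proof. by rewrite innerC inner_suml; apply: eq_bigr => i _; rewrite innerC. Qed.

Lemma normD_sqr x y : `|x + y| ^+ 2 = `|x| ^+ 2 + 2 * inner x y + `|y| ^+ 2.
Proof. rewrite -!inner_norm !innerDl !innerDr (innerC y x); ring. Qed.

Lemma normB_sqr x y : `|x - y| ^+ 2 = `|x| ^+ 2 - 2 * inner x y + `|y| ^+ 2.
Proof. by rewrite normD_sqr innerNr normrN mulrN. Qed.

Lemma inner_le x y : `|inner x y| <= `|x| * `|y|.
Proof.
have [->|x0] := eqVneq x 0; first by rewrite inner0l !normr0 mul0r.
have x2 : 0 < `|x| ^+ 2 by rewrite exprn_gt0// normr_gt0.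
rewrite -(@ler_pXn2r _ 2)//; last by rewrite nnegrE mulr_ge0.
rewrite exprMn -normrX ger0_norm ?sqr_ge0//.
have : 0 <= `|y - (inner x y / `|x| ^+ 2) *: x| ^+ 2 by rewrite sqr_ge0.
rewrite normB_sqr innerZr normrZ exprMn -normrX [X in _ + X * _]ger0_norm ?sqr_ge0//.
rewrite (innerC y x).
have -> : `|y| ^+ 2 - 2 * (inner x y / `|x| ^+ 2 * inner x y) +
  (inner x y / `|x| ^+ 2) ^+ 2 * `|x| ^+ 2 = `|y| ^+ 2 - inner x y ^+ 2 / `|x| ^+ 2.
  by field; rewrite normr_eq0.
by rewrite subr_ge0 ler_pdivrMr// mulrC.
Qed.

End hilbert_algebra.

Lemma normD_sqr_le (R : realType) (V : normedModType R) (x y : V) :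
  `|x + y| ^+ 2 <= 2 * (`|x| ^+ 2 + `|y| ^+ 2).
Proof.
apply: (@le_trans _ _ ((`|x| + `|y|) ^+ 2)).
  by rewrite lerXn2r// ?nnegrE ?addr_ge0// ler_normD.
rewrite -subr_ge0.
have -> : 2 * (`|x| ^+ 2 + `|y| ^+ 2) - (`|x| + `|y|) ^+ 2 = (`|x| - `|y|) ^+ 2 by ring.
exact: sqr_ge0.
Qed.

(** * Bounded operators, unconditional sums and orthonormal families *)

Section bounded_operators.
Context {R : realType} {V W : normedModType R}.
Implicit Types (L : V -> W).

Lemma bop0 L : linear L -> L 0 = 0.
Proof. by move=> LL; have := LL (-1) 0 0; rewrite scaler0 add0r scaleN1r addNr. Qed.

Lemma bopD L : linear L -> forall x y, L (x + y) = L x + L y.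
Proof. by move=> LL x y; have := LL 1 x y; rewrite !scale1r. Qed.

Lemma bopZ L : linear L -> forall a x, L (a *: x) = a *: L x.
Proof. by move=> LL a x; have := LL a x 0; rewrite (bop0 LL) !addr0. Qed.

Lemma bopB L : linear L -> forall x y, L (x - y) = L x - L y.
Proof. by move=> LL x y; rewrite bopD// -scaleN1r bopZ// scaleN1r. Qed.

Lemma bop_sum L : linear L -> forall (I : Type) (r : seq I) (P : pred I) (f : I -> V),
  L (\sum_(i <- r | P i) f i) = \sum_(i <- r | P i) L (f i).
Proof.
move=> LL I r P f; elim: r => [|i r ih]; first by rewrite !big_nil bop0.
by rewrite !big_cons; case: (P i) => //; rewrite bopD// ih.
Qed.

Lemma bop_bound L : bounded_operator L ->
  exists2 M : R, 0 < M & forall x, `|L x| <= M * `|x|.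
Proof.
move=> [LL Lc].
have /cvgrPdist_lt /(_ 1 ltr01) := Lc 0.
rewrite (bop0 LL) => /nbhs_ballP[e /= e0 He].
exists (2 / e); first by rewrite divr_gt0.
move=> x; have [->|x0] := eqVneq x 0; first by rewrite (bop0 LL) !normr0 mulr0.
have nx : 0 < `|x| by rewrite normr_gt0.
have /He : ball 0 e ((e / 2 / `|x|) *: x).
  rewrite -ball_normE /= sub0r normrN normrZ ger0_norm ?divr_ge0 ?ltW//.
  by rewrite mulfVK ?gt_eqF// ltr_pdivrMr// mulr_natr mulr2n ltrDl.
rewrite /= sub0r normrN (bopZ LL) normrZ ger0_norm; last first.
  by rewrite !divr_ge0// ltW.
move=> h; have : e / 2 / `|x| * `|L x| * (2 / e * `|x|) <= 1 * (2 / e * `|x|).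
  by rewrite ler_wpM2r ?(ltW h)// mulr_ge0// divr_ge0// ltW.
rewrite mul1r; have -> // : e / 2 / `|x| * `|L x| * (2 / e * `|x|) = `|L x|.
by field; rewrite ?normr_eq0 ?x0 ?gt_eqF.
Qed.

Lemma bounded_bop L (M : R) : linear L -> (forall x, `|L x| <= M * `|x|) ->
  bounded_operator L.
Proof.
move=> LL LM; split => // x; apply/cvgrPdist_le => e e0.
have M1 : 0 < `|M| + 1 by rewrite ltr_wpDl.
near=> y; rewrite -(bopB LL); apply: (le_trans (LM _)).
apply: (@le_trans _ _ ((`|M| + 1) * `|x - y|)).
  by rewrite ler_wpM2r// (le_trans (ler_norm _))// lerDl.
rewrite mulrC -ler_pdivlMr//; near: y.
by apply: cvgr_dist_le; [exact: cvg_id|rewrite divr_gt0].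
Unshelve. all: by end_near. Qed.

End bounded_operators.

Lemma bounded_operator_comp (R : realType) (V W Z : normedModType R)
    (L : V -> W) (K : W -> Z) :
  bounded_operator L -> bounded_operator K -> bounded_operator (K \o L).
Proof.
move=> [L1 L2] [K1 K2]; split; first by move=> a x y /=; rewrite L1 K1.
by move=> x; apply: continuous_comp; [exact: L2|exact: K2].
Qed.

Lemma inner_bop (R : realType) (V : hilbertType R) (x : V) :
  bounded_operator (fun y => inner x y : R^o).
Proof.
apply: (@bounded_bop _ _ _ _ `|x|); last by move=> y; exact: inner_le.
by move=> a y z; rewrite innerDr innerZr.
Qed.

Section has_sum_theory.
Context {R : realType} {T : choiceType} {V : normedModType R}.
Implicit Types (I : set T) (f : T -> V).

Lemma fsetsU I F G : fsets I F -> fsets I G -> fsets I (F `|` G).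
Proof.
move=> [F1 F2] [G1 G2]; split; first by rewrite finite_setU.
by move=> x [/F2|/G2].
Qed.

Lemma has_sum_unique I f l1 l2 : has_sum I f l1 -> has_sum I f l2 -> l1 = l2.
Proof.
move=> h1 h2; apply/eqP; rewrite -subr_eq0 -normr_le0 leNgt; apply/negP => e0.
have e2 : 0 < `|l1 - l2| / 2 by rewrite divr_gt0.
have [F1 F1I H1] := h1 _ e2; have [F2 F2I H2] := h2 _ e2.
have FI := fsetsU F1I F2I.
have := ltrD (H1 _ FI (@subsetUl _ _ _)) (H2 _ FI (@subsetUr _ _ _)).
rewrite -splitr ltNge => /negP; apply.
rewrite -[X in _ <= _ + X]normrN opprB; set s := \sum_(_ \in _) _.
by rewrite (le_trans _ (ler_normD _ _))// addrA subrK.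
Qed.

Lemma eq_has_sum I f g l : (forall i, I i -> f i = g i) ->
  has_sum I f l -> has_sum I g l.
Proof.
move=> fg h e e0; have [F FI H] := h e e0; exists F => // G GI FG.
rewrite (_ : \sum_(i \in G) g i = \sum_(i \in G) f i); first exact: H.
by apply: eq_fsbigr => i /[!inE] /GI.2 Ii; rewrite fg.
Qed.

Lemma has_sum_single I f l j : has_sum I f l -> I j ->
  (forall i, I i -> i != j -> f i = 0) -> l = f j.
Proof.
move=> h Ij f0; apply: (has_sum_unique h) => e e0.
have jI : fsets I [set j] by split=> // _ ->.
exists [set j] => // F [Ffin FI] jF.
rewrite (fsbigD1 j)//=; last exact/jF.
rewrite fsbig1 ?addr0 ?subrr ?normr0// => i [Fi /eqP ij].
by apply: f0 => //; exact: FI.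
Qed.

Lemma has_sum0 I f l : has_sum I f l -> (forall i, I i -> f i = 0) -> l = 0.
Proof.
move=> h f0; apply: (has_sum_unique h) => e e0.
have jI : fsets I set0 by split.
exists set0 => // F [Ffin FI] _.
by rewrite fsbig1 ?subrr ?normr0// => i Fi; apply: f0; exact: FI.
Qed.

End has_sum_theory.

Lemma has_sum_bop (R : realType) (T : choiceType) (V W : normedModType R)
    (I : set T) (f : T -> V) (L : V -> W) l :
  bounded_operator L -> has_sum I f l -> has_sum I (fun i => L (f i)) (L l).
Proof.
move=> bL h e e0; have [M M0 HM] := bop_bound bL.
have [F FI H] := h (e / M) (divr_gt0 e0 M0); exists F => // G GI FG.
have -> : \sum_(i \in G) L (f i) = L (\sum_(i \in G) f i).
  by rewrite !fsbig_finite ?(bop_sum bL.1)//; case: GI.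
rewrite -(bopB bL.1) (le_lt_trans (HM _))//.
by rewrite mulrC -ltr_pdivlMr//; exact: H.
Qed.

Section orthonormal_families.
Context {R : realType} {T : choiceType} {V : hilbertType R}.
Implicit Types (I : set T) (f : T -> V) (a : T -> R).

(** Families indexed by a set rather than subsets of the space: the basis of [Hr r] used below is
    indexed by the eigenvectors, which live in [Hr 0]. *)
Definition orthonormal_family I f :=
  forall i j, I i -> I j -> inner (f i) (f j) = (i == j)%:R.

Definition onb_family I f := orthonormal_family I f /\
  forall v, has_sum I (fun i => inner (f i) v *: f i) v.

Lemma inner_fsum I f a F i : orthonormal_family I f -> fsets I F -> I i ->
  inner (f i) (\sum_(j \in F) a j *: f j) = (i \in F)%:R * a i.
Proof.
move=> of_ [Ffin FI] Ii; rewrite fsbig_finite//= inner_sumr.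
rewrite (_ : \sum_(j <- _) _ = \sum_(j <- finmap.enum_fset (fset_set F)) (if j == i then a i else 0)).
  have [iF|niF] := boolP (i \in F); last first.
    rewrite mul0r big_seq big1// => j; rewrite in_fset_set//.
    by case: eqP => // ->; rewrite (negbTE niF).
  rewrite mul1r (bigD1_seq i) ?in_fset_set ?finmap.fset_uniq//= eqxx big1 ?addr0// => j.
  by move=> /negbTE ->.
rewrite big_seq [RHS]big_seq; apply: eq_bigr => j; rewrite in_fset_set// inE => /FI Ij.
by rewrite innerZr of_// eq_sym; case: eqP => [->|_]; rewrite ?mulr1 ?mulr0.
Qed.

Lemma norm_fsum I f a F : orthonormal_family I f -> fsets I F ->
  `|\sum_(j \in F) a j *: f j| ^+ 2 = \sum_(j \in F) a j ^+ 2.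
Proof.
move=> of_ IF; have [Ffin FI] := IF.
rewrite -inner_norm {1}fsbig_finite//= inner_suml [RHS]fsbig_finite//=.
rewrite big_seq [RHS]big_seq; apply: eq_bigr => j; rewrite in_fset_set// inE => Fj.
by rewrite innerZl (inner_fsum _ of_)//; [rewrite mem_set// mul1r expr2|exact: FI].
Qed.

Lemma bessel_eq I f v F : orthonormal_family I f -> fsets I F ->
  `|v - \sum_(j \in F) inner (f j) v *: f j| ^+ 2 =
  `|v| ^+ 2 - \sum_(j \in F) inner (f j) v ^+ 2.
Proof.
move=> of_ IF; rewrite normB_sqr (norm_fsum _ of_ IF).
have [Ffin FI] := IF.
rewrite [X in inner _ X]fsbig_finite//= inner_sumr [X in _ = _ - X]fsbig_finite//= [X in _ + X]fsbig_finite//=.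
under [X in 2 * X]eq_bigr => j _ do rewrite innerZr (innerC v) -expr2.
ring.
Qed.

Lemma sum_le_esum I (b : T -> R) F : fsets I F ->
  ((\sum_(i \in F) b i)%:E <= \esum_(i in I) (b i)%:E)%E.
Proof.
move=> FI; apply: ereal_sup_ubound; exists F => //.
by rewrite !fsbig_finite ?sumEFin//; case: FI.
Qed.

Lemma esum_leP I (b : T -> R) (x : \bar R) :
  (forall F, fsets I F -> ((\sum_(i \in F) b i)%:E <= x)%E) ->
  (\esum_(i in I) (b i)%:E <= x)%E.
Proof.
move=> H; apply: ge_ereal_sup => _ [F FI <-].
have := H F FI; rewrite !fsbig_finite ?sumEFin//; by case: FI.
Qed.

Lemma bessel I f v : orthonormal_family I f ->
  (\esum_(i in I) (inner (f i) v ^+ 2)%:E <= (`|v| ^+ 2)%:E)%E.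
Proof.
move=> of_; apply: esum_leP => F FI; rewrite lee_fin -subr_ge0 -(bessel_eq v of_ FI).
exact: sqr_ge0.
Qed.

Lemma parseval I f v : onb_family I f ->
  (\esum_(i in I) (inner (f i) v ^+ 2)%:E = (`|v| ^+ 2)%:E)%E.
Proof.
move=> [of_ hs]; apply/eqP; rewrite eq_le bessel//=.
apply/lee_addgt0Pr => e e0.
have [F FI H] := hs v (Num.sqrt e) (ltac:(by rewrite sqrtr_gt0)).
have := H F FI (@subset_refl _ _).
rewrite -(@ltr_pXn2r _ 2) ?nnegrE// sqr_sqrtr ?(ltW e0)// (bessel_eq v of_ FI) ltrBlDl => h.
apply: (@le_trans _ _ ((\sum_(i \in F) inner (f i) v ^+ 2)%:E + e%:E)%E).
  by rewrite -EFinD lee_fin ltW.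
by rewrite leeD2r// sum_le_esum.
Qed.

Lemma onb_inj I f v w : onb_family I f ->
  (forall i, I i -> inner (f i) v = inner (f i) w) -> v = w.
Proof.
move=> [_ hs] vw; apply: has_sum_unique (hs v) _.
by apply: eq_has_sum (hs w) => i Ii; rewrite vw.
Qed.

(** The increments of the net of finite partial sums are tails of a convergent sum of squares.
    Completeness is used along sequences, so finite sets [Fn n] with tail at most 1/(n+1) are
    chosen, and the limit along them is shown to be the limit of the whole net. *)
Lemma riesz_fischer I f a : orthonormal_family I f ->
  (\esum_(i in I) (a i ^+ 2)%:E < +oo)%E ->
  exists2 v, has_sum I (fun i => a i *: f i) v &
    forall i, I i -> inner (f i) v = a i.
Proof.
move=> of_ sfin.
have s0 : (0 <= \esum_(i in I) (a i ^+ 2)%:E)%E.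
  by apply: esum_ge0 => i _; rewrite lee_fin sqr_ge0.
have [s sE] : exists s : R, (\esum_(i in I) (a i ^+ 2)%:E = s%:E)%E.
  by exists (fine (\esum_(i in I) (a i ^+ 2)%:E)); rewrite fineK// ge0_fin_numE.
have tail (e : R) : 0 < e -> exists2 F, fsets I F &
    forall G, fsets I G -> F `<=` G ->
      `|\sum_(i \in G) a i *: f i - \sum_(i \in F) a i *: f i| ^+ 2 <= e.
  move=> e0.
  have : (s%:E - e%:E < \esum_(i in I) (a i ^+ 2)%:E)%E.
    by rewrite sE -EFinB lte_fin ltrBlDr ltrDl.
  move=> /ereal_sup_gt[_ [F FI <-]] hF; exists F => // G GI FG.
  have -> : \sum_(i \in G) a i *: f i - \sum_(i \in F) a i *: f i =
            \sum_(i \in G `\` F) a i *: f i.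
    rewrite (fsbigID F)/=; last by case: GI.
    by rewrite setIidr// addrAC subrr add0r.
  have GFI : fsets I (G `\` F).
    by split; [apply: finite_setD; case: GI|move=> x [/GI.2]].
  rewrite (norm_fsum _ of_ GFI).
  have : (\sum_(i \in G) a i ^+ 2) <= s by rewrite -lee_fin -sE sum_le_esum.
  rewrite (fsbigID F)/=; last by case: GI.
  rewrite setIidr//; move: hF; rewrite fsbig_finite/=; last by case: FI.
  rewrite sumEFin -EFinB lte_fin fsbig_finite/=; last by case: FI.
  move=> *; lra.
have /boolp.choice[Fn FnP] (n : nat) : exists F, fsets I F /\ forall G, fsets I G ->
    F `<=` G -> `|\sum_(i \in G) a i *: f i - \sum_(i \in F) a i *: f i| ^+ 2 <=
      n.+1%:R^-1 ^+ 2.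
  have [F FI HF] := tail (n.+1%:R^-1 ^+ 2) (ltac:(by rewrite exprn_gt0)).
  by exists F.
have FnP' n G : fsets I G -> Fn n `<=` G ->
    `|\sum_(i \in G) a i *: f i - \sum_(i \in Fn n) a i *: f i| <= n.+1%:R^-1.
  move=> GI FG; have := (FnP n).2 G GI FG.
  by rewrite ler_pXn2r ?nnegrE.
(* The unions are nested: [G n] contains [Fn m] for all [m <= n], so the defining property of [Fn m]
   yields both the Cauchy property and the distance to the limit. *)
pose G n := \bigcup_(k in `I_n.+1) Fn k.
have GI n : fsets I (G n).
  split; last by move=> x [k _ /(FnP k).1.2].
  by apply: bigcup_finite => [|k _]; [exact: finite_II|case: (FnP k).1].
have FG m n : (m <= n)%N -> Fn m `<=` G n by move=> mn x Fx; exists m.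
pose u n := \sum_(i \in G n) a i *: f i.
have small (e : R) : 0 < e -> exists n : nat, n.+1%:R^-1 < e.
  move=> e0; have /cvgrPdist_lt/(_ e e0)[n _ /(_ n (leqnn n))] := @cvg_harmonic R.
  by rewrite /= sub0r normrN ger0_norm// => ?; exists n.
have ucvg : cvgn u.
  apply/cauchy_cvgP/cauchy_exP => e /small[m me]; exists (\sum_(i \in Fn m) a i *: f i).
  exists m => // n /= mn; rewrite -ball_normE /= distrC.
  by apply: le_lt_trans me; apply: FnP' => //; exact: FG.
have uv m : `|limn u - \sum_(i \in Fn m) a i *: f i| <= m.+1%:R^-1.
  have cn : `|u n - \sum_(i \in Fn m) a i *: f i| @[n --> \oo] -->
     `|limn u - \sum_(i \in Fn m) a i *: f i|.
    by apply: cvg_norm; apply: cvgB => //; exact: cvg_cst.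
  rewrite -(cvg_lim _ cn)//; apply: limr_le; first by apply/cvg_ex; eexists; exact: cn.
  by exists m => // n /= mn; apply: FnP' => //; exact: FG.
have hs : has_sum I (fun i => a i *: f i) (limn u).
  move=> e e0; have [m me] := small (e / 2) (ltac:(by rewrite divr_gt0)).
  exists (Fn m) => [|H HI FH]; first by case: (FnP m).
  rewrite -[limn u](subrK (\sum_(i \in Fn m) a i *: f i)) -addrA.
  rewrite (le_lt_trans (ler_normD _ _))// [e]splitr.
  rewrite ltrD ?(le_lt_trans (uv m))// distrC (le_lt_trans _ me)//.
  exact: FnP'.
exists (limn u) => // i Ii.
have := has_sum_single (has_sum_bop (inner_bop (f i)) hs) Ii.
rewrite innerZr of_// eqxx mulr1; apply => j Ij ij.
by rewrite innerZr of_// eq_sym (negbTE ij) mulr0.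
Qed.

Lemma onb_family_total I f : orthonormal_family I f ->
  (forall v, (forall i, I i -> inner (f i) v = 0) -> v = 0) -> onb_family I f.
Proof.
move=> of_ tot; split => // v.
have [w hw cw] := riesz_fischer of_ (le_lt_trans (bessel v of_) (ltry _)).
suff -> : v = w by apply: eq_has_sum hw => i Ii; rewrite cw.
apply/eqP; rewrite -subr_eq0; apply/eqP/tot => i Ii.
by rewrite innerBr cw// subrr.
Qed.

End orthonormal_families.

Section onb_existence.
Context {R : realType} {V : hilbertType R}.

(** [hs_norm] sums over a basis picked by [get], which has a meaning only if some basis exists. A
    maximal orthonormal set from Zorn's lemma is total, since a vector orthogonal to it could be
    normalised and added. *)
Lemma orthonormal_basis_exists : exists b : set V, orthonormal_basis b.
Proof.
have [|b [ob max]] := @Zorn_bigcup V (fun b => orthonormal_family b id).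
  move=> F FP tot x y [X FX Xx] [Y FY Yy].
  have [XY|YX] := tot _ _ FX FY.
    by apply: (FP _ FY) => //; exact: XY.
  by apply: (FP _ FX) => //; exact: YX.
exists b; apply: onb_family_total => // v v0.
apply/eqP/negPn/negP => vn0.
have nv : `|v| != 0 by rewrite normr_eq0.
pose e := `|v|^-1 *: v.
have ee : inner e e = 1 by rewrite innerZl innerZr inner_norm; field.
have eb x : b x -> inner x e = 0 by move=> bx; rewrite innerZr (v0 x bx) mulr0.
have nbe : ~ b e by move=> /eb /eqP; rewrite ee oner_eq0.
apply: (max (b `|` [set e])).
  split; first exact: subsetUl.
  by move=> /(_ e (or_intror erefl)).
move=> x y [bx|->] [by_|->].
- exact: ob.
- rewrite /= eb//; case: eqP => // xe; by rewrite -xe in nbe.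
- rewrite /= innerC eb//; case: eqP => // xe; by rewrite xe in nbe.
- by rewrite /= ee eqxx.
Qed.

Definition std_onb : set V := get (@orthonormal_basis R V).

Lemma std_onbP : orthonormal_basis std_onb.
Proof. by have := orthonormal_basis_exists; apply: getPex. Qed.

(** Gram-Schmidt, one vector at a time. It provides the coordinates in which finite-rank operators
    and Gaussian vectors are split into scalars. *)
Lemma finite_orthonormal_span (xs : seq V) : exists fs : seq V,
  [/\ uniq fs, {in fs &, forall f g, inner f g = (f == g)%:R} &
      {in xs, forall x, x = \sum_(f <- fs) inner f x *: f}].
Proof.
elim: xs => [|x xs [fs [ufs ofs spn]]]; first by exists [::].
pose y := x - \sum_(f <- fs) inner f x *: f.
have yfs f : f \in fs -> inner f y = 0.
  move=> ffs; rewrite innerBr inner_sumr (big_rem f)//= innerZr (ofs f f)// eqxx mulr1.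
  rewrite big_seq big1 ?addr0 ?subrr// => g; rewrite mem_rem_uniq// !inE => /andP[gf gfs].
  by rewrite innerZr (ofs f g)// eq_sym (negbTE gf) mulr0.
have [y0|y0] := eqVneq y 0.
  exists fs; split => // z; rewrite inE => /orP[/eqP ->|]; last exact: spn.
  by apply/eqP; rewrite -subr_eq0; apply/eqP.
have ny : `|y| != 0 by rewrite normr_eq0.
pose e := `|y|^-1 *: y.
have ee : inner e e = 1 by rewrite innerZl innerZr inner_norm; field.
have efs f : f \in fs -> inner f e = 0 by move=> ffs; rewrite innerZr yfs// mulr0.
have enfs : e \notin fs by apply/negP => /efs /eqP; rewrite ee oner_eq0.
exists (e :: fs); split.
- by rewrite /= enfs.
- move=> f g; rewrite !inE => /orP[/eqP ->|ffs] /orP[/eqP ->|gfs].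
  + by rewrite eqxx.
  + rewrite innerC efs//; case: eqP => // eg; by rewrite eg gfs in enfs.
  + rewrite efs//; case: eqP => // fe; by rewrite -fe ffs in enfs.
  + exact: ofs.
- move=> z; rewrite inE => /orP[/eqP ->|zxs]; rewrite big_cons; last first.
    have -> : inner e z = 0.
      rewrite (spn _ zxs) inner_sumr big_seq big1// => f ffs.
      by rewrite innerZr (innerC e) efs// mulr0.
    by rewrite scale0r add0r; exact: spn.
  have xE : x = y + \sum_(f <- fs) inner f x *: f by rewrite subrK.
  have -> : inner e x = `|y|.
    rewrite xE innerDr inner_sumr big_seq big1 ?addr0; last first.
      by move=> f ffs; rewrite innerZr (innerC e) efs// mulr0.
    by rewrite innerZl inner_norm; field.
  by rewrite scalerA divff// scale1r -xE.
Qed.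

Lemma norm_sqr_orthonormal_span (fs : seq V) (x : V) :
  uniq fs -> {in fs &, forall f g, inner f g = (f == g)%:R} ->
  x = \sum_(f <- fs) inner f x *: f -> `|x| ^+ 2 = \sum_(f <- fs) inner f x ^+ 2.
Proof.
move=> ufs ofs xE; rewrite -inner_norm {2}xE inner_sumr.
by apply: eq_bigr => f _; rewrite innerZr innerC expr2.
Qed.

End onb_existence.

(** * The Hilbert-Schmidt norm *)

Section hilbert_schmidt_norm.
Context {R : realType} {U : hilbertType R}.
Local Open Scope ereal_scope.

(** The squared Hilbert-Schmidt norm; without the root it is a plain sum over a basis, and it is the
    quantity that enters the Ito isometry. *)
Definition hs2 (V : hilbertType R) (L : U -> V) : \bar R :=
  \esum_(u in std_onb) (`|L u| ^+ 2)%:E.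

Lemma hs2_ge0 (V : hilbertType R) (L : U -> V) : 0 <= hs2 L.
Proof. by apply: esum_ge0 => u _; rewrite lee_fin sqr_ge0. Qed.

Lemma sqre_hs_norm (V : hilbertType R) (L : U -> V) : hs_norm L ^+ 2 = hs2 L.
Proof. by rewrite /hs_norm sqr_sqrte// hs2_ge0. Qed.

Lemma hs2_le (V W : hilbertType R) (L : U -> V) (K : U -> W) (M : R) : (0 <= M)%R ->
  (forall u, `|L u| <= M * `|K u|)%R -> hs2 L <= (M ^+ 2)%:E * hs2 K.
Proof.
move=> M0 LK; apply: esum_leP => F FI.
apply: (@le_trans _ _ ((M ^+ 2)%:E * (\sum_(i \in F) `|K i| ^+ 2)%R%:E)).
  rewrite -EFinM lee_fin mulr_fsumr !fsbig_finite/=; [|by case: FI..].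
  apply: ler_sum => u _; rewrite -exprMn lerXn2r// nnegrE// mulr_ge0//.
rewrite lee_wpmul2l ?lee_fin ?sqr_ge0//.
exact: (sum_le_esum (fun i => `|K i| ^+ 2)%R FI).
Qed.

Lemma hs2D (V : hilbertType R) (L K : U -> V) :
  hs2 (fun u => L u + K u)%R <= 2%:E * (hs2 L + hs2 K).
Proof.
rewrite /hs2 -esumD; try by move=> ? _; rewrite lee_fin sqr_ge0.
apply: esum_leP => F FI.
apply: (@le_trans _ _ (2%:E * (\sum_(i \in F) (`|L i| ^+ 2 + `|K i| ^+ 2))%R%:E)).
  rewrite -EFinM lee_fin mulr_fsumr !fsbig_finite/=; [|by case: FI..].
  by apply: ler_sum => u _; exact: normD_sqr_le.
rewrite lee_wpmul2l ?lee_fin//.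
under eq_esum do rewrite -EFinD.
exact: sum_le_esum.
Qed.

(* Testing [phi \o Q] against the vector [\sum_(u in F) phi (Q u) u] replaces
   the adjoint of [Q]. *)
Lemma esum_functional_comp (phi : U -> R) (Q : U -> U) (M : R) :
  bounded_operator (phi : U -> R^o) -> linear Q -> (0 <= M)%R ->
  (forall u, `|Q u| <= M * `|u|)%R ->
  \esum_(u in std_onb) (phi (Q u) ^+ 2)%:E <=
  (M ^+ 2)%:E * \esum_(u in std_onb) (phi u ^+ 2)%:E.
Proof.
move=> bphi LQ M0 HQ; apply: esum_leP => F FI.
set s := (\sum_(i \in F) phi (Q i) ^+ 2)%R.
have s0 : (0 <= s)%R.
  by rewrite /s fsbig_finite/=; [apply: sumr_ge0 => *; rewrite sqr_ge0|case: FI].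
have [->|sn0] := eqVneq s 0%R.
  by rewrite mule_ge0 ?lee_fin ?sqr_ge0//; apply: esum_ge0 => *; rewrite lee_fin sqr_ge0.
have sgt0 : (0 < s)%R by rewrite lt_neqAle eq_sym sn0.
have [ob hs] := @std_onbP R U.
pose w : U := (\sum_(i \in F) phi (Q i) *: i)%R.
have w2 : (`|w| ^+ 2)%R = s by apply: norm_fsum FI.
have pQw : phi (Q w) = s.
  rewrite /w /s !fsbig_finite/=; [|by case: FI..].
  rewrite (bop_sum LQ) (bop_sum bphi.1); apply: eq_bigr => i _.
  by rewrite (bopZ LQ) (bopZ bphi.1) expr2.
have := has_sum_bop bphi (hs (Q w)); rewrite pQw => hsum.
have [->|] := eqVneq (\esum_(u in std_onb) (phi u ^+ 2)%:E) +oo.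
  (* An infinite right-hand sum proves the claim once [M] is non-zero; [M = 0] would force [Q w = 0]
     and thereby [s = 0]. *)
  have M1 : (0 < M ^+ 2)%R.
    rewrite exprn_gt0// lt_neqAle M0 andbT eq_sym; apply/eqP => Mz.
    have : `|Q w|%R == 0%R by rewrite eq_le normr_ge0 andbT (le_trans (HQ w))// Mz mul0r.
    by rewrite normr_eq0 => /eqP Qw; move: pQw; rewrite Qw (bop0 bphi.1) => /esym/eqP; rewrite (negbTE sn0).
  by rewrite gt0_muley ?lte_fin// leey.
set ps := \esum_(u in _) _ => psoo.
have ps0 : 0 <= ps by apply: esum_ge0 => *; rewrite lee_fin sqr_ge0.
have [p pE] : exists p : R, ps = p%:E.
  by exists (fine ps); rewrite fineK// ge0_fin_numE// ltey.
have p0 : (0 <= p)%R by rewrite -lee_fin -pE.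
rewrite pE -EFinM lee_fin.
suff : (s ^+ 2 <= p * `|Q w| ^+ 2)%R.
  move=> h; have h2 : (s ^+ 2 <= p * (M ^+ 2 * s))%R.
    apply: (le_trans h); rewrite ler_wpM2l// -w2 -exprMn lerXn2r// nnegrE// mulr_ge0//.
  by move: h2; rewrite expr2 mulrA ler_pM2r// mulrC.
(* Cauchy-Schwarz for finite parts of the expansion of [phi (Q w)], whose full sum is [s]; passing
   to the limit gives [s ^+ 2 <= p * |Q w| ^+ 2], and [|Q w| ^+ 2 <= M ^+ 2 * s]. *)
have cs G : fsets std_onb G ->
    ((\sum_(i \in G) phi (inner i (Q w) *: i)) ^+ 2 <= p * `|Q w| ^+ 2)%R.
  move=> GI; pose z : U := (\sum_(i \in G) phi i *: i)%R.
  have -> : (\sum_(i \in G) phi (inner i (Q w) *: i) = inner z (Q w))%R.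
    rewrite /z !fsbig_finite/=; [|by case: GI..].
    rewrite inner_suml; apply: eq_bigr => i _.
    by rewrite (bopZ bphi.1) innerZl mulrC.
  have z2 : (`|z| ^+ 2 <= p)%R.
    rewrite (norm_fsum phi ob GI) -lee_fin -pE.
    exact: (sum_le_esum (fun i => phi i ^+ 2)%R GI).
  rewrite -[X in (X <= _)%R]ger0_norm ?sqr_ge0// normrX.
  apply: (@le_trans _ _ ((`|z| * `|Q w|) ^+ 2)%R).
    by rewrite lerXn2r ?nnegrE ?mulr_ge0// inner_le.
  by rewrite exprMn ler_wpM2r// sqr_ge0.
apply/ler_addgt0Pr => e e0.
have [F0 F0I HF] := hsum (Num.min (s / 2) (e / (2 * s)))%R
  (ltac:(by rewrite lt_min !divr_gt0// mulr_gt0)).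
have := HF F0 F0I (@subset_refl _ _); rewrite lt_min => /andP[h1 h2].
have h3 := cs F0 F0I.
move: h1 h2 h3; set q := (\sum_(i \in F0) _)%R => h1 h2 h3.
apply: le_trans (_ : (q ^+ 2 + e <= _)%R); last by rewrite lerD2r.
have h4 : (s - q < e / (2 * s))%R by rewrite (le_lt_trans (ler_norm _)).
have h5 : ((s - q) * (2 * s) < e)%R by rewrite -ltr_pdivlMr// mulr_gt0.
have := sqr_ge0 (s - q)%R.
have -> : ((s - q) ^+ 2 = q ^+ 2 + (s - q) * (2 * s) - s ^+ 2)%R by ring.
move=> *; lra.
Qed.

(** Expanding in a basis of the target makes the squared norm a double sum; after an exchange of the
    sums, each target vector contributes a scalar functional to which [esum_functional_comp]
    applies. This is how the bounded operators on [U] are handled. *)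
Lemma hs2_comp_le (V : hilbertType R) (L : U -> V) (Q : U -> U) (M : R) :
  bounded_operator L -> linear Q -> (0 <= M)%R ->
  (forall u, `|Q u| <= M * `|u|)%R -> hs2 (L \o Q) <= (M ^+ 2)%:E * hs2 L.
Proof.
move=> bL LQ M0 HQ; have [b ob] := @orthonormal_basis_exists R V.
have sq0 k u : 0 <= (inner k (L u) ^+ 2)%:E by rewrite lee_fin sqr_ge0.
apply: ge_ereal_sup => _ [F FI <-]; rewrite fsbig_finite/=; last by case: FI.
under eq_bigr => u _ do rewrite -(parseval (L (Q u)) ob).
rewrite -esum_sum; last by move=> *; rewrite lee_fin sqr_ge0.
apply: (@le_trans _ _ (\esum_(k in b) ((M ^+ 2)%:E *
    \esum_(u in std_onb) (inner k (L u) ^+ 2)%:E))).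
  apply: le_esum => k _.
  have := esum_functional_comp (bounded_operator_comp bL (inner_bop k)) LQ M0 HQ.
  apply: le_trans; rewrite -fsbig_finite/=; last by case: FI.
  by apply: ereal_sup_ubound; exists F.
apply: ge_ereal_sup => _ [G GI <-]; rewrite fsbig_finite/=; last by case: GI.
rewrite -ge0_sume_distrr; last by move=> *; exact: esum_ge0.
rewrite lee_wpmul2l ?lee_fin ?sqr_ge0// -esum_sum//.
apply: le_esum => u _; rewrite -(parseval (L u) ob) -fsbig_finite/=; last by case: GI.
by apply: ereal_sup_ubound; exists G.
Qed.

End hilbert_schmidt_norm.

(** * Diagonal operators and coordinates on the interpolation scale *)

Section diagonal_operators.
Context {R : realType} {V : hilbertType R} {HH : set V}.
Hypothesis onb : orthonormal_basis HH.
Implicit Types (phi : V -> R) (v : V).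

Let onbF : onb_family HH id := onb.

Lemma diag_opP phi v : diag_dom HH phi v ->
  forall h, HH h -> inner h (diag_op HH phi v) = phi h * inner h v.
Proof.
move=> dv; have [w hw cw] : exists2 w, has_sum HH (fun h => (phi h * inner h v) *: h) w &
    forall h, HH h -> inner h w = phi h * inner h v.
  have [|w hw cw] := @riesz_fischer _ _ _ HH id (fun h => phi h * inner h v) onbF.1.
    move: dv; rewrite /diag_dom /=; congr (_ < _)%E.
    by apply: eq_esum => h _; rewrite -normrX ger0_norm// sqr_ge0.
  by exists w.
suff -> : diag_op HH phi v = w by [].
apply: (has_sum_unique _ hw).
exact: (getPex (ex_intro [set w | has_sum HH (fun h => (phi h * inner h v) *: h) w] w hw)).
Qed.

Lemma diag_dom_basis phi k (a : R) : HH k -> diag_dom HH phi (a *: k).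
Proof.
move=> Hk; rewrite /diag_dom /=.
apply: (@le_lt_trans _ _ (`|phi k| ^+ 2 * a ^+ 2)%:E%E); last exact: ltry.
apply: (@le_trans _ _ (\esum_(h in HH) ((phi k * a) ^+ 2 * (inner h k ^+ 2))%:E)%E).
  apply: le_esum => h Hh; rewrite lee_fin innerZr onbF.1//.
  case: eqP => [->|_]; last by rewrite !mulr0 normr0 expr0n mulr0.
  by rewrite !mulr1 expr1n mulr1 -normrX ger0_norm// sqr_ge0.
apply: esum_leP => F FI; rewrite lee_fin -mulr_fsumr.
have : ((\sum_(h \in F) inner h k ^+ 2)%:E <= (`|k| ^+ 2)%:E)%E.
  rewrite -(parseval k onbF); exact: (sum_le_esum (fun h => inner h k ^+ 2) FI).
rewrite lee_fin -inner_norm onbF.1// eqxx => h.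
rewrite exprMn real_normK ?num_real// -[leRHS]mulr1.
by rewrite ler_wpM2l// mulr_ge0 ?sqr_ge0.
Qed.

Lemma diag_dom_bounded phi (M : R) v : (forall h, HH h -> `|phi h| <= M) ->
  diag_dom HH phi v.
Proof.
move=> phiM; have [h0|/set0P[h0 Hh0]] := eqVneq HH set0.
  by rewrite /diag_dom /= h0 esum_set0 ltry.
have M0 : 0 <= M by apply: le_trans (phiM h0 Hh0).
rewrite /diag_dom /=; apply: (@le_lt_trans _ _ (M ^+ 2 * `|v| ^+ 2)%:E%E); last exact: ltry.
apply: (@le_trans _ _ (\esum_(h in HH) (M ^+ 2 * (inner h v ^+ 2))%:E)%E).
  apply: le_esum => h Hh; rewrite lee_fin normrM exprMn [`|inner _ _| ^+ 2]real_normK ?num_real//.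
  by rewrite ler_wpM2r ?sqr_ge0// lerXn2r ?nnegrE// phiM.
apply: esum_leP => F FI; rewrite lee_fin -mulr_fsumr ler_wpM2l ?sqr_ge0// -lee_fin.
rewrite -(parseval v onbF); exact: (sum_le_esum (fun h => inner h v ^+ 2) FI).
Qed.

Lemma diag_op_basis phi k (a : R) : HH k -> diag_op HH phi (a *: k) = (phi k * a) *: k.
Proof.
move=> Hk; apply: (onb_inj onbF) => h Hh.
rewrite (diag_opP (diag_dom_basis phi a Hk))// !innerZr onbF.1//.
by case: eqP => [->|_]; rewrite ?mulr0// !mulr1.
Qed.

End diagonal_operators.

Section interpolation_scale.
Context {R : realType} {Hr : R -> hilbertType R} {HH : set (Hr 0)}.
Hypothesis onb : orthonormal_basis HH.
Context {lam : Hr 0 -> R} {c0 : R}.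
Hypothesis c0_gt0 : 0 < c0.
Hypothesis lamc : forall h, HH h -> lam h <= - c0.
Context {emb : forall r s : R, Hr r -> Hr s}.
Arguments emb : clear implicits.
Hypothesis Hr_interp : interpolation_family emb HH lam.

Let onbF : onb_family HH id := onb.
Let mu h := - lam h.
Let frac (r : R) := fun h => mu h `^ r.

Let mu_ge h : HH h -> c0 <= mu h.
Proof. by move=> /lamc; rewrite lerNr. Qed.

Let mu_gt0 h : HH h -> 0 < mu h.
Proof. by move=> /mu_ge; apply: lt_le_trans. Qed.

Let muD h r s : HH h -> mu h `^ (r + s) = mu h `^ r * mu h `^ s.
Proof. by move=> /mu_gt0 m0; rewrite powRD// (gt_eqF m0) implybT. Qed.

Let muN h r : HH h -> mu h `^ r * mu h `^ (- r) = 1.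
Proof. by move=> Hh; rewrite -muD// subrr powRr0. Qed.

Let mur_gt0 h r : HH h -> 0 < mu h `^ r.
Proof. by move=> Hh; rewrite powR_gt0// mu_gt0. Qed.

Lemma emb_bop r s : s <= r -> bounded_operator (emb r s).
Proof. by case: Hr_interp => + _ _ _ _; apply. Qed.

Lemma emb_id r x : emb r r x = x.
Proof. by case: Hr_interp => _ + _ _ _; apply. Qed.

Lemma emb_comp r s q x : s <= r -> q <= s -> emb s q (emb r s x) = emb r q x.
Proof. by case: Hr_interp => _ _ + _ _; apply. Qed.

Let pos r : 0 <= r -> [/\ injective (emb r 0), range (emb r 0) = diag_dom HH (frac r) &
   forall u v, inner u v = inner (diag_op HH (frac r) (emb r 0 u))
                     (diag_op HH (frac r) (emb r 0 v))].
Proof. by case: Hr_interp => _ _ _ + _; apply. Qed.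

Let neg r : r < 0 -> dense (range (emb 0 r)) /\
         forall v, `|emb 0 r v| = `|diag_op HH (frac r) v|.
Proof. by case: Hr_interp => _ _ _ _ +; apply. Qed.

(** The eigenvector [h] rescaled to norm one in [Hr r]. For [0 <= r] it is found as a preimage under
    the embedding into [Hr 0], for [r < 0] it is an image under the embedding out of [Hr 0]. *)
Definition basis r (h : Hr 0) : Hr r :=
  if 0 <= r then get [set x | emb r 0 x = mu h `^ (- r) *: h]
  else mu h `^ (- r) *: emb 0 r h.

Let basis_pos r h : 0 <= r -> HH h -> emb r 0 (basis r h) = mu h `^ (- r) *: h.
Proof.
move=> r0 Hh; rewrite /basis r0.
apply: (@getPex (Hr r) [set x | emb r 0 x = mu h `^ (- r) *: h]) => /=.
have [_ rng _] := pos r0.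
have : diag_dom HH (frac r) (mu h `^ (- r) *: h) by exact: diag_dom_basis.
by rewrite -rng => -[x _ <-]; exists x.
Qed.

Lemma basis_le0 r h : r <= 0 -> HH h -> basis r h = mu h `^ (- r) *: emb 0 r h.
Proof.
rewrite le_eqVlt => /predU1P[->|r0] Hh; last by rewrite /basis leNgt r0.
by rewrite -(emb_id (basis 0 h)) basis_pos// emb_id.
Qed.

Let frac_neg r h : r <= 0 -> HH h -> `|frac r h| <= c0 `^ r.
Proof.
move=> r0 Hh; rewrite ger0_norm ?powR_ge0// /frac.
have E (x : R) : x `^ r = (x `^ (- r))^-1 by rewrite powRN invrK.
rewrite !E lef_pV2 ?posrE ?powR_gt0 ?mu_gt0//.
apply: ge0_ler_powR; rewrite ?nnegrE ?oppr_ge0 ?(ltW c0_gt0) ?mu_ge//.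
by rewrite -oppr_ge0; exact: ltW (mu_gt0 Hh).
Qed.

(** For negative [r] the scale prescribes the norm alone; the inner product is recovered by
    polarisation. *)
Let emb_neg_inner r u v : r < 0 ->
  inner (emb 0 r u) (emb 0 r v) = inner (diag_op HH (frac r) u) (diag_op HH (frac r) v).
Proof.
move=> r0; have [_ nE] := neg r0.
have dd w : diag_dom HH (frac r) w.
  by apply: (diag_dom_bounded onb) => h Hh; exact: frac_neg (ltW r0) Hh.
have DD : diag_op HH (frac r) (u + v) = diag_op HH (frac r) u + diag_op HH (frac r) v.
  apply: (onb_inj onbF) => h Hh.
  by rewrite innerDr !(diag_opP onb (dd _))// innerDr mulrDr.
have := nE (u + v); rewrite (bopD (emb_bop (ltW r0)).1) DD.
move=> /(congr1 (fun x => x ^+ 2)); rewrite !normD_sqr !nE => h.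
by move: h; set a := inner _ _; set b := inner _ _; set p := _ ^+ 2; set q := _ ^+ 2 => h; lra.
Qed.

Lemma basis_inner_pos r h x : 0 <= r -> HH h ->
  inner (basis r h) x = mu h `^ r * inner h (emb r 0 x).
Proof.
move=> r0 Hh; have [_ rng ->] := pos r0.
rewrite basis_pos// (diag_op_basis onb)// /frac muN// scale1r (diag_opP onb)// -rng.
by exists x.
Qed.

Lemma basis_inner_neg r h v : r < 0 -> HH h ->
  inner (basis r h) (emb 0 r v) = mu h `^ r * inner h v.
Proof.
move=> r0 Hh; rewrite basis_le0 ?ltW// -(bopZ (emb_bop (ltW r0)).1) emb_neg_inner//.
rewrite (diag_op_basis onb)// /frac muN// scale1r (diag_opP onb)//.
by apply: (diag_dom_bounded onb) => k Hk; exact: frac_neg (ltW r0) Hk.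
Qed.

Lemma basis_onb r : onb_family HH (basis r).
Proof.
apply: onb_family_total => [h k Hh Hk|x x0].
  have [r0|r0] := leP 0 r.
    rewrite basis_inner_pos// basis_pos// innerZr onbF.1//.
    by case: eqP => [->|_]; rewrite ?mulr0// mulr1 muN.
  rewrite [basis r k]basis_le0 ?ltW// innerZr basis_inner_neg// onbF.1//.
  by case: eqP => [->|_]; rewrite ?mulr0// mulr1 mulrC muN.
have [r0|r0] := leP 0 r.
  have [inj _ _] := pos r0; apply: inj; rewrite (bop0 (emb_bop r0).1).
  apply: (onb_inj onbF) => h Hh; rewrite inner0r.
  have := x0 h Hh; rewrite basis_inner_pos// => /eqP; rewrite mulf_eq0 gt_eqF ?mur_gt0//=.
  by move/eqP.
have [dns _] := neg r0.
have xv v : inner x (emb 0 r v) = 0.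
  have bop := bounded_operator_comp (emb_bop (ltW r0)) (inner_bop x).
  apply: (has_sum0 (has_sum_bop bop (onbF.2 v))) => h Hh /=.
  rewrite (bopZ (emb_bop (ltW r0)).1) innerZr -[emb 0 r h]scale1r -(muN r Hh).
  by rewrite -scalerA -basis_le0 ?ltW// innerZr (innerC x) x0// !mulr0.
apply/eqP/negPn/negP => xn0.
have nx : 0 < `|x| by rewrite normr_gt0.
(* The open ball of radius [|x|] around [x] meets the dense range, yet every vector orthogonal to
   [x] has distance at least [|x|] from it. *)
have [||y [+ [v _ vy]]] := dns (ball x `|x|); first by exists x; exact: ballxx.
  exact: ball_open.
rewrite -vy -ball_normE /= ltNge => /negP; apply.
have := inner_le x (x - emb 0 r v); rewrite innerBr xv subr0 inner_norm normrX normr_id expr2.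
by rewrite ler_pM2l.
Qed.

(** The coefficient at the unnormalised eigenvector [h]. Unlike the coefficient at [basis r h], it
    is preserved by the embeddings, so the semigroup and the projections act on it through
    multipliers that do not depend on [r]. *)
Definition coord r (h : Hr 0) (x : Hr r) : R := mu h `^ (- r) * inner (basis r h) x.

Lemma basis_coord r h x : HH h -> inner (basis r h) x = mu h `^ r * coord h x.
Proof. by move=> Hh; rewrite /coord mulrA muN// mul1r. Qed.

Lemma coord_bop r h : bounded_operator (@coord r h : Hr r -> R^o).
Proof.
apply: (@bounded_bop _ _ _ _ (mu h `^ (- r) * `|basis r h|)).
  by move=> a x y; rewrite /coord innerDr innerZr mulrDr mulrCA.
move=> x; rewrite normrM ger0_norm ?powR_ge0// -mulrA ler_wpM2l ?powR_ge0//.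
exact: inner_le.
Qed.

Lemma coordB r h (x y : Hr r) : coord h (x - y) = coord h x - coord h y.
Proof. exact: (bopB (coord_bop r h).1). Qed.

Lemma norm_coord r (x : Hr r) :
  (\esum_(h in HH) ((mu h `^ r * coord h x) ^+ 2)%:E = (`|x| ^+ 2)%:E)%E.
Proof.
rewrite -(parseval x (basis_onb r)); apply: eq_esum => h Hh.
by rewrite basis_coord.
Qed.

Lemma coord_inj r (x y : Hr r) : (forall h, HH h -> coord h x = coord h y) -> x = y.
Proof.
move=> xy; apply: (onb_inj (basis_onb r)) => h Hh.
by rewrite !basis_coord// xy.
Qed.

Lemma coord_surj r (a : Hr 0 -> R) :
  (\esum_(h in HH) ((mu h `^ r * a h) ^+ 2)%:E < +oo)%E ->
  exists x : Hr r, forall h, HH h -> coord h x = a h.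
Proof.
move=> fin; have [x _ cx] := riesz_fischer (basis_onb r).1 fin.
exists x => h Hh; rewrite /coord cx// mulrA [mu h `^ _ * _]mulrC.
by rewrite muN// mul1r.
Qed.

Let emb_basis r s h : s <= r -> HH h -> emb r s (basis r h) = mu h `^ (s - r) *: basis s h.
Proof.
move=> sr Hh; have [s0|s0] := leP 0 s.
  have [inj _ _] := pos s0; apply: inj.
  rewrite emb_comp// (bopZ (emb_bop s0).1) !basis_pos// ?(le_trans s0)//.
  by rewrite scalerA -muD// addrAC subrr add0r.
have [r0|r0] := leP 0 r.
  rewrite -(emb_comp _ r0 (ltW s0)) basis_pos// (bopZ (emb_bop (ltW s0)).1).
  by rewrite basis_le0 ?ltW// scalerA -muD// addrAC subrr add0r.
rewrite basis_le0 ?ltW// (bopZ (emb_bop sr).1) emb_comp ?(ltW r0)//.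
by rewrite [basis s h]basis_le0 ?ltW// scalerA -muD// addrAC subrr add0r.
Qed.

Let coord_basis r h k : HH h -> HH k -> coord h (basis r k) = mu h `^ (- r) * (h == k)%:R.
Proof. by move=> Hh Hk; rewrite /coord (basis_onb r).1. Qed.

(** A bounded functional is determined by its values on the basis. This identifies the coordinates
    of embedded vectors, of the semigroup and of the projections. *)
Let functional_diag r h (f : Hr r -> R) (a : R) : bounded_operator (f : Hr r -> R^o) -> HH h ->
  (forall k, HH k -> f (basis r k) = a * coord h (basis r k)) ->
  forall x, f x = a * coord h x.
Proof.
move=> bf Hh fb x.
have := has_sum_single (has_sum_bop bf ((basis_onb r).2 x)) Hh.
move=> ->; last first.
  move=> k Hk kh; rewrite (bopZ bf.1) fb// coord_basis// eq_sym (negbTE kh).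
  by rewrite !mulr0 scaler0.
rewrite (bopZ bf.1) fb// coord_basis// eqxx /coord mulr1.
by rewrite -[LHS]/(_ * _) mulrC -mulrA.
Qed.

Lemma coord_emb r s h (x : Hr r) : s <= r -> HH h -> coord h (emb r s x) = coord h x.
Proof.
move=> sr Hh; rewrite -[RHS]mul1r.
apply: (functional_diag (f := fun x => coord h (emb r s x))) => // [|k Hk].
  exact: bounded_operator_comp (emb_bop sr) (coord_bop s h).
rewrite emb_basis// (bopZ (coord_bop s h).1) !coord_basis// mul1r.
case: eqP => [->|_]; last by rewrite !mulr0 scaler0.
by rewrite !mulr1 /GRing.scale /= -muD// addrAC subrr add0r.
Qed.

Lemma emb_inj r s : s <= r -> injective (emb r s).
Proof.
move=> sr x y xy; apply: coord_inj => h Hh.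
by rewrite -(coord_emb x sr Hh) xy coord_emb.
Qed.

Lemma restrP r s (x : Hr r) : s <= r -> restr emb r (emb r s x) = x.
Proof.
move=> sr; apply: (emb_inj sr).
by apply: (@getPex (Hr r) [set y | emb r s y = emb r s x]); exists x.
Qed.

(** [restr] takes a preimage by choice, so its value is meaningful only once a preimage is known to
    exist; square-summability of the prescribed coordinates supplies one. *)
Lemma restr_coord r s (a : Hr 0 -> R) (y : Hr s) : s <= r ->
  (\esum_(h in HH) ((mu h `^ r * a h) ^+ 2)%:E < +oo)%E ->
  (forall h, HH h -> coord h y = a h) ->
  forall h, HH h -> coord h (restr emb r y) = a h.
Proof.
move=> sr fin ya h Hh; have [x xa] := coord_surj fin.
suff -> : y = emb r s x by rewrite restrP// xa.
by apply: coord_inj => k Hk; rewrite coord_emb// ya// xa.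
Qed.

(** The norms of [Hr r] and [Hr s] weight the same coordinate by [mu ^ r] and [mu ^ s], so a
    multiplier of size [M * mu ^ (r - s)] maps one to the other with norm [M]. All smoothing
    estimates are instances. *)
Lemma multiplier_bound r s (phi : Hr 0 -> R) (M : R) (x : Hr r) (y : Hr s) : 0 <= M ->
  (forall h, HH h -> coord h y = phi h * coord h x) ->
  (forall h, HH h -> `|phi h| <= M * mu h `^ (r - s)) -> `|y| <= M * `|x|.
Proof.
move=> M0 cy phiM; rewrite -(@ler_pXn2r _ 2) ?nnegrE ?mulr_ge0// -lee_fin -norm_coord.
apply: esum_leP => F FI.
apply: (@le_trans _ _ (M ^+ 2 * (\sum_(h \in F) (mu h `^ r * coord h x) ^+ 2))%:E%E).
  rewrite lee_fin mulr_fsumr !fsbig_finite/=; [|by case: FI..].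
  rewrite big_seq [leRHS]big_seq; apply: ler_sum => h; rewrite in_fset_set ?inE; last by case: FI.
  move=> /FI.2 Hh; rewrite cy// -exprMn -[leLHS]real_normK ?num_real//.
  rewrite -[leRHS]real_normK ?num_real// lerXn2r ?nnegrE//.
  move: (coord h x) => c; rewrite !normrM.
  rewrite [`|_ `^ s|]ger0_norm ?powR_ge0// [`|_ `^ r|]ger0_norm ?powR_ge0// [`|M|]ger0_norm//.
  rewrite !mulrA ler_wpM2r// mulrC.
  rewrite (le_trans (ler_wpM2r _ (phiM h Hh))) ?powR_ge0// -mulrA ler_wpM2l// -muD//.
  by rewrite subrK.
rewrite exprMn !EFinM lee_wpmul2l ?lee_fin ?sqr_ge0//.
by rewrite -lee_fin -norm_coord; exact: (sum_le_esum (fun h => (mu h `^ r * coord h x) ^+ 2)).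
Qed.

Lemma multiplier_fin r s (phi : Hr 0 -> R) (M : R) (x : Hr r) :
  (forall h, HH h -> `|phi h| <= M * mu h `^ (r - s)) ->
  (\esum_(h in HH) ((mu h `^ s * (phi h * coord h x)) ^+ 2)%:E < +oo)%E.
Proof.
move=> phiM; apply: (@le_lt_trans _ _ (M ^+ 2 * `|x| ^+ 2)%:E%E); last exact: ltry.
apply: esum_leP => F FI.
apply: (@le_trans _ _ (M ^+ 2 * (\sum_(h \in F) (mu h `^ r * coord h x) ^+ 2))%:E%E).
  rewrite lee_fin mulr_fsumr !fsbig_finite/=; [|by case: FI..].
  rewrite big_seq [leRHS]big_seq; apply: ler_sum => h; rewrite in_fset_set ?inE; last by case: FI.
  move=> /FI.2 Hh; rewrite -exprMn -[leLHS]real_normK ?num_real//.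
  rewrite -[leRHS]real_normK ?num_real// lerXn2r ?nnegrE//.
  move: (coord h x) => c; rewrite !normrM.
  rewrite [`|_ `^ s|]ger0_norm ?powR_ge0// [`|_ `^ r|]ger0_norm ?powR_ge0//.
  rewrite !mulrA ler_wpM2r// mulrC.
  rewrite (le_trans (ler_wpM2r _ (phiM h Hh))) ?powR_ge0// -mulrA.
  by rewrite -muD// subrK ler_wpM2r ?powR_ge0// ler_norm.
rewrite !EFinM lee_wpmul2l ?lee_fin ?sqr_ge0//.
by rewrite -lee_fin -norm_coord; exact: (sum_le_esum (fun h => (mu h `^ r * coord h x) ^+ 2)).
Qed.

(** * The semigroup on eigenvectors *)

Section semigroup.
Context {A : Hr 0 -> Hr 0} {S : forall r : R, R -> Hr r -> Hr r}.
Arguments S : clear implicits.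
Hypothesis A_diag : forall v, diag_dom HH lam v ->
     has_sum HH (fun h => (lam h * inner h v) *: h) (A v).
Hypothesis S_semigroup : semigroup_family emb (diag_dom HH lam) A S.

Let Sbop r t : 0 <= t -> bounded_operator (S r t).
Proof. by case: S_semigroup => _ + _; apply. Qed.

Let SA h : HH h -> A h = lam h *: h.
Proof.
move=> Hh; have dh : diag_dom HH lam h by rewrite -[h]scale1r; exact: diag_dom_basis.
rewrite (has_sum_single (A_diag dh) Hh); first by rewrite onbF.1// eqxx mulr1.
by move=> k Hk kh; rewrite onbF.1// (negbTE kh) mulr0 scale0r.
Qed.

(** Otherwise there are times [t n <= 1/(n+1)] at which the operator norm exceeds [n]. Strong
    continuity at zero keeps each orbit along these times bounded, finitely many of them being
    estimated by a sum, and this contradicts the uniform boundedness principle. *)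
Let S_bounded_near0 : exists2 d : R, 0 < d & exists M : R, forall t, 0 <= t <= d ->
  forall x, `|S 0 t x| <= M * `|x|.
Proof.
apply: contrapT => nb.
have /boolp.choice[t tP] (n : nat) : exists t : R, 0 <= t <= n.+1%:R^-1 /\
    exists x, n%:R * `|x| < `|S 0 t x|.
  apply: contrapT => nt; apply: nb; exists n.+1%:R^-1; rewrite ?invr_gt0//.
  exists n%:R => s sd x; rewrite leNgt; apply/negP => h; apply: nt; exists s; split => //.
  by exists x.
have [[_ S0 _ Sc _] _ _] := S_semigroup.
have bs : uniform_bounded [set f | exists n, f = S 0 (t n)].
  apply: Banach_Steinhauss.
    move=> _ [n ->]; have /andP[t0 _] := (tP n).1; split; last exact: (Sbop 0 t0).1.
    have [M M0 HM] := bop_bound (Sbop 0 t0).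
    move=> r; exists (M * r) => x xr; rewrite (le_trans (HM x))// ler_wpM2l// ltW//.
  move=> v; have /cvgrPdist_lt/(_ 1 ltr01) := Sc v.
  move=> [/= e e0 He].
  have [n0 n0e] : exists n0 : nat, n0.+1%:R^-1 < e.
    have /cvgrPdist_lt/(_ e e0)[n _ /(_ n (leqnn n))] := @cvg_harmonic R.
    by rewrite /= sub0r normrN ger0_norm// => ?; exists n.
  exists (`|v| + 1 + \sum_(i < n0) `|S 0 (t i) v|) => _ [n ->].
  have [nn0|n0n] := ltnP n n0.
    rewrite (bigD1 (Ordinal nn0))//= addrCA lerDl !addr_ge0//.
    by apply: sumr_ge0 => *.
  apply: (@le_trans _ _ (`|v| + 1)); last by rewrite lerDl; apply: sumr_ge0 => *.
  have /andP[t0 tn] := (tP n).1.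
  move: t0; rewrite le_eqVlt => /predU1P[<-|t0]; first by rewrite S0 lerDl.
  have : `|v - S 0 (t n) v| < 1.
    apply: He => //=; rewrite sub0r normrN gtr0_norm// (le_lt_trans tn)//.
    by rewrite (le_lt_trans _ n0e)// lef_pV2 ?posrE// ler_nat.
  rewrite distrC => /ltW h; rewrite -[S 0 (t n) v](subrK v) addrC.
  by rewrite (le_trans (ler_normD _ _))// lerD2l.
have [M HM] := bs 1.
have [n Mn] : exists n : nat, M < n%:R by exists (Num.truncn M).+1; rewrite truncnS_gt.
have [/andP[t0 _] [x]] := tP n; apply/negP; rewrite -leNgt.
have [->|x0] := eqVneq x 0; first by rewrite (bop0 (Sbop 0 t0).1) !normr0 mulr0.
have nx : 0 < `|x| by rewrite normr_gt0.
have := HM (S 0 (t n)) (ex_intro _ n erefl) (`|x|^-1 *: x).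
rewrite normrZ normrV ?unitfE ?gt_eqF// normr_id mulVf ?gt_eqF// => /(_ (lexx _)).
rewrite (bopZ (Sbop 0 t0).1) normrZ normrV ?unitfE ?gt_eqF// normr_id ler_pdivrMl// mulrC => h.
by rewrite (le_trans h)// ler_wpM2r// ltW.
Qed.

Let S_bounded t0 : exists2 M : R, 1 <= M & forall t, 0 <= t <= t0 ->
  forall x, `|S 0 t x| <= M * `|x|.
Proof.
have [d d0 [M HM]] := S_bounded_near0.
have [[_ _ SD _ _] _ _] := S_semigroup.
pose K := Num.max 1 M.
have K1 : 1 <= K by rewrite le_max lexx.
have HK t : 0 <= t <= d -> forall x, `|S 0 t x| <= K * `|x|.
  move=> td x; rewrite (le_trans (HM _ td x))// ler_wpM2r// le_max lexx orbT//.
have HKn n : forall t, 0 <= t <= n%:R * d -> forall x, `|S 0 t x| <= K ^+ n.+1 * `|x|.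
  elim: n => [|n ih] t /andP[t0' tn] x.
    by rewrite expr1 HK// t0' (le_trans tn)// mul0r ltW.
  have [td|dt] := leP t d.
    rewrite (le_trans (HK t _ x)) ?t0'// ler_wpM2r// exprS ler_peMr// ?(le_trans ler01)//.
    exact: exprn_ege1.
  have -> : t = d + (t - d) by rewrite addrC subrK.
  have td0 : 0 <= t - d by rewrite subr_ge0 ltW.
  rewrite SD// ?(ltW d0)//.
  rewrite (le_trans (HK d _ _)) ?(ltW d0)//= exprS -mulrA ler_wpM2l ?(le_trans ler01)//.
  by rewrite ih// td0 /= lerBlDr (le_trans tn)// -nat1r mulrDl mul1r addrC.
exists (K ^+ (Num.truncn (t0 / d)).+2); first exact: exprn_ege1.
move=> t /andP[t0' tt0] x; apply: HKn; rewrite t0' (le_trans tt0)//.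
by rewrite -ler_pdivrMr// ltW// truncnS_gt.
Qed.

Let expR_quad (x : R) : 0 <= x -> `|expR (- x) - 1 + x| <= x ^+ 2.
Proof.
move=> x0; rewrite ger0_norm; last by have := expR_ge1Dx (- x); lra.
have h : expR (- x) <= (1 + x)^-1.
  by rewrite expRN lef_pV2 ?posrE ?expR_gt0 ?expR_ge1Dx// ltr_pwDl.
suff : (1 + x)^-1 <= 1 - x + x ^+ 2 by lra.
rewrite -[leLHS]mul1r ler_pdivrMr ?ltr_pwDl//.
have -> : (1 - x + x ^+ 2) * (1 + x) = 1 + x ^+ 3 by ring.
by rewrite lerDl exprn_ge0.
Qed.

(** Only the derivative at time zero is given. Over [n.+1] steps of length [t/(n+1)] the one-step
    errors are of smaller order than the step; they add up through a telescoping sum in which the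
    semigroup is bounded by [M] and the scalar exponential by one. *)
Let S_basis0 t h : 0 <= t -> HH h -> S 0 t h = expR (lam h * t) *: h.
Proof.
move=> t0 Hh; have [M M1 HM] := S_bounded t.
have [[_ S0 SD _ SA'] _ _] := S_semigroup.
have {SA'} : (t^-1 *: (S 0 t h - h) @[t --> 0^'+] --> lam h *: h).
  apply/SA'; split; last by rewrite SA.
  by rewrite -[h]scale1r; exact: diag_dom_basis.
move=> /cvgrPdist_lt gen.
move: t0; rewrite le_eqVlt => /predU1P[<-|t0].
  by rewrite S0 mulr0 expR0 scale1r.
have h1 : `|h| = 1.
  apply/eqP; rewrite -(@eqrXn2 _ 2)// expr1n -inner_norm; apply/eqP.
  by rewrite onbF.1// eqxx.
have E t' : 0 <= t' -> expR (lam h * t') <= 1.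
  by move=> t'0; rewrite expR_le1 -[lam h]opprK mulNr oppr_le0 mulr_ge0// ltW// mu_gt0.
apply/eqP; rewrite -subr_eq0 -normr_le0; apply/ler_addgt0Pl => e e0; rewrite addr0.
have e' : 0 < e / (2 * M * t) by rewrite divr_gt0// !mulr_gt0// (lt_le_trans ltr01).
have [/= d d0 Hd] := gen _ e'.
(* The error budget is halved: [d] controls the difference quotient of the semigroup, the second
   bound the quadratic remainder of the exponential. *)
pose d' := Num.min d (e / (2 * M * t) / (mu h ^+ 2)).
have d'0 : 0 < d' by rewrite lt_min d0 divr_gt0// exprn_gt0// mu_gt0.
have [n nd] : exists n : nat, t / n.+1%:R < d'.
  exists (Num.truncn (t / d')); rewrite ltr_pdivrMr// mulrC -ltr_pdivrMr//.
  by rewrite truncnS_gt.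
pose s := t / n.+1%:R; have s0 : 0 < s by rewrite divr_gt0.
have sd : s < d by rewrite (lt_le_trans nd)// ge_min lexx.
have sq : s * mu h ^+ 2 < e / (2 * M * t).
  by rewrite -ltr_pdivlMr ?exprn_gt0 ?mu_gt0// (lt_le_trans nd)// ge_min lexx orbT.
have ts : t = n.+1%:R * s by rewrite /s mulrC divfK.
pose w := S 0 s h - expR (lam h * s) *: h.
have hw : `|w| <= s * (e / (M * t)).
  have := Hd s; rewrite /= sub0r normrN gtr0_norm// => /(_ sd s0) g1.
  have -> : w = s *: ((s^-1 *: (S 0 s h - h) - lam h *: h)
              - (s^-1 * (expR (- (mu h * s)) - 1 + mu h * s)) *: h).
    set c := expR _ - 1 + _.
    rewrite !scalerBr !scalerA mulrA mulfV ?gt_eqF// mul1r !scale1r /w -/mu.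
    have -> : expR (lam h * s) = 1 + s * lam h + c by rewrite /c /mu mulNr opprK; ring.
    by rewrite !scalerDl scale1r !opprD !addrA.
  rewrite normrZ gtr0_norm// ler_pM2l// (le_trans (ler_normB _ _))//.
  have -> : e / (M * t) = e / (2 * M * t) + e / (2 * M * t).
    by field; rewrite ?gt_eqF// (lt_le_trans ltr01).
  rewrite lerD//; first by rewrite distrC ltW.
  rewrite normrZ h1 mulr1 normrM gtr0_norm ?invr_gt0// ler_pdivrMl//.
  rewrite (le_trans (expR_quad _))//; first by rewrite mulr_ge0// ltW// mu_gt0.
  have -> : (mu h * s) ^+ 2 = s * (s * mu h ^+ 2) by ring.
  by rewrite ler_pM2l// ltW.
(* With G the semigroup step and E the scalar step, G^(k+1) - E^(k+1) = G^k (G - E) + E (G^k - E^k),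
   applied to [h]. *)
have step k : (k <= n.+1)%N ->
    `|S 0 (k%:R * s) h - expR (lam h * (k%:R * s)) *: h| <= k%:R * (M * `|w|).
  elim: k => [|k ih] kn; first by rewrite !mul0r mulr0 expR0 S0 scale1r subrr normr0.
  have ks0 : 0 <= k%:R * s by rewrite mulr_ge0// ltW.
  have kst : k%:R * s <= t by rewrite ts ler_pM2r// ler_nat ltnW.
  have -> : k.+1%:R * s = k%:R * s + s by rewrite -nat1r mulrDl mul1r addrC.
  rewrite SD// ?(ltW s0)// mulrDr expRD -scalerA.
  have -> : S 0 (k%:R * s) (S 0 s h) - expR (lam h * (k%:R * s)) *: (expR (lam h * s) *: h)
    = S 0 (k%:R * s) w + expR (lam h * s) *:
       (S 0 (k%:R * s) h - expR (lam h * (k%:R * s)) *: h).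
    rewrite /w (bopB (Sbop 0 ks0).1) (bopZ (Sbop 0 ks0).1) scalerBr addrA subrK.
    by rewrite !scalerA (mulrC (expR (lam h * s))).
  rewrite (le_trans (ler_normD _ _))// -nat1r mulrDl mul1r lerD//; first by rewrite HM ?ks0.
  rewrite normrZ gtr0_norm ?expR_gt0// (le_trans _ (ih (ltnW kn)))//.
  by rewrite ler_piMl// E// ltW.
rewrite {1 2}ts (le_trans (step _ (leqnn _)))//.
rewrite (le_trans (ler_wpM2l _ (ler_wpM2l _ hw)))// ?(le_trans ler01)//.
have -> : n.+1%:R * (M * (s * (e / (M * t)))) = (n.+1%:R * s) * (e / t).
  by field; rewrite ?gt_eqF// (lt_le_trans ltr01).
by rewrite -ts mulrCA divff ?mulr1// gt_eqF.
Qed.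

Lemma coord_semigroup r t h x : r <= 0 -> 0 <= t -> HH h ->
  coord h (S r t x) = expR (lam h * t) * coord h x.
Proof.
move=> r0 t0 Hh.
apply: (functional_diag (f := fun x => coord h (S r t x))) => // [|k Hk].
  exact: bounded_operator_comp (Sbop r t0) (coord_bop r h).
rewrite {1}basis_le0// (bopZ (Sbop r t0).1).
have [_ _ Semb] := S_semigroup.
rewrite Semb// S_basis0// (bopZ (emb_bop r0).1) scalerA mulrC -scalerA -basis_le0//.
rewrite (bopZ (coord_bop r h).1) coord_basis//.
by case: eqP => [->//|_]; rewrite !mulr0 scaler0.
Qed.

End semigroup.

Lemma coord_projection (HN : set (Hr 0)) r (Q : Hr r -> Hr r) : r <= 0 -> HN `<=` HH ->
  bounded_operator Q ->
  (forall v, exists2 w, has_sum HN (fun h => inner h v *: h) w & Q (emb 0 r v) = emb 0 r w) ->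
  forall h x, HH h -> coord h (Q x) = \1_HN h * coord h x.
Proof.
move=> r0 sub bQ HQ h x Hh.
apply: (functional_diag (f := fun x => coord h (Q x))) => // [|k Hk].
  exact: bounded_operator_comp bQ (coord_bop r h).
rewrite basis_le0// (bopZ bQ.1).
have [w hw ->] := HQ k.
have -> : w = (\1_HN k : R) *: k.
  rewrite indicE; case: (boolP (k \in HN)) => [/set_mem kN|/negP kN].
    rewrite (has_sum_single hw kN) ?onbF.1// ?eqxx// => j jN jk.
    by rewrite onbF.1// ?(negbTE jk) ?scale0r//; exact: sub.
  rewrite scale0r; apply: (has_sum0 hw) => j jN.
  rewrite onbF.1//; last exact: sub.
  by case: eqP => [jk|_]; rewrite ?scale0r//; case: kN; rewrite -jk; exact: mem_set.
rewrite (bopZ (emb_bop r0).1) scalerA mulrC -scalerA -basis_le0//.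
rewrite (bopZ (coord_bop r h).1) coord_basis//.
by case: eqP => [->//|_]; rewrite !mulr0 scaler0.
Qed.

End interpolation_scale.

(** * Smoothing estimates for the projected semigroup *)

Section real_inequalities.
Context {R : realType}.
Implicit Types x y t s q : R.

Lemma powR_le_1D x q : 0 < x -> 0 <= q <= 1 -> x `^ q <= 1 + x.
Proof.
move=> x0 /andP[q0 q1]; have [x1|x1] := leP x 1.
  apply: (@le_trans _ _ 1); last by rewrite lerDl ltW.
  by rewrite -[leRHS](powRr0 x) ger_powR// x0.
by rewrite (le_trans (ler1_powR (ltW x1) q1))// lerDr.
Qed.

(** Analyticity of the semigroup in scalar form: (x t)^q <= 1 + x t <= e^(x t). For [q] at most one
    the constant is one. *)
Lemma powR_expRN x t q : 0 < x -> 0 < t -> 0 <= q <= 1 ->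
  x `^ q * expR (- (x * t)) <= t `^ (- q).
Proof.
move=> x0 t0 q01; rewrite powRN expRN -ler_pdivlMr ?invr_gt0 ?expR_gt0// invrK.
rewrite mulrC ler_pdivlMr ?powR_gt0// -powRM ?(ltW x0) ?(ltW t0)//.
by rewrite (le_trans (powR_le_1D _ q01)) ?mulr_gt0// expR_ge1Dx.
Qed.

Lemma expRN_diff x t q : 0 < x -> 0 <= t -> 0 <= q <= 1 ->
  `|expR (- (x * t)) - 1| <= (x * t) `^ q.
Proof.
move=> x0; rewrite le_eqVlt => /predU1P[<-|t0] q01.
  by rewrite mulr0 oppr0 expR0 subrr normr0 powR_ge0.
have xt : 0 < x * t by rewrite mulr_gt0.
rewrite distrC ger0_norm ?subr_ge0 ?expR_le1 ?oppr_le0 ?(ltW xt)//.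
have [h|h] := leP (x * t) 1.
  apply: (@le_trans _ _ (x * t)); first by have := expR_ge1Dx (- (x * t)); lra.
  by rewrite ger1_powR ?xt//; case/andP: q01.
apply: (@le_trans _ _ 1); first by rewrite lerBlDr lerDl expR_ge0.
by rewrite -[leLHS](powRr0 (x * t)) ler_powR ?(ltW h)//; case/andP: q01.
Qed.

Lemma powRN_le t T q p : 0 < t <= T -> q <= p -> t `^ (- q) <= T `^ (p - q) * t `^ (- p).
Proof.
move=> /andP[t0 tT] qp.
have -> : t `^ (- q) = t `^ (p - q) * t `^ (- p).
  by rewrite -powRD ?(gt_eqF t0) ?implybT// addrAC subrr add0r.
rewrite ler_wpM2r ?powR_ge0//.
by rewrite ge0_ler_powR ?nnegrE ?subr_ge0 ?(ltW t0)// (le_trans _ tT)// ltW.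
Qed.

End real_inequalities.

Section smoothing.
Context {R : realType} {Hr : R -> hilbertType R} {HH : set (Hr 0)}.
Hypothesis onb : orthonormal_basis HH.
Context {lam : Hr 0 -> R} {c0 : R}.
Hypothesis c0_gt0 : 0 < c0.
Hypothesis lamc : forall h, HH h -> lam h <= - c0.
Context {emb : forall r s : R, Hr r -> Hr s}.
Arguments emb : clear implicits.
Hypothesis Hr_interp : interpolation_family emb HH lam.
Context {A : Hr 0 -> Hr 0} {S : forall r : R, R -> Hr r -> Hr r}.
Arguments S : clear implicits.
Hypothesis A_diag : forall v, diag_dom HH lam v ->
     has_sum HH (fun h => (lam h * inner h v) *: h) (A v).
Hypothesis S_semigroup : semigroup_family emb (diag_dom HH lam) A S.
Context {HN : nat -> set (Hr 0)} {m gam : R}.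
Hypothesis m_le0 : m <= 0.
Hypothesis m_gam : m <= gam.
Hypothesis HN_sub : forall N, HN N `<=` HH.
Hypothesis HN0 : HN 0%N = HH.
Context {PH : nat -> Hr m -> Hr m}.
Hypothesis PH_bounded : forall N, bounded_operator (PH N).
Hypothesis PH_proj : forall N v, exists2 w, has_sum (HN N) (fun h => inner h v *: h) w &
     PH N (emb 0 m v) = emb 0 m w.

Let mu h := - lam h.

Let mu_gt0 h : HH h -> 0 < mu h.
Proof. by move=> /lamc; rewrite lerNr; apply: lt_le_trans. Qed.

Let muD h r s : HH h -> mu h `^ (r + s) = mu h `^ r * mu h `^ s.
Proof. by move=> /mu_gt0 m0; rewrite powRD// (gt_eqF m0) implybT. Qed.

(** Literally the shape of the terms in the mild equation: embed into [Hr m], project, apply the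
    semigroup there, and lift the result to [Hr gam]. For [t > 0] the lift exists as long as at most
    one order of regularity is to be gained. *)
Definition smoothing N r t (x : Hr r) : Hr gam :=
  restr emb gam (S m t (PH N (emb r m x))).

Notation coord := (@coord _ _ lam emb _).
Let cemb := coord_emb onb c0_gt0 lamc Hr_interp.
Let cinj := coord_inj onb c0_gt0 lamc Hr_interp.
Let mbound := multiplier_bound onb c0_gt0 lamc Hr_interp.

Let preimage_coord N r t (x : Hr r) h : m <= r -> 0 <= t -> HH h ->
  coord h (S m t (PH N (emb r m x))) = expR (lam h * t) * \1_(HN N) h * coord h x.
Proof.
move=> mr t0 Hh.
rewrite (coord_semigroup onb c0_gt0 lamc Hr_interp A_diag S_semigroup)//.
rewrite (coord_projection onb c0_gt0 lamc Hr_interp m_le0 (@HN_sub N) (PH_bounded N) (PH_proj N))//.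
by rewrite cemb// mulrA.
Qed.

Let exp_bound N t q h : 0 < t -> 0 <= q <= 1 -> HH h ->
  `|expR (lam h * t) * \1_(HN N) h| <= t `^ (- q) * mu h `^ (- q).
Proof.
move=> t0 q01 Hh; rewrite normrM ger0_norm ?expR_ge0//.
apply: (@le_trans _ _ (expR (lam h * t))).
  rewrite ler_piMr ?expR_ge0// ger0_norm ?indicE//; by case: (_ \in _).
rewrite [mu h `^ _]powRN ler_pdivlMr ?powR_gt0 ?mu_gt0// mulrC.
by have := powR_expRN (mu_gt0 Hh) t0 q01; rewrite /mu mulNr opprK.
Qed.

Lemma coord_smoothing N r t (x : Hr r) h : m <= r -> gam - 1 <= r <= gam -> 0 < t -> HH h ->
  coord h (smoothing N t x) = expR (lam h * t) * \1_(HN N) h * coord h x.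
Proof.
move=> mr /andP[r1 rg] t0 Hh.
apply: (restr_coord onb c0_gt0 lamc Hr_interp m_gam (a := fun h =>
    expR (lam h * t) * \1_(HN N) h * coord h x)) => // [|k Hk]; last first.
  by rewrite preimage_coord// ltW.
apply: (multiplier_fin onb c0_gt0 lamc Hr_interp (M := t `^ (- (gam - r)))) => k Hk.
rewrite -[r - gam]opprB; apply: exp_bound => //.
by rewrite subr_ge0 rg/= lerBlDr addrC -lerBlDr.
Qed.

Lemma coord_smoothing0 N t (x : Hr gam) h : 0 <= t -> HH h ->
  coord h (smoothing N t x) = expR (lam h * t) * \1_(HN N) h * coord h x.
Proof.
move=> t0 Hh.
apply: (restr_coord onb c0_gt0 lamc Hr_interp m_gam (a := fun h =>
    expR (lam h * t) * \1_(HN N) h * coord h x)) => // [|k Hk]; last first.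
  by rewrite preimage_coord// ltW.
apply: (multiplier_fin onb c0_gt0 lamc Hr_interp (M := 1)) => k Hk.
rewrite subrr powRr0 mulr1 normrM !ger0_norm ?expR_ge0//.
have e1 : expR (lam k * t) <= 1.
  by rewrite expR_le1 -[lam k]opprK mulNr oppr_le0 mulr_ge0// ltW// mu_gt0.
by rewrite indicE; case: (_ \in _); rewrite ?mulr1 ?mulr0.
Qed.

Lemma smoothing_lin N r t (x y : Hr r) : m <= r -> gam - 1 <= r <= gam -> 0 < t ->
  smoothing N t (x - y) = smoothing N t x - smoothing N t y.
Proof.
move=> mr r1 t0; apply: cinj => h Hh.
by rewrite coordB !coord_smoothing// coordB mulrBr.
Qed.

Lemma smoothing_emb N r s t (x : Hr r) : s <= r -> m <= s ->
  smoothing N t (emb r s x) = smoothing N t x.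
Proof. by move=> sr ms; rewrite /smoothing (emb_comp Hr_interp). Qed.

Lemma smoothing_bound N r t (x : Hr r) : m <= r -> gam - 1 <= r <= gam -> 0 < t ->
  `|smoothing N t x| <= t `^ (- (gam - r)) * `|x|.
Proof.
move=> mr r1 t0; apply: mbound; [exact: powR_ge0|by move=> h Hh; rewrite coord_smoothing|].
move=> h Hh; rewrite -[r - gam]opprB; apply: exp_bound => //.
by case/andP: r1 => r1 r2; rewrite subr_ge0 r2/= lerBlDr addrC -lerBlDr.
Qed.

(** On the discarded modes one splits off [mu ^ (- th)], which is at most [M]; the compensating
    [mu ^ th] is absorbed by the exponential and raises the singularity in [t] by [th]. *)
Lemma smoothing_diff N (th M : R) r t (x : Hr r) : 0 <= th -> 0 <= M ->
  m <= r -> gam - 1 <= r <= gam -> gam - r + th <= 1 -> 0 < t ->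
  (forall h, HH h -> ~ HN N h -> mu h `^ (- th) <= M) ->
  `|smoothing 0 t x - smoothing N t x| <= M * t `^ (- (gam - r + th)) * `|x|.
Proof.
move=> th0 M0 mr r1 q1 t0 HM.
apply: (mbound (phi := fun h => expR (lam h * t) * (1 - \1_(HN N) h))).
- by rewrite mulr_ge0 ?powR_ge0.
- move=> h Hh; rewrite coordB !coord_smoothing// HN0 [\1_HH h]indicE mem_set//=; ring.
move=> h Hh; rewrite normrM ger0_norm ?expR_ge0// indicE.
have [hN|hN] := boolP (h \in HN N).
  by rewrite subrr normr0 mulr0 !mulr_ge0 ?powR_ge0.
rewrite subr0 normr1 mulr1.
have q01 : 0 <= gam - r + th <= 1 by rewrite q1 andbT addr_ge0// subr_ge0; case/andP: r1.
have := powR_expRN (mu_gt0 Hh) t0 q01; rewrite {2}/mu mulNr opprK => h1.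
have E : expR (lam h * t) = mu h `^ (- th) * mu h `^ (r - gam) *
    (mu h `^ (gam - r + th) * expR (lam h * t)).
  rewrite mulrA -!muD//; have -> : - th + (r - gam) + (gam - r + th) = 0 by ring.
  by rewrite powRr0 mul1r.
rewrite E; move: h1; set a := mu h `^ _ * expR _; set b := t `^ _ => ab.
have hM : mu h `^ (- th) <= M by apply: HM => // /mem_set hN'; rewrite hN' in hN.
have -> : mu h `^ (- th) * mu h `^ (r - gam) * a = mu h `^ (r - gam) * (mu h `^ (- th) * a) by ring.
have -> : M * b * mu h `^ (r - gam) = mu h `^ (r - gam) * (M * b) by ring.
rewrite ler_wpM2l ?powR_ge0// ler_pM ?powR_ge0// mulr_ge0 ?powR_ge0 ?expR_ge0//.
Qed.

(** The factor [expR (lam h * (t - s)) - 1] is at most [(mu h * (t - s)) ^ th], and the smoothing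
    over the time [s] pays for the power of [mu]. *)
Lemma smoothing_time N (th : R) r t s (x : Hr r) : 0 <= th ->
  m <= r -> gam - 1 <= r <= gam -> gam - r + th <= 1 -> 0 < s <= t ->
  `|smoothing N t x - smoothing N s x| <= (t - s) `^ th * s `^ (- (gam - r + th)) * `|x|.
Proof.
move=> th0 mr r1 q1 /andP[s0 st]; have t0 := lt_le_trans s0 st.
apply: (mbound (phi := fun h => expR (lam h * s) * (expR (lam h * (t - s)) - 1) * \1_(HN N) h)).
- by rewrite mulr_ge0 ?powR_ge0.
- move=> h Hh; rewrite coordB !coord_smoothing//.
  have -> : lam h * t = lam h * s + lam h * (t - s) by ring.
  rewrite expRD; ring.
move=> h Hh; rewrite !normrM ger0_norm ?expR_ge0//.
have hI : `|\1_(HN N) h| <= 1 :> R by rewrite indicE; case: (_ \in _); rewrite ?normr1 ?normr0.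
rewrite (le_trans (ler_wpM2l _ hI)) ?mulr_ge0 ?expR_ge0// mulr1.
have th1 : 0 <= th <= 1.
  by rewrite th0 (le_trans _ q1)// lerDr subr_ge0; case/andP: r1.
have ts : 0 <= t - s by rewrite subr_ge0.
have h2 : `|expR (lam h * (t - s)) - 1| <= (mu h * (t - s)) `^ th.
  by have := expRN_diff (mu_gt0 Hh) ts th1; rewrite -mulNr /mu opprK.
have q01 : 0 <= gam - r + th <= 1 by rewrite q1 andbT addr_ge0// subr_ge0; case/andP: r1.
have := powR_expRN (mu_gt0 Hh) s0 q01; rewrite {2}/mu mulNr opprK => h1.
apply: (le_trans (ler_wpM2l (expR_ge0 _) h2)); rewrite powRM ?(ltW (mu_gt0 Hh))//.
have -> : expR (lam h * s) * (mu h `^ th * (t - s) `^ th) =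
    (t - s) `^ th * (mu h `^ (r - gam) * (mu h `^ (gam - r + th) * expR (lam h * s))).
  have -> : mu h `^ th = mu h `^ (r - gam) * mu h `^ (gam - r + th).
    by rewrite -muD//; congr (_ `^ _); ring.
  ring.
by rewrite -!mulrA ler_wpM2l ?powR_ge0// mulrC ler_wpM2r ?powR_ge0.
Qed.

(** Here the additional regularity of the vector itself pays for [mu ^ th], so that no singularity
    at time zero arises, in contrast to [smoothing_diff]. *)
Lemma smoothing0_diff N (th M : R) t (z : Hr (gam + th)) : 0 <= th -> 0 <= M -> 0 <= t ->
  (forall h, HH h -> ~ HN N h -> mu h `^ (- th) <= M) ->
  `|smoothing 0 t (emb (gam + th) gam z) - smoothing N t (emb (gam + th) gam z)| <= M * `|z|.
Proof.
move=> th0 M0 t0 HM.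
apply: (mbound (phi := fun h => expR (lam h * t) * (1 - \1_(HN N) h))) => //.
  move=> h Hh; rewrite coordB !coord_smoothing0// HN0 [\1_HH h]indicE mem_set//= cemb ?lerDl//; ring.
move=> h Hh; rewrite normrM ger0_norm ?expR_ge0// indicE.
have [hN|hN] := boolP (h \in HN N).
  by rewrite subrr normr0 mulr0 !mulr_ge0 ?powR_ge0.
rewrite subr0 normr1 mulr1 addrAC subrr add0r.
have hM : mu h `^ (- th) <= M by apply: HM => // /mem_set hN'; rewrite hN' in hN.
apply: (@le_trans _ _ 1).
  by rewrite expR_le1 -[lam h]opprK mulNr oppr_le0 mulr_ge0// ltW// mu_gt0.
have <- : mu h `^ (- th) * mu h `^ th = 1 by rewrite -muD// addNr powRr0.
by rewrite ler_wpM2r ?powR_ge0.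
Qed.

Lemma smoothing0_time N (th : R) t s (z : Hr (gam + th)) : 0 <= th <= 1 -> 0 <= s <= t ->
  `|smoothing N t (emb (gam + th) gam z) - smoothing N s (emb (gam + th) gam z)| <=
    (t - s) `^ th * `|z|.
Proof.
move=> th1 /andP[s0 st]; have t0 := le_trans s0 st; have /andP[th0 _] := th1.
apply: (mbound (phi := fun h => expR (lam h * s) * (expR (lam h * (t - s)) - 1) * \1_(HN N) h)).
- by rewrite powR_ge0.
- move=> h Hh; rewrite coordB !coord_smoothing0// cemb ?lerDl//.
  have -> : lam h * t = lam h * s + lam h * (t - s) by ring.
  rewrite expRD; ring.
move=> h Hh; rewrite !normrM ger0_norm ?expR_ge0//.
have hI : `|\1_(HN N) h| <= 1 :> R by rewrite indicE; case: (_ \in _); rewrite ?normr1 ?normr0.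
rewrite (le_trans (ler_wpM2l _ hI)) ?mulr_ge0 ?expR_ge0// mulr1.
have ts : 0 <= t - s by rewrite subr_ge0.
have h2 : `|expR (lam h * (t - s)) - 1| <= (mu h * (t - s)) `^ th.
  by have := expRN_diff (mu_gt0 Hh) ts th1; rewrite -mulNr /mu opprK.
have e1 : expR (lam h * s) <= 1.
  by rewrite expR_le1 -[lam h]opprK mulNr oppr_le0 mulr_ge0// ltW// mu_gt0.
rewrite (le_trans (ler_wpM2r _ e1))// mul1r (le_trans h2)//.
by rewrite powRM ?(ltW (mu_gt0 Hh))// [gam + th - gam]addrAC subrr add0r mulrC.
Qed.

(** Lower semicontinuity of the stronger norm: membership says that every finite sum of weighted
    squared coordinates is at most [a ^+ 2], and each of these is a closed condition in the weaker
    norm. It makes the localisation of the initial value measurable. *)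
Lemma closed_emb_ball r (th a : R) : 0 <= th -> 0 <= a ->
  closed [set x : Hr r | exists2 z, x = emb (r + th) r z & `|z| <= a].
Proof.
move=> th0 a0.
have -> : [set x : Hr r | exists2 z, x = emb (r + th) r z & `|z| <= a] =
  \bigcap_(F in fsets HH) [set x : Hr r |
     \sum_(h <- finmap.enum_fset (fset_set F)) (mu h `^ (r + th) * coord h x) ^+ 2 <= a ^+ 2].
  apply/seteqP; split=> [x [z -> za] F FI /=|x xF /=].
    rewrite -lee_fin; apply: (@le_trans _ _ (`|z| ^+ 2)%:E%E); last first.
      by rewrite lee_fin lerXn2r ?nnegrE.
    rewrite -(norm_coord onb c0_gt0 lamc Hr_interp z).
    have -> : \sum_(h <- finmap.enum_fset (fset_set F)) (mu h `^ (r + th) *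
         coord h (emb (r + th) r z)) ^+ 2 = \sum_(h \in F) (mu h `^ (r + th) * coord h z) ^+ 2.
      rewrite fsbig_finite//=; last by case: FI.
      rewrite big_seq [RHS]big_seq; apply: eq_bigr => h; rewrite in_fset_set ?inE; last by case: FI.
      by move=> /FI.2 Hh; rewrite cemb// lerDl.
    exact: (sum_le_esum (fun h => (mu h `^ (r + th) * coord h z) ^+ 2)).
  have h1 : (\esum_(h in HH) ((mu h `^ (r + th) * coord h x) ^+ 2)%:E <= (a ^+ 2)%:E)%E.
    apply: esum_leP => F FI; rewrite lee_fin fsbig_finite; last by case: FI.
    exact: xF FI.
  have [z zx] := coord_surj onb c0_gt0 lamc Hr_interp (le_lt_trans h1 (ltry _)).
  exists z; first by apply: cinj => h Hh; rewrite cemb ?lerDl// zx.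
  rewrite -(@ler_pXn2r _ 2) ?nnegrE// -lee_fin -(norm_coord onb c0_gt0 lamc Hr_interp z).
  apply: le_trans h1; apply: le_esum => h Hh; by rewrite zx.
have cont (hs : seq (Hr 0)) : continuous (fun x : Hr r =>
    \sum_(h <- hs) (mu h `^ (r + th) * coord h x) ^+ 2 : R).
  elim: hs => [|h hs ih] x.
    by under eq_fun do rewrite big_nil; exact: cvg_cst.
  under eq_fun do rewrite big_cons.
  apply: cvgD; last exact: ih.
  apply: (@continuous_comp _ _ _ (fun x => mu h `^ (r + th) * coord h x) (fun y : R => y ^+ 2)).
    by apply: cvgM; [exact: cvg_cst|exact: (coord_bop r h).2].
  exact: exprn_continuous.
rewrite -openC setC_bigcap; apply: bigcup_open => F FI.
rewrite openC.
apply: (@preimage_closed _ _ (fun x : Hr r =>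
    \sum_(h <- finmap.enum_fset (fset_set F)) (mu h `^ (r + th) * coord h x) ^+ 2 : R)
    [set y : R | y <= a ^+ 2]); last exact: closed_le.
by move=> x _; exact: cont.
Qed.

End smoothing.

(** Distinct orthonormal vectors are at distance sqrt 2, so two of them cannot share a point of the
    dense set within 1/2 of both. *)
Lemma orthonormal_countable (R : realType) (V : hilbertType R) (b : set V) :
  separable V -> orthonormal_family b id -> countable b.
Proof.
move=> [D cD dD] ob.
have near_ h : exists x, D x /\ `|h - x| < 2^-1.
  have [||x [hx Dx]] := dD (ball h 2^-1); first by exists h; exact: ballxx.
    exact: ball_open.
  by exists x; split => //; move: hx; rewrite -ball_normE.
have /boolp.choice[f fP] := near_.
apply/countable_injP; case/countable_injP: cD => g inj.
exists (g \o f) => h k /set_mem bh /set_mem bk /= E.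
have fhk : f h = f k by apply: inj => //; apply: mem_set; [case: (fP h)|case: (fP k)].
apply/eqP/negPn/negP => hk.
have n2 : `|h - k| ^+ 2 = 2.
  by rewrite normB_sqr -!inner_norm !ob// !eqxx (negbTE hk) /= mulr0 subr0 -natrD.
have : `|h - k| < 1.
  have -> : h - k = (h - f h) - (k - f k) by rewrite fhk opprB addrA subrK.
  rewrite (le_lt_trans (ler_normB _ _))//.
  have := (fP h).2; have := (fP k).2; lra.
move=> lt1; have : `|h - k| ^+ 2 < 1 by rewrite expr_lt1.
by rewrite n2; lra.
Qed.

(** * Gaussian moments, independence and the calculus of expectations *)

Section normal_moments.
Import HBNNSimple.
Context {R : realType}.
Local Notation mu := (@lebesgue_measure R).

(** Equality holds for simple functions by the definition of [normal_prob], and monotone convergence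
    carries the upper bound over; this direction is what finiteness of moments asks for. *)
Lemma ge0_integral_normal_prob_le (m s : R) (f : R -> R) :
  (forall x, 0 <= f x) -> measurable_fun setT f ->
  (\int[normal_prob m s]_x (f x)%:E <= \int[mu]_x (f x * normal_pdf m s x)%:E)%E.
Proof.
move=> f0 mf.
have mf' : measurable_fun (setT : set (measurableTypeR R)) (EFin \o f).
  exact/measurable_EFinP.
have mpdf := @measurable_normal_pdf R m s.
have f0' x : setT x -> (0 <= (EFin \o f) x)%E by rewrite lee_fin.
pose h := @nnsfun_approx _ (measurableTypeR R) R setT measurableT (EFin \o f) mf'.
have hf n x : (h n x <= f x).
  have nd : nondecreasing_seq (fun k => (h k x)%:E).
    by move=> a b ab; rewrite lee_fin; exact/lefP/nd_nnsfun_approx.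
  have cv : ((h k x)%:E @[k --> \oo] --> (f x)%:E)%E.
    exact: (@cvg_nnsfun_approx _ (measurableTypeR R) _ setT measurableT (EFin \o f)).
  rewrite -lee_fin -(cvg_lim _ cv)// (cvg_lim _ (ereal_nondecreasing_cvgn nd))//.
  by apply: ereal_sup_ubound; exists n.
rewrite [leLHS](_ : _ = limn (fun n => \int[normal_prob m s]_x (h n x)%:E)%E); last first.
  rewrite -monotone_convergence//=.
  - apply: eq_integral => x _; apply/esym/cvg_lim => //.
    by apply: (@cvg_nnsfun_approx _ (measurableTypeR R) _ setT measurableT (EFin \o f)) => //.
  - by move=> n; exact/measurable_EFinP/measurable_funP.
  - by move=> n x _; rewrite lee_fin.
  - by move=> x _ a b ab; rewrite lee_fin; exact/lefP/nd_nnsfun_approx.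
apply: lime_le.
  apply: ereal_nondecreasing_is_cvgn => a b ab; apply: ge0_le_integral => //.
  - by move=> x _; rewrite lee_fin.
  - exact/measurable_EFinP.
  - exact/measurable_EFinP.
  - by move=> x _; rewrite lee_fin; exact/lefP/nd_nnsfun_approx.
apply: nearW => n.
have -> : (\int[normal_prob m s]_x (h n x)%:E = \int[mu]_x (h n x * normal_pdf m s x)%:E)%E.
  transitivity (\int[normal_prob m s]_x
     (\sum_(y \in range (h n)) (y * \1_(h n @^-1` [set y]) x)%:E))%E.
    by apply: eq_integral => t _; rewrite /= fimfunE -fsumEFin.
  have mh r : measurable_fun setT (fun x => (r * \1_(h n @^-1` [set r]) x)%:E).
    by apply/measurable_EFinP; exact: measurable_funM.
  rewrite ge0_integral_fsum//; last by move=> y x _; exact: nnfun_muleindic_ge0.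
  transitivity (\int[mu]_x (\sum_(y \in range (h n))
      (y * \1_(h n @^-1` [set y]) x)%:E * (normal_pdf m s x)%:E))%E.
    2: {
    apply: eq_integral => x _.
    rewrite -ge0_mule_fsuml => [|y]; last exact: nnfun_muleindic_ge0.
    by rewrite fsumEFin // -(fimfunE _ x). }
  rewrite ge0_integral_fsum//; last 2 first.
  - by move=> y; apply: emeasurable_funM => //; exact/measurable_EFinP.
  - by move=> y x _; rewrite mule_ge0 ?lee_fin ?normal_pdf_ge0// -lee_fin nnfun_muleindic_ge0.
  apply: eq_fsbigr => r /set_mem rh.
  have r0 : 0 <= r by case: rh => x _ <-.
  under eq_integral => x _ do rewrite EFinM.
  rewrite ge0_integralZl_EFin//; last exact/measurable_EFinP.
  rewrite integral_indic//= setIT.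
  under [RHS]eq_integral => x _ do rewrite EFinM -muleA.
  rewrite ge0_integralZl_EFin//; last 2 first.
  - by move=> x _; rewrite mule_ge0// lee_fin normal_pdf_ge0.
  - by apply: emeasurable_funM; exact/measurable_EFinP.
  congr (_ * _)%E; rewrite /normal_prob.
  rewrite [LHS]integral_mkcond; congr (integral _ _ _); apply/funext => x.
  rewrite patchE indicE; case: (_ \in _); by rewrite ?mul1e ?mul0e.
apply: ge0_le_integral => //.
- by move=> x _; rewrite lee_fin mulr_ge0 ?normal_pdf_ge0.
- by apply/measurable_EFinP; exact: measurable_funM.
- by apply/measurable_EFinP; exact: measurable_funM.
- by move=> x _; rewrite lee_fin ler_wpM2r ?normal_pdf_ge0.
Qed.

(** The integrand is dominated by a multiple [c] of the normal density with standard deviation 2.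
    Its exponential leaves exp (3 x^2 / 8) to spare, which dominates the power through one term of
    the exponential series; this is the origin of the factorial and of 8/3. *)
Lemma normal_moment_fin n : (\int[normal_prob 0 1]_x (`|x| ^+ n)%:E < +oo :> \bar R)%E.
Proof.
have mabs : measurable_fun setT (fun x : R => `|x| ^+ n).
  by apply: measurable_funX; exact: normr_measurable.
apply: le_lt_trans (ge0_integral_normal_prob_le 0 1 _ mabs) _.
  by move=> x; rewrite exprn_ge0.
pose c : R := (1 + n.+1`!%:R * (8 / 3) ^+ n.+1) * normal_peak 1 / normal_peak 2.
have c0 : 0 <= c.
  by rewrite !mulr_ge0 ?invr_ge0 ?normal_peak_ge0// addr_ge0// mulr_ge0// exprn_ge0// divr_ge0.
apply: (@le_lt_trans _ _ (\int[mu]_x (c * normal_pdf 0 2 x)%:E)%E); last first.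
  under eq_integral do rewrite EFinM.
  rewrite ge0_integralZl_EFin ?integral_normal_pdf ?mule1 ?ltry//.
    by move=> x _; rewrite lee_fin normal_pdf_ge0.
  by apply/measurable_EFinP; exact: measurable_normal_pdf.
have m1 := @measurable_normal_pdf R 0 1; have m2 := @measurable_normal_pdf R 0 2.
apply: ge0_le_integral => //.
- by move=> x _; rewrite lee_fin mulr_ge0 ?normal_pdf_ge0.
- by apply/measurable_EFinP; exact: measurable_funM.
- by apply/measurable_EFinP; exact: measurable_funM.
move=> x _; rewrite lee_fin !normal_pdfE ?oner_neq0// /normal_fun subr0.
have p2 : normal_peak 2 != 0 :> R by rewrite gt_eqF// normal_peak_gt0.
have -> : c * (normal_peak 2 * expR (- x ^+ 2 / (2 ^+ 2 *+ 2))) =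
  normal_peak 1 * ((1 + n.+1`!%:R * (8 / 3) ^+ n.+1) * expR (- x ^+ 2 / (2 ^+ 2 *+ 2))).
  by rewrite /c; field.
rewrite mulrCA ler_wpM2l ?normal_peak_ge0// expr1n.
pose y : R := 3 / 8 * x ^+ 2.
have y0 : 0 <= y by rewrite mulr_ge0 ?sqr_ge0// divr_ge0.
have -> : - x ^+ 2 / (1 *+ 2) = - x ^+ 2 / (2 ^+ 2 *+ 2) - y :> R by rewrite /y; field.
rewrite expRB mulrA [leLHS]mulrAC ler_wpM2r ?expR_ge0// ler_pdivrMr ?expR_gt0//.
have y1 : 1 <= expR y by rewrite -expR0 ler_expR.
apply: (@le_trans _ _ (1 + (x ^+ 2) ^+ n.+1)).
  have [x1|x1] := leP `|x| 1.
    apply: (@le_trans _ _ 1); first by rewrite exprn_ile1.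
    by rewrite lerDl exprn_ge0// sqr_ge0.
  apply: (@le_trans _ _ ((x ^+ 2) ^+ n.+1)); last by rewrite lerDr.
  rewrite -[x ^+ 2]real_normK ?num_real// -exprM ler_eXn2l//.
  lia.
rewrite mulrDl mul1r lerD//.
have -> : x ^+ 2 = 8 / 3 * y by rewrite /y; field.
rewrite exprMn [leRHS]mulrAC [leRHS]mulrC ler_wpM2l ?exprn_ge0 ?divr_ge0//.
have := @expR_ge1Dxn R y n y0; have f0 : 0 < n.+1`!%:R :> R by rewrite ltr0n fact_gt0.
move=> h; rewrite -ler_pdivrMl// mulrC; apply: le_trans h; by rewrite lerDr.
Qed.

End normal_moments.

Section independence.
Context {R : realType} {d : measure_display} {Om : measurableType d} {P : probability Om R}.
Local Open Scope ereal_scope.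

(** Independence makes the joint law the product of the two laws, by uniqueness on rectangles;
    Tonelli then factorises the integral. *)
Lemma indep_integral (Z X : Om -> R) (f g : R -> R) :
  measurable_fun setT Z -> measurable_fun setT X ->
  (forall A B : set R, measurable A -> measurable B ->
     P ((Z @^-1` A) `&` (X @^-1` B)) = P (Z @^-1` A) * P (X @^-1` B)) ->
  measurable_fun setT f -> measurable_fun setT g ->
  (forall x, 0 <= f x)%R -> (forall x, 0 <= g x)%R ->
  \int[P]_w (f (Z w) * g (X w))%:E = \int[P]_w (f (Z w))%:E * \int[P]_w (g (X w))%:E.
Proof.
move=> mZ mX ind mf mg f0 g0.
pose RZ : {RV P >-> R} := HB.pack Z (isMeasurableFun.Build _ _ _ _ Z mZ).
pose RX : {RV P >-> R} := HB.pack X (isMeasurableFun.Build _ _ _ _ X mX).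
pose ZX w := (Z w, X w).
have mZX : measurable_fun setT ZX by exact: measurable_fun_pair.
pose RZX : {RV P >-> (R * R)%type} := HB.pack ZX (isMeasurableFun.Build _ _ _ _ ZX mZX).
have E Y : measurable Y -> (distribution P RZ \x distribution P RX) Y = distribution P RZX Y.
  by move=> mY; exact: product_measure_unique.
have mfg : measurable_fun setT (fun p : R * R => (f p.1 * g p.2)%:E).
  by apply/measurable_EFinP; apply: measurable_funM; apply: measurableT_comp.
transitivity (\int[distribution P RZX]_p (f p.1 * g p.2)%:E).
  rewrite ge0_integral_distribution//.
  by move=> p; rewrite lee_fin mulr_ge0.
rewrite (eq_measure_integral (distribution P RZ \x distribution P RX)%E); last first.
  by move=> A mA _; apply/esym; exact: E.
rewrite fubini_tonelli1//; last by move=> p; rewrite lee_fin mulr_ge0.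
rewrite /fubini_F /=.
have mf' : measurable_fun setT (EFin \o f) by exact/measurable_EFinP.
have mg' : measurable_fun setT (EFin \o g) by exact/measurable_EFinP.
under eq_integral => x _.
  under eq_integral => y _ do rewrite EFinM.
  rewrite ge0_integralZl_EFin//; last by move=> y _; rewrite lee_fin.
  over.
rewrite ge0_integralZr//; last 2 first.
- by move=> x _; rewrite lee_fin.
- by apply: integral_ge0 => y _; rewrite lee_fin.
by rewrite (ge0_integral_distribution RZ mf')// (ge0_integral_distribution RX mg').
Qed.

End independence.

Section all_moments.
Context {R : realType} {d : measure_display} {Om : measurableType d} {P : probability Om R}.
Implicit Types f g : Om -> R.

(** A class closed under sums and products: every polynomial expression in its members is
    integrable, so expectations can be manipulated as real numbers. *)
Definition all_moments f := measurable_fun setT f /\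
  forall n, (\int[P]_w (`|f w| ^+ n)%:E < +oo)%E.

Let mnorm f n : measurable_fun setT f ->
  measurable_fun setT (fun w => (`|f w| ^+ n)%:E).
Proof.
move=> mf; apply/measurable_EFinP; apply: measurable_funX.
exact: measurableT_comp.
Qed.

Lemma all_moments_le f g : measurable_fun setT f -> all_moments g ->
  (forall w, `|f w| <= `|g w|) -> all_moments f.
Proof.
move=> mf [mg gn] fg; split => // n; apply: le_lt_trans (gn n).
apply: ge0_le_integral => //; [exact: mnorm|exact: mnorm|].
by move=> w _; rewrite lee_fin lerXn2r// nnegrE.
Qed.

Lemma all_moments_cst (c : R) : all_moments (fun=> c).
Proof.
split => // n; rewrite integral_cst//= (_ : P _ = 1%E) ?mule1 ?ltry//; exact: probability_setT.
Qed.

Lemma all_moments_bounded f (c : R) : measurable_fun setT f ->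
  (forall w, `|f w| <= c) -> all_moments f.
Proof.
move=> mf fc; apply: (all_moments_le mf (all_moments_cst c)) => w.
by rewrite (le_trans (fc w))// ler_norm.
Qed.

Lemma all_momentsD f g : all_moments f -> all_moments g -> all_moments (fun w => f w + g w).
Proof.
move=> [mf fn] [mg gn]; split; first exact: measurable_funD.
move=> n; apply: (@le_lt_trans _ _
    (\int[P]_w ((2 ^+ n)%:E * ((`|f w| ^+ n)%:E + (`|g w| ^+ n)%:E)))%E).
  apply: ge0_le_integral => //.
  - by apply: mnorm; exact: measurable_funD.
  - by apply: measurable_funeM; apply: emeasurable_funD; exact: mnorm.
  move=> w _; rewrite -EFinD -EFinM lee_fin.
  apply: (@le_trans _ _ ((2 * Num.max `|f w| `|g w|) ^+ n)).
    rewrite lerXn2r ?nnegrE ?mulr_ge0 ?le_max ?normr_ge0//.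
    rewrite (le_trans (ler_normD _ _))// mulr_natl mulr2n lerD// le_max lexx ?orbT//.
  rewrite exprMn ler_wpM2l ?exprn_ge0//.
  have [|] := leP `|f w| `|g w| => _; by rewrite ?lerDr ?lerDl exprn_ge0.
rewrite ge0_integralZl_EFin//; last 2 first.
- by move=> w _; rewrite adde_ge0// lee_fin exprn_ge0.
- by apply: emeasurable_funD; exact: mnorm.
rewrite ge0_integralD//; [|exact: mnorm|exact: mnorm].
apply: lte_mul_pinfty; [by rewrite lee_fin exprn_ge0|by []|exact: lte_add_pinfty].
Qed.

Lemma all_momentsM f g : all_moments f -> all_moments g -> all_moments (fun w => f w * g w).
Proof.
move=> [mf fn] [mg gn]; split; first exact: measurable_funM.
move=> n; apply: (@le_lt_trans _ _
    (\int[P]_w ((`|f w| ^+ (n * 2))%:E + (`|g w| ^+ (n * 2))%:E))%E).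
  apply: ge0_le_integral => //.
  - by apply: mnorm; exact: measurable_funM.
  - by apply: emeasurable_funD; exact: mnorm.
  move=> w _; rewrite -EFinD lee_fin normrM exprMn !exprM.
  set a := _ ^+ n; set b := `|g w| ^+ n.
  rewrite -subr_ge0; have -> : a ^+ 2 + b ^+ 2 - a * b = (a - b / 2) ^+ 2 + 3 / 4 * b ^+ 2 by field.
  by rewrite addr_ge0 ?sqr_ge0// mulr_ge0 ?sqr_ge0// divr_ge0.
rewrite ge0_integralD//; [|exact: mnorm|exact: mnorm].
exact: lte_add_pinfty.
Qed.

Lemma all_momentsZ (c : R) f : all_moments f -> all_moments (fun w => c * f w).
Proof. by move=> mf; apply: all_momentsM => //; exact: all_moments_cst. Qed.

Lemma all_momentsB f g : all_moments f -> all_moments g -> all_moments (fun w => f w - g w).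
Proof.
move=> mf mg; apply: all_momentsD => //.
by under eq_fun do rewrite -mulN1r; exact: all_momentsZ.
Qed.

Lemma all_momentsX f n : all_moments f -> all_moments (fun w => f w ^+ n).
Proof.
move=> mf; elim: n => [|n ih]; first by under eq_fun do rewrite expr0; exact: all_moments_cst.
by under eq_fun do rewrite exprS; exact: all_momentsM.
Qed.

Lemma all_moments_sum (I : Type) (r : seq I) (f : I -> Om -> R) :
  (forall i, all_moments (f i)) -> all_moments (fun w => \sum_(i <- r) f i w).
Proof.
move=> mf; elim: r => [|i r ih].
  by under eq_fun do rewrite big_nil; exact: all_moments_cst.
by under eq_fun do rewrite big_cons; exact: all_momentsD.
Qed.

Lemma all_moments_integrable f : all_moments f -> P.-integrable setT (EFin \o f).
Proof.
move=> [mf fn]; apply/integrableP; split; first exact/measurable_EFinP.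
by have := fn 1%N; under eq_integral do rewrite expr1.
Qed.

Definition Ex f : R := \int[P]_w f w.

Lemma ExE f : all_moments f -> ((Ex f)%:E = \int[P]_w (f w)%:E)%E.
Proof. by move=> /all_moments_integrable/integrable_fin_num h; rewrite /Ex fineK// h. Qed.

Lemma ExD f g : all_moments f -> all_moments g -> Ex (fun w => f w + g w) = Ex f + Ex g.
Proof. by move=> mf mg; rewrite /Ex RintegralD//; exact: all_moments_integrable. Qed.

Lemma ExZ (c : R) f : all_moments f -> Ex (fun w => c * f w) = c * Ex f.
Proof. by move=> mf; rewrite /Ex RintegralZl//; exact: all_moments_integrable. Qed.

Lemma ExB f g : all_moments f -> all_moments g -> Ex (fun w => f w - g w) = Ex f - Ex g.
Proof. by move=> mf mg; rewrite /Ex RintegralB//; exact: all_moments_integrable. Qed.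

Lemma Ex_le f g : all_moments f -> all_moments g -> (forall w, f w <= g w) -> Ex f <= Ex g.
Proof. by move=> mf mg fg; apply: le_Rintegral => //; exact: all_moments_integrable. Qed.

Lemma Ex_ge0 f : (forall w, 0 <= f w) -> 0 <= Ex f.
Proof. by move=> f0; exact: Rintegral_ge0. Qed.

Lemma Ex_cst (c : R) : Ex (fun=> c) = c.
Proof. by rewrite /Ex Rintegral_cst//= (_ : P _ = 1%E) ?mulr1//; exact: probability_setT. Qed.

Lemma Ex_sum (I : Type) (r : seq I) (f : I -> Om -> R) : (forall i, all_moments (f i)) ->
  Ex (fun w => \sum_(i <- r) f i w) = \sum_(i <- r) Ex (f i).
Proof.
move=> mf; elim: r => [|i r ih].
  rewrite big_nil; under [X in Ex X]eq_fun do rewrite big_nil; exact: Ex_cst.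
rewrite big_cons -ih -ExD//; last exact: all_moments_sum.
by congr Ex; apply/funext => w; rewrite big_cons.
Qed.

Lemma eq_Ex_ae f g : measurable_fun setT f -> measurable_fun setT g ->
  {ae P, forall w, f w = g w} -> Ex f = Ex g.
Proof.
move=> mf mg fg; rewrite /Ex /Rintegral; congr fine; apply: ae_eq_integral => //.
- exact/measurable_EFinP.
- exact/measurable_EFinP.
- by apply: filterS fg => w fgw _; rewrite fgw.
Qed.

End all_moments.
Arguments all_moments {R d Om} P f.
Arguments Ex {R d Om} P f.

(** * A Burkholder inequality in discrete time *)

Section increment_inequalities.
Context {R : realType}.
Implicit Types S b c q e : R.

(** One step of Ito's formula for a power of the squared norm: [S], [c], [b] stand for |M|^2, <M, D>
    and |D|^2, the new squared norm is [S + 2 * c + b], and [c ^+ 2 <= S * b] is Cauchy-Schwarz. The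
    induction multiplies the inequality for [k] by the new squared norm. *)
Lemma exprD_le_taylor k : exists2 C : R, 0 < C & forall S b c : R, 0 <= S -> 0 <= b ->
  c ^+ 2 <= S * b -> 0 <= S + 2 * c + b ->
  (S + 2 * c + b) ^+ k.+1 <= S ^+ k.+1 + 2 * k.+1%:R * S ^+ k * c +
     C * (S ^+ k * b + b ^+ k.+1).
Proof.
elim: k => [|k [C C0 ih]].
  exists 1 => // S b c S0 b0 _ _; rewrite !expr1 expr0; lra.
exists ((8 * k.+2%:R + 4 * C) * 3) => [|S b c S0 b0 cSb S'0].
  by rewrite mulr_gt0// addr_gt0// mulr_gt0.
have {ih} := ler_wpM2l S'0 (ih S b c S0 b0 cSb S'0).
rewrite -exprS => h; apply: (le_trans h).
have cle : `|c| <= (S + b) / 2.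
  rewrite -(@ler_pXn2r _ 2) ?nnegrE ?divr_ge0 ?addr_ge0// real_normK ?num_real//.
  rewrite (le_trans cSb)// -subr_ge0.
  have -> : ((S + b) / 2) ^+ 2 - S * b = ((S - b) / 2) ^+ 2 by field.
  exact: sqr_ge0.
have Sk : 0 <= S ^+ k by rewrite exprn_ge0.
have bk : 0 <= b ^+ k by rewrite exprn_ge0.
have S'le : S + 2 * c + b <= 2 * (S + b) by have := ler_norm c; lra.
(* Every mixed monomial of the remainder is dominated by a multiple of [Z], by distinguishing
   [b <= S] from [S < b]. *)
pose Z := S ^+ k.+1 * b + b ^+ k.+2.
have y1 : S ^+ k * b ^+ 2 <= Z.
  have [bS|Sb] := leP b S.
    apply: (@le_trans _ _ (S ^+ k.+1 * b)); last by rewrite lerDl exprn_ge0.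
    by rewrite [S ^+ k.+1]exprSr expr2 -mulrA ler_wpM2l// ler_wpM2r.
  apply: (@le_trans _ _ (b ^+ k.+2)); last by rewrite lerDr mulr_ge0// exprn_ge0.
  have -> : b ^+ k.+2 = b ^+ k * b ^+ 2 by rewrite -exprD addn2.
  by rewrite ler_wpM2r ?sqr_ge0// lerXn2r// ?nnegrE// ltW.
have y2 : S * b ^+ k.+1 <= Z.
  have [bS|Sb] := leP b S.
    apply: (@le_trans _ _ (S ^+ k.+1 * b)); last by rewrite lerDl exprn_ge0.
    by rewrite [b ^+ _]exprSr [S ^+ _]exprS mulrA ler_wpM2r// ler_wpM2l// lerXn2r.
  apply: (@le_trans _ _ (b ^+ k.+2)); last by rewrite lerDr mulr_ge0// exprn_ge0.
  by rewrite [leRHS]exprS ler_wpM2r// ?exprn_ge0// ltW.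
have Z0 : 0 <= Z.
  by apply: addr_ge0; [apply: mulr_ge0 => //|]; exact: exprn_ge0.
have Y : (S + b) * (S ^+ k * b + b ^+ k.+1) <= 3 * Z.
  have -> : (S + b) * (S ^+ k * b + b ^+ k.+1) =
     Z + S ^+ k * b ^+ 2 + S * b ^+ k.+1 by rewrite /Z !exprS; ring.
  lra.
have p1 : C * ((S + 2 * c + b) * (S ^+ k * b + b ^+ k.+1)) <= C * (6 * Z).
  rewrite ler_wpM2l ?(ltW C0)//.
  apply: (@le_trans _ _ (2 * (S + b) * (S ^+ k * b + b ^+ k.+1))).
    by rewrite ler_wpM2r// addr_ge0 ?mulr_ge0 ?exprn_ge0.
  rewrite -mulrA; lra.
have p2 : S ^+ k * c ^+ 2 <= Z.
  apply: (@le_trans _ _ (S ^+ k * (S * b))); first by rewrite ler_wpM2l.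
  by rewrite mulrA -exprSr lerDl exprn_ge0.
have p3 : S ^+ k * c * b <= Z.
  apply: (@le_trans _ _ (S ^+ k * ((S + b) / 2) * b)).
    by rewrite ler_wpM2r// ler_wpM2l// (le_trans (ler_norm _)).
  have -> : S ^+ k * ((S + b) / 2) * b = (S ^+ k.+1 * b + S ^+ k * b ^+ 2) / 2.
    by rewrite exprS; field.
  have : S ^+ k.+1 * b <= Z by rewrite lerDl exprn_ge0.
  lra.
have p4 : S ^+ k.+1 * b <= Z by rewrite lerDl exprn_ge0.
have -> : (S + 2 * c + b) * (S ^+ k.+1 + 2 * k.+1%:R * S ^+ k * c +
    C * (S ^+ k * b + b ^+ k.+1)) =
  S ^+ k.+2 + 2 * k.+2%:R * S ^+ k.+1 * c + (S ^+ k.+1 * b + 4 * k.+1%:R * (S ^+ k * c ^+ 2) +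
   2 * k.+1%:R * (S ^+ k * c * b) + C * ((S + 2 * c + b) * (S ^+ k * b + b ^+ k.+1))).
  by rewrite -[k.+2%:R]natr1 !exprS; ring.
rewrite lerD2l -/Z.
have k0 : 0 <= k.+1%:R :> R by [].
have q2 := ler_wpM2l k0 p2; have q3 := ler_wpM2l k0 p3.
rewrite -[k.+2%:R]natr1.
have CZ : 0 <= C * Z by rewrite mulr_ge0// ltW.
have kZ : 0 <= k.+1%:R * Z by rewrite mulr_ge0.
have -> : (8 * (k.+1%:R + 1) + 4 * C) * 3 * Z = 24 * (k.+1%:R * Z) + 24 * Z + 12 * (C * Z) by ring.
have E1 : 4 * k.+1%:R * (S ^+ k * c ^+ 2) = 4 * (k.+1%:R * (S ^+ k * c ^+ 2)) by ring.
have E2 : 2 * k.+1%:R * (S ^+ k * c * b) = 2 * (k.+1%:R * (S ^+ k * c * b)) by ring.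
rewrite E1 E2; move: p1; rewrite (mulrCA C) => p1; lra.
Qed.

(** The power lies above its tangent at [S], and the non-negative contribution of [b] is dropped.
    With [b = 0] it is the tangent inequality behind Jensen's inequality below. *)
Lemma exprD_ge_taylor n : forall S b c : R, 0 <= S -> 0 <= b -> 0 <= S + 2 * c + b ->
  S ^+ n + 2 * n%:R * S ^+ n.-1 * c <= (S + 2 * c + b) ^+ n.
Proof.
move=> S b c S0 b0 S'0; pose X := 2 * c + b.
have XE : S + 2 * c + b = S + X by rewrite /X addrA.
rewrite XE in S'0 *.
have H k : S ^+ k + k%:R * S ^+ k.-1 * X <= (S + X) ^+ k.
  elim: k => [|k ih]; first by rewrite !expr0 !mul0r addr0.
  rewrite [leRHS]exprS; apply: (le_trans _ (ler_wpM2l S'0 ih)).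
  case: k {ih} => [|k] /=; first by rewrite !expr0 expr1; lra.
  rewrite -subr_ge0.
  have -> : (S + X) * (S ^+ k.+1 + k.+1%:R * S ^+ k * X) -
     (S ^+ k.+2 + k.+2%:R * S ^+ k.+1 * X) = k.+1%:R * S ^+ k * X ^+ 2.
    by rewrite -[k.+2%:R]natr1 !exprS; ring.
  apply: mulr_ge0; last exact: sqr_ge0.
  by apply: mulr_ge0 => //; exact: exprn_ge0.
apply: le_trans (H n); rewrite lerD2l.
rewrite (_ : 2 * n%:R * S ^+ n.-1 * c = n%:R * S ^+ n.-1 * (2 * c)); last by ring.
by rewrite ler_wpM2l ?mulr_ge0 ?exprn_ge0// lerDl.
Qed.

Lemma young_absorb n Q S e : 0 <= Q -> 0 <= S -> 0 < e ->
  Q * S ^+ n <= e * S ^+ n.+1 + e^-1 ^+ n * Q ^+ n.+1.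
Proof.
move=> Q0 S0 e0; have [h|h] := leP Q (e * S).
  apply: (@le_trans _ _ (e * S ^+ n.+1)).
    by rewrite exprS mulrA ler_wpM2r ?exprn_ge0.
  by rewrite lerDl mulr_ge0 ?exprn_ge0 ?invr_ge0 ?(ltW e0).
apply: (@le_trans _ _ (e^-1 ^+ n * Q ^+ n.+1)); last first.
  by rewrite lerDr mulr_ge0 ?exprn_ge0 ?(ltW e0).
rewrite exprS mulrCA ler_wpM2l// -exprMn lerXn2r ?nnegrE ?mulr_ge0 ?invr_ge0 ?(ltW e0)//.
by rewrite ler_pdivlMl// ltW.
Qed.

End increment_inequalities.

Section discrete_burkholder.
Context {R : realType} {d : measure_display} {Om : measurableType d} {P : probability Om R}.

Lemma sum_expr_le (n : nat) (q : nat -> R) (L : nat) : (forall i, 0 <= q i) ->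
  \sum_(i < L) q i ^+ n.+1 <= (\sum_(i < L) q i) ^+ n.+1.
Proof.
move=> q0; elim: L => [|L ih]; first by rewrite !big_ord0 expr0n.
rewrite !big_ord_recr /=; set Q := \sum_(i < L) q i in ih *.
have Q0 : 0 <= Q by apply: sumr_ge0.
apply: (@le_trans _ _ (Q ^+ n.+1 + q L ^+ n.+1)); first by rewrite lerD2r.
rewrite 3!exprS mulrDl lerD// ler_wpM2l// lerXn2r ?nnegrE ?addr_ge0//; by rewrite ?lerDl ?lerDr.
Qed.

(* [E S^{n+1} - C E (Q S^n) - C sum E q^{n+1}] is nonincreasing in time, so that
   the square function is controlled without a maximal inequality. *)
Lemma discrete_burkholder (n : nat) (c0 : R) : 0 < c0 -> exists2 C : R, 0 < C &
  forall (V : hilbertType R) (D : nat -> Om -> V) (q : nat -> Om -> R),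
  let M k w := \sum_(i < k) D i w in
  let Q k w := \sum_(i < k) q i w in
  (forall k, all_moments P (fun w => `|M k w| ^+ 2)) ->
  (forall k, all_moments P (fun w => inner (M k w) (D k w))) ->
  (forall k, all_moments P (fun w => `|D k w| ^+ 2)) ->
  (forall k, all_moments P (q k)) ->
  (forall k w, 0 <= q k w) ->
  (forall k, Ex P (fun w => (`|M k w| ^+ 2) ^+ n * `|D k w| ^+ 2) <=
     c0 * Ex P (fun w => (`|M k w| ^+ 2) ^+ n * q k w)) ->
  (forall k, Ex P (fun w => (`|D k w| ^+ 2) ^+ n.+1) <= c0 * Ex P (fun w => q k w ^+ n.+1)) ->
  (forall k, Ex P (fun w => (`|M k w| ^+ 2) ^+ n * inner (M k w) (D k w)) = 0) ->
  (forall k, Ex P (fun w => Q k.+1 w * (`|M k w| ^+ 2) ^+ n.-1 * inner (M k w) (D k w)) = 0) ->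
  forall L, Ex P (fun w => (`|M L w| ^+ 2) ^+ n.+1) <= C * Ex P (fun w => Q L w ^+ n.+1).
Proof.
move=> c00; have [Ct Ct0 tay] := @exprD_le_taylor R n.
pose C1 := Ct * c0; have C10 : 0 < C1 by rewrite mulr_gt0.
(* The choice gives [C1 * e = 1/2]: Young's inequality then returns half of E S^(n+1), which the
   left-hand side absorbs. *)
pose e := (2 * C1)^-1; have e0 : 0 < e by rewrite invr_gt0 mulr_gt0.
exists (2 * (C1 * e^-1 ^+ n + C1)).
  by rewrite mulr_gt0// ltr_wpDl// mulr_ge0 ?(ltW C10)// exprn_ge0// invr_ge0 ltW.
move=> V D q M Q mM mMD mD mq q0 H1 H1' H2 H2' L.
have mQ k : all_moments P (Q k) by exact: all_moments_sum.
have Q0 k w : 0 <= Q k w by exact: sumr_ge0.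
have ME k w : `|M k.+1 w| ^+ 2 = `|M k w| ^+ 2 + 2 * inner (M k w) (D k w) + `|D k w| ^+ 2.
  by rewrite /M big_ord_recr /= normD_sqr.
have QE k w : Q k.+1 w = Q k w + q k w by rewrite /Q big_ord_recr.
pose S k w := `|M k w| ^+ 2; have S0 k w : 0 <= S k w by exact: sqr_ge0.
pose c k w := inner (M k w) (D k w).
pose b k w := `|D k w| ^+ 2; have b0 k w : 0 <= b k w by exact: sqr_ge0.
have cSb k w : c k w ^+ 2 <= S k w * b k w.
  rewrite /S /b -exprMn -[c k w ^+ 2]real_normK ?num_real// lerXn2r ?nnegrE ?mulr_ge0//.
  exact: inner_le.
have S'0 k w : 0 <= S k w + 2 * c k w + b k w by rewrite -ME sqr_ge0.
have mSn k j : all_moments P (fun w => S k w ^+ j) by apply: all_momentsX; exact: mM.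
have main k : Ex P (fun w => S k w ^+ n.+1) <= C1 * Ex P (fun w => Q k w * S k w ^+ n) +
    C1 * \sum_(i < k) Ex P (fun w => q i w ^+ n.+1).
  elim: k => [|k ih].
    rewrite big_ord0 mulr0 addr0 (_ : (fun w => S 0 w ^+ n.+1) = fun=> 0); last first.
      by apply/funext => w; rewrite /S /M big_ord0 normr0 expr0n/= expr0n.
    by rewrite Ex_cst mulr_ge0 ?(ltW C10)// Ex_ge0// => w; rewrite mulr_ge0// exprn_ge0.
  (* The cross term of the expansion has mean zero, and the moment hypotheses trade the powers of
     |D|^2 for those of [q]. *)
  have h1 : Ex P (fun w => S k.+1 w ^+ n.+1) <= Ex P (fun w => S k w ^+ n.+1) +
      C1 * (Ex P (fun w => S k w ^+ n * q k w) + Ex P (fun w => q k w ^+ n.+1)).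
    have mSc : all_moments P (fun w => S k w ^+ n * c k w) := all_momentsM (mSn k n) (mMD k).
    have mSb : all_moments P (fun w => S k w ^+ n * b k w) := all_momentsM (mSn k n) (mD k).
    have mqn : all_moments P (fun w => q k w ^+ n.+1) := all_momentsX _ (mq k).
    have mSq : all_moments P (fun w => S k w ^+ n * q k w) := all_momentsM (mSn k n) (mq k).
    have mSn1 := mSn k n.+1; have mSn1' := mSn k.+1 n.+1.
    have mbn : all_moments P (fun w => b k w ^+ n.+1) by apply: all_momentsX; exact: mD.
    apply: (@le_trans _ _ (Ex P (fun w => S k w ^+ n.+1 + 2 * n.+1%:R * (S k w ^+ n * c k w) +
        Ct * (S k w ^+ n * b k w + b k w ^+ n.+1)))).
      apply: Ex_le => //.
        by do ![apply: all_momentsD|apply: all_momentsZ].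
      move=> w; have := tay _ _ _ (S0 k w) (b0 k w) (cSb k w) (S'0 k w).
      have -> : S k.+1 w = S k w + 2 * c k w + b k w := ME k w.
      by rewrite -[2 * _ * _ * c k w]mulrA.
    rewrite ExD; last 2 first.
      by do ![apply: all_momentsD|apply: all_momentsZ].
      by do ![apply: all_momentsD|apply: all_momentsZ].
    rewrite ExD//; last by do ![apply: all_momentsD|apply: all_momentsZ].
    have H2k : Ex P (fun w => S k w ^+ n * c k w) = 0 := H2 k.
    rewrite (ExZ _ mSc) H2k mulr0 addr0 (ExZ _ (all_momentsD mSb mbn)).
    rewrite ExD// lerD2l /C1 -mulrA ler_wpM2l ?(ltW Ct0)// mulrDr lerD//; [exact: H1|exact: H1'].
  (* E[Q S^n] grows by at least the term produced in the Ito step. The factor is [Q k.+1], including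
     the current [q k]: in the application it is already known before the step, so that the cross
     term still has mean zero. *)
  have h2 : Ex P (fun w => Q k w * S k w ^+ n) + Ex P (fun w => S k w ^+ n * q k w) <=
      Ex P (fun w => Q k.+1 w * S k.+1 w ^+ n).
    have mX : all_moments P (fun w => Q k.+1 w * S k w ^+ n.-1 * c k w).
      exact: all_momentsM (all_momentsM (mQ _) (mSn k _)) (mMD k).
    have mQS' : all_moments P (fun w => Q k w * S k w ^+ n) := all_momentsM (mQ k) (mSn k n).
    have mSq : all_moments P (fun w => S k w ^+ n * q k w) := all_momentsM (mSn k n) (mq k).
    have mQ1S : all_moments P (fun w => Q k.+1 w * S k w ^+ n) := all_momentsM (mQ _) (mSn k n).
    have mQ1S1 : all_moments P (fun w => Q k.+1 w * S k.+1 w ^+ n) := all_momentsM (mQ _) (mSn _ n).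
    rewrite -ExD//.
    have -> : Ex P (fun w => Q k w * S k w ^+ n + S k w ^+ n * q k w) =
        Ex P (fun w => Q k.+1 w * S k w ^+ n + 2 * n%:R * (Q k.+1 w * S k w ^+ n.-1 * c k w)).
      rewrite [RHS]ExD//; last exact: all_momentsZ.
      have H2k : Ex P (fun w => Q k.+1 w * S k w ^+ n.-1 * c k w) = 0 := H2' k.
      rewrite (ExZ _ mX) H2k mulr0 addr0; congr Ex; apply/funext => w.
      by rewrite QE mulrDl (mulrC (q k w)).
    apply: Ex_le => //.
      by apply: all_momentsD => //; exact: all_momentsZ.
    move=> w.
    have -> : Q k.+1 w * S k w ^+ n + 2 * n%:R * (Q k.+1 w * S k w ^+ n.-1 * c k w) =
      Q k.+1 w * (S k w ^+ n + 2 * n%:R * S k w ^+ n.-1 * c k w) by ring.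
    have -> : S k.+1 w = S k w + 2 * c k w + b k w := ME k w.
    rewrite ler_wpM2l//; exact: exprD_ge_taylor (S0 k w) (b0 k w) (S'0 k w).
  rewrite big_ord_recr /=; set s := \sum_(i < k) _ in ih *.
  have h3 := ler_wpM2l (ltW C10) h2.
  rewrite !mulrDr in h1 h3 *.
  have := le_trans h1 (lerD ih (lexx _)); lra.
have mQS : all_moments P (fun w => Q L w * S L w ^+ n) := all_momentsM (mQ L) (mSn L n).
have mQn : all_moments P (fun w => Q L w ^+ n.+1) := all_momentsX _ (mQ L).
have mSL := mSn L n.+1.
have y : Ex P (fun w => Q L w * S L w ^+ n) <=
    e * Ex P (fun w => S L w ^+ n.+1) + e^-1 ^+ n * Ex P (fun w => Q L w ^+ n.+1).
  rewrite -!ExZ// -ExD; try exact: all_momentsZ.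
  apply: Ex_le => //; first by apply: all_momentsD; exact: all_momentsZ.
  by move=> w; exact: young_absorb.
have z : \sum_(i < L) Ex P (fun w => q i w ^+ n.+1) <= Ex P (fun w => Q L w ^+ n.+1).
  rewrite -Ex_sum; last by move=> i; exact: all_momentsX.
  apply: Ex_le => //; first by apply: all_moments_sum => i; exact: all_momentsX.
  by move=> w; apply: (sum_expr_le n (q := q^~ w)) => i.
have := main L; have y' := ler_wpM2l (ltW C10) y; have z' := ler_wpM2l (ltW C10) z.
move: y'; rewrite mulrDr mulrA.
have -> : C1 * e = 2^-1 by rewrite /e; field; rewrite gt_eqF.
rewrite mulrA.
have -> : 2 * (C1 * e^-1 ^+ n + C1) * Ex P (fun w => Q L w ^+ n.+1) =
  2 * (C1 * e^-1 ^+ n * Ex P (fun w => Q L w ^+ n.+1)) + 2 * (C1 * Ex P (fun w => Q L w ^+ n.+1)).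
  ring.
move=> *; lra.
Qed.

End discrete_burkholder.

Lemma measurable_open_sigma (R : realType) (C : set R) : measurable C -> <<s open >> C.
Proof.
move=> mC; have : (@RGenOpens.G R).-sigma.-measurable C by rewrite -RGenOpens.measurableE.
apply: smallest_sub; first exact: smallest_sigma_algebra.
move=> _ [x [y ->]]; apply: sub_gen_smallest; exact: interval_open.
Qed.

(** * Finite-rank operators *)

Section finite_rank.
Context {R : realType} {U V : hilbertType R}.

(** The squared Hilbert-Schmidt norm of the operator with terms [z i <u i, .> v i], see [hs2_gram].
    As a polynomial in [z] it inherits measurability and moments from the coefficients. *)
Definition gram (I : finType) (z : I -> R) (u : I -> U) (v : I -> V) : R :=
  \sum_i \sum_j z i * z j * inner (u i) (u j) * inner (v i) (v j).

Lemma gram_orthonormal (I : finType) (z : I -> R) (u : I -> U) (v : I -> V) (fs : seq V) :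
  uniq fs -> {in fs &, forall f g, inner f g = (f == g)%:R} ->
  (forall i, v i = \sum_(f <- fs) inner f (v i) *: f) ->
  gram z u v = \sum_(f <- fs) `|\sum_i (z i * inner f (v i)) *: u i| ^+ 2.
Proof.
move=> ufs ofs vE.
under [RHS]eq_bigr => f _.
  rewrite -inner_norm inner_suml.
  under eq_bigr => i _ do rewrite innerZl inner_sumr mulr_sumr.
  over.
rewrite exchange_big; apply: eq_bigr => i _; rewrite exchange_big; apply: eq_bigr => j _ /=.
rewrite [inner (v i) (v j)](_ : _ = \sum_(f <- fs) inner f (v i) * inner f (v j)).
  by rewrite mulr_sumr; apply: eq_bigr => f _; rewrite innerZr; ring.
rewrite {1}vE inner_suml; apply: eq_bigr => f _; by rewrite innerZl.
Qed.

Lemma norm_orthonormal (I : finType) (x : I -> R) (v : I -> V) (fs : seq V) :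
  uniq fs -> {in fs &, forall f g, inner f g = (f == g)%:R} ->
  (forall i, v i = \sum_(f <- fs) inner f (v i) *: f) ->
  `|\sum_i x i *: v i| ^+ 2 = \sum_(f <- fs) (\sum_i x i * inner f (v i)) ^+ 2.
Proof.
move=> ufs ofs vE; rewrite (norm_sqr_orthonormal_span ufs ofs); last first.
  rewrite {1}(eq_bigr _ (fun i _ => congr1 (GRing.scale (x i)) (vE i))).
  under eq_bigr => i _ do rewrite scaler_sumr.
  rewrite exchange_big; apply: eq_bigr => f _ /=.
  by rewrite inner_sumr scaler_suml; apply: eq_bigr => i _; rewrite innerZr scalerA.
apply: eq_bigr => f _; rewrite inner_sumr; congr (_ ^+ 2).
by apply: eq_bigr => i _; rewrite innerZr.
Qed.

Lemma finite_span (I : finType) (v : I -> V) : exists fs : seq V,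
  [/\ uniq fs, {in fs &, forall f g, inner f g = (f == g)%:R} &
    forall i, v i = \sum_(f <- fs) inner f (v i) *: f].
Proof.
have [fs [ufs ofs spn]] := finite_orthonormal_span [seq v i | i <- enum I].
exists fs; split => // i; apply: spn; apply/mapP; exists i => //; exact: mem_enum.
Qed.

Lemma gram_ge0 (I : finType) (z : I -> R) (u : I -> U) (v : I -> V) : 0 <= gram z u v.
Proof.
have [fs [ufs ofs spn]] := finite_span v.
by rewrite (gram_orthonormal _ _ ufs ofs spn); apply: sumr_ge0 => f _; exact: sqr_ge0.
Qed.

Lemma hs2_gram (I : finType) (z : I -> R) (u : I -> U) (v : I -> V) :
  hs2 (fun y => \sum_i (z i * inner (u i) y) *: v i) = (gram z u v)%:E.
Proof.
have [fs [ufs ofs spn]] := finite_span v.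
rewrite (gram_orthonormal _ _ ufs ofs spn) /hs2 -sumEFin.
under eq_esum => y _ do rewrite (norm_orthonormal _ ufs ofs spn) -sumEFin.
rewrite esum_sum; last by move=> *; rewrite lee_fin sqr_ge0.
apply: eq_bigr => f _; rewrite -(parseval _ (@std_onbP R U)).
apply: eq_esum => y _; congr (_ ^+ 2)%:E.
rewrite innerC inner_suml; apply: eq_bigr => i _; rewrite innerZl; ring.
Qed.

End finite_rank.

(** Summing the tangent inequality of the power at the weighted mean [t], against the weights [w],
    makes the linear term vanish. *)
Lemma jensen_sum (R : realType) (I : Type) (r : seq I) (w y : I -> R) n :
  (forall i, 0 <= w i) -> (forall i, 0 <= y i) ->
  (\sum_(i <- r) w i * y i) ^+ n.+1 <= (\sum_(i <- r) w i) ^+ n * \sum_(i <- r) w i * y i ^+ n.+1.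
Proof.
move=> w0 y0.
have zero : \sum_(i <- r) w i = 0 -> \sum_(i <- r) w i * y i = 0.
  elim: r => [|i r ih]; first by rewrite !big_nil.
  rewrite !big_cons => /eqP; rewrite paddr_eq0//; last by apply: sumr_ge0.
  by move=> /andP[/eqP -> /eqP /ih ->]; rewrite mul0r addr0.
set s := \sum_(i <- r) w i; set m := \sum_(i <- r) w i * y i in zero *.
have s0 : 0 <= s by apply: sumr_ge0.
have m0 : 0 <= m by apply: sumr_ge0 => i _; exact: mulr_ge0.
have Y0 : 0 <= \sum_(i <- r) w i * y i ^+ n.+1.
  by apply: sumr_ge0 => i _; rewrite mulr_ge0// exprn_ge0.
have [sz|sn0] := eqVneq s 0.
  by rewrite zero// expr0n /= mulr_ge0// exprn_ge0.
have sgt0 : 0 < s by rewrite lt_neqAle eq_sym sn0.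
pose t := m / s; have t0 : 0 <= t by rewrite divr_ge0.
have tg i : t ^+ n.+1 + n.+1%:R * t ^+ n * (y i - t) <= y i ^+ n.+1.
  have := @exprD_ge_taylor R n.+1 t 0 ((y i - t) / 2) t0 (lexx _).
  rewrite addr0 /= [2 * _]mulrC divfK// addrC subrK => /(_ (y0 i)).
  by rewrite (_ : 2 * n.+1%:R * t ^+ n * ((y i - t) / 2) = n.+1%:R * t ^+ n * (y i - t))//; field.
have h : s * t ^+ n.+1 <= \sum_(i <- r) w i * y i ^+ n.+1.
  apply: (@le_trans _ _ (\sum_(i <- r) w i * (t ^+ n.+1 + n.+1%:R * t ^+ n * (y i - t)))).
    under eq_bigr => i _ do rewrite mulrDr mulrCA mulrBr.
    rewrite big_split /= -mulr_suml -mulr_sumr big_split /= sumrN -mulr_suml -/s -/m.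
    by rewrite /t mulrCA divff// mulr1 subrr mulr0 addr0.
  by apply: ler_sum => i _; rewrite ler_wpM2l.
have -> : m ^+ n.+1 = s ^+ n * (s * t ^+ n.+1).
  by rewrite mulrA -exprSr -exprMn mulrCA divff// mulr1.
by rewrite ler_wpM2l// exprn_ge0.
Qed.

(** * Increments of the cylindrical Wiener process *)

Section wiener_increments.
Context {R : realType} {d : measure_display} {Om : measurableType d} {P : probability Om R}.
Context {T : R} {Fl : R -> set (set Om)} (Fl_normal : normal_filtration P T Fl).
Context {U : hilbertType R} {W : R -> U -> Om -> R} (W_wiener : cylindrical_wiener P T Fl W).
Implicit Types (s t : R) (f g : Om -> R).

(** Measurability for the measurable type generated by [Fl s]; the closure properties of measurable
    functions apply to it directly. *)
Definition past_measurable s f :=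
  measurable_fun (setT : set (g_sigma_algebraType (Fl s))) f.

Lemma Fl_sigma_algebra s : 0 <= s <= T -> sigma_algebra setT (Fl s).
Proof. by move=> sT; case: Fl_normal => /(_ s sT)[]. Qed.

Lemma Fl_measurable s E : 0 <= s <= T -> Fl s E -> measurable E.
Proof. by move=> sT; have [/(_ s sT)[_ + _ _ _]] := Fl_normal; apply. Qed.

Lemma Fl_mono s t E : 0 <= s -> s <= t -> t <= T -> Fl s E -> Fl t E.
Proof. by move=> s0 st tT; case: Fl_normal => _ /(_ s t s0 st tT) + _ _; apply. Qed.

Lemma past_measurableP s f : 0 <= s <= T ->
  past_measurable s f <-> forall C : set R, measurable C -> Fl s (f @^-1` C).
Proof.
move=> sT; have sg := Fl_sigma_algebra sT; split => [mf C mC|mf _ C mC].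
  have := mf measurableT C mC; rewrite setTI => h.
  by rewrite -[X in X _](sigma_algebra_id sg).
by rewrite setTI; apply: sub_gen_smallest; exact: mf.
Qed.

Lemma past_measurable_fun s f : 0 <= s <= T -> past_measurable s f -> measurable_fun setT f.
Proof.
move=> sT /(past_measurableP _ sT) mf _ C mC; rewrite setTI.
by apply: (Fl_measurable sT); exact: mf.
Qed.

Lemma past_measurable_mono s t f : 0 <= s -> s <= t -> t <= T ->
  past_measurable s f -> past_measurable t f.
Proof.
move=> s0 st tT mf; have sT : 0 <= s <= T by rewrite s0 (le_trans st).
have tT' : 0 <= t <= T by rewrite (le_trans s0).
apply/(past_measurableP _ tT') => C mC; apply: (Fl_mono s0 st tT).
exact: (past_measurableP _ sT).1.
Qed.

Lemma past_measurable_indic s E : 0 <= s <= T -> Fl s E -> past_measurable s (\1_E : Om -> R).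
Proof.
move=> sT FE.
apply: (@measurable_indic _ (g_sigma_algebraType (Fl s))).
exact: sub_gen_smallest.
Qed.

Lemma past_measurable_wiener s u : 0 <= s <= T -> past_measurable s (W s u).
Proof.
move=> sT; apply/past_measurableP => // C mC.
by have [ad _ _ _ _] := W_wiener; exact: (ad u s sT C (measurable_open_sigma mC)).
Qed.

Definition past_moments s f := all_moments P f /\ past_measurable s f.

Lemma past_moments_cst s (c : R) : past_moments s (fun=> c).
Proof. by split; [exact: all_moments_cst|exact: measurable_cst]. Qed.

Lemma past_momentsD s f g : past_moments s f -> past_moments s g ->
  past_moments s (fun w => f w + g w).
Proof.
move=> [f1 f2] [g1 g2]; split; first exact: all_momentsD.
exact: (@measurable_funD _ (g_sigma_algebraType (Fl s))).
Qed.

Lemma past_momentsM s f g : past_moments s f -> past_moments s g ->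
  past_moments s (fun w => f w * g w).
Proof.
move=> [f1 f2] [g1 g2]; split; first exact: all_momentsM.
exact: (@measurable_funM _ (g_sigma_algebraType (Fl s))).
Qed.

Lemma past_momentsX s f n : past_moments s f -> past_moments s (fun w => f w ^+ n).
Proof.
move=> mf; elim: n => [|n ih]; first by under eq_fun do rewrite expr0; exact: past_moments_cst.
by under eq_fun do rewrite exprS; exact: past_momentsM.
Qed.

Lemma past_moments_sum s (I : Type) (r : seq I) (f : I -> Om -> R) :
  (forall i, past_moments s (f i)) -> past_moments s (fun w => \sum_(i <- r) f i w).
Proof.
move=> mf; elim: r => [|i r ih].
  by under eq_fun do rewrite big_nil; exact: past_moments_cst.
by under eq_fun do rewrite big_cons; exact: past_momentsD.
Qed.

Lemma past_moments_mono s t f : 0 <= s -> s <= t -> t <= T -> past_moments s f -> past_moments t f.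
Proof. by move=> s0 st tT [? ?]; split => //; exact: (past_measurable_mono s0). Qed.

Lemma past_moments_indic s E : 0 <= s <= T -> Fl s E -> past_moments s (\1_E).
Proof.
move=> sT FE; have mf := past_measurable_indic sT FE; split => //.
apply: (@all_moments_bounded _ _ _ _ _ 1); first exact: past_measurable_fun mf.
by move=> w; rewrite indicE; case: (_ \in _); rewrite ?normr1 ?normr0.
Qed.

Definition increment s t u w := W t u w - W s u w.

Let past_increment s t u : 0 <= s -> s <= t -> t <= T -> past_measurable t (increment s t u).
Proof.
move=> s0 st tT; have sT : 0 <= s <= T by rewrite s0 (le_trans st).
have tT' : 0 <= t <= T by rewrite (le_trans s0).
apply: (@measurable_funB _ (g_sigma_algebraType (Fl t))).
  exact: past_measurable_wiener.
by apply: (past_measurable_mono s0 st tT); exact: past_measurable_wiener.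
Qed.

Let measurable_increment s t u : 0 <= s -> s <= t -> t <= T -> measurable_fun setT (increment s t u).
Proof.
move=> s0 st tT; apply: (@past_measurable_fun t); first by rewrite tT andbT (le_trans s0).
exact: past_increment.
Qed.

Lemma increment_linear s t a u v : 0 <= s -> s <= t -> t <= T ->
  {ae P, forall w, increment s t (a *: u + v) w = a * increment s t u w + increment s t v w}.
Proof.
move=> s0 st tT; have sT : 0 <= s <= T by rewrite s0 (le_trans st).
have tT' : 0 <= t <= T by rewrite (le_trans s0).
case: W_wiener => _ lin _ _ _.
apply: filterS2 (lin s a u v sT) (lin t a u v tT') => w h1 h2.
by rewrite /increment h1 h2; ring.
Qed.

Lemma increment0 s t : 0 <= s -> s <= t -> t <= T -> {ae P, forall w, increment s t 0 w = 0}.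
Proof.
move=> s0 st tT; apply: filterS (increment_linear 1 0 0 s0 st tT) => w.
by rewrite scaler0 addr0 mul1r => /eqP; rewrite -subr_eq0 opprD addrA subrr sub0r oppr_eq0 => /eqP.
Qed.

(** Linearity in [u] holds outside a null set that depends on the vectors, so only finite
    combinations are formed. *)
Lemma increment_sum s t (I : Type) (r : seq I) (a : I -> R) (u : I -> U) :
  0 <= s -> s <= t -> t <= T ->
  {ae P, forall w, increment s t (\sum_(i <- r) a i *: u i) w =
      \sum_(i <- r) a i * increment s t (u i) w}.
Proof.
move=> s0 st tT; elim: r => [|i r ih].
  by apply: filterS (increment0 s0 st tT) => w; rewrite !big_nil.
apply: filterS2 ih (increment_linear (a i) (u i) (\sum_(i <- r) a i *: u i) s0 st tT) => w h1.
by rewrite !big_cons h1.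
Qed.

Let law s t u (g : R -> R) : 0 <= s -> s < t -> t <= T -> u != 0 ->
  measurable_fun setT g -> (forall x, 0 <= g x) ->
  (\int[P]_w (g (increment s t u w))%:E =
   \int[normal_prob 0 (Num.sqrt (t - s) * `|u|)]_x (g x)%:E)%E.
Proof.
move=> s0 st tT u0 mg g0.
have mX := measurable_increment u s0 (ltW st) tT.
pose X : {RV P >-> measurableTypeR R} := HB.pack (increment s t u)
  (isMeasurableFun.Build _ _ Om (measurableTypeR R) (increment s t u) mX).
have mg' : measurable_fun (setT : set (measurableTypeR R)) (EFin \o g) by exact/measurable_EFinP.
transitivity (\int[distribution P X]_x (g x)%:E)%E.
  by rewrite (ge0_integral_distribution X mg').
apply: (@eq_measure_integral _ (measurableTypeR R) _ setT
  (normal_prob 0 (Num.sqrt (t - s) * `|u|)) (distribution P X)) => A mA _.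
by case: W_wiener => _ _ _ _ /(_ s t u s0 st tT u0 A mA)[].
Qed.

Let indep s t u f : 0 <= s -> s < t -> t <= T -> u != 0 -> past_measurable s f ->
  forall A B : set R, measurable A -> measurable B ->
  P ((f @^-1` A) `&` (increment s t u @^-1` B)) = (P (f @^-1` A) * P (increment s t u @^-1` B))%E.
Proof.
move=> s0 st tT u0 mf A B mA mB.
have sT : 0 <= s <= T by rewrite s0 (le_trans (ltW st)).
case: W_wiener => _ _ _ _ /(_ s t u s0 st tT u0 B mB)[_]; apply.
exact: (past_measurableP _ sT).1.
Qed.

(** Rescaling to a direction whose increment over [s, t] is standard normal; all moments are thereby
    expressed through those of [normal_prob 0 1]. *)
Let unit_scale s t (u : U) : s < t -> u != 0 -> exists2 v : U, v != 0 &
  u = (Num.sqrt (t - s) * `|u|) *: v /\ Num.sqrt (t - s) * `|v| = 1.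
Proof.
move=> st u0; have ts : 0 < Num.sqrt (t - s) by rewrite sqrtr_gt0 subr_gt0.
have nu : 0 < `|u| by rewrite normr_gt0.
have a0 : 0 < Num.sqrt (t - s) * `|u| by rewrite mulr_gt0.
exists ((Num.sqrt (t - s) * `|u|)^-1 *: u).
  by rewrite scaler_eq0 negb_or u0 invr_eq0 gt_eqF.
split; first by rewrite scalerA divff ?scale1r// gt_eqF.
rewrite normrZ gtr0_norm ?invr_gt0// mulrCA.
by rewrite mulVf// gt_eqF.
Qed.

Definition normal_moment n : R := fine (\int[normal_prob 0 1]_x (`|x| ^+ n)%:E)%E.

Lemma normal_moment_ge0 n : 0 <= normal_moment n.
Proof. by apply: fine_ge0; apply: integral_ge0 => x _; rewrite lee_fin exprn_ge0. Qed.

Let normal_momentE n : (\int[normal_prob 0 1]_x (`|x| ^+ n)%:E = (normal_moment n)%:E)%E.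
Proof.
rewrite fineK// ge0_fin_numE; first exact: normal_moment_fin.
by apply: integral_ge0 => x _; rewrite lee_fin exprn_ge0.
Qed.

Let mabsX n : measurable_fun setT (fun x : R => `|x| ^+ n).
Proof. by apply: measurable_funX; exact: normr_measurable. Qed.

Lemma increment_moment s t u n f : 0 <= s -> s <= t -> t <= T -> (0 < n)%N ->
  past_measurable s f -> (forall w, 0 <= f w) ->
  (\int[P]_w (f w * `|increment s t u w| ^+ n)%:E =
   ((Num.sqrt (t - s) * `|u|) ^+ n * normal_moment n)%:E * \int[P]_w (f w)%:E)%E.
Proof.
move=> s0 st tT n0 pf f0.
have sT : 0 <= s <= T by rewrite s0 (le_trans st).
have mf := past_measurable_fun sT pf.
have mX u' := measurable_increment u' s0 st tT.
have mfX u' (c : R) : measurable_fun setT (fun w => (f w * `|c * increment s t u' w| ^+ n)%:E).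
  apply/measurable_EFinP; apply: measurable_funM => //; apply: measurable_funX.
  apply: measurableT_comp => //; exact: measurable_funM.
have triv : {ae P, forall w, increment s t u w = 0} -> Num.sqrt (t - s) * `|u| = 0 ->
  (\int[P]_w (f w * `|increment s t u w| ^+ n)%:E =
   ((Num.sqrt (t - s) * `|u|) ^+ n * normal_moment n)%:E * \int[P]_w (f w)%:E)%E.
  move=> X0 ->; rewrite expr0n gtn_eqF// mul0r mul0e.
  rewrite (ae_eq_integral (cst 0%E))//; first by rewrite integral0.
    by have := mfX u 1; under eq_fun do rewrite mul1r.
  apply: filterS X0 => w -> _; by rewrite normr0 expr0n gtn_eqF// mulr0.
have [u0|u0] := eqVneq u 0.
  by apply: triv; rewrite ?u0 ?normr0 ?mulr0//; exact: increment0.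
move: st; rewrite le_eqVlt => /predU1P[E|st].
  apply: triv; last by rewrite E subrr sqrtr0 mul0r.
  by apply: aeW => w; rewrite /increment E subrr.
have [v v0 [uE v1]] := unit_scale st u0.
set a := Num.sqrt (t - s) * `|u| in uE *.
have a0 : 0 <= a by rewrite mulr_ge0// sqrtr_ge0.
transitivity (\int[P]_w (f w * `|a * increment s t v w| ^+ n)%:E)%E.
  apply: ae_eq_integral => //.
    by have := mfX u 1; under eq_fun do rewrite mul1r.
  apply: filterS2 (increment_linear a v 0 s0 (ltW st) tT) (increment0 s0 (ltW st) tT) => w.
  by rewrite addr0 -uE => -> -> _; rewrite addr0.
(* [indep_integral] asks for functions that are non-negative on the whole line; [Num.max x 0] is one
   and agrees with the identity on the values of [f]. *)
transitivity (\int[P]_w ((a ^+ n)%:E * (Num.max (f w) 0 * `|increment s t v w| ^+ n)%:E))%E.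
  apply: eq_integral => w _; rewrite -EFinM normrM (ger0_norm a0) exprMn.
  by rewrite (max_idPl (f0 w)); congr (_%:E); ring.
rewrite ge0_integralZl_EFin ?exprn_ge0//; last 2 first.
- by move=> w _; rewrite lee_fin mulr_ge0 ?exprn_ge0// le_max lexx orbT.
- apply/measurable_EFinP; apply: measurable_funM; first exact: measurable_maxr.
  by apply: (measurableT_comp (mabsX n)); exact: mX.
have mmax : measurable_fun setT (fun x : R => Num.max x 0) by exact: measurable_maxr.
have max0 (x : R) : 0 <= Num.max x 0 by rewrite le_max lexx orbT.
have abs0 (x : R) : 0 <= `|x| ^+ n by rewrite exprn_ge0.
rewrite (indep_integral mf (mX v) (indep s0 st tT v0 pf) mmax (mabsX n) max0 abs0).
rewrite (@law s t v (fun x => `|x| ^+ n))// v1 normal_momentE.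
rewrite EFinM -muleA (muleC (normal_moment n)%:E); congr (_ * (_ * _))%E.
by apply: eq_integral => w _; rewrite (max_idPl (f0 w)).
Qed.

Lemma increment_all_moments s t u : 0 <= s -> s <= t -> t <= T ->
  past_moments t (increment s t u).
Proof.
move=> s0 st tT; split; last exact: past_increment.
split; first exact: measurable_increment.
case=> [|n].
  exact: (@all_moments_cst _ _ _ P 1).2 0%N.
have := @increment_moment s t u n.+1 (fun=> 1) s0 st tT (ltn0Sn n) (@measurable_cst _ _ _ _ _ _) (fun=> ler01).
under eq_integral do rewrite mul1r.
move=> ->; rewrite integral_cst//= (_ : P _ = 1%E) ?mule1 ?ltry//; exact: probability_setT.
Qed.

Lemma increment_even_moment s t u n f : 0 <= s -> s <= t -> t <= T -> past_moments s f ->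
  (forall w, 0 <= f w) ->
  Ex P (fun w => f w * (increment s t u w ^+ 2) ^+ n.+1) =
  ((t - s) * `|u| ^+ 2) ^+ n.+1 * normal_moment (2 * n.+1) * Ex P f.
Proof.
move=> s0 st tT [mf pf] f0; apply: EFin_inj.
have mX := (increment_all_moments u s0 st tT).1.
rewrite ExE; last by apply: all_momentsM => //; do 2 apply: all_momentsX.
have E w : (increment s t u w ^+ 2) ^+ n.+1 = `|increment s t u w| ^+ (2 * n.+1).
  by rewrite exprM real_normK// num_real.
under eq_integral do rewrite E.
rewrite increment_moment// [RHS]EFinM ExE// exprM [(_ * `|u|) ^+ 2]exprMn.
by rewrite sqr_sqrtr ?subr_ge0.
Qed.

(** Factorisation is available for non-negative functions, so both factors are split into positive
    and negative parts. The two parts of the increment have the same mean, because the directions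
    [u] and [-u] have increments of the same law. *)
Lemma increment_mean0 s t u f : 0 <= s -> s <= t -> t <= T -> past_moments s f ->
  Ex P (fun w => f w * increment s t u w) = 0.
Proof.
move=> s0 st tT [mf pf].
have mX u' := (increment_all_moments u' s0 st tT).1.
have triv : {ae P, forall w, increment s t u w = 0} -> Ex P (fun w => f w * increment s t u w) = 0.
  move=> h; rewrite (eq_Ex_ae (g := fun=> 0)) ?Ex_cst//.
    exact: (all_momentsM mf (mX u)).1.
  by apply: filterS h => w ->; rewrite mulr0.
have [u0|u0] := eqVneq u 0; first by apply: triv; rewrite u0; exact: increment0.
move: st; rewrite le_eqVlt => /predU1P[E|st].
  by apply: triv; apply: aeW => w; rewrite /increment E subrr.
pose pp (x : R) := Num.max x 0; pose pm (x : R) := Num.max (- x) 0.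
have mpp : measurable_fun setT pp by exact: measurable_maxr.
have mpm : measurable_fun setT pm by apply: measurable_maxr => //; exact: measurableT_comp.
have ppE x : x = pp x - pm x.
  rewrite /pp /pm; have [x0|x0] := leP x 0.
    by rewrite (max_idPl _) ?oppr_ge0// sub0r opprK.
  by rewrite (max_idPr _) ?subr0// oppr_le0 ltW.
have pp0 x : 0 <= pp x by rewrite le_max lexx orbT.
have pm0 x : 0 <= pm x by rewrite le_max lexx orbT.
have mc (c : R -> R) g : (c = pp \/ c = pm) -> all_moments P g -> all_moments P (fun w => c (g w)).
  move=> cE mg; apply: (all_moments_le _ mg).
    by case: cE => ->; [exact: (measurableT_comp mpp mg.1)|exact: (measurableT_comp mpm mg.1)].
  move=> w; case: cE => ->; rewrite ger0_norm// ge_max ?normr_ge0 ?andbT ?ler_norm//.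
  by rewrite -normrN ler_norm.
have ind c e : (c = pp \/ c = pm) -> (e = pp \/ e = pm) ->
    Ex P (fun w => c (f w) * e (increment s t u w)) = Ex P (fun w => c (f w)) * Ex P (fun w => e (increment s t u w)).
  move=> cE eE; apply: EFin_inj; rewrite EFinM.
  rewrite ExE; last by apply: all_momentsM; exact: mc.
  rewrite ExE; last exact: mc.
  rewrite ExE; last exact: mc.
  have mm x : (x = pp \/ x = pm) -> measurable_fun setT x by case=> ->.
  have x0 x : (x = pp \/ x = pm) -> forall y, 0 <= x y by case=> ->.
  exact: (indep_integral mf.1 (mX u).1 (indep s0 st tT u0 pf) (mm c cE) (mm e eE)
    (x0 c cE) (x0 e eE)).
have sym : Ex P (fun w => pp (increment s t u w)) = Ex P (fun w => pm (increment s t u w)).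
  have h : Ex P (fun w => pp (increment s t (- u) w)) = Ex P (fun w => pm (increment s t u w)).
    apply: eq_Ex_ae; [exact: (mc pp _ (or_introl erefl) (mX _)).1|exact: (mc pm _ (or_intror erefl) (mX _)).1|].
    apply: filterS2 (increment_linear (-1) u 0 s0 (ltW st) tT) (increment0 s0 (ltW st) tT) => w.
    by rewrite addr0 scaleN1r => -> ->; rewrite addr0 mulN1r.
  rewrite -h; apply: EFin_inj.
  rewrite !ExE; [|exact: (mc pp _ (or_introl erefl) (mX _))|exact: (mc pp _ (or_introl erefl) (mX _))].
  have nu0 : - u != 0 by rewrite oppr_eq0.
  by rewrite (law s0 st tT u0 mpp pp0) (law s0 st tT nu0 mpp pp0) normrN.
transitivity (Ex P (fun w =>
   (pp (f w) * pp (increment s t u w) - pp (f w) * pm (increment s t u w)) -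
   (pm (f w) * pp (increment s t u w) - pm (f w) * pm (increment s t u w)))).
  congr Ex; apply/funext => w; rewrite {1}[f w]ppE {1}[increment s t u w]ppE; ring.
have mM c e : (c = pp \/ c = pm) -> (e = pp \/ e = pm) ->
   all_moments P (fun w => c (f w) * e (increment s t u w)).
  by move=> ? ?; apply: all_momentsM; exact: mc.
have l := @or_introl (pp = pp) (pp = pm) erefl; have r := @or_intror (pm = pp) (pm = pm) erefl.
rewrite ExB; [|by apply: all_momentsB; exact: mM|by apply: all_momentsB; exact: mM].
rewrite ExB; [|exact: mM|exact: mM]; rewrite ExB; [|exact: mM|exact: mM].
by rewrite !ind// sym !subrr.
Qed.

End wiener_increments.

Lemma ae_eq_sum (R : realType) (d : measure_display) (Om : measurableType d)
    (P : probability Om R) (I : Type) (r : seq I) (f g : I -> Om -> R) :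
  (forall i, {ae P, forall w, f i w = g i w}) ->
  {ae P, forall w, \sum_(i <- r) f i w = \sum_(i <- r) g i w}.
Proof.
move=> fg; elim: r => [|i r ih]; first by apply: aeW => w; rewrite !big_nil.
by apply: filterS2 (fg i) ih => w h1 h2; rewrite !big_cons h1 h2.
Qed.

(** * Elementary stochastic integrals *)

Section simple_martingales.
Context {R : realType} {d : measure_display} {Om : measurableType d} {P : probability Om R}.
Context {T : R} {Fl : R -> set (set Om)} (Fl_normal : normal_filtration P T Fl).
Context {U : hilbertType R} {W : R -> U -> Om -> R} (W_wiener : cylindrical_wiener P T Fl W).
Context {V : hilbertType R}.

Local Notation past_moments := (@past_moments _ _ _ P Fl).
Local Notation increment := (@increment _ _ _ _ W).

Lemma past_moments_prod s (I : Type) (r : seq I) (f : I -> Om -> R) :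
  (forall i, past_moments s (f i)) -> past_moments s (fun w => \prod_(i <- r) f i w).
Proof.
move=> mf; elim: r => [|i r ih].
  by under eq_fun do rewrite big_nil; exact: past_moments_cst.
by under eq_fun do rewrite big_cons; exact: past_momentsM.
Qed.

(** Random vectors with scalar coefficients known at time [s] along finitely many fixed vectors:
    inner products and norms reduce to scalar random variables, and no measurable structure on [V]
    is involved. *)
Inductive tame (s : R) : (Om -> V) -> Prop :=
| tame0 : tame s (fun=> 0)
| tame_cons x v Y : past_moments s x -> tame s Y -> tame s (fun w => x w *: v + Y w).

Lemma tame_scale s x v : past_moments s x -> tame s (fun w => x w *: v).
Proof.
by move=> mx; have := tame_cons v mx (tame0 s); under eq_fun do rewrite addr0.
Qed.

Lemma tameD s Y Z : tame s Y -> tame s Z -> tame s (fun w => Y w + Z w).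
Proof.
move=> tY tZ; elim: tY => [|x v Y' mx _ ih]; first by under eq_fun do rewrite add0r.
by under eq_fun do rewrite -addrA; exact: tame_cons.
Qed.

Lemma tame_sum s (I : Type) (r : seq I) (Y : I -> Om -> V) :
  (forall i, tame s (Y i)) -> tame s (fun w => \sum_(i <- r) Y i w).
Proof.
move=> tY; elim: r => [|i r ih]; first by under eq_fun do rewrite big_nil; exact: tame0.
by under eq_fun do rewrite big_cons; exact: tameD.
Qed.

Lemma tame_mono s t Y : 0 <= s -> s <= t -> t <= T -> tame s Y -> tame t Y.
Proof.
move=> s0 st tT; elim=> [|x v Z mx _ ih]; first exact: tame0.
by apply: tame_cons => //; exact: (past_moments_mono Fl_normal s0 st tT mx).
Qed.

Lemma tame_inner_cst s Y v : tame s Y -> past_moments s (fun w => inner (Y w) v).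
Proof.
elim=> [|x u Z mx _ ih]; first by under eq_fun do rewrite inner0l; exact: past_moments_cst.
under eq_fun do rewrite innerDl innerZl; apply: past_momentsD => //.
by apply: past_momentsM => //; exact: past_moments_cst.
Qed.

Lemma tame_inner s Y Z : tame s Y -> tame s Z -> past_moments s (fun w => inner (Y w) (Z w)).
Proof.
move=> tY tZ; elim: tY => [|x u Y' mx _ ih].
  by under eq_fun do rewrite inner0l; exact: past_moments_cst.
under eq_fun do rewrite innerDl innerZl; apply: past_momentsD => //.
apply: past_momentsM => //.
by under eq_fun do rewrite innerC; exact: tame_inner_cst.
Qed.

Lemma tame_norm s Y : tame s Y -> past_moments s (fun w => `|Y w| ^+ 2).
Proof. by move=> tY; under eq_fun do rewrite -inner_norm; exact: tame_inner. Qed.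

Section one_step.
Context {s t : R} (s0 : 0 <= s) (st : s <= t) (tT : t <= T).
Context {k : nat} {u : 'I_k -> U} {v : 'I_k -> V}.

Let sT : 0 <= s <= T. Proof. by rewrite s0 (le_trans st). Qed.
Let mX x := increment_all_moments Fl_normal W_wiener x s0 st tT.

Let mD (z : 'I_k -> R) : tame t (fun w => \sum_l (z l * increment s t (u l) w) *: v l).
Proof.
apply: tame_sum => l; apply: tame_scale.
by apply: past_momentsM => //; exact: past_moments_cst.
Qed.

(** With deterministic coefficients the step is a Gaussian vector. In orthonormal coordinates of the
    span of [v], its squared norm is a weighted sum of squared increments in directions [a' g] of
    norm at most one. The weights add up to the Gram number, so Jensen reduces the power to scalar
    moments; the coordinates need not be independent. *)
Lemma frozen_moment (z : 'I_k -> R) f j : past_moments s f -> (forall w, 0 <= f w) ->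
  Ex P (fun w => f w * (`|\sum_l (z l * increment s t (u l) w) *: v l| ^+ 2) ^+ j.+1) <=
  normal_moment (2 * j.+1) * (((t - s) * gram z u v) ^+ j.+1 * Ex P f).
Proof.
move=> mf f0; have [fs [ufs ofs spn]] := finite_span v.
pose a g := \sum_l (z l * inner g (v l)) *: u l.
pose a' g := `|a g|^-1 *: a g.
have aE g : a g = `|a g| *: a' g.
  have [->|a0] := eqVneq (a g) 0; first by rewrite normr0 scale0r.
  by rewrite scalerA divff ?scale1r// normr_eq0.
have a'1 g : `|a' g| ^+ 2 <= 1.
  have [a0|a0] := eqVneq (a g) 0; first by rewrite /a' a0 scaler0 normr0 expr0n.
  by rewrite normrZ normrV ?unitfE ?normr_eq0// normr_id mulVf ?normr_eq0// expr1n.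
have ae1 : {ae P, forall w, `|\sum_l (z l * increment s t (u l) w) *: v l| ^+ 2 =
    \sum_(g <- fs) `|a g| ^+ 2 * increment s t (a' g) w ^+ 2}.
  suff : {ae P, forall w, \sum_(g <- fs) (\sum_l z l * increment s t (u l) w * inner g (v l)) ^+ 2 =
    \sum_(g <- fs) `|a g| ^+ 2 * increment s t (a' g) w ^+ 2}.
    by apply: filterS => w; rewrite (norm_orthonormal _ ufs ofs spn).
  apply: ae_eq_sum => g.
  have h1 := increment_sum W_wiener (index_enum 'I_k)
    (fun l => z l * inner g (v l)) u s0 st tT.
  have h2 := increment_linear W_wiener `|a g| (a' g) 0 s0 st tT.
  have h3 := increment0 W_wiener s0 st tT.
  apply: filterS3 h1 h2 h3 => w; rewrite addr0 -aE => e1 e2 e3.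
  rewrite e3 addr0 in e2; rewrite -exprMn -e2 e1; congr (_ ^+ 2).
  by apply: eq_bigr => l _; ring.
have mn : all_moments P (fun w => (`|\sum_l (z l * increment s t (u l) w) *: v l| ^+ 2) ^+ j.+1).
  by apply: all_momentsX; exact: (tame_norm (mD z)).1.
have msum : all_moments P (fun w => (\sum_(g <- fs) `|a g| ^+ 2 * increment s t (a' g) w ^+ 2) ^+ j.+1).
  apply: all_momentsX; apply: all_moments_sum => g; apply: all_momentsZ; apply: all_momentsX.
  exact: (mX _).1.
rewrite (eq_Ex_ae (g := fun w => f w *
   (\sum_(g <- fs) `|a g| ^+ 2 * increment s t (a' g) w ^+ 2) ^+ j.+1)); last 3 first.
- exact: (all_momentsM mf.1 mn).1.
- exact: (all_momentsM mf.1 msum).1.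
- by apply: filterS ae1 => w ->.
pose G := gram z u v.
have GE : G = \sum_(g <- fs) `|a g| ^+ 2 by rewrite /G (gram_orthonormal _ _ ufs ofs spn).
have G0 : 0 <= G by exact: gram_ge0.
have mterm g : all_moments P (fun w => f w * (increment s t (a' g) w ^+ 2) ^+ j.+1).
  by apply: all_momentsM; [exact: mf.1|do 2 apply: all_momentsX; exact: (mX _).1].
apply: (@le_trans _ _ (Ex P (fun w => G ^+ j * \sum_(g <- fs) `|a g| ^+ 2 *
    (f w * (increment s t (a' g) w ^+ 2) ^+ j.+1)))).
  apply: Ex_le; first exact: all_momentsM mf.1 msum.
    by apply: all_momentsZ; apply: all_moments_sum => g; exact: all_momentsZ.
  move=> w.
  rewrite [X in _ <= _ * X](_ : _ = f w * \sum_(g <- fs) `|a g| ^+ 2 * (increment s t (a' g) w ^+ 2) ^+ j.+1).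
    rewrite mulrCA ler_wpM2l// GE.
    by apply: jensen_sum => g; exact: sqr_ge0.
  by rewrite mulr_sumr; apply: eq_bigr => g _; rewrite mulrCA.
rewrite ExZ; last by apply: all_moments_sum => g; exact: all_momentsZ.
rewrite Ex_sum; last by move=> g; exact: all_momentsZ.
have -> : normal_moment (2 * j.+1) * (((t - s) * G) ^+ j.+1 * Ex P f) =
   G ^+ j * (\sum_(g <- fs) `|a g| ^+ 2 * ((t - s) ^+ j.+1 * normal_moment (2 * j.+1) * Ex P f)).
  by rewrite -mulr_suml -GE exprMn [G ^+ j.+1]exprSr; ring.
rewrite ler_wpM2l ?exprn_ge0//; apply: ler_sum => g _.
rewrite ExZ// ler_wpM2l ?sqr_ge0// (increment_even_moment Fl_normal W_wiener)//.
rewrite ler_wpM2r ?Ex_ge0// ler_wpM2r ?normal_moment_ge0// lerXn2r ?nnegrE ?mulr_ge0 ?subr_ge0//.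
by rewrite -[leRHS]mulr1 ler_wpM2l ?subr_ge0.
Qed.

Context {E : 'I_k -> set Om} (FE : forall l, Fl s (E l)).

Let z w l : R := \1_(E l) w.
Let mz l : past_moments s (fun w => z w l).
Proof. exact: (past_moments_indic Fl_normal). Qed.

Let gram_moments : past_moments s (fun w => gram (z w) u v).
Proof.
apply: past_moments_sum => i; apply: past_moments_sum => j.
do ![apply: past_momentsM|exact: mz|exact: past_moments_cst].
Qed.

Let pattern w : {ffun 'I_k -> bool} := [ffun l => w \in E l].

Let mpattern b : past_moments s (fun w => (pattern w == b)%:R).
Proof.
have -> : (fun w => (pattern w == b)%:R) =
    (fun w => \prod_(l <- index_enum 'I_k) (if b l then z w l else 1 + (-1) * z w l) : R).
  apply/funext => w; have [pb|/eqP/ffunP pb] := eqVneq (pattern w) b.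
    rewrite big1// => l _; rewrite -pb ffunE /z indicE; case: (_ \in _) => //=.
    by rewrite mulr0 addr0.
  apply/esym/eqP/prodf_eq0.
  have [l bl] : exists l, pattern w l != b l.
    by apply/existsP; rewrite -negb_forall; apply/negP => /forallP h; apply: pb => l; apply/eqP/h.
  exists l => //; move: bl; rewrite ffunE /z indicE.
  by case: (_ \in _); case: (b l) => //= _; rewrite ?mulN1r ?subrr.
apply: past_moments_prod => l; case: (b l) => //.
by apply: past_momentsD; [exact: past_moments_cst|apply: past_momentsM; [exact: past_moments_cst|]].
Qed.

Let sum_pattern (X : {ffun 'I_k -> bool} -> R) w :
  \sum_b (pattern w == b)%:R * X b = X (pattern w).
Proof.
rewrite (bigD1 (pattern w))//= eqxx mul1r big1 ?addr0// => b.
by rewrite eq_sym => /negbTE ->; rewrite mul0r.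
Qed.

Let zE w : z w = fun l => (pattern w l)%:R.
Proof. by apply/funext => l; rewrite ffunE /z indicE. Qed.

(** The indicators take finitely many joint values, and which of them occurs is known at time [s].
    Splitting over these patterns freezes the coefficients. *)
Lemma step_moment f j : past_moments s f -> (forall w, 0 <= f w) ->
  Ex P (fun w => f w * (`|\sum_l (\1_(E l) w * increment s t (u l) w) *: v l| ^+ 2) ^+ j.+1) <=
  normal_moment (2 * j.+1) *
    Ex P (fun w => f w * ((t - s) * gram (fun l => \1_(E l) w) u v) ^+ j.+1).
Proof.
move=> mf f0.
pose D (b : {ffun 'I_k -> bool}) w := \sum_l ((b l)%:R * increment s t (u l) w) *: v l.
pose g (b : {ffun 'I_k -> bool}) := gram (fun l => (b l)%:R) u v.
have mfb b : past_moments s (fun w => (pattern w == b)%:R * f w) by exact: past_momentsM.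
have mDb b : all_moments P (fun w => (pattern w == b)%:R * f w * (`|D b w| ^+ 2) ^+ j.+1).
  apply: all_momentsM; first exact: (mfb b).1.
  by apply: all_momentsX; exact: (tame_norm (mD _)).1.
have -> : (fun w => f w * (`|\sum_l (\1_(E l) w * increment s t (u l) w) *: v l| ^+ 2) ^+ j.+1) =
  (fun w => \sum_b (pattern w == b)%:R * f w * (`|D b w| ^+ 2) ^+ j.+1).
  apply/funext => w; under [RHS]eq_bigr do rewrite -mulrA.
  rewrite (sum_pattern (fun b => f w * (`|D b w| ^+ 2) ^+ j.+1)) /D.
  by under [in RHS]eq_bigr => l _ do rewrite ffunE -indicE.
have -> : (fun w => f w * ((t - s) * gram (fun l => \1_(E l) w) u v) ^+ j.+1) =
  (fun w => \sum_b ((t - s) * g b) ^+ j.+1 * ((pattern w == b)%:R * f w)).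
  apply/funext => w; under [RHS]eq_bigr do rewrite mulrCA.
  rewrite (sum_pattern (fun b => ((t - s) * g b) ^+ j.+1 * f w)) mulrC /g.
  by congr ((_ * gram _ _ _) ^+ _ * _); exact: zE.
rewrite !Ex_sum//; last by move=> b; apply: all_momentsZ; exact: (mfb b).1.
rewrite mulr_sumr; apply: ler_sum => b _; rewrite ExZ; last exact: (mfb b).1.
by apply: frozen_moment => // w; rewrite mulr_ge0.
Qed.

Lemma step_mean0 f Y : past_moments s f -> tame s Y ->
  Ex P (fun w => f w * inner (Y w) (\sum_l (\1_(E l) w * increment s t (u l) w) *: v l)) = 0.
Proof.
move=> mf tY.
have mfl l : past_moments s (fun w => f w * z w l * inner (Y w) (v l)).
  by apply: past_momentsM; [exact: past_momentsM|exact: tame_inner_cst].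
have -> : (fun w => f w * inner (Y w) (\sum_l (\1_(E l) w * increment s t (u l) w) *: v l)) =
  (fun w => \sum_l f w * z w l * inner (Y w) (v l) * increment s t (u l) w).
  apply/funext => w; rewrite inner_sumr mulr_sumr; apply: eq_bigr => l _.
  by rewrite innerZr /z; ring.
rewrite Ex_sum; last by move=> l; apply: all_momentsM; [exact: (mfl l).1|exact: (mX _).1].
by rewrite big1// => l _; exact: (increment_mean0 Fl_normal W_wiener).
Qed.

Lemma step_tame : tame t (fun w => \sum_l (\1_(E l) w * increment s t (u l) w) *: v l).
Proof.
apply: tame_sum => l; apply: tame_scale; apply: past_momentsM => //.
exact: (past_moments_mono Fl_normal s0 st tT (mz l)).
Qed.

Lemma step_gram : past_moments s (fun w => (t - s) * gram (fun l => \1_(E l) w) u v).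
Proof. by apply: past_momentsM; [exact: past_moments_cst|exact: gram_moments]. Qed.

End one_step.

(** [C] is fixed before the rank, the vectors, the grid and the events; this uniformity is what
    allows the passage to general integrands. *)
Lemma simple_burkholder n : exists2 C : R, 0 < C &
  forall (k : nat) (u : 'I_k -> U) (v : 'I_k -> V) (tau : nat -> R) (E : nat -> 'I_k -> set Om),
  (forall i, 0 <= tau i /\ tau i <= tau i.+1 <= T) -> (forall i l, Fl (tau i) (E i l)) ->
  forall L : nat,
  Ex P (fun w => (`|\sum_(i < L) \sum_l (\1_(E i l) w * increment (tau i) (tau i.+1) (u l) w) *: v l|
     ^+ 2) ^+ n.+1) <=
  C * Ex P (fun w => (\sum_(i < L) (tau i.+1 - tau i) * gram (fun l => \1_(E i l) w) u v) ^+ n.+1).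
Proof.
(* The two moments serve the hypotheses with one and with [n.+1] powers of the squared step; the
   summand 1 makes the constant positive. *)
pose c0 : R := normal_moment (2 * 1) + normal_moment (2 * n.+1) + 1.
have m0 j : 0 <= normal_moment j :> R by exact: normal_moment_ge0.
have c00 : 0 < c0 by rewrite ltr_wpDl// addr_ge0.
have [C C0 HC] := @discrete_burkholder R d Om P n c0 c00.
exists C => // k u v tau E tauT FE L.
have t0 i : 0 <= tau i by case: (tauT i).
have tS i : tau i <= tau i.+1 by case: (tauT i) => _ /andP[].
have tT i : tau i <= T by apply: (le_trans (tS i)); case: (tauT i) => _ /andP[].
have tm i j : (i <= j)%N -> tau i <= tau j.
  by move=> ij; rewrite -(subnK ij); elim: (j - i)%N => // a ih; rewrite addSn (le_trans ih).
pose D i w := \sum_l (\1_(E i l) w * increment (tau i) (tau i.+1) (u l) w) *: v l.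
pose q i w := (tau i.+1 - tau i) * gram (fun l => \1_(E i l) w) u v.
have tD i : tame (tau i.+1) (D i) by exact: step_tame.
have tM j : tame (tau j) (fun w => \sum_(i < j) D i w).
  by apply: tame_sum => i; apply: (tame_mono (t0 _) _ (tT j) (tD i)); exact: tm.
have tM' j : tame (tau j.+1) (fun w => \sum_(i < j) D i w) by exact: tame_mono (tM j).
have mq i : past_moments (tau i) (q i) by apply: step_gram.
have q0 i w : 0 <= q i w by rewrite mulr_ge0 ?subr_ge0// gram_ge0.
have mQ j : past_moments (tau j) (fun w => \sum_(i < j.+1) q i w).
  apply: past_moments_sum => i; apply: (past_moments_mono Fl_normal (t0 _) _ (tT j) (mq i)).
  by apply: tm; rewrite -ltnS.
have mSn j : past_moments (tau j) (fun w => (`|\sum_(i < j) D i w| ^+ 2) ^+ n).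
  by apply: past_momentsX; exact: tame_norm.
apply: (HC V D q).
- by move=> j; exact: (tame_norm (tM j)).1.
- by move=> j; exact: (tame_inner (tM' j) (tD j)).1.
- by move=> j; exact: (tame_norm (tD j)).1.
- by move=> j; exact: (mq j).1.
- by [].
- move=> j; have h : 0 <= Ex P (fun w => (`|\sum_(i < j) D i w| ^+ 2) ^+ n * q j w).
    by apply: Ex_ge0 => w; rewrite mulr_ge0// exprn_ge0// sqr_ge0.
  have := step_moment (t0 j) (tS j) (tT j.+1) (u := u) (v := v) (FE j) 0 (mSn j).
  move=> /(_ (fun w => exprn_ge0 _ (sqr_ge0 _))) => h1; apply: (le_trans h1).
  by rewrite ler_wpM2r// /c0 -addrA lerDl addr_ge0.
- move=> j; have h : 0 <= Ex P (fun w => q j w ^+ n.+1).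
    by apply: Ex_ge0 => w; rewrite exprn_ge0.
  have e (f : Om -> R) : Ex P f = Ex P (fun w => 1 * f w).
    by congr Ex; apply/funext => w; rewrite mul1r.
  have := step_moment (t0 j) (tS j) (tT j.+1) (u := u) (v := v) (FE j) n
     (past_moments_cst (tau j) 1) (fun=> ler01).
  rewrite -(e (fun w => (`|D j w| ^+ 2) ^+ n.+1)) -(e (fun w => q j w ^+ n.+1)).
  move=> h1; apply: (le_trans h1).
  by rewrite ler_wpM2r// /c0 addrAC lerDr addr_ge0.
- by move=> j; exact: (step_mean0 (t0 j) (tS j) (tT j.+1) (FE j) (mSn j) (tM j)).
- move=> j; apply: (step_mean0 (t0 j) (tS j) (tT j.+1) (FE j) _ (tM j)).
  by apply: past_momentsM; [exact: mQ|apply: past_momentsX; exact: tame_norm].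
Qed.

End simple_martingales.

(** The given points are sorted together with a uniform grid. By the last clause no given point lies
    strictly inside a cell, so a simple process whose jump times are among them is constant on each
    cell. *)
Lemma fine_grid (R : realType) (t eta : R) (pts : seq R) : 0 <= t -> 0 < eta ->
  (forall p, p \in pts -> 0 <= p <= t) ->
  exists (L : nat) (tau : nat -> R), [/\ tau 0%N = 0, tau L = t,
    forall i, 0 <= tau i /\ tau i <= tau i.+1 <= t,
    forall i, tau i.+1 - tau i <= eta &
    forall i p, p \in pts -> p <= tau i \/ tau i.+1 <= p].
Proof.
move=> t0 eta0 pts01.
pose M := (Num.truncn (t / eta)).+1; have M0 : 0 < M%:R :> R by [].
have tM : t / M%:R <= eta by rewrite ler_pdivrMr// mulrC -ler_pdivrMr// ltW// truncnS_gt.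
pose qs := [:: 0, t & pts ++ [seq j%:R * (t / M%:R) | j <- iota 0 M.+1]].
pose ps := sort <=%R qs.
have qs01 p : p \in qs -> 0 <= p <= t.
  rewrite !inE mem_cat => /or3P[/eqP ->|/eqP ->|/orP[/pts01//|]]; rewrite ?lexx ?t0//.
  move=> /mapP[j]; rewrite mem_iota add0n ltnS => jM ->.
  rewrite mulr_ge0 ?divr_ge0//= mulrC -mulrA ler_piMr// ler_pdivrMl// mulr1 ler_nat//.
have pst p : (p \in ps) = (p \in qs) by rewrite mem_sort.
have ss : sorted <=%R ps by exact: sort_le_sorted.
(* The default [t] makes the grid constant beyond its last node, so the cells are defined for every
   index and [tau (size ps) = t]. *)
pose tau i := nth t ps i.
have tau01 i : 0 <= tau i <= t.
  have [iL|iL] := ltnP i (size ps); last by rewrite /tau nth_default ?t0 ?lexx.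
  by apply: qs01; rewrite -pst mem_nth.
have tle i j : (i <= j)%N -> tau i <= tau j.
  move=> ij; have [jL|jL] := ltnP j (size ps); last first.
    by rewrite {2}/tau nth_default//; case/andP: (tau01 i).
  by apply: (sorted_leq_nth le_trans le_refl t ss); rewrite ?inE// (leq_ltn_trans ij).
have sep i p : p \in qs -> p <= tau i \/ tau i.+1 <= p.
  rewrite -pst => /(nthP t)[j jL <-]; have [ij|ij] := leqP j i; [left|right]; exact: tle.
have t00 : tau 0%N = 0.
  have : 0 \in qs by rewrite inE eqxx.
  rewrite -pst => /(nthP t)[j jL j0]; apply/eqP; rewrite eq_le; case/andP: (tau01 0%N) => -> _.
  by rewrite andbT -j0; exact: (tle 0%N j).
exists (size ps), tau; split => //.
- by rewrite /tau nth_default.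
- by move=> i; case/andP: (tau01 i) => -> _; rewrite tle//=; case/andP: (tau01 i.+1).
- move=> i; have [tz|tn0] := eqVneq t 0.
    move: (tau01 i) (tau01 i.+1); rewrite tz => /andP[a b] /andP[c e].
    by rewrite (le_trans _ (ltW eta0))// subr_le0 (le_trans e).
  have tp : 0 < t by rewrite lt_neqAle eq_sym tn0.
  have st0 : 0 < t / M%:R by rewrite divr_gt0.
  have [h|h] := leP (tau i.+1) (tau i); first by rewrite (le_trans _ (ltW eta0))// subr_le0.
  pose j := (Num.truncn (tau i / (t / M%:R))).+1.
  have jp : tau i < j%:R * (t / M%:R) by rewrite -ltr_pdivrMr// truncnS_gt.
  have jq : j%:R * (t / M%:R) <= tau i + t / M%:R.
    rewrite -natr1 mulrDl mul1r lerD2r -ler_pdivlMr//.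
    by rewrite truncn_le divr_ge0//; [case/andP: (tau01 i)|exact: ltW].
  have jM : (j <= M)%N.
    rewrite /j truncn_lt_nat; last by rewrite divr_ge0//; [case/andP: (tau01 i)|exact: ltW].
    rewrite ltr_pdivrMr// mulrC divfK ?gt_eqF//.
    by rewrite (lt_le_trans h)//; case/andP: (tau01 i.+1).
  have jqs : j%:R * (t / M%:R) \in qs.
    rewrite !inE mem_cat; apply/or3P; apply: Or33; apply/orP; right.
    by apply/mapP; exists j => //; rewrite mem_iota add0n ltnS.
  have [|h2] := sep i _ jqs; first by rewrite leNgt jp.
  by rewrite lerBlDl (le_trans h2)// (le_trans jq)// lerD2l.
- by move=> i p pp; apply: sep; rewrite !inE mem_cat pp !orbT.
Qed.

(** * Elementary integrals cut along a decreasing family of events *)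

Section ito.
Context {R : realType} {d : measure_display} {Om : measurableType d} {P : probability Om R}.
Context {T : R} {Fl : R -> set (set Om)} (Fl_normal : normal_filtration P T Fl).
Context {U : hilbertType R} {W : R -> U -> Om -> R} (W_wiener : cylindrical_wiener P T Fl W).
Context {V : hilbertType R}.
Local Notation past_moments := (@past_moments _ _ _ P Fl).

(* A variant of [is_ito_integral] that only bounds the errors from above by
   measurable functions; unlike that notion it is evidently stable under
   linear combinations. *)
Definition ito_approx (t : R) (Phi : R -> Om -> U -> V) (I : Om -> V) :=
  exists (g : nat -> seq (rank1_term R Om U V)) (e : nat -> R -> Om -> \bar R)
    (r : nat -> Om -> R),
  [/\ forall n, simple_process_on Fl t (g n),
      (forall n, measurable_fun (`[0%R, t[ `*` setT) (fun p : R * Om => e n p.1 p.2)) /\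
        (forall n s w, (0 <= e n s w)%E),
      forall n s w, 0 <= s < t ->
        (hs2 (fun u => Phi s w u - simple_process (g n) s w u)%R <= e n s w)%E,
      cvg_to0_in_probability P (fun n w =>
        (\int[lebesgue_measure]_(s in `[0%R, t[) e n s w)%E) &
      [/\ forall n, measurable_fun setT (r n),
          cvg_to0_in_probability P (fun n w => (r n w)%:E) &
          forall n w, `|I w - simple_process_int W (g n) w| <= r n w]].

Section grid_cut.
Context {t : R} (t0 : 0 <= t) (tT : t <= T).
Context {G : R -> set Om}.
Hypothesis FG : forall s, 0 <= s <= t -> Fl s (G s).
Hypothesis G_mono : forall r s, 0 <= r -> r <= s -> s <= t -> G s `<=` G r.
Context {g : seq (rank1_term R Om U V)} (gt : simple_process_on Fl t g).
Context {L : nat} {tau : nat -> R}.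
Hypothesis tau0 : tau 0%N = 0.
Hypothesis tauL : tau L = t.
Hypothesis tau_le : forall i, 0 <= tau i /\ tau i <= tau i.+1 <= t.
Hypothesis tau_sep : forall i p, p \in map (@lo _ _ _ _) g ++ map (@hi _ _ _ _) g ->
  p <= tau i \/ tau i.+1 <= p.

Let k := size g.
Let term (l : 'I_k) := tnth (in_tuple g) l.
Let u (l : 'I_k) := src (term l).
Let v (l : 'I_k) := dst (term l).

Let termP l : [/\ 0 <= lo (term l), lo (term l) <= hi (term l), hi (term l) <= t &
  Fl (lo (term l)) (ev (term l))].
Proof.
have /(all_nthP (term l))/(_ l (ltn_ord l)) := gt.
by rewrite -(tnth_nth _ (in_tuple g)) => /asboolP.
Qed.

Let mem_term (h : rank1_term R Om U V -> R) l : h (term l) \in map h g.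
Proof.
rewrite /term (tnth_nth (term l)) -(nth_map _ (h (term l))) ?ltn_ord//.
by rewrite mem_nth// size_map ltn_ord.
Qed.

Let sep_lo i l : lo (term l) <= tau i \/ tau i.+1 <= lo (term l).
Proof. by apply: tau_sep; rewrite mem_cat mem_term. Qed.

Let sep_hi i l : hi (term l) <= tau i \/ tau i.+1 <= hi (term l).
Proof. by apply: tau_sep; rewrite mem_cat (mem_term (@hi _ _ _ _)) orbT. Qed.

(** By the separation property a cell lies either inside the interval of a term or outside it. Cells
    of length zero may count as active, but contribute nothing. *)
Definition active i (l : 'I_k) := (lo (term l) <= tau i) && (tau i.+1 <= hi (term l)).

Let z i w (l : 'I_k) : R := (active i l)%:R * \1_(ev (term l)) w.

Definition step_energy i w : R := gram (z i w) u v.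

Let step_energy_ge0 i w : 0 <= step_energy i w. Proof. exact: gram_ge0. Qed.

(** A crude deterministic bound on [step_energy]; times the mesh, it pays for the single cell in
    which the event [G] is lost. *)
Definition energy_bound : R := \sum_(l : 'I_k) \sum_(l' : 'I_k)
  `|inner (u l) (u l') * inner (v l) (v l')|.

Let step_energy_le i w : step_energy i w <= energy_bound.
Proof.
apply: ler_sum => l _; apply: ler_sum => l' _.
rewrite -mulrA (le_trans (ler_norm _))// normrM ler_piMl//.
rewrite /z !indicE; do 2 case: (active _ _); do 2 case: (_ \in _);
  by rewrite ?mulr1 ?mulr0 ?mul0r ?normr0 ?normr1.
Qed.

Let tau_t i : tau i <= t. Proof. by case: (tau_le i) => _ /andP[/le_trans]; apply. Qed.
Let tau_ge0 i : 0 <= tau i. Proof. by case: (tau_le i). Qed.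
Let tau_S i : tau i <= tau i.+1. Proof. by case: (tau_le i) => _ /andP[]. Qed.
Let tau_mono i j : (i <= j)%N -> tau i <= tau j.
Proof. by move=> ij; rewrite -(subnK ij); elim: (j - i)%N => // a ih; rewrite addSn (le_trans ih). Qed.
Let tau_T i : 0 <= tau i <= T. Proof. by rewrite tau_ge0 (le_trans (tau_t i)). Qed.

Lemma hs2_simple_process i s w : tau i < s <= tau i.+1 ->
  hs2 (simple_process g s w) = (step_energy i w)%:E.
Proof.
move=> /andP[is_ si]; rewrite -hs2_gram; congr hs2; apply/funext => x.
rewrite /simple_process big_tnth; apply: eq_bigr => l _.
rewrite /z -!mulrA; congr ((_ * _) *: _); rewrite indicE.
have -> : (s \in `]lo (term l), hi (term l)]%classic) = active i l.
  apply/idP/idP => [/set_mem|/andP[h1 h2]].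
    rewrite /= in_itv/= => /andP[h1 h2]; apply/andP; split.
      by case: (sep_lo i l) => // h; have := lt_le_trans h1 (le_trans si h); rewrite ltxx.
    by case: (sep_hi i l) => // h; have := lt_le_trans is_ (le_trans h2 h); rewrite ltxx.
  by apply/mem_set; rewrite /= in_itv/= (le_lt_trans h1)// (le_trans si).
by [].
Qed.

Lemma simple_process_int_grid w : simple_process_int W g w =
  \sum_(i < L) \sum_l (z i w l * increment (W := W) (tau i) (tau i.+1) (u l) w) *: v l.
Proof.
rewrite exchange_big /= /simple_process_int [LHS]big_tnth; apply: eq_bigr => l _.
rewrite -scaler_suml; congr (_ *: _).
under eq_bigr => i _ do rewrite /z mulrAC mulrC.
rewrite -mulr_sumr; congr (_ * _).
have [l0 lh ht _] := termP l.
(* Clipping time to the interval of the term turns the increments over active cells into a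
   telescoping sum over all cells. *)
pose c x := Num.max (lo (term l)) (Num.min x (hi (term l))).
rewrite (eq_bigr (fun i : 'I_L => W (c (tau i.+1)) (src (term l)) w - W (c (tau i)) (src (term l)) w)).
  rewrite -(big_mkord xpredT (fun i => W (c (tau i.+1)) (src (term l)) w - W (c (tau i)) (src (term l)) w)).
  rewrite telescope_sumr// tau0 tauL /c (min_idPr ht) (max_idPr lh).
  by rewrite (min_idPl (le_trans l0 lh)) (max_idPl l0).
move=> i _; rewrite /increment /active.
have [h1|h1] := sep_lo i l; have [h2|h2] := sep_hi i l.
- have -> : c (tau i.+1) = hi (term l).
    by rewrite /c (min_idPr (le_trans h2 (tau_S i))) (max_idPr lh).
  have -> : c (tau i) = hi (term l) by rewrite /c (min_idPr h2) (max_idPr lh).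
  rewrite subrr h1 /=; case: leP => h3; last by rewrite mul0r.
  by rewrite mul1r (_ : tau i.+1 = tau i) ?subrr//; apply/le_anti; rewrite tau_S andbT (le_trans h3).
- rewrite h1 h2 mul1r /c (min_idPl h2) (min_idPl (le_trans (tau_S i) h2)).
  by rewrite (max_idPr h1) (max_idPr (le_trans h1 (tau_S i))).
- have e : tau i.+1 = tau i.
    by apply/le_anti; rewrite tau_S andbT (le_trans h1)// (le_trans lh).
  by rewrite e !subrr mulr0.
- have -> : c (tau i.+1) = lo (term l).
    by rewrite /c (min_idPl h2) (max_idPl h1).
  have -> : c (tau i) = lo (term l).
    by rewrite /c (min_idPl (le_trans (tau_S i) h2)) (max_idPl (le_trans (tau_S i) h1)).
  rewrite subrr h2 andbT; case: leP => h3; last by rewrite mul0r.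
  by rewrite mul1r (_ : tau i.+1 = tau i) ?subrr//; apply/le_anti; rewrite tau_S andbT (le_trans h1).
Qed.

(** Quadratic variation accumulated on the cells at whose left end the event [G] still holds. *)
Definition energy j w : R :=
  \sum_(i < j) \1_(G (tau i)) w * ((tau i.+1 - tau i) * step_energy i w).

Let energy_term_ge0 i w : 0 <= \1_(G (tau i)) w * ((tau i.+1 - tau i) * step_energy i w) :> R.
Proof. by rewrite !mulr_ge0 ?subr_ge0// indicE; case: (_ \in _). Qed.

Let energyS j w : energy j.+1 w =
  energy j w + \1_(G (tau j)) w * ((tau j.+1 - tau j) * step_energy j w).
Proof. by rewrite /energy big_ord_recr. Qed.

Let energy_mono i j w : (i <= j)%N -> energy i w <= energy j w.
Proof.
move=> ij; rewrite -(subnK ij); elim: (j - i)%N => // a ih.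
by rewrite addSn energyS (le_trans ih)// lerDl.
Qed.

(** [energy] tests [G] at left ends, whereas the bound by [h] on a cell is applied when [G] holds at
    its right end. Since [G] decreases, the two tests differ in at most one cell, and this cell
    costs [c]. *)
Lemma energy_le (h : R -> \bar R) w (c : R) : 0 <= c ->
  measurable_fun (`[0%R, t[ : set (measurableTypeR R)) h -> (forall s, (0 <= h s)%E) ->
  (forall s, 0 <= s < t -> G s w -> (hs2 (simple_process g s w) <= h s)%E) ->
  (forall i, (tau i.+1 - tau i) * energy_bound <= c) ->
  ((energy L w)%:E <= \int[lebesgue_measure]_(s in `[0%R, t[) h s + c%:E)%E.
Proof.
move=> c0 mh h0 hh mesh.
have mhi i : measurable_fun (`]tau i, tau i.+1[ : set (measurableTypeR R)) h.
  apply: measurable_funS mh => // s /=; rewrite !in_itv/= => /andP[a b].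
  by rewrite (le_trans (tau_ge0 i) (ltW a)) (lt_le_trans b).
have mhj j : measurable_fun (`[0%R, tau j[ : set (measurableTypeR R)) h.
  by apply: measurable_funS mh => // s /=; rewrite !in_itv/= => /andP[-> b]; rewrite (lt_le_trans b).
(* The strengthened claim spends [c] only after [G] has been left, hence only once. *)
suff H j : ((energy j w)%:E <= \int[lebesgue_measure]_(s in `[0%R, (tau j)[) h s +
     (if w \in G (tau j) then 0 else c)%:E)%E.
  have := H L; rewrite tauL => h1; apply: (le_trans h1); rewrite leeD2l// lee_fin; case: ifP => //.
elim: j => [|j ih].
  rewrite /energy big_ord0 adde_ge0//; first exact: integral_ge0.
  by rewrite lee_fin; case: ifP.
have sub1 : (\int[lebesgue_measure]_(s in `[0%R, (tau j)[) h s +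
    \int[lebesgue_measure]_(s in `](tau j), (tau j.+1)[) h s <=
    \int[lebesgue_measure]_(s in `[0%R, (tau j.+1)[) h s)%E.
  rewrite -ge0_integral_setU//=; last 2 first.
    exact/measurable_funU.
    apply/disj_setPRL => s /=; rewrite !in_itv/= => /andP[a b]; apply/negP.
    by rewrite negb_and -!leNgt (ltW a) orbT.
  apply: ge0_subset_integral => //; first exact: measurableU.
  move=> s /=; rewrite !in_itv/= => -[/andP[-> a]|/andP[a b]].
    by rewrite (lt_le_trans a).
  by rewrite b (le_trans (tau_ge0 j) (ltW a)).
have I0 : (0 <= \int[lebesgue_measure]_(s in `](tau j), (tau j.+1)[) h s)%E by exact: integral_ge0.
have [GS|GS] := boolP (w \in G (tau j.+1)).
  have Gj : w \in G (tau j).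
    by apply/mem_set; apply: (G_mono (tau_ge0 j) (tau_S j) (tau_t _)); exact/set_mem.
  rewrite energyS EFinD adde0 indicE Gj mul1r; rewrite Gj adde0 in ih.
  apply: le_trans sub1; rewrite leeD//.
  apply: (@le_trans _ _ (\int[lebesgue_measure]_(s in `](tau j), (tau j.+1)[) (step_energy j w)%:E)%E).
    rewrite integral_cst//= lebesgue_measure_itv/= lte_fin; case: ltP => h1.
      by rewrite -EFinB -EFinM mulrC.
    by rewrite mule0 lee_fin (_ : tau j.+1 - tau j = 0) ?mul0r//; apply/eqP; rewrite subr_eq0 eq_le h1 tau_S.
  apply: ge0_le_integral => //.
    by move=> s _; rewrite lee_fin.
  move=> s /=; rewrite in_itv/= => /andP[a b].
  rewrite -(@hs2_simple_process j s w) ?a ?(ltW b)//; apply: hh.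
    by rewrite (le_trans (tau_ge0 j) (ltW a)) (lt_le_trans b).
  apply: (G_mono (s := tau j.+1)) => //; first by rewrite (le_trans (tau_ge0 j) (ltW a)).
    exact: ltW.
  exact/set_mem.
rewrite energyS EFinD; have [Gj|Gj] := boolP (w \in G (tau j)).
  rewrite Gj adde0 in ih; rewrite indicE Gj mul1r leeD//.
    by apply: (le_trans ih); apply: le_trans sub1; rewrite leeDl.
  by rewrite lee_fin (le_trans _ (mesh j))// ler_wpM2l// subr_ge0.
rewrite indicE (negbTE Gj) mul0r adde0; rewrite (negbTE Gj) in ih.
by apply: (le_trans ih); rewrite leeD2r//; apply: le_trans sub1; rewrite leeDl.
Qed.

Let step_energy_past i : past_moments (tau i) (step_energy i).
Proof.
apply: past_moments_sum => l; apply: past_moments_sum => l'.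
have zp l1 : past_moments (tau i) (fun w => z i w l1).
  rewrite /z; case E : (active i l1); last first.
    by under eq_fun do rewrite mul0r; exact: past_moments_cst.
  apply: past_momentsM; first exact: past_moments_cst.
  apply: (past_moments_indic Fl_normal (tau_T i)); have [l0 _ _ Fev] := termP l1.
  by case/andP: E => E1 _; apply: (Fl_mono Fl_normal l0 E1) => //; case/andP: (tau_T i).
by do ![exact: zp|exact: past_moments_cst|apply: past_momentsM].
Qed.

Let energy_past i : past_moments (tau i) (energy i.+1).
Proof.
apply: past_moments_sum => j; have ji : (j <= i)%N by rewrite -ltnS.
have [_ tiT] := andP (tau_T i).
apply: (past_moments_mono Fl_normal (tau_ge0 j) (tau_mono ji) tiT).
apply: past_momentsM.
  by apply: (past_moments_indic Fl_normal (tau_T j)); apply: FG; rewrite tau_ge0 tau_t.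
by apply: past_momentsM; [exact: past_moments_cst|exact: step_energy_past].
Qed.

(** The energy includes the coming cell, [energy i.+1] being known at time [tau i]: the cap is never
    exceeded and the event remains adapted. *)
Definition capped K i := G (tau i) `&` [set w | energy i.+1 w <= K].

Let Fcut K i : Fl (tau i) (capped K i).
Proof.
have sg := Fl_sigma_algebra Fl_normal (tau_T i).
rewrite -(sigma_algebra_id sg).
apply: (@measurableI _ (g_sigma_algebraType (Fl (tau i)))).
  by apply: sub_gen_smallest; apply: FG; rewrite tau_ge0 tau_t.
have h := (past_measurableP Fl_normal _ (tau_T i)).1 (energy_past i).2 `]-oo, K]%classic (measurable_itv _).
apply: sub_gen_smallest; rewrite (_ : [set w | _] = energy i.+1 @^-1` `]-oo, K]%classic)//.
Qed.

Definition cut_event K i (l : 'I_k) := if active i l then capped K i `&` ev (term l) else set0.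

Let Fcut_event K i l : Fl (tau i) (cut_event K i l).
Proof.
have sg := Fl_sigma_algebra Fl_normal (tau_T i).
rewrite /cut_event; case: ifP => [/andP[E1 _]|_]; rewrite -(sigma_algebra_id sg); last first.
  exact: (@measurable0 _ (g_sigma_algebraType (Fl (tau i)))).
apply: (@measurableI _ (g_sigma_algebraType (Fl (tau i)))); apply: sub_gen_smallest => //.
have [l0 _ _ Fev] := termP l.
by apply: (Fl_mono Fl_normal l0 E1) => //; case/andP: (tau_T i).
Qed.

Let cut_eventE K i w l : \1_(cut_event K i l) w = \1_(capped K i) w * z i w l :> R.
Proof.
rewrite /cut_event /z; case: ifP => _; last by rewrite indic0 mul0r mulr0.
by rewrite mul1r indicI.
Qed.

Let gram_cut K i w : gram (fun l => \1_(cut_event K i l) w) u v = \1_(capped K i) w * step_energy i w.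
Proof.
rewrite mulr_sumr; apply: eq_bigr => l _; rewrite mulr_sumr; apply: eq_bigr => l' _.
rewrite !cut_eventE !indicE; case: (_ \in capped K i); rewrite ?mul1r ?mul0r//.
Qed.

(** The elementary integral switched off as soon as [G] fails or the energy would pass [K]. It
    stands in for a stopped integral while remaining elementary, so that [simple_burkholder]
    applies. *)
Definition cut_int K w := \sum_(i < L) \sum_l
   (\1_(cut_event K i l) w * increment (W := W) (tau i) (tau i.+1) (u l) w) *: v l.

Lemma cut_int_eq K w : G t w -> energy L w <= K -> cut_int K w = simple_process_int W g w.
Proof.
move=> Gt EK; rewrite simple_process_int_grid; apply: eq_bigr => i _; apply: eq_bigr => l _.
rewrite cut_eventE indicE mem_set ?mul1r//; split.
  exact: (G_mono (tau_ge0 i) (tau_t i) (lexx t)).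
by apply: le_trans EK; apply: energy_mono.
Qed.

Let cut_energy_le K w j : 0 <= K -> let q i := (tau i.+1 - tau i) * gram (fun l => \1_(cut_event K i l) w) u v in
  \sum_(i < j) q i <= Num.min (energy j w) K.
Proof.
move=> K0 /=; pose q i := (tau i.+1 - tau i) * gram (fun l => \1_(cut_event K i l) w) u v.
change (\sum_(i < j) q i <= Num.min (energy j w) K).
have qE i : q i = \1_(capped K i) w * ((tau i.+1 - tau i) * step_energy i w).
  by rewrite /q gram_cut mulrCA.
have le1 i : q i <= \1_(G (tau i)) w * ((tau i.+1 - tau i) * step_energy i w).
  rewrite qE ler_wpM2r ?mulr_ge0 ?subr_ge0// !indicE; case: (boolP (_ \in capped K i)) => // /set_mem[h _].
  by rewrite mem_set.
rewrite le_min; apply/andP; split; first exact: ler_sum.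
elim: j => [|j ih]; first by rewrite big_ord0.
have [c|c] := boolP (w \in capped K j); last first.
  by rewrite big_ord_recr /= qE indicE (negbTE c) mul0r addr0.
have [_ /= h] := set_mem c.
by apply: le_trans h; apply: ler_sum.
Qed.

Lemma cut_int_all_moments K : all_moments P (fun w => `|cut_int K w| ^+ 2).
Proof.
suff h : @tame _ _ _ P Fl V t (cut_int K) by exact: (tame_norm h).1.
apply: tame_sum => i; have [_ tS] := andP (tau_T i.+1).
apply: (tame_mono Fl_normal (tau_ge0 i.+1) (tau_t i.+1) tT).
exact: (step_tame Fl_normal W_wiener (tau_ge0 i) (tau_S i) tS (Fcut_event K i)).
Qed.

Lemma energy_measurable : measurable_fun setT (energy L).
Proof.
suff h i : measurable_fun setT (energy i).
  exact: h.
case: i => [|i]; last first.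
  exact: (past_measurable_fun Fl_normal (tau_T i) (energy_past i).2).
by rewrite /energy; under eq_fun do rewrite big_ord0; exact: measurable_cst.
Qed.

Lemma cut_int_moment n (C K : R) : 0 <= C -> 0 <= K ->
  (forall (k : nat) (u : 'I_k -> U) (v : 'I_k -> V) (tau : nat -> R) (E : nat -> 'I_k -> set Om),
  (forall i, 0 <= tau i /\ tau i <= tau i.+1 <= T) -> (forall i l, Fl (tau i) (E i l)) ->
  forall L : nat,
  Ex P (fun w => (`|\sum_(i < L) \sum_l (\1_(E i l) w * increment (W := W) (tau i) (tau i.+1) (u l) w) *: v l|
     ^+ 2) ^+ n.+1) <=
  C * Ex P (fun w => (\sum_(i < L) (tau i.+1 - tau i) * gram (fun l => \1_(E i l) w) u v) ^+ n.+1)) ->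
  (\int[P]_w ((`|cut_int K w| ^+ 2) ^+ n.+1)%:E <=
   C%:E * \int[P]_w (Num.min (energy L w) K ^+ n.+1)%:E)%E.
Proof.
move=> C0 K0 HC.
have tauT i : 0 <= tau i /\ tau i <= tau i.+1 <= T.
  by rewrite tau_ge0 tau_S; split => //; case/andP: (tau_T i.+1).
have := HC k u v tau (cut_event K) tauT (Fcut_event K) L => h.
rewrite -ExE; last by apply: all_momentsX; exact: cut_int_all_moments.
apply: (@le_trans _ _ (C%:E * (Ex P (fun w => (\sum_(i < L) (tau i.+1 - tau i) *
   gram (fun l => \1_(cut_event K i l) w) u v) ^+ n.+1))%:E)%E); first by rewrite -EFinM lee_fin.
rewrite lee_wpmul2l//.
have mq : all_moments P (fun w => \sum_(i < L) (tau i.+1 - tau i) * gram (fun l => \1_(cut_event K i l) w) u v).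
  apply: all_moments_sum => i; apply: all_momentsZ; under eq_fun do rewrite gram_cut.
  apply: all_momentsM; last exact: (step_energy_past i).1.
  exact: (past_moments_indic Fl_normal (tau_T i) (Fcut K i)).1.
rewrite ExE; last exact: all_momentsX.
have q0 w : 0 <= \sum_(i < L) (tau i.+1 - tau i) * gram (fun l => \1_(cut_event K i l) w) u v.
  by apply: sumr_ge0 => i _; rewrite mulr_ge0 ?subr_ge0// gram_ge0.
apply: ge0_le_integral => //.
- by move=> w _; rewrite lee_fin exprn_ge0.
- by apply/measurable_EFinP; exact: (all_momentsX _ mq).1.
- apply/measurable_EFinP; apply: measurable_funX; apply: measurable_minr => //.
  exact: energy_measurable.
move=> w _; rewrite lee_fin; apply: lerXn2r.
- by rewrite nnegrE.
- by rewrite nnegrE le_min K0 andbT; apply: sumr_ge0.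
- exact: (cut_energy_le w L K0).
Qed.

End grid_cut.

End ito.

Lemma measurable_section (R : realType) (d : measure_display) (Om : measurableType d)
    (D : set R) (f : R -> Om -> \bar R) w : measurable D ->
  measurable_fun (D `*` setT) (fun p : R * Om => f p.1 p.2) ->
  measurable_fun (D : set (measurableTypeR R)) (fun s => f s w).
Proof.
move=> mD mf.
apply: (@measurable_comp _ _ _ _ (R * Om)%type _ (D `*` setT) (fun p : R * Om => f p.1 p.2)
  D (fun s => (s, w))) => //.
- by apply: measurableX.
- by move=> p [s Ds <-].
apply: measurable_funTS; exact: measurable_fun_pair.
Qed.

Lemma expr_sum3_le (R : realType) (x y z : R) m : 0 <= x -> 0 <= y -> 0 <= z ->
  (x + y + z) ^+ m <= 3 ^+ m * (x ^+ m + y ^+ m + z ^+ m).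
Proof.
move=> x0 y0 z0; pose M := Num.max x (Num.max y z).
have xM : x <= M by rewrite le_max lexx.
have yM : y <= M by rewrite !le_max lexx orbT.
have zM : z <= M by rewrite !le_max lexx !orbT.
have M0 : 0 <= M := le_trans x0 xM.
apply: (@le_trans _ _ ((3 * M) ^+ m)).
  by rewrite lerXn2r ?nnegrE ?mulr_ge0 ?addr_ge0//; lra.
rewrite exprMn ler_wpM2l ?exprn_ge0//.
have xm : 0 <= x ^+ m by rewrite exprn_ge0.
have ym : 0 <= y ^+ m by rewrite exprn_ge0.
have zm : 0 <= z ^+ m by rewrite exprn_ge0.
have [|[|]] : M = x \/ M = y \/ M = z.
  by rewrite /M; case: (leP y z) => _; [case: (leP x z)|case: (leP x y)] => _; auto.
all: by move=> ->; lra.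
Qed.

Lemma expr_sum2_le (R : realType) (x y : R) m : 0 <= x -> 0 <= y ->
  (x + y) ^+ m <= 2 ^+ m * (x ^+ m + y ^+ m).
Proof.
move=> x0 y0; pose M := Num.max x y.
have xM : x <= M by rewrite le_max lexx.
have yM : y <= M by rewrite le_max lexx orbT.
have M0 : 0 <= M := le_trans x0 xM.
apply: (@le_trans _ _ ((2 * M) ^+ m)).
  by rewrite lerXn2r ?nnegrE ?mulr_ge0 ?addr_ge0//; lra.
rewrite exprMn ler_wpM2l ?exprn_ge0//.
have xm : 0 <= x ^+ m by rewrite exprn_ge0.
have ym : 0 <= y ^+ m by rewrite exprn_ge0.
have [|] : M = x \/ M = y by rewrite /M; case: (leP x y) => _; auto.
all: by move=> ->; lra.
Qed.

(** * Moments of the Ito integral *)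

Section ito_moment.
Context {R : realType} {d : measure_display} {Om : measurableType d} {P : probability Om R}.
Context {T : R} {Fl : R -> set (set Om)} (Fl_normal : normal_filtration P T Fl).
Context {U : hilbertType R} {W : R -> U -> Om -> R} (W_wiener : cylindrical_wiener P T Fl W).
Context {V : hilbertType R}.
Local Notation ito_approx := (@ito_approx _ _ _ P Fl U W V).

Let IP (f : Om -> R) : \bar R := (\int[P]_w (f w)%:E)%E.

Let IPD (f g : Om -> R) : measurable_fun setT f -> measurable_fun setT g ->
  (forall w, 0 <= f w) -> (forall w, 0 <= g w) -> (IP (fun w => (f w + g w)%R) = IP f + IP g)%E.
Proof.
move=> mf mg f0 g0; rewrite /IP; under eq_integral do rewrite EFinD.
by rewrite ge0_integralD//; [move=> w _; rewrite lee_fin|exact/measurable_EFinP|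
   move=> w _; rewrite lee_fin|exact/measurable_EFinP].
Qed.

Let IPZ (c : R) (f : Om -> R) : 0 <= c -> measurable_fun setT f -> (forall w, 0 <= f w) ->
  (IP (fun w => (c * f w)%R) = c%:E * IP f)%E.
Proof.
move=> c0 mf f0; rewrite /IP; under eq_integral do rewrite EFinM.
by rewrite ge0_integralZl_EFin//; [move=> w _; rewrite lee_fin|exact/measurable_EFinP].
Qed.

Let IPc (c : R) : IP (fun=> c) = c%:E.
Proof. rewrite /IP integral_cst//= (_ : P _ = 1%E) ?mule1//; exact: probability_setT. Qed.

Let IP_le (f g : Om -> R) : measurable_fun setT f -> measurable_fun setT g ->
  (forall w, 0 <= f w) -> (forall w, f w <= g w) -> (IP f <= IP g)%E.
Proof.
move=> mf mg f0 fg; apply: ge0_le_integral => //; try exact/measurable_EFinP.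
  by move=> w _; rewrite lee_fin.
by move=> w _; rewrite lee_fin.
Qed.

Let IP_ge0 (f : Om -> R) : (forall w, 0 <= f w) -> (0 <= IP f)%E.
Proof. by move=> f0; apply: integral_ge0 => w _; rewrite lee_fin. Qed.

Let cvg_small (Y : nat -> Om -> \bar R) (e : R) : 0 < e -> cvg_to0_in_probability P Y ->
  \forall n \near \oo, (P [set w | (e%:E < Y n w)%E] < e%:E)%E.
Proof.
move=> e0 /(_ e e0)[_ cv]; apply: (cv [set x | (x < e%:E)%E]).
apply: open_nbhs_nbhs; split; first exact: open_ereal_lt_ereal.
by rewrite /= lte_fin.
Qed.

(** Instead of bounding moments of [I], a bounded [y] with [y <= a + |I|] on [G t] is bounded. One
    approximant is chosen together with a small event [Bad]. Off [Bad] the energy is below the cap,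
    so the cut integral is the elementary one and close to [I]; on [Bad] the bounds [b] and [K] are
    used. They enter only terms that vanish with the probability of [Bad], not the constant. *)
Lemma ito_moment n : exists2 C : R, 0 < C &
  forall t (Phi : R -> Om -> U -> V) (I : Om -> V), 0 <= t <= T -> ito_approx t Phi I ->
  forall (G : R -> set Om) (k : R -> Om -> \bar R) (kap y a : Om -> R) (K b : R),
  (forall s, 0 <= s <= t -> Fl s (G s)) ->
  (forall r s, 0 <= r -> r <= s -> s <= t -> G s `<=` G r) ->
  measurable_fun (`[0%R, t[ `*` setT) (fun p : R * Om => k p.1 p.2) ->
  (forall s w, (0 <= k s w)%E) ->
  (forall s w, 0 <= s < t -> G s w -> (hs2 (Phi s w) <= k s w)%E) ->
  measurable_fun setT kap -> (forall w, 0 <= kap w <= K) ->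
  (forall w, (\int[lebesgue_measure]_(s in `[0%R, t[) k s w <= (kap w)%:E)%E) ->
  measurable_fun setT y -> measurable_fun setT a ->
  (forall w, 0 <= y w) -> (forall w, 0 <= a w) -> (forall w, G t w -> y w <= b) ->
  {ae P, forall w, G t w -> y w <= a w + `|I w|} ->
  (\int[P]_w (\1_(G t) w * (y w ^+ 2) ^+ n.+1)%:E <=
   C%:E * (\int[P]_w (\1_(G t) w * (a w ^+ 2) ^+ n.+1)%:E + \int[P]_w (kap w ^+ n.+1)%:E))%E.
Proof.
have [C C0 HC] := simple_burkholder Fl_normal W_wiener (V := V) n.
pose m := n.+1.
(* [3] comes from splitting [a + |I| + ep] under the power 2m, [4 ^+ m] from splitting the energy
   bound [2 * kap + 3 * ep] under the power m. *)
pose C' : R := (3 ^+ 2) ^+ m * (1 + C * 4 ^+ m).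
have C'0 : 0 < C' by rewrite mulr_gt0 ?exprn_gt0// addr_gt0// mulr_gt0// exprn_gt0.
exists C' => // t Phi I /andP[t0 tT] [g [e [r [gon [me e0] hse cve [mr cvr Ir]]]]].
move=> G k kap y a K b FG Gmono mk k0 hk mkap kapK ik my ma y0 a0 yb ae.
have tT' : 0 <= t <= T by rewrite t0.
have mG : measurable (G t) by apply: (Fl_measurable Fl_normal tT'); apply: FG; rewrite t0 lexx.
have m1G : measurable_fun setT (\1_(G t) : Om -> R) by exact: measurable_indic.
have ind01 (A : set Om) w : (0 : R) <= (\1_A w : R) <= (1 : R).
  by rewrite !indicE; case: (w \in A); rewrite ?mulr1n ?mulr0n ?lexx ?ler01.
have ind0 (A : set Om) w : (0 : R) <= (\1_A w : R) by case/andP: (ind01 A w).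
have kap0 w : 0 <= kap w by case/andP: (kapK w).
have K0 : 0 <= K.
  have /set0P[w _] : [set: Om] != set0.
    by apply/eqP => z; have := @probability_setT _ _ _ P; rewrite z measure0 => /eqP; rewrite eq_sym onee_eq0.
  by have /andP[h1 h2] := kapK w; exact: le_trans h1 h2.
have b0 : 0 <= `|b| by [].
pose fa w := \1_(G t) w * (a w ^+ 2) ^+ m.
pose fy w := \1_(G t) w * (y w ^+ 2) ^+ m.
have fa0 w : 0 <= fa w by rewrite mulr_ge0// exprn_ge0// sqr_ge0.
have fy0 w : 0 <= fy w by rewrite mulr_ge0// exprn_ge0// sqr_ge0.
have mfa : measurable_fun setT fa by apply: measurable_funM => //; do 2 apply: measurable_funX.
have mfy : measurable_fun setT fy by apply: measurable_funM => //; do 2 apply: measurable_funX.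
pose fk w := kap w ^+ m.
have fk0 w : 0 <= fk w by rewrite exprn_ge0.
have mfk : measurable_fun setT fk by exact: measurable_funX.
rewrite -/(IP fy) -/(IP fa) -/(IP fk).
have [|] := eqVneq (IP fa + IP fk)%E +oo%E.
  by move=> ->; rewrite gt0_muley ?lte_fin// leey.
move=> noo; have A0 := IP_ge0 fa0; have KK0 := IP_ge0 fk0.
have [A AE] : exists A : R, IP fa = A%:E.
  exists (fine (IP fa)); rewrite fineK// ge0_fin_numE// ltey; apply: contra noo => /eqP ->.
  by rewrite addye// gt_eqF// (lt_le_trans _ KK0)// ltNyr.
have [Km KE] : exists Km : R, IP fk = Km%:E.
  exists (fine (IP fk)); rewrite fineK// ge0_fin_numE// ltey; apply: contra noo => /eqP ->.
  by rewrite addey// gt_eqF// (lt_le_trans _ A0)// ltNyr.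
rewrite AE KE; apply/lee_addgt0Pr => eps' eps'0.
(* [K'] dominates [2 * kap + 3 * ep] for [ep <= 1], so the cap is inactive off [Bad]. [C''] collects
   the coefficients of [ep] in the final estimate, and [ep] is small enough for their total to stay
   below [eps']. *)
pose K' := 2 * K + 3; have K'0 : 0 <= K' by rewrite addr_ge0// mulr_ge0.
pose C'' := (3 ^+ 2) ^+ m * (C * (6 ^+ m + 2 * K' ^+ m) + 1) + 2 * (`|b| ^+ 2) ^+ m.
have C''0 : 0 <= C''.
  by rewrite addr_ge0// mulr_ge0 ?exprn_ge0// addr_ge0// mulr_ge0 ?(ltW C0)// addr_ge0 ?exprn_ge0// mulr_ge0// exprn_ge0.
pose ep := Num.min 1 (eps' / (C'' + 1)).
have ep0 : 0 < ep by rewrite lt_min ltr01 divr_gt0// ltr_wpDl.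
have ep1 : ep <= 1 by rewrite ge_min lexx.
have [N [PN1 PN2]] : exists N, (P [set w | (ep%:E < \int[lebesgue_measure]_(s in `[0%R, t[) e N s w)%E] < ep%:E)%E /\
    (P [set w | (ep%:E < (r N w)%:E)%E] < ep%:E)%E.
  have [N0 _ HN] := filterI (cvg_small ep0 cve) (cvg_small ep0 cvr).
  by exists N0; exact: (HN N0 (leqnn N0)).
have mB1 := (cve ep ep0).1 N; have mB2 := (cvr ep ep0).1 N.
set B1 := [set w | _] in PN1 mB1; set B2 := [set w | _] in PN2 mB2.
pose Bad := B1 `|` B2.
have mBad : measurable Bad by exact: measurableU.
have PBad : (IP (\1_Bad) <= (2 * ep)%:E)%E.
  rewrite /IP integral_indic// setIT (le_trans (measureU2 _ mB1 mB2))//.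
  by rewrite mulr_natl mulr2n EFinD leeD// ltW.
pose Bd := @energy_bound R d Om U V (g N); have Bd0 : 0 <= Bd.
  by apply: sumr_ge0 => ? _; apply: sumr_ge0.
pose eta := ep / (Bd + 1); have eta0 : 0 < eta by rewrite divr_gt0// ltr_wpDl.
have [|L [tau [tau0 tauL tau_le mesh sep]]] := @fine_grid R t eta
  (map (@lo _ _ _ _) (g N) ++ map (@hi _ _ _ _) (g N)) t0 eta0.
  move=> p; rewrite mem_cat.
  suff H l (hl : (l < size (g N))%N) x0 : 0 <= lo (nth x0 (g N) l) <= t /\ 0 <= hi (nth x0 (g N) l) <= t.
    by move=> /orP[] /(nthP 0)[l]; rewrite size_map => hl <-;
      case E : (g N) hl => [//|x0 gl]; rewrite -E => hl;
      rewrite (nth_map x0)//; case: (H l hl x0).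
  have /(all_nthP x0)/(_ l hl)/asboolP[l0 lh ht _] := gon N.
  by rewrite l0 ht (le_trans lh ht) (le_trans l0 lh).
pose h w s := (2%:E * (k s w + e N s w))%E.
have mkw w := measurable_section w (measurable_itv _) mk.
have mew w := measurable_section w (measurable_itv _) (me N).
(* The simple process costs twice the integrand plus twice the error of approximation, whose time
   integral is at most [ep] here; the mesh adds another [ep]. *)
have enb w : ~ Bad w -> @energy R d Om U V G (g N) tau L w <= 2 * kap w + 3 * ep.
  move=> nB; rewrite -lee_fin.
  have c1 i : (tau i.+1 - tau i) * Bd <= ep.
    apply: (@le_trans _ _ (eta * Bd)); first by rewrite ler_wpM2r.
    rewrite /eta mulrAC ler_pdivrMr ?ltr_wpDl// ler_wpM2l ?(ltW ep0)// lerDl//.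
  have := @energy_le R d Om U V t G Gmono (g N) L tau tauL tau_le sep (h w) w ep (ltW ep0).
  move=> /(_ _ _ _ c1) H; apply: (le_trans (H _ _ _)) => //.
  - by apply: measurable_funeM; exact: emeasurable_funD.
  - by move=> s; rewrite mule_ge0// adde_ge0.
  - move=> s st Gs; have := @hs2D R U V (Phi s w) (fun u => simple_process (g N) s w u - Phi s w u).
    have -> : (fun u => Phi s w u + (simple_process (g N) s w u - Phi s w u)) = simple_process (g N) s w.
      by apply/funext => u; rewrite addrC subrK.
    move=> h1; apply: (le_trans h1); apply: lee_wpmul2l; first by rewrite lee_fin.
    apply: leeD; first by apply: hk.
    apply: le_trans (hse N s w st); rewrite /hs2; apply: le_esum => u _.
    by rewrite distrC.
  - rewrite ge0_integralZl_EFin//; last by exact: emeasurable_funD.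
      2: { by move=> s _; rewrite adde_ge0. }
    rewrite ge0_integralD//.
    apply: (@le_trans _ _ (2%:E * ((kap w)%:E + ep%:E) + ep%:E)%E).
      rewrite leeD2r// lee_wpmul2l// leeD// leNgt; apply/negP => hB; apply: nB; by left.
    by rewrite -!(EFinD, EFinM) lee_fin; lra.
pose ci := @cut_int R d Om U W V G (g N) L tau K'.
have mci := @cut_int_all_moments R d Om P T Fl Fl_normal U W W_wiener V t tT G FG (g N) (gon N) L tau tau_le K'.
have men := @energy_measurable R d Om P T Fl Fl_normal U V t tT G FG (g N) (gon N) L tau tau_le.
have hci := @cut_int_moment R d Om P T Fl Fl_normal U W W_wiener V t tT G FG (g N) (gon N) L tau tau_le n C K' (ltW C0) K'0 HC.
rewrite -/ci in mci hci.
pose fc w := (`|ci w| ^+ 2) ^+ m.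
have fc0 w : 0 <= fc w by rewrite exprn_ge0// sqr_ge0.
have mfc : measurable_fun setT fc by apply: measurable_funX; exact: mci.1.
have mBadi : measurable_fun setT (\1_Bad : Om -> R) by exact: measurable_indic.
have IPc_le : (IP fc <= (C * (4 ^+ m * Km + 6 ^+ m * ep + K' ^+ m * (2 * ep)))%:E)%E.
  rewrite EFinM; apply: (le_trans hci); rewrite lee_wpmul2l ?lee_fin ?(ltW C0)//.
  pose q w := (4 ^+ m * fk w + 6 ^+ m * ep) + K' ^+ m * \1_Bad w.
  apply: (@le_trans _ _ (IP q)).
    have en0 w : 0 <= @energy R d Om U V G (g N) tau L w.
      apply: sumr_ge0 => i _; rewrite !mulr_ge0 ?gram_ge0// subr_ge0; by case: (tau_le i) => _ /andP[].
    apply: IP_le.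
    - by apply: measurable_funX; exact: measurable_minr.
    - apply: measurable_funD; last exact: measurable_funM.
      by apply: measurable_funD => //; exact: measurable_funM.
    - by move=> w; rewrite exprn_ge0// le_min en0.
    move=> w; rewrite /q indicE; have [wB|wB] := boolP (w \in Bad).
      rewrite mulr1 (@le_trans _ _ (K' ^+ m))//.
        by rewrite lerXn2r ?nnegrE ?le_min ?en0// ge_min lexx orbT.
      by rewrite lerDr addr_ge0 ?mulr_ge0 ?exprn_ge0 ?(ltW ep0).
    rewrite mulr0 addr0; have nB : ~ Bad w by move=> /mem_set; rewrite (negbTE wB).
    apply: (@le_trans _ _ ((2 * kap w + 3 * ep) ^+ m)).
      rewrite lerXn2r ?nnegrE ?le_min ?en0 ?addr_ge0 ?mulr_ge0 ?(ltW ep0)//.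
      by rewrite ge_min enb.
    have e4 : 2 ^+ m * 2 ^+ m = 4 ^+ m :> R by rewrite -exprMn -natrM.
    have e6 : 2 ^+ m * 3 ^+ m = 6 ^+ m :> R by rewrite -exprMn -natrM.
    apply: (@le_trans _ _ (2 ^+ m * ((2 * kap w) ^+ m + (3 * ep) ^+ m))).
      by apply: expr_sum2_le; rewrite mulr_ge0 ?(ltW ep0).
    rewrite !exprMn mulrDr !mulrA e4 e6 lerD2l ler_wpM2l ?exprn_ge0//.
    by rewrite exprS ler_piMr ?(ltW ep0)// exprn_ile1 ?(ltW ep0).
  rewrite /q IPD; [|by apply: measurable_funD => //; exact: measurable_funM|exact: measurable_funM| |]; last 2 first.
  - by move=> w; rewrite addr_ge0 ?mulr_ge0 ?exprn_ge0 ?(ltW ep0).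
  - by move=> w; rewrite mulr_ge0 ?exprn_ge0.
  rewrite IPD; [|exact: measurable_funM|by []| |]; last 2 first.
  - by move=> w; rewrite mulr_ge0 ?exprn_ge0.
  - by move=> w; rewrite mulr_ge0 ?exprn_ge0 ?(ltW ep0).
  rewrite (IPZ (f := fk)) ?exprn_ge0// (IPZ (f := \1_Bad)) ?exprn_ge0// IPc KE !EFinD -EFinM leeD2l// EFinM lee_wpmul2l// lee_fin exprn_ge0//.
pose F w := (3 ^+ 2) ^+ m * (fa w + fc w + ep) + (`|b| ^+ 2) ^+ m * \1_Bad w.
have F0 w : 0 <= F w.
  by rewrite addr_ge0 ?mulr_ge0 ?exprn_ge0 ?sqr_ge0// !addr_ge0 ?(ltW ep0).
have mF1 : measurable_fun setT (fun w => fa w + fc w + ep).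
  by apply: measurable_funD => //; exact: measurable_funD.
have mF : measurable_fun setT F.
  by apply: measurable_funD; exact: measurable_funM.
apply: (@le_trans _ _ (IP F)).
  apply: ae_ge0_le_integral => //.
  - by move=> w _; rewrite lee_fin.
  - exact/measurable_EFinP.
  - by move=> w _; rewrite lee_fin.
  - exact/measurable_EFinP.
  apply: filterS ae => w aew _; rewrite lee_fin /fy [\1_(G t) w]indicE.
  have [wG|wG] := boolP (w \in G t); last by rewrite mul0r.
  have Gt := set_mem wG; rewrite mul1r /F [\1_Bad w]indicE.
  have [wB|wB] := boolP (w \in Bad).
    rewrite mulr1 (@le_trans _ _ ((`|b| ^+ 2) ^+ m))//.
      rewrite lerXn2r ?nnegrE ?sqr_ge0// lerXn2r ?nnegrE//.
      by rewrite (le_trans (yb w Gt))// ler_norm.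
    by rewrite lerDr mulr_ge0 ?exprn_ge0// !addr_ge0 ?(ltW ep0).
  have nB : ~ Bad w by move=> /mem_set; rewrite (negbTE wB).
  rewrite mulr0 addr0.
  have enK : @energy R d Om U V G (g N) tau L w <= K'.
    apply: (le_trans (enb w nB)); have /andP[_ hK] := kapK w; rewrite /K'; lra.
  have ciE := @cut_int_eq R d Om Fl U W V t G Gmono (g N) (gon N) L tau tau0 tauL tau_le sep K' w Gt enK.
  have yle : y w <= a w + `|ci w| + ep.
    apply: (le_trans (aew Gt)); rewrite -addrA lerD2l.
    have -> : I w = ci w + (I w - ci w) by rewrite addrC subrK.
    apply: (le_trans (ler_normD _ _)); rewrite lerD2l.
    rewrite /ci ciE (le_trans (Ir N w))// leNgt; apply/negP => hr; apply: nB; right.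
    by rewrite /B2 /= lte_fin.
  rewrite -!exprM; apply: (@le_trans _ _ ((a w + `|ci w| + ep) ^+ (2 * m))).
    by rewrite lerXn2r ?nnegrE ?addr_ge0 ?(ltW ep0).
  rewrite (le_trans (expr_sum3_le _ _ _ _)) ?(ltW ep0)// ler_wpM2l ?exprn_ge0//.
  rewrite /fa /fc indicE wG mul1r -!exprM lerD2l.
  rewrite /m mul2n doubleS exprS ler_piMr ?(ltW ep0)// exprn_ile1 ?(ltW ep0)//.
rewrite /F IPD; [|exact: measurable_funM|exact: measurable_funM| |]; last 2 first.
- by move=> w; rewrite mulr_ge0 ?exprn_ge0// !addr_ge0 ?(ltW ep0).
- by move=> w; rewrite mulr_ge0 ?exprn_ge0.
rewrite IPZ ?exprn_ge0//; last by move=> w; rewrite !addr_ge0 ?(ltW ep0).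
rewrite IPZ ?exprn_ge0//.
rewrite IPD//; [|exact: measurable_funD|by move=> w; rewrite addr_ge0|by move=> w; exact: ltW].
rewrite IPD// IPc AE.
apply: (@le_trans _ _ ((3 ^+ 2) ^+ m * (A + C * (4 ^+ m * Km + 6 ^+ m * ep + K' ^+ m * (2 * ep)) + ep)
    + (`|b| ^+ 2) ^+ m * (2 * ep))%:E).
  rewrite EFinD !EFinM; apply: leeD; last by rewrite lee_wpmul2l// lee_fin exprn_ge0// sqr_ge0.
  rewrite lee_wpmul2l ?lee_fin ?exprn_ge0// (EFinD _ ep) (EFinD A) leeD2r// leeD2l//.
rewrite -[(C'%:E * _)%E]EFinM -EFinD lee_fin.
have Km0 : 0 <= Km by rewrite -lee_fin -KE.
have A0' : 0 <= A by rewrite -lee_fin -AE.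
have e1 : C'' * ep <= eps'.
  apply: (@le_trans _ _ (C'' * (eps' / (C'' + 1)))); first by rewrite ler_wpM2l// ge_min lexx orbT.
  by rewrite mulrCA ler_piMr ?(ltW eps'0)// ler_pdivrMr ?ltr_wpDl// mul1r lerDl.
apply: (@le_trans _ _ (C' * (A + Km) + C'' * ep)); last by rewrite lerD2l.
have h1 : 0 <= (3 ^+ 2) ^+ m * (Km + C * 4 ^+ m * A).
  by rewrite mulr_ge0 ?exprn_ge0// addr_ge0// !mulr_ge0 ?(ltW C0) ?exprn_ge0.
rewrite -subr_ge0; set LHS := (X in 0 <= X).
have -> : LHS = (3 ^+ 2) ^+ m * (Km + C * 4 ^+ m * A) by rewrite /LHS /C' /C''; ring.
by [].
Qed.

End ito_moment.

(** * Differences, restrictions and bounds for Ito and Bochner integrals *)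

Lemma subrBB (V : zmodType) (a b c e : V) : a - b - (c - e) = (a - c) - (b - e).
Proof. by rewrite !opprB addrACA [RHS]addrACA [- b - c]addrC. Qed.

Lemma measurable_integral_time (R : realType) (d : measure_display) (Om : measurableType d)
    (D : set R) (f : R -> Om -> \bar R) : measurable D ->
  measurable_fun (D `*` setT) (fun p : R * Om => f p.1 p.2) ->
  (forall s w, D s -> (0 <= f s w)%E) ->
  measurable_fun setT (fun w => \int[lebesgue_measure]_(s in D) f s w)%E.
Proof.
move=> mD mf f0.
have mDT : measurable (D `*` [set: Om]) by exact: measurableX.
have mf' := (measurable_restrictT _ mDT).1 mf.
have -> : (fun w => \int[lebesgue_measure]_(s in D) f s w)%E =
    fun w => (\int[lebesgue_measure]_s (((fun p : R * Om => f p.1 p.2) \_ (D `*` setT)) (s, w)))%E.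
  apply/funext => w; rewrite integral_mkcond; apply: eq_integral => s _.
  rewrite /patch; congr (if _ then _ else _).
  by apply/idP/idP => /set_mem h; apply/mem_set; [split|case: h].
apply: (@measurable_fun_fubini_tonelli_G _ _ (measurableTypeR R) Om R lebesgue_measure _ mf').
by move=> p; rewrite /patch; case: ifPn => // /set_mem[h _]; exact: f0.
Qed.

Lemma itv_splitU (R : realType) (s t : R) : 0 <= s -> s <= t ->
  `[0, t[%classic = `[0, s[%classic `|` `[s, t[%classic.
Proof.
move=> s0 st; apply/seteqP; split => x /=; rewrite !in_itv/=.
  by case: (ltP x s) => h /andP[-> ->]; [left|right].
by move=> [/andP[-> h]|/andP[h ->]]; rewrite ?(lt_le_trans h st)// ?(le_trans s0 h).
Qed.

Section prob.
Context {R : realType} {d : measure_display} {Om : measurableType d} {P : probability Om R}.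
Local Notation cvg0 := (cvg_to0_in_probability P).

Lemma measurable_gt (f : Om -> \bar R) (e : R) :
  measurable_fun setT f -> measurable [set w | (e%:E < f w)%E].
Proof.
by move=> mf; have := emeasurable_fun_o_infty measurableT mf e%:E; rewrite setTI.
Qed.

Lemma cvg_in_probability_dominated (Y1 Y2 Z : nat -> Om -> \bar R) : cvg0 Y1 -> cvg0 Y2 ->
  (forall n, measurable_fun setT (Z n)) ->
  (forall n w, (0 <= Y1 n w)%E) -> (forall n w, (0 <= Y2 n w)%E) ->
  (forall n w, (Z n w <= 2%:E * (Y1 n w + Y2 n w))%E) -> cvg0 Z.
Proof.
move=> c1 c2 mZ p1 p2 ZY e e0; split; first by move=> n; exact: measurable_gt.
have e40 : 0 < e / 4 by rewrite divr_gt0.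
have [m1 v1] := c1 _ e40; have [m2 v2] := c2 _ e40.
apply: (@squeeze_cvge _ _ _ _ (cst 0%E) _ (fun n => P [set w | ((e / 4)%:E < Y1 n w)%E] +
    P [set w | ((e / 4)%:E < Y2 n w)%E])%E).
- apply: nearW => n; rewrite measure_ge0/=.
  apply: (le_trans _ (measureU2 _ (m1 n) (m2 n))); apply: le_measure; rewrite ?inE.
  + exact: measurable_gt.
  + exact: measurableU.
  move=> w /= ew; have [h1|h1] := boolP ((e / 4)%:E < Y1 n w)%E; first by left.
  have [h2|h2] := boolP ((e / 4)%:E < Y2 n w)%E; [by right|exfalso].
  rewrite -!leNgt in h1 h2; have : (Z n w <= (2 * (e / 4 + e / 4))%:E)%E.
    rewrite (le_trans (ZY n w))// EFinM [(e / 4 + e / 4)%:E]EFinD.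
    by apply: lee_wpmul2l => //; exact: leeD.
  by move=> /(lt_le_trans ew); rewrite lte_fin; lra.
- exact: cvg_cst.
- by rewrite -[0%E]adde0; apply: cvgeD.
Qed.

(** Convergence in probability, as defined, includes measurability of the level sets above positive
    thresholds; non-negativity and a countable union supply the others. *)
Lemma cvg_in_probability_measurable (r : nat -> Om -> R) :
  (forall n w, 0 <= r n w) -> cvg0 (fun n w => (r n w)%:E) -> forall n, measurable_fun setT (r n).
Proof.
move=> r0 cr n; apply: (measurability _ (measurable_realfun.RGenOInfty.measurableE R)) => //.
move=> _ [_ [x ->] <-]; rewrite setTI.
have mpos (e : R) : 0 < e -> measurable [set w | e < r n w].
  by move=> e0; have [/(_ n) + _] := cr e e0; under eq_set do rewrite lte_fin.
have -> : r n @^-1` `]x, +oo[ = [set w | x < r n w].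
  by apply/seteqP; split => w /=; rewrite in_itv/= andbT.
have [x0|x0] := ltP 0 x; first exact: mpos.
have [xl|xg] := ltP x 0.
  rewrite (_ : [set w | _] = setT); first exact: measurableT.
  by apply/seteqP; split => w //= _; exact: lt_le_trans (r0 n w).
have -> : x = 0 by apply/eqP; rewrite eq_le x0.
have -> : [set w | 0 < r n w] = \bigcup_k [set w | k.+1%:R^-1 < r n w].
  apply/seteqP; split => w /=.
    move=> rw; exists (Num.truncn (r n w)^-1) => //=.
    by rewrite -[ltRHS]invrK ltf_pV2 ?posrE ?invr_gt0// truncnS_gt.
  by move=> [k _ /=]; apply: lt_trans; rewrite invr_gt0.
by apply: bigcupT_measurable => k; apply: mpos; rewrite invr_gt0.
Qed.

End prob.

Section ito.
Context {R : realType} {d : measure_display} {Om : measurableType d} {P : probability Om R}.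
Context {Fl : R -> set (set Om)}.
Context {U : hilbertType R} {W : R -> U -> Om -> R} {V : hilbertType R}.
Local Notation ito_approx := (@ito_approx _ _ _ P Fl U W V).
Implicit Types (Phi Psi : R -> Om -> U -> V) (I J : Om -> V).

Lemma is_ito_integral_approx t Phi I : is_ito_integral P Fl W t Phi I -> ito_approx t Phi I.
Proof.
move=> [g [gon mh cvh cvI]].
exists g, (fun n s w => hs_norm (Phi s w \- simple_process (g n) s w)%R ^+ 2)%E,
  (fun n w => `|I w - simple_process_int W (g n) w|); split => //.
- split=> [n|n s w]; last by rewrite sqre_hs_norm hs2_ge0.
  apply: (eq_measurable_fun (fun p : R * Om =>
    hs_norm (Phi p.1 p.2 \- simple_process (g n) p.1 p.2)%R *
    hs_norm (Phi p.1 p.2 \- simple_process (g n) p.1 p.2)%R)%E).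
    by move=> p _; rewrite expe2.
  by apply: emeasurable_funM; exact: mh.
- by move=> n s w _; rewrite sqre_hs_norm.
- split=> //.
  exact: (@cvg_in_probability_measurable _ _ _ P (fun n w => `|I w - simple_process_int W (g n) w|)).
Qed.

Definition opp_term (h : rank1_term R Om U V) := Rank1Term (lo h) (hi h) (ev h) (src h) (- dst h).

Lemma simple_processB (g1 g2 : seq (rank1_term R Om U V)) s w u :
  simple_process (g1 ++ map opp_term g2) s w u = simple_process g1 s w u - simple_process g2 s w u.
Proof.
rewrite /simple_process big_cat big_map/= -sumrN; congr (_ + _).
by apply: eq_bigr => h _; rewrite scalerN.
Qed.

Lemma simple_process_intB (g1 g2 : seq (rank1_term R Om U V)) w :
  simple_process_int W (g1 ++ map opp_term g2) w =
  simple_process_int W g1 w - simple_process_int W g2 w.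
Proof.
rewrite /simple_process_int big_cat big_map/= -sumrN; congr (_ + _).
by apply: eq_bigr => h _; rewrite scalerN.
Qed.

Lemma hs2_sub (L K : U -> V) : (hs2 (fun u => L u - K u)%R <= 2%:E * (hs2 L + hs2 K))%E.
Proof.
have -> : hs2 K = hs2 (fun u => - K u).
  by rewrite /hs2; apply: eq_esum => u _; rewrite normrN.
exact: hs2D.
Qed.

Lemma ito_approxB t Phi Psi I J : ito_approx t Phi I -> ito_approx t Psi J ->
  ito_approx t (fun s w u => Phi s w u - Psi s w u) (fun w => I w - J w).
Proof.
move=> [g1 [e1 [r1 [on1 [me1 e10] h1 ce1 [mr1 cr1 I1]]]]] [g2 [e2 [r2 [on2 [me2 e20] h2 ce2 [mr2 cr2 I2]]]]].
have mi (e : R -> Om -> \bar R) : measurable_fun (`[0%R, t[ `*` setT) (fun p : R * Om => e p.1 p.2) ->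
    (forall s w, 0 <= e s w)%E ->
    measurable_fun setT (fun w => \int[lebesgue_measure]_(s in `[0%R, t[) e s w)%E.
  by move=> me e0; apply: measurable_integral_time => // s w _.
have r10 n w : 0 <= r1 n w by exact: le_trans (I1 n w).
have r20 n w : 0 <= r2 n w by exact: le_trans (I2 n w).
exists (fun n => g1 n ++ map opp_term (g2 n)), (fun n s w => 2%:E * (e1 n s w + e2 n s w))%E,
  (fun n w => r1 n w + r2 n w).
have me n : measurable_fun (`[0%R, t[ `*` setT)
    (fun p : R * Om => 2%:E * (e1 n p.1 p.2 + e2 n p.1 p.2))%E.
  by apply: measurable_funeM; apply: emeasurable_funD.
have e0 n s w : (0 <= 2%:E * (e1 n s w + e2 n s w))%E by rewrite mule_ge0// adde_ge0.
split.
- move=> n; rewrite /simple_process_on all_cat all_map; apply/andP; split; first exact: on1.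
  by apply: sub_all (on2 n) => h /asboolP hh; exact/asboolP.
- by split.
- move=> n s w st; rewrite (_ : (fun u => _) = fun u =>
    (Phi s w u - simple_process (g1 n) s w u) - (Psi s w u - simple_process (g2 n) s w u)).
    by apply: (le_trans (hs2_sub _ _)); rewrite lee_wpmul2l// leeD ?h1 ?h2.
  apply/funext => u; by rewrite simple_processB subrBB.
- apply: (cvg_in_probability_dominated ce1 ce2).
  + by move=> n; exact: mi.
  + by move=> n w; exact: integral_ge0.
  + by move=> n w; exact: integral_ge0.
  move=> n w; have ms1 := measurable_section w (measurable_itv _) (me1 n).
  have ms2 := measurable_section w (measurable_itv _) (me2 n).
  rewrite ge0_integralZl//; first by rewrite ge0_integralD.
  + exact: emeasurable_funD.
  + by move=> s _; rewrite adde_ge0.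
split.
- by move=> n; exact: measurable_funD.
- apply: (cvg_in_probability_dominated cr1 cr2).
  + by move=> n; apply/measurable_EFinP; exact: measurable_funD.
  + by move=> n w; rewrite /= lee_fin; exact: r10.
  + by move=> n w; rewrite /= lee_fin; exact: r20.
  + move=> n w; rewrite -EFinD -EFinM lee_fin.
    by rewrite ler_peMl ?addr_ge0// ler1n.
move=> n w; rewrite simple_process_intB.
have -> : I w - J w - (simple_process_int W (g1 n) w - simple_process_int W (g2 n) w) =
    (I w - simple_process_int W (g1 n) w) - (J w - simple_process_int W (g2 n) w).
  exact: subrBB.
by rewrite (le_trans (ler_normB _ _))// lerD.
Qed.

(** An integral up to [s] is read as one up to [t] with integrand zero afterwards, so that a time
    increment of the mild equation becomes a single integral. *)
Lemma ito_approx_widen s t Phi I : 0 <= s <= t -> ito_approx s Phi I ->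
  ito_approx t (fun r w u => if r < s then Phi r w u else 0) I.
Proof.
move=> /andP[s0 st] [g [e [r [gon [me e0] he ce cr]]]].
(* At [q = s] the simple process may be non-zero, its intervals being closed on the right, while the
   new integrand vanishes there. The error is declared infinite at this single time, which the
   integral does not see. *)
pose e' n (q : R) w : \bar R := if q < s then e n q w else if q == s then +oo%E else 0%E.
have e'0 n q w : (0 <= e' n q w)%E by rewrite /e'; case: ifP => // _; case: ifP.
have DE := itv_splitU s0 st.
have me' n : measurable_fun (`[0%R, t[ `*` setT) (fun p : R * Om => e' n p.1 p.2).
  have -> : `[0%R, t[%classic `*` setT = (`[0%R, s[%classic `*` setT) `|` (`[s, t[%classic `*` setT) :> set (R * Om).
    rewrite DE; apply/seteqP; split => -[x w] /=.
      by move=> [[h|h] _]; [left|right].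
    by case=> -[h _]; split => //; [left|right].
  have mX (a b : R) : measurable (`[a, b[%classic `*` [set: Om]) by apply: measurableX.
  apply/measurable_funU => //; split.
    apply: (eq_measurable_fun (fun p : R * Om => e n p.1 p.2)) => // -[x w] /set_mem[/=].
    by rewrite in_itv/= /e' => /andP[_ ->].
  apply: (eq_measurable_fun (fun p : R * Om => if p.1 == s then +oo%E else 0%E)).
    move=> [x w] /set_mem[/=]; rewrite in_itv/= /e' => /andP[sx _] _.
    by rewrite ltNge sx.
  apply: measurable_fun_if => //.
  by apply: measurable_fun_eqr => //; apply: measurable_funTS; exact: measurable_fst.
have ie n w : (\int[lebesgue_measure]_(q in `[0%R, t[) e' n q w =
    \int[lebesgue_measure]_(q in `[0%R, s[) e n q w)%E.
  have ms := measurable_section w (measurable_itv _) (me' n).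
  rewrite DE in ms *; rewrite ge0_integral_setU//; last first.
    rewrite disj_set2E; apply/eqP/seteqP; split => x //=; rewrite !in_itv/=.
    by move=> [/andP[_ h] /andP[]]; rewrite leNgt h.
  rewrite [X in (_ + X)%E](_ : _ = 0%E).
    rewrite adde0; apply: eq_integral => q /set_mem/=; rewrite in_itv/= /e' => /andP[_ ->//].
  transitivity (\int[lebesgue_measure]_(q in `[s, t[%classic `\` [set s]) e' n q w)%E.
    apply: (@ge0_negligible_integral _ (measurableTypeR R)) => //.
    - by apply: measurable_funS ms => //; exact: measurableU.
    - exact: lebesgue_measure_set1.
  apply: integral0_eq => q [/=]; rewrite in_itv/= /e' => /andP[sq _] qs.
  by rewrite ltNge sq/=; case: eqP => // h; case: qs.
exists g, e', r; split => //.
- move=> n; apply: sub_all (gon n) => h /asboolP[h1 h2 h3 h4]; apply/asboolP.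
  by split => //; exact: le_trans st.
- move=> n q w /andP[q0 qt]; rewrite /e'; case: ifPn => qs; first by rewrite he// q0.
  case: eqP => [_|qs']; first by rewrite leey.
  rewrite /hs2 esum1// => u _; rewrite sub0r normrN.
  have -> : simple_process (g n) q w u = 0.
    have sq : s < q by rewrite lt_neqAle leNgt qs andbT; apply/eqP => qe; apply: qs'.
    rewrite /simple_process; have := gon n; rewrite /simple_process_on.
    elim: (g n) => [|h gl IH] /=; first by rewrite big_nil.
    move=> /andP[/asboolP[_ _ hs _] /IH{}IH]; rewrite big_cons IH indicE memNset ?mul0r ?scale0r ?addr0//.
    by rewrite /= in_itv/= => /andP[_ qh]; have := lt_le_trans sq (le_trans qh hs); rewrite ltxx.
  by rewrite normr0 expr0n.
- move=> a a0; have [h1 h2] := ce a a0; split=> [n|].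
    by under eq_set do rewrite ie; exact: h1.
  by under eq_fun do under eq_set do rewrite ie.
Qed.

(** Over an empty interval all elementary integrals vanish, so [|I|] lies below every [r n], and
    these tend to zero in probability. *)
Lemma ito_approx0 Phi I : ito_approx 0 Phi I -> {ae P, forall w, I w = 0}.
Proof.
move=> [g [e [r [gon _ _ _ [mr cr Ir]]]]].
have int0 n w : simple_process_int W (g n) w = 0.
  rewrite /simple_process_int; have := gon n; rewrite /simple_process_on.
  elim: (g n) => [|h l IH] /=; first by rewrite big_nil.
  move=> /andP[/asboolP[h1 h2 h3 _] /IH]; rewrite big_cons => ->.
  have -> : hi h = lo h by apply/eqP; rewrite eq_le h2 (le_trans h3).
  by rewrite subrr mulr0 scale0r addr0.
pose A k n := [set w | (k.+1%:R^-1%:E < (r n w)%:E)%E].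
have mA k n : measurable (A k n).
  by apply: measurable_gt; exact/measurable_EFinP.
pose N := \bigcup_k \bigcap_n A k n.
have mB k : measurable (\bigcap_n A k n) by exact: bigcapT_measurable.
have mN : measurable N by exact: bigcupT_measurable.
exists N; split => //.
  apply/eqP; rewrite eq_le measure_ge0 andbT.
  apply: (le_trans (measure_sigma_subadditive _ mB mN (@subset_refl _ _))).
  rewrite eseries0// => k _ _; apply/eqP; rewrite eq_le measure_ge0 andbT.
  have [_ cv] := cr k.+1%:R^-1 (ltac:(by rewrite invr_gt0)).
  rewrite -(cvg_lim _ cv)//; apply: lime_ge; first by apply/cvg_ex; exists 0%E.
  apply: nearW => n; apply: le_measure; rewrite ?inE//; first exact: mA.
  by move=> w /(_ n Logic.I).
move=> w /= Iw; have In : 0 < `|I w| by rewrite normr_gt0; apply/eqP.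
exists (Num.truncn `|I w|^-1) => // n _; rewrite /A /= lte_fin.
have := Ir n w; rewrite int0 subr0; apply: lt_le_trans.
rewrite -[ltRHS]invrK ltf_pV2 ?posrE ?invr_gt0//; exact: truncnS_gt.
Qed.

End ito.

Section bochner.
Context {R : realType} {V : hilbertType R}.
Implicit Types (f : R -> V) (l : V) (t : R).

(* The counterpart of [ito_approx] for [is_bochner_integral]. *)
Definition bochner_approx t f l := exists (g : nat -> seq (set R * V)) (e : nat -> R -> \bar R),
  [/\ forall n, simple_fun_on `[0%R, t[ (g n),
      forall n, measurable_fun (`[0%R, t[ : set (measurableTypeR R)) (e n) /\ (forall s, 0 <= e n s)%E,
      forall n s, 0 <= s < t -> (`|f s - simple_fun (g n) s|%:E <= e n s)%E,
      (\int[lebesgue_measure]_(s in `[0%R, t[) e n s @[n --> \oo] --> 0)%E &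
      simple_fun_int (g n) @[n --> \oo] --> l].

Lemma is_bochner_integral_approx t f l : is_bochner_integral `[0, t[ f l -> bochner_approx t f l.
Proof.
move=> [g [gon mg ce cl]]; exists g, (fun n s => `|f s - simple_fun (g n) s|%:E); split => //.
move=> n; split => [|s]; last by rewrite lee_fin.
apply/measurable_EFinP; exact: mg.
Qed.

Lemma simple_fun_inner (D : set R) (g : seq (set R * V)) (u : V) :
  measurable D -> simple_fun_on D g ->
  lebesgue_measure.-integrable (D : set (measurableTypeR R)) (fun s => (inner (simple_fun g s) u)%:E) /\
  (\int[lebesgue_measure]_(s in D) (inner (simple_fun g s) u)%:E = (inner (simple_fun_int g) u)%:E)%E.
Proof.
move=> mD; elim: g => [_|[A v] g IH].
  have -> : (fun s => (inner (simple_fun [::] s) u)%:E) = cst 0%E.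
    by apply/funext => s; rewrite /simple_fun big_nil inner0l.
  rewrite /simple_fun_int big_nil inner0l.
  by split; [exact: integrable0|rewrite integral0].
move=> /andP[/asboolP[/= mA AD Aoo] /IH[ig eg]].
have -> : (fun s => (inner (simple_fun ((A, v) :: g) s) u)%:E) =
    (fun s => (inner v u)%:E * (\1_A s)%:E + (inner (simple_fun g s) u)%:E)%E.
  by apply/funext => s; rewrite /simple_fun big_cons innerDl innerZl EFinD EFinM muleC.
have iA1 : lebesgue_measure.-integrable (D : set (measurableTypeR R)) (fun s => (\1_A s)%:E).
  apply/integrableP; split; first by apply/measurable_EFinP; exact: measurable_indic.
  under eq_integral do rewrite gee0_abs ?lee_fin//.
  by rewrite integral_indic//= setIidl.
have iA : lebesgue_measure.-integrable (D : set (measurableTypeR R)) (fun s => (inner v u)%:E * (\1_A s)%:E)%E.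
  exact: integrableZl.
split; first exact: integrableD.
rewrite integralD// eg /simple_fun_int big_cons innerDl innerZl EFinD; congr (_ + _)%E.
rewrite integralZl//.
rewrite integral_indic//= setIidl// muleC EFinM fineK//.
by rewrite ge0_fin_numE.
Qed.

(** Pairing the integral of a simple function with itself turns the norm estimate into one for
    scalar integrals; the limit along the approximants follows. *)
Lemma bochner_approx_le t f l (k : R -> \bar R) : bochner_approx t f l ->
  measurable_fun (`[0%R, t[ : set (measurableTypeR R)) k -> (forall s, 0 <= k s)%E ->
  (forall s, 0 <= s < t -> (`|f s|%:E <= k s)%E) ->
  (`|l|%:E <= \int[lebesgue_measure]_(s in `[0%R, t[) k s)%E.
Proof.
move=> [g [e [gon me he ce cl]]] mk k0 hk.
set K := (\int[lebesgue_measure]_(s in `[0%R, t[) k s)%E.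
have [->|Koo] := eqVneq K +oo%E; first by rewrite leey.
have K0 : (0 <= K)%E by apply: integral_ge0.
have [c Kc] : exists c : R, K = c%:E.
  by exists (fine K); rewrite fineK// ge0_fin_numE// ltey.
have step n : (`|simple_fun_int (g n)|%:E <= K + \int[lebesgue_measure]_(s in `[0%R, t[) e n s)%E.
  set ln := simple_fun_int (g n); have [me1 e0] := me n.
  have [->|ln0] := eqVneq ln 0; first by rewrite normr0 adde_ge0// integral_ge0.
  have lnp : 0 < `|ln| by rewrite normr_gt0.
  have [ig eg] := simple_fun_inner ln (measurable_itv `[0%R, t[) (gon n).
  rewrite -(lee_pmul2l (x := `|ln|%:E))//.
  rewrite -EFinM -expr2 -inner_norm -eg.
  rewrite -[leLHS]gee0_abs; last by rewrite eg lee_fin inner_norm sqr_ge0.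
  apply: (le_trans (le_abse_integral _ _ _)) => //; first by case/integrableP: ig.
  rewrite -ge0_integralD// -ge0_integralZl//; last 2 first.
  - exact: emeasurable_funD.
  - by move=> s _; rewrite adde_ge0.
  apply: ge0_le_integral => //.
  - by apply: measurableT_comp => //; case/integrableP: ig.
  - by apply: measurable_funeM; exact: emeasurable_funD.
  move=> s; rewrite /= in_itv/= => st.
  rewrite -abse_EFin; apply: (@le_trans _ _ (`|ln| * `|simple_fun (g n) s|)%:E).
    by rewrite lee_fin mulrC inner_le.
  rewrite EFinM lee_wpmul2l ?lee_fin//.
  apply: (@le_trans _ _ (`|f s|%:E + `|f s - simple_fun (g n) s|%:E)%E); last by rewrite leeD ?hk ?he.
  rewrite -EFinD lee_fin -{1}[simple_fun (g n) s](subKr (f s)).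
  exact: ler_normB.
rewrite Kc in step *; rewrite lee_fin; apply/ler_addgt0Pr => ep ep0.
have ep2 : 0 < ep / 2 by rewrite divr_gt0.
have H1 : \forall n \near \oo, (\int[lebesgue_measure]_(s in `[0%R, t[) e n s < (ep / 2)%:E)%E.
  apply: (ce [set x | (x < (ep / 2)%:E)%E]).
  by apply: open_nbhs_nbhs; split; [exact: open_ereal_lt_ereal|rewrite /= lte_fin].
have H2 : \forall n \near \oo, `|l - simple_fun_int (g n)| < ep / 2 by exact: cvgr_dist_lt.
have [n0 _ Hn] := filterI H1 H2; have [h1 h2] := Hn n0 (leqnn n0).
have h3 : `|simple_fun_int (g n0)| <= c + ep / 2.
  by rewrite -lee_fin EFinD (le_trans (step n0))// leeD2l// ltW.
rewrite -[l](subrK (simple_fun_int (g n0))) (le_trans (ler_normD _ _))//.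
by rewrite (le_trans (lerD (ltW h2) h3))//; lra.
Qed.

Definition opp_atom (p : set R * V) := (p.1, - p.2).

Lemma simple_funB (g1 g2 : seq (set R * V)) s :
  simple_fun (g1 ++ map opp_atom g2) s = simple_fun g1 s - simple_fun g2 s.
Proof.
rewrite /simple_fun big_cat big_map/= -sumrN; congr (_ + _).
by apply: eq_bigr => h _; rewrite scalerN.
Qed.

Lemma simple_fun_intB (g1 g2 : seq (set R * V)) :
  simple_fun_int (g1 ++ map opp_atom g2) = simple_fun_int g1 - simple_fun_int g2.
Proof.
rewrite /simple_fun_int big_cat big_map/= -sumrN; congr (_ + _).
by apply: eq_bigr => h _; rewrite scalerN.
Qed.

Lemma bochner_approxB t f1 f2 l1 l2 : bochner_approx t f1 l1 -> bochner_approx t f2 l2 ->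
  bochner_approx t (fun s => f1 s - f2 s) (l1 - l2).
Proof.
move=> [g1 [e1 [on1 me1 h1 ce1 cl1]]] [g2 [e2 [on2 me2 h2 ce2 cl2]]].
exists (fun n => g1 n ++ map opp_atom (g2 n)), (fun n s => e1 n s + e2 n s)%E; split.
- move=> n; rewrite /simple_fun_on all_cat all_map; apply/andP; split; first exact: on1.
  by apply: sub_all (on2 n) => h /asboolP hh; exact/asboolP.
- move=> n; have [m1 p1] := me1 n; have [m2 p2] := me2 n.
  by split=> [|s]; [exact: emeasurable_funD|rewrite adde_ge0].
- move=> n s st; rewrite (le_trans _ (leeD (h1 n s st) (h2 n s st)))// -EFinD lee_fin.
  have -> : f1 s - f2 s - simple_fun (g1 n ++ map opp_atom (g2 n)) s =
      (f1 s - simple_fun (g1 n) s) - (f2 s - simple_fun (g2 n) s).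
    by rewrite simple_funB subrBB.
  exact: ler_normB.
- rewrite -[0%E]adde0; have -> : (fun n => \int[lebesgue_measure]_(s in `[0%R, t[) (e1 n s + e2 n s))%E =
    (fun n => \int[lebesgue_measure]_(s in `[0%R, t[) e1 n s + \int[lebesgue_measure]_(s in `[0%R, t[) e2 n s)%E.
    apply/funext => n; have [m1 p1] := me1 n; have [m2 p2] := me2 n.
    by rewrite ge0_integralD.
  exact: cvgeD.
- have -> : (fun n => simple_fun_int (g1 n ++ map opp_atom (g2 n))) =
     (fun n => simple_fun_int (g1 n) - simple_fun_int (g2 n)).
    by apply/funext => n; exact: simple_fun_intB.
  exact: cvgB.
Qed.

Lemma bochner_approx_widen s t f l : 0 <= s <= t -> bochner_approx s f l ->
  bochner_approx t (fun r => if r < s then f r else 0) l.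
Proof.
move=> /andP[s0 st] [g [e [gon me he ce cl]]].
pose e' n (q : R) : \bar R := if q < s then e n q else 0%E.
have DE := itv_splitU s0 st.
have me' n : measurable_fun (`[0%R, t[ : set (measurableTypeR R)) (e' n).
  rewrite DE; apply/measurable_funU => //; split.
    apply: (eq_measurable_fun (e n)); last by case: (me n).
    by move=> x /set_mem/=; rewrite in_itv/= /e' => /andP[_ ->].
  apply: (eq_measurable_fun (cst 0%E)) => //.
  by move=> x /set_mem/=; rewrite in_itv/= /e' => /andP[sx _]; rewrite ltNge sx.
have e'0 n q : (0 <= e' n q)%E by rewrite /e'; case: ifP => // _; case: (me n).
have ie n : (\int[lebesgue_measure]_(q in `[0%R, t[) e' n q = \int[lebesgue_measure]_(q in `[0%R, s[) e n q)%E.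
  have ms := me' n; rewrite DE in ms *; rewrite ge0_integral_setU//; last first.
    rewrite disj_set2E; apply/eqP/seteqP; split => x //=; rewrite !in_itv/=.
    by move=> [/andP[_ h] /andP[]]; rewrite leNgt h.
  rewrite [X in (_ + X)%E](_ : _ = 0%E).
    by rewrite adde0; apply: eq_integral => q /set_mem/=; rewrite in_itv/= /e' => /andP[_ ->].
  by apply: integral0_eq => q /=; rewrite in_itv/= /e' => /andP[sx _]; rewrite ltNge sx.
exists g, e'; split => //.
- move=> n; apply: sub_all (gon n) => h /asboolP[h1 h2 h3]; apply/asboolP; split => //.
  by rewrite DE; apply: subset_trans h2 _; exact: subsetUl.
- move=> n q /andP[q0 qt]; rewrite /e'; case: ifPn => qs; first by rewrite he// q0.
  rewrite sub0r normrN /simple_fun; have := gon n; rewrite /simple_fun_on.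
  elim: (g n) => [|h gl IH] /=; first by rewrite big_nil normr0.
  move=> /andP[/asboolP[_ hD _] /IH{}IH]; rewrite big_cons indicE memNset ?scale0r ?add0r//.
  by move=> /hD /=; rewrite in_itv/= (negbTE qs) andbF.
- by under eq_fun do rewrite ie.
Qed.

End bochner.

(** * Singular kernels: Gronwall and Jensen *)

Section kernel.
Context {R : realType}.
Local Notation mu := (@lebesgue_measure R).
Local Notation "'RR'" := (measurableTypeR R).

Lemma measurable_powR_sub (D : set RR) (t q : R) : measurable D ->
  measurable_fun D (fun s : R => (t - s) `^ q).
Proof.
move=> mD; apply: (measurableT_comp (measurable_powR q)).
by apply: measurable_funB.
Qed.

Lemma is_derive_cstB (t x : R) : is_derive x 1 (fun s : R => t - s) (-1).
Proof.
have -> : (fun s : R => t - s) = cst t - (id : R -> R) by [].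
by apply: (is_derive_eq (is_deriveB _ _)); rewrite sub0r.
Qed.

(** The fundamental theorem of calculus is applied on intervals that stay away from the singularity
    at [t], and these exhaust [[a, t[] monotonically. *)
Lemma integral_powR (a t p : R) : 0 <= p < 1 -> a <= t ->
  (\int[mu]_(s in `[a, t[) ((t - s) `^ (- p))%:E <= ((t - a) `^ (1 - p) / (1 - p))%:E)%E.
Proof.
move=> /andP[p0 p1] at_; have q0 : 0 < 1 - p by rewrite subr_gt0.
have [ta|ta] := leP t a.
  by rewrite set_itv_ge ?bnd_simp -?leNgt// integral_set0 lee_fin divr_ge0 ?powR_ge0 ?ltW.
pose F k : set R := `[a, t - (t - a) / k.+2%:R]%classic.
have F0 k : 0 < (t - a) / k.+2%:R by rewrite divr_gt0// subr_gt0.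
have -> : `[a, t[%classic = \bigcup_k F k.
  apply/seteqP; split => x /=; last first.
    move=> [k _]; rewrite /F /= !in_itv/= => /andP[-> h].
    by rewrite (le_lt_trans h)// ltrBlDr ltrDl.
  rewrite in_itv/= => /andP[ax xt]; exists (Num.truncn ((t - a) / (t - x))) => //=.
  rewrite /F /= in_itv/= ax lerBrDr -lerBrDl ler_pdivrMr// -ler_pdivrMl ?subr_gt0// mulrC.
  by apply: ltW; apply: (lt_trans (truncnS_gt _)); rewrite ltr_nat.
have mF k : measurable (F k) by exact: measurable_itv.
have ndF : nondecreasing_seq F.
  move=> j k jk; apply/subsetPset => x; rewrite /F /= !in_itv/= => /andP[-> h].
  rewrite (le_trans h)// lerD2l lerN2 ler_wpM2l ?subr_ge0// lef_pV2 ?posrE//.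
  by rewrite ler_nat.
have mf k : measurable_fun (F k : set RR) (fun s => ((t - s) `^ (- p))%:E).
  by apply/measurable_EFinP; apply: measurable_powR_sub; exact: mF.
have cv := @ge0_nondecreasing_set_cvg_integral _ RR R F (fun s => ((t - s) `^ (- p))%:E) mu ndF mF.
have {cv}cv := cv mf (fun k x _ => powR_ge0 _ _ : (0 <= ((t - x) `^ (- p))%:E)%E).
rewrite -(cvg_lim _ cv)//; apply: lime_le; first by apply/cvg_ex; eexists; exact: cv.
apply: nearW => k; rewrite /F; set b := t - _.
have bt : b < t by rewrite /b ltrBlDr ltrDl.
have ab : a < b.
  rewrite /b ltrBrDr -ltrBrDl ltr_pdivrMr// -[ltLHS]mulr1 ltr_pM2l ?subr_gt0//.
  by rewrite ltr1n.
pose G s : R := - ((t - s) `^ (1 - p) / (1 - p)).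
have dG (x : R) : x < t -> is_derive x 1 G ((t - x) `^ (- p)).
  move=> xt; have tx : 0 < t - x by rewrite subr_gt0.
  have h1 : is_derive x 1 (fun s : R => t - s) (-1).
    exact: is_derive_cstB.
  have h2 := is_derive1_powR (1 - p) tx.
  have h3 := @is_derive1_comp _ (fun y => y `^ (1 - p)) (fun s : R => t - s) x _ _ h2 h1.
  have -> : G = (- (1 - p)^-1) *: ((fun y => y `^ (1 - p)) \o (fun s : R => t - s)).
    by apply/funext => s; rewrite /G /= scaleNr mulrC.
  apply: (is_derive_eq (is_deriveZ _ h3)).
  have -> : 1 - p - 1 = - p by lra.
  by rewrite /GRing.scale/=; field; rewrite gt_eqF.
have cG (x : R) : x < t -> {for x, continuous G}.
  by move=> xt; apply: differentiable_continuous; apply/derivable1_diffP; case: (dG x xt).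
rewrite (@continuous_FTC2 _ (fun s => (t - s) `^ (- p)) G)//.
- rewrite -EFinB lee_fin /G opprK addrC lerBlDr lerDl divr_ge0 ?powR_ge0 ?ltW//.
- apply: continuous_in_subspaceT => x /set_mem/=; rewrite in_itv/= => /andP[_ xb].
  have xt : x < t := le_lt_trans xb bt; have tx : 0 < t - x by rewrite subr_gt0.
  have h2 := is_derive1_powR (- p) tx.
  have h1 : is_derive x 1 (fun s : R => t - s) (-1).
    exact: is_derive_cstB.
  have h3 := @is_derive1_comp _ (fun y => y `^ (- p)) (fun s : R => t - s) x _ _ h2 h1.
  by apply: differentiable_continuous; apply/derivable1_diffP; case: h3.
- split.
  + move=> x; rewrite in_itv/= => /andP[_ xb].
    by case: (dG x (lt_trans xb bt)).
  + by apply: cvg_at_right_filter; apply: cG; exact: lt_trans bt.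
  + by apply: cvg_at_left_filter; apply: cG.
- move=> x; rewrite in_itv/= => /andP[_ xb]; rewrite derive1E.
  by case: (dG x (lt_trans xb bt)) => _ ->.
Qed.

Lemma powR_le_expR (x s : R) : 0 <= x -> 0 <= s <= 1 -> x `^ s <= expR x.
Proof.
move=> x0 /andP[s0 s1]; have [x1|x1] := leP x 1.
  apply: (@le_trans _ _ 1); last by rewrite (le_trans _ (expR_ge1Dx x))// lerDl.
  apply: (@le_trans _ _ (1 `^ s)); last by rewrite powR1.
  by apply: ge0_ler_powR; rewrite ?nnegrE.
by rewrite (le_trans (ler1_powR (ltW x1) s1))// (le_trans _ (expR_ge1Dx x))// lerDr.
Qed.

(** From (m x)^s <= e^(m x), the exponential weight gains m^(-s) for [s] more in the singularity.
    With [s = (1 - p)/2] the kernel stays integrable, and [m] is chosen such that m^s = 2 (C + 1)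
    K. *)
Lemma weighted_kernel (T p C : R) : 0 < T -> 0 <= p < 1 -> 0 <= C ->
  exists2 m : R, 0 < m & forall t, 0 <= t <= T ->
  (C%:E * \int[mu]_(s in `[0%R, t[) ((t - s) `^ (- p) * expR (- (m * (t - s))))%:E <= 2^-1%:E)%E.
Proof.
move=> T0 /andP[p0 p1] C0; pose s := (1 - p) / 2.
have s0 : 0 < s by rewrite divr_gt0// subr_gt0.
have s1 : s <= 1 by rewrite /s; lra.
pose K := T `^ s / s; have K0 : 0 < K by rewrite divr_gt0// powR_gt0.
pose m := (2 * (C + 1) * K) `^ s^-1.
have m0 : 0 < m by rewrite powR_gt0// mulr_gt0// mulr_gt0// ltr_wpDl.
have ms : m `^ s = 2 * (C + 1) * K.
  have sn0 : s != 0 by rewrite gt_eqF.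
  have c0 : 0 <= 2 * (C + 1) * K by rewrite mulr_ge0 ?(ltW K0)// mulr_ge0// addr_ge0.
  by rewrite /m -powRrM (mulVf sn0) powRr1.
have bd (x : R) : 0 < x -> x `^ (- p) * expR (- (m * x)) <= (m `^ s)^-1 * x `^ (- (p + s)).
  move=> x0; rewrite opprD powRD; last by rewrite (gt_eqF x0) implybT.
  rewrite mulrCA ler_wpM2l ?powR_ge0// expRN powRN -invfM -powRM ?(ltW m0) ?(ltW x0)//.
  rewrite lef_pV2 ?posrE ?expR_gt0 ?powR_gt0 ?mulr_gt0//.
  apply: powR_le_expR; first by rewrite mulr_ge0 ?(ltW m0) ?(ltW x0).
  by rewrite (ltW s0) s1.
exists m => // t /andP[t0 tT].
have mS (q : R) : measurable_fun (`[0, t[%classic : set RR) (fun s => (t - s) `^ q).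
  by apply: measurable_powR_sub; exact: measurable_itv.
apply: (@le_trans _ _ (C%:E * ((m `^ s)^-1 * K)%:E)%E); last first.
  have e (k : R) : 0 < k -> C * ((2 * (C + 1) * k)^-1 * k) = C / (C + 1) * 2^-1.
    by move=> k0; field; rewrite !gt_eqF// ltr_wpDl.
  rewrite -EFinM lee_fin ms e//.
  by rewrite ler_piMl ?invr_ge0// ler_pdivrMr ?mul1r ?ltr_wpDl// lerDl.
rewrite lee_wpmul2l ?lee_fin//.
apply: (@le_trans _ _ (\int[mu]_(r in `[0%R, t[) ((m `^ s)^-1%:E * ((t - r) `^ (- (p + s)))%:E))%E).
  apply: ge0_le_integral => //.
  - by move=> r _; rewrite lee_fin mulr_ge0 ?powR_ge0 ?expR_ge0.
  - apply/measurable_EFinP; apply: measurable_funM; first exact: mS.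
    apply: (measurableT_comp (@measurable_expR R)); apply: measurableT_comp => //.
    by apply: measurable_funM => //; exact: measurable_funB.
  - by apply: measurable_funeM; apply/measurable_EFinP; exact: mS.
  by move=> r; rewrite /= in_itv/= => /andP[r0 rt]; rewrite -EFinM lee_fin; apply: bd; rewrite subr_gt0.
rewrite ge0_integralZl_EFin//; last 3 first.
- by move=> r _; rewrite lee_fin powR_ge0.
- by apply/measurable_EFinP; exact: mS.
- by rewrite invr_ge0 powR_ge0.
rewrite EFinM lee_wpmul2l ?lee_fin ?invr_ge0 ?powR_ge0//.
apply: (le_trans (integral_powR _ t0)); first by rewrite /s; apply/andP; split; lra.
have -> : 1 - (p + s) = s by rewrite /s; lra.
rewrite lee_fin subr0 ler_wpM2r ?invr_ge0 ?(ltW s0)//.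
by apply: ge0_ler_powR; rewrite ?nnegrE ?(ltW s0)// (le_trans t0).
Qed.

(** In the supremum [S] of e^(-m t) v(t) the kernel contributes at most [S / 2], whence
    [S <= 2 * A]. The a priori bound [b] makes [S] finite and does not enter the constant. *)
Lemma singular_gronwall (T p C : R) : 0 < T -> 0 <= p < 1 -> 0 <= C ->
  exists2 L : R, 0 <= L & forall (v : R -> R) (A b : R), 0 <= A ->
  measurable_fun (`[0, T[%classic : set RR) v ->
  (forall t, 0 <= t <= T -> 0 <= v t <= b) ->
  (forall t, 0 <= t <= T ->
    ((v t)%:E <= A%:E + C%:E * \int[mu]_(s in `[0%R, t[) ((t - s) `^ (- p) * v s)%:E)%E) ->
  forall t, 0 <= t <= T -> v t <= L * A.
Proof.
move=> T0 p01 C0; have [m m0 Hm] := weighted_kernel T0 p01 C0.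
exists (2 * expR (m * T)); first by rewrite mulr_ge0 ?expR_ge0.
move=> v A b A0 mv vb hv.
pose E := [set expR (- (m * t)) * v t | t in `[0, T]%classic].
have ubE : has_ubound E.
  exists b => _ [t /= /[!in_itv]/= tT <-]; have /andP[v0 vb'] := vb t tT.
  rewrite (le_trans _ vb')// ler_piMl// expR_le1 oppr_le0.
  by rewrite mulr_ge0 ?(ltW m0)//; case/andP: tT.
pose S := sup E.
have leS t : 0 <= t <= T -> v t <= S * expR (m * t).
  move=> tT; have : expR (- (m * t)) * v t <= S.
    by apply: ub_le_sup => //; exists t => //=; rewrite in_itv.
  by rewrite expRN mulrC ler_pdivrMr ?expR_gt0.
have S0 : 0 <= S.
  have T00 : 0 <= (0 : R) <= T by rewrite lexx ltW.
  have := leS 0 T00; rewrite mulr0 expR0 mulr1; apply: le_trans.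
  by case/andP: (vb 0 T00).
have key t : 0 <= t <= T -> v t <= A + 2^-1 * S * expR (m * t).
  move=> tT; have /andP[t0 tT'] := tT; rewrite -lee_fin (le_trans (hv t tT))// EFinD leeD2l//.
  have sub : `[0, t[%classic `<=` `[0, T]%classic.
    by move=> x /=; rewrite !in_itv/= => /andP[-> /ltW h]; rewrite (le_trans h).
  have mS (q : R) : measurable_fun (`[0, t[%classic : set RR) (fun s => (t - s) `^ q).
    by apply: measurable_powR_sub; exact: measurable_itv.
  have mv' : measurable_fun (`[0, t[%classic : set RR) v.
    apply: measurable_funS mv => //.
    by move=> x /=; rewrite !in_itv/= => /andP[-> h]; exact: lt_le_trans tT'.
  have mw : measurable_fun (`[0, t[%classic : set RR)
      (fun s => (t - s) `^ (- p) * expR (- (m * (t - s)))).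
    apply: measurable_funM; first exact: mS.
    apply: (measurableT_comp (@measurable_expR R)); apply: measurableT_comp => //.
    by apply: measurable_funM => //; exact: measurable_funB.
  apply: (@le_trans _ _ (C%:E * \int[mu]_(s in `[0%R, t[) ((S * expR (m * t))%:E *
      ((t - s) `^ (- p) * expR (- (m * (t - s))))%:E))%E).
    rewrite lee_wpmul2l ?lee_fin//; apply: ge0_le_integral => //.
    - move=> s /sub /= /[!in_itv]/= sT; rewrite lee_fin mulr_ge0 ?powR_ge0//.
      by case/andP: (vb s sT).
    - by apply/measurable_EFinP; apply: measurable_funM => //; exact: mS.
    - by apply: measurable_funeM; apply/measurable_EFinP.
    move=> s /= /[!in_itv]/= /andP[s0 st]; rewrite -EFinM lee_fin.
    rewrite [leRHS]mulrCA ler_wpM2l ?powR_ge0//.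
    have sT : 0 <= s <= T by rewrite s0 (le_trans (ltW st)).
    rewrite (le_trans (leS s sT))// -mulrA -expRD (_ : m * t + _ = m * s)//; ring.
  rewrite ge0_integralZl_EFin//; last 3 first.
  - by move=> s _; rewrite lee_fin mulr_ge0 ?powR_ge0 ?expR_ge0.
  - exact/measurable_EFinP.
  - by rewrite mulr_ge0 ?expR_ge0.
  rewrite muleCA; apply: (@le_trans _ _ ((S * expR (m * t))%:E * 2^-1%:E)%E).
    by rewrite lee_wpmul2l ?lee_fin ?mulr_ge0 ?expR_ge0// Hm.
  by rewrite -EFinM lee_fin mulrC mulrA.
have S2 : S <= 2 * A.
  suff : S <= A + 2^-1 * S by lra.
  apply: ge_sup.
    by exists (expR (- (m * 0)) * v 0); exists 0 => //=; rewrite in_itv/= lexx ltW.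
  move=> _ [t /= /[!in_itv]/= tT <-]; have /andP[t0 _] := tT.
  rewrite expRN mulrC ler_pdivrMr ?expR_gt0// (le_trans (key t tT))// mulrDl lerD2r.
  by rewrite ler_peMr// -expR0 ler_expR mulr_ge0// ltW.
move=> t tT; have /andP[t0 tT'] := tT; rewrite (le_trans (leS t tT))//.
rewrite mulrAC; apply: ler_pM => //; rewrite ?expR_ge0//.
by rewrite ler_expR ler_wpM2l// ltW.
Qed.

Lemma expr_tangent (x c : R) n : 0 <= x -> 0 <= c ->
  n.+1%:R * c ^+ n * x <= x ^+ n.+1 + n%:R * c ^+ n.+1.
Proof.
move=> x0 c0; elim: n => [|n IH]; first by rewrite expr0 mul0r addr0 !mul1r expr1.
have : 0 <= x * (x ^+ n.+1 + n%:R * c ^+ n.+1 - n.+1%:R * c ^+ n * x) +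
    n.+1%:R * c ^+ n * (x - c) ^+ 2.
  apply: addr_ge0; first by apply: mulr_ge0; rewrite ?subr_ge0.
  by apply: mulr_ge0; [apply: mulr_ge0; rewrite ?exprn_ge0|exact: sqr_ge0].
set E := (X in 0 <= X) => H; rewrite -subr_ge0.
rewrite (_ : _ - _ = E)//; rewrite /E -[n.+2%:R]natr1 -[n.+1%:R]natr1 !exprS; ring.
Qed.

(** Jensen for a measure of mass at most [K]: the tangent inequality of the power at [c], the
    integral of [k * g] divided by [K], is integrated against [k]. *)
Lemma kernel_jensen (D : set RR) (k g : R -> R) (K b : R) n : measurable D -> 0 < K ->
  measurable_fun D k -> measurable_fun D g ->
  (forall s, D s -> 0 <= k s) -> (forall s, D s -> 0 <= g s <= b) ->
  (\int[mu]_(s in D) (k s)%:E <= K%:E)%E ->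
  ((fine (\int[mu]_(s in D) (k s * g s)%:E)%E ^+ n.+1)%:E <=
    (K ^+ n)%:E * \int[mu]_(s in D) (k s * g s ^+ n.+1)%:E)%E.
Proof.
move=> mD K0 mk mg k0 gb kK.
have g0 s : D s -> 0 <= g s by move=> /gb /andP[].
set I := (\int[mu]_(s in D) (k s * g s)%:E)%E; set J := (\int[mu]_(s in D) _)%E.
have I0 : (0 <= I)%E by apply: integral_ge0 => s Ds; rewrite lee_fin mulr_ge0 ?k0 ?g0.
pose G := fine I; have G0 : 0 <= G by exact: fine_ge0.
have J0 : (0 <= J)%E.
  by apply: integral_ge0 => s Ds; rewrite lee_fin mulr_ge0 ?k0 ?exprn_ge0 ?g0.
have Ifin : I = G%:E.
  rewrite /G fineK// ge0_fin_numE//.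
  apply: (@le_lt_trans _ _ (\int[mu]_(s in D) (`|b|%:E * (k s)%:E))%E).
    apply: ge0_le_integral => //.
    - by move=> s Ds; rewrite lee_fin mulr_ge0 ?k0 ?g0.
    - by apply/measurable_EFinP; exact: measurable_funM.
    - by apply: measurable_funeM; exact/measurable_EFinP.
    move=> s Ds; rewrite -EFinM lee_fin mulrC ler_wpM2r ?k0//.
    by have /andP[_ h] := gb s Ds; rewrite (le_trans h)// ler_norm.
  rewrite ge0_integralZl_EFin; [|exact: mD|by move=> s Ds; rewrite lee_fin k0|exact/measurable_EFinP|by []].
  by apply: (@le_lt_trans _ _ (`|b|%:E * K%:E)%E); rewrite ?lee_wpmul2l ?lee_fin// -EFinM ltry.
have [->|Joo] := eqVneq J +oo%E.
  by rewrite gt0_muley ?leey// lte_fin exprn_gt0.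
have [j Jj] : exists j : R, J = j%:E.
  by exists (fine J); rewrite fineK// ge0_fin_numE// ltey.
pose c := G / K; have c0 : 0 <= c by rewrite divr_ge0// ltW.
have mkg : measurable_fun D (fun s => (k s * g s)%:E) by apply/measurable_EFinP; exact: measurable_funM.
have mkgn : measurable_fun D (fun s => (k s * g s ^+ n.+1)%:E).
  by apply/measurable_EFinP; apply: measurable_funM => //; exact: measurable_funX.
have key : ((n.+1%:R * c ^+ n)%:E * I <= J + (n%:R * c ^+ n.+1)%:E * \int[mu]_(s in D) (k s)%:E)%E.
  rewrite -ge0_integralZl_EFin; [|exact: mD|by move=> s Ds; rewrite lee_fin mulr_ge0 ?k0 ?g0|exact: mkg|
    by rewrite mulr_ge0 ?exprn_ge0].
  rewrite -ge0_integralZl_EFin; [|exact: mD|by move=> s Ds; rewrite lee_fin k0|exact/measurable_EFinP|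
    by rewrite mulr_ge0 ?exprn_ge0].
  rewrite -ge0_integralD; [|exact: mD|by move=> s Ds; rewrite lee_fin mulr_ge0 ?k0 ?exprn_ge0 ?g0|exact: mkgn|
    by move=> s Ds; rewrite -EFinM lee_fin !mulr_ge0 ?k0 ?exprn_ge0|
    by apply: measurable_funeM; exact/measurable_EFinP].
  apply: ge0_le_integral => //.
  - by move=> s Ds; rewrite -EFinM lee_fin !mulr_ge0 ?k0 ?exprn_ge0 ?g0.
  - exact: measurable_funeM.
  - by apply: emeasurable_funD => //; apply: measurable_funeM; exact/measurable_EFinP.
  move=> s Ds; rewrite -!EFinM -EFinD lee_fin.
  have := ler_wpM2l (k0 s Ds) (expr_tangent n (g0 s Ds) c0).
  by rewrite mulrDr => h; rewrite mulrCA (le_trans h)// lerD2l mulrC.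
have : ((n.+1%:R * c ^+ n * G)%:E <= (j + n%:R * c ^+ n.+1 * K)%:E)%E.
  rewrite EFinM -Ifin (le_trans key)// Jj EFinD leeD2l// [leRHS]EFinM lee_wpmul2l//.
  by rewrite lee_fin mulr_ge0 ?exprn_ge0.
rewrite Jj -EFinM !lee_fin => h.
have GK : G = c * K by rewrite /c divfK// gt_eqF.
have : K ^+ n * (c ^+ n * G) <= K ^+ n * j.
  rewrite ler_wpM2l ?exprn_ge0 ?(ltW K0)//; move: h; rewrite GK -natr1 exprSr; lra.
by rewrite mulrA -exprMn [K * c]mulrC -GK -exprSr.
Qed.

End kernel.

(** * Joint measurability and events of staying in a closed set *)

Lemma measurable_integral_space (R : realType) (d : measure_display) (Om : measurableType d)
    (P : probability Om R) (D : set R) (f : R -> Om -> \bar R) : measurable D ->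
  measurable_fun (D `*` setT) (fun p : R * Om => f p.1 p.2) ->
  (forall s w, D s -> (0 <= f s w)%E) ->
  measurable_fun (D : set (measurableTypeR R)) (fun s => \int[P]_w f s w)%E /\
  (\int[P]_w \int[lebesgue_measure]_(s in D) f s w =
   \int[lebesgue_measure]_(s in D) \int[P]_w f s w)%E.
Proof.
move=> mD mf f0.
have mDT : measurable (D `*` [set: Om]) by exact: measurableX.
pose F := (fun p : R * Om => f p.1 p.2) \_ (D `*` setT).
have mf' : measurable_fun setT F := (measurable_restrictT _ mDT).1 mf.
have F0 p : (0 <= F p)%E by rewrite /F /patch; case: ifPn => // /set_mem[h _]; exact: f0.
have FE s w : D s -> F (s, w) = f s w by move=> Ds; rewrite /F /patch mem_set.
have FN s w : ~ D s -> F (s, w) = 0%E by move=> Ds; rewrite /F /patch memNset// => -[].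
have E1 w : (\int[lebesgue_measure]_(s in D) f s w = \int[lebesgue_measure]_s F (s, w))%E.
  rewrite integral_mkcond; apply: eq_integral => s _; rewrite /patch.
  by case: ifPn => [/set_mem/FE ->//|/negP nD]; rewrite FN// => /mem_set.
have E2 : ((fun s => \int[P]_w f s w) \_ D = fun s => \int[P]_w F (s, w))%E.
  apply/funext => s; rewrite /patch; case: ifPn => [/set_mem Ds|/negP nD].
    by apply: eq_integral => w _; rewrite FE.
  by rewrite integral0_eq// => w _; rewrite FN// => /mem_set.
split.
  apply/(measurable_restrictT _ mD); rewrite E2.
  exact: (@measurable_fun_fubini_tonelli_F _ _ (measurableTypeR R) Om R P _ mf').
under eq_integral do rewrite E1.
rewrite [RHS]integral_mkcond E2.
by rewrite (@fubini_tonelli _ _ (measurableTypeR R) Om R lebesgue_measure P _ mf').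
Qed.

Section open_measurable.
Context {R : realType} {d : measure_display} {Om : measurableType d}.

Definition open_measurable (V : topologicalType) (X : Om -> V) :=
  forall O, open O -> measurable (X @^-1` O).

Lemma open_measurable_real (V : topologicalType) (X : Om -> V) (g : V -> R) :
  open_measurable X -> continuous g -> measurable_fun setT (fun w => g (X w)).
Proof.
move=> mX cg; apply: (measurability _ (measurable_realfun.RGenOInfty.measurableE R)) => //.
move=> _ [_ [x ->] <-]; rewrite setTI.
rewrite (_ : _ @^-1` _ = X @^-1` (g @^-1` [set y | x < y])).
  by apply: mX; apply: open_comp; [move=> v _; exact: cg|exact: open_gt].
by apply/seteqP; split => w /=; rewrite in_itv/= andbT.
Qed.

(** Parseval makes the squared norm a countable sum of squared scalar coordinates. Differences of
    random vectors are thus treated without a sigma-algebra on pairs of vectors, and separability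
    enters here. *)
Lemma measurable_norm (I : choiceType) (V : hilbertType R) (A : set I) (f : I -> V)
    (X : Om -> V) : countable A -> onb_family A f ->
  (forall i, measurable_fun setT (fun w => inner (f i) (X w))) -> measurable_fun setT (fun w => `|X w|).
Proof.
move=> /countable_injP[e einj] onb mc; pose c i w := inner (f i) (X w).
pose b n w : \bar R := if pselect (exists2 i, A i & e i = n) is left h then
  (c (projT1 (cid2 h)) w ^+ 2)%:E else 0%E.
have bE i w : A i -> b (e i) w = (c i w ^+ 2)%:E.
  move=> Ai; rewrite /b; case: pselect => [h|]; last by case; exists i.
  case: cid2 => j Aj /= /einj -> //; exact/mem_set.
have mb n : measurable_fun setT (b n).
  rewrite /b; case: pselect => // h.
  by apply/measurable_EFinP; apply: measurable_funX; exact: mc.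
have b0 n w : (0 <= b n w)%E by rewrite /b; case: pselect => // h; rewrite lee_fin sqr_ge0.
have nE w : (`|X w| ^+ 2)%:E = (\sum_(n <oo | n \in predT) b n w)%E.
  rewrite -(parseval _ onb) nneseries_esum//.
  rewrite (_ : [set x | _] = setT); last by apply/seteqP; split.
  have -> : (\esum_(n in [set: nat]) b n w = \esum_(n in e @` A) b n w)%E.
    rewrite [RHS]esum_mkcond; apply: eq_esum => n _; case: ifPn => // /negP nA.
    by rewrite /b; case: pselect => // -[i Ai ei]; case: nA; apply/mem_set; exists i.
  rewrite esum_image; last by move=> i j /set_mem Ai /set_mem Aj; apply: einj; exact/mem_set.
  by apply: eq_esum => i Ai; rewrite bE.
have m2 : measurable_fun setT (fun w => `|X w| ^+ 2).
  apply/measurable_EFinP; rewrite (_ : _ \o _ = fun w => \sum_(n <oo | n \in predT) b n w)%E; last first.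
    by apply/funext => w; rewrite /= nE.
  by apply: ge0_emeasurable_sum => // n w _ _; exact: b0.
rewrite (_ : (fun w => _) = fun w => (`|X w| ^+ 2) `^ 2^-1).
  by apply: (measurableT_comp (measurable_powR 2^-1)).
by apply/funext => w; rewrite powR12_sqrt ?sqr_ge0// sqrtr_sqr normr_id.
Qed.

Lemma open_measurable_inner (V : hilbertType R) (v : V) (X : Om -> V) :
  open_measurable X -> measurable_fun setT (fun w => inner v (X w)).
Proof.
move=> mX; have ci : continuous (fun x => inner v x) by case: (inner_bop v).
exact: (open_measurable_real (g := fun x => inner v x)).
Qed.

End open_measurable.

Section grid.
Context {R : realType}.

Definition grid_floor (T : R) n (s : R) : R := T * (Num.truncn (s * n.+1%:R / T))%:R / n.+1%:R.

Lemma grid_floor_bounds (T s : R) n : 0 <= s <= T ->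
  [/\ 0 <= grid_floor T n s, grid_floor T n s <= s & s - grid_floor T n s <= T / n.+1%:R].
Proof.
move=> /andP[s0 sT]; have T0 := le_trans s0 sT.
pose h := T / n.+1%:R; pose x := s * n.+1%:R / T.
have h0 : 0 <= h by rewrite divr_ge0.
have gE : grid_floor T n s = (Num.truncn x)%:R * h.
  by rewrite /grid_floor /h -mulrA mulrCA mulrA.
have x0 : 0 <= x by rewrite divr_ge0// mulr_ge0.
have sE : s = x * h.
  have [Tz|Tn] := eqVneq T 0.
    by rewrite /h Tz mul0r mulr0; apply/eqP; rewrite eq_le s0 andbT -Tz.
  by rewrite /x /h mulrA divfK// mulfK// pnatr_eq0.
have /andP[k1 k2] := truncn_itv x0; split.
- by rewrite gE mulr_ge0.
- by rewrite gE [leRHS]sE ler_wpM2r.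
- rewrite gE {1}sE -mulrBl -[leRHS]mul1r ler_wpM2r// lerBlDl natr1; exact: ltW.
Qed.

Lemma grid_floor_index (T s : R) n : 0 <= s <= T ->
  exists2 k, (k <= n.+1)%N & grid_floor T n s = T * k%:R / n.+1%:R.
Proof.
move=> /andP[s0 sT]; have T0 := le_trans s0 sT.
exists (Num.truncn (s * n.+1%:R / T)) => //; rewrite -ltnS truncn_lt_nat ?divr_ge0 ?mulr_ge0//.
have [Tz|Tn] := eqVneq T 0; first by rewrite Tz invr0 mulr0.
have Tp : 0 < T by rewrite lt_neqAle eq_sym Tn.
rewrite ltr_pdivrMr//; apply: (@le_lt_trans _ _ (T * n.+1%:R)); first exact: ler_wpM2r.
by rewrite mulrC ltr_pM2r// ltr_nat.
Qed.

Lemma grid_floor_cvg (T s : R) : 0 <= s <= T -> grid_floor T n s @[n --> \oo] --> s.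
Proof.
move=> sT; apply/cvgrPdist_le => e e0; exists (Num.truncn (T / e)) => // n /= hn.
have [_ h1 h2] := grid_floor_bounds n sT.
rewrite ger0_norm ?subr_ge0// (le_trans h2)// ler_pdivrMr// mulrC -ler_pdivrMr//.
by rewrite (le_trans (ltW (truncnS_gt _)))// ler_nat.
Qed.

Lemma cvg_path (V : topologicalType) (phi : R -> V) (T : R) (x : nat -> R) s :
  {within `[0, T], continuous phi} -> 0 <= s <= T -> (forall n, 0 <= x n <= T) ->
  x n @[n --> \oo] --> s -> phi (x n) @[n --> \oo] --> phi s.
Proof.
move=> /subspace_continuousP c sT xT xs; apply: (cvg_trans _ (c s _)); last by rewrite /= in_itv.
move=> O /= HO.
have H : \forall n \near \oo, `[0, T]%classic (x n) -> O (phi (x n)) := xs _ HO.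
have H' : \forall n \near \oo, O (phi (x n)).
  by apply: filterS H => n; apply; rewrite /= in_itv; exact: xT.
exact: H'.
Qed.

(** The discretisations at left grid points are jointly measurable and converge pointwise.
    Convergence is asked only along [grid_floor], because the indicators of the localising events
    are continuous merely from the left. *)
Lemma joint_measurable (d : measure_display) (Om : measurableType d) (T : R) (Z : R -> Om -> R) :
  0 < T -> (forall s, 0 <= s <= T -> measurable_fun setT (Z s)) ->
  (forall s w, 0 <= s < T -> Z (grid_floor T n s) w @[n --> \oo] --> Z s w) ->
  measurable_fun (`[0, T[ `*` setT) (fun p : R * Om => Z p.1 p.2).
Proof.
move=> T0 mZ cZ.
apply: (@measurable_fun_cvg _ _ _ _ (fun n (p : R * Om) => Z (grid_floor T n p.1) p.2)); last first.
  by move=> [s w] [/= /[!in_itv]/= sT _]; exact: cZ.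
move=> m; pose h := T / m.+1%:R; have h0 : 0 < h by rewrite divr_gt0.
pose E k : set (R * Om) := (`[k%:R * h, k.+1%:R * h[%classic `&` `[0, T[%classic) `*` setT.
have mE k : measurable (E k) by apply: measurableX => //; exact: measurableI.
have DE : `[0, T[%classic `*` setT = \bigcup_k E k :> set (R * Om).
  apply/seteqP; split => -[s w] /=; last by move=> [k _ [[_ ?] _]].
  rewrite in_itv/= => -[sT _]; have /andP[s0 _] := sT.
  exists (Num.truncn (s / h)) => //; split => //; split => /=; rewrite in_itv//=.
  by rewrite -ler_pdivlMr// -ltr_pdivrMr// truncn_itv// divr_ge0// ltW.
rewrite DE; apply/measurable_fun_bigcup => // k.
have [km|km] := leqP k m; last first.
  rewrite (_ : E k = set0); first exact: measurable_fun_set0.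
  apply/seteqP; split => -[s w] //= [[/=]]; rewrite !in_itv/= => /andP[h1 _] /andP[_ h2] _.
  have := le_lt_trans h1 h2; rewrite ltNge; apply/negP; rewrite negbK /h mulrA.
  by rewrite ler_pdivlMr// mulrC ler_pM2r// ler_nat.
apply: (eq_measurable_fun (fun p : R * Om => Z (T * k%:R / m.+1%:R) p.2)).
  move=> [s w] /set_mem[[/=]]; rewrite !in_itv/= => /andP[h1 h2] /andP[s0 sT] _.
  congr (Z (_ * _%:R / _) _); apply/esym/eqP.
  have sx : s * m.+1%:R / T = s / h by rewrite /h invf_div mulrA.
  rewrite sx truncn_eq; last by rewrite divr_ge0// ltW.
  by apply/andP; split; [rewrite ler_pdivlMr|rewrite ltr_pdivrMr].
apply: measurable_funTS; apply: measurableT_comp (measurable_snd); apply: mZ.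
rewrite divr_ge0 ?mulr_ge0 ?(ltW T0)//= ler_pdivrMr// ler_pM2l// ler_nat.
exact: leqW.
Qed.

End grid.

Lemma sigma_algebra_bigcap_nat (T : Type) (G : set (set T)) (A : nat -> set T) :
  sigma_algebra setT G -> (forall n, G (A n)) -> G (\bigcap_n A n).
Proof.
move=> [G0 GC GU] GA; have GN n : G (~` A n) by rewrite -setTD; exact: (GC _ (GA n)).
by rewrite -[X in G X]setCK setC_bigcap -setTD; exact: (GC _ (GU _ GN)).
Qed.

Section running.
Context {R : realType} {d : measure_display} {Om : measurableType d} {P : probability Om R}.
Context {T : R} (T0 : 0 < T) {Fl : R -> set (set Om)} (Fl_normal : normal_filtration P T Fl).
Context {Z : set Om} {B : R -> set Om} (FZ : Fl 0 Z).
Hypothesis FB : forall s, 0 <= s <= T -> Fl s (B s).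
Hypothesis B_closed : forall w (x : nat -> R) s, 0 <= s <= T -> (forall n, 0 <= x n <= T) ->
  x n @[n --> \oo] --> s -> (forall n, B (x n) w) -> B s w.

(** With [B] a closed condition on a continuous path, this replaces the event that the exit time has
    not occurred up to [s]. *)
Definition running s : set Om := Z `&` [set w | forall r, 0 <= r <= s -> B r w].

Lemma running_sub r s : r <= s -> running s `<=` running r.
Proof.
move=> rs w [Zw H]; split => // q /andP[q0 qr]; apply: H.
by rewrite q0 (le_trans qr).
Qed.

(** By closedness it suffices to test [B] at the countably many times s k / n with k <= n; the index
    [n = 0] of the intersection carries [Z]. *)
Lemma running_adapted s : 0 <= s <= T -> Fl s (running s).
Proof.
move=> sT; have /andP[s0 sT'] := sT; have sF := Fl_sigma_algebra Fl_normal sT.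
have FT : Fl s setT by have [G0 GC _] := sF; have := GC _ G0; rewrite setTD setC0.
pose C n k := if n is n'.+1 then
  if (k <= n)%N then B (s * k%:R / n%:R) else setT else Z.
have -> : running s = \bigcap_n \bigcap_k C n k.
  apply/seteqP; split => w.
    move=> [Zw H] [|n] _ k _ //=; case: ifP => // kn; apply: H.
    rewrite divr_ge0 ?mulr_ge0//= ler_pdivrMr//; apply: ler_wpM2l => //; by rewrite ler_nat.
  move=> H; split; first exact: (H 0%N Logic.I 0%N Logic.I).
  move=> r rs; apply: (@B_closed w (fun n => grid_floor s n r)).
  - by have /andP[-> h] := rs; exact: le_trans sT'.
  - by move=> n; have [h1 h2 _] := grid_floor_bounds n rs; have /andP[_ h] := rs;
      rewrite h1 (le_trans h2)// (le_trans h).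
  - exact: grid_floor_cvg.
  move=> n; have [k kn ->] := grid_floor_index n rs.
  by have := H n.+1 Logic.I k Logic.I; rewrite /C kn.
apply: sigma_algebra_bigcap_nat => // n; apply: sigma_algebra_bigcap_nat => // k.
case: n => [|n] /=; first by apply: (Fl_mono Fl_normal _ s0).
case: ifP => // kn; have h0 : 0 <= s * k%:R / n.+1%:R by rewrite divr_ge0 ?mulr_ge0.
have h1 : s * k%:R / n.+1%:R <= s.
  by rewrite ler_pdivrMr//; apply: ler_wpM2l => //; rewrite ler_nat.
by apply: (Fl_mono Fl_normal h0 h1 sT'); apply: FB; rewrite h0 (le_trans h1).
Qed.

(** Left-continuity of a decreasing indicator: if the event held at infinitely many of the grid
    points approaching [s] from below, closedness would extend it to [s]. *)
Lemma running_grid s w : 0 <= s < T ->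
  (\1_(running (grid_floor T n s)) w : R) @[n --> \oo] --> (\1_(running s) w : R).
Proof.
move=> /andP[s0 sT]; have sT' : 0 <= s <= T by rewrite s0 ltW.
have [ws|ws] := pselect (running s w).
  rewrite indicE mem_set//; apply: cvg_near_cst; apply: nearW => n.
  by rewrite indicE mem_set//; apply: running_sub ws; case: (grid_floor_bounds n sT').
have [[n0 Hn]|H] := pselect (exists n0, forall n, (n0 <= n)%N -> ~ running (grid_floor T n s) w).
  rewrite [X in _ --> X]indicE memNset//; apply: cvg_near_cst; exists n0 => // n /= nn.
  by rewrite indicE memNset//; exact: Hn.
exfalso; apply: ws.
have /choice[u Hu] : forall j, exists n, (j <= n)%N /\ running (grid_floor T n s) w.
  move=> j; apply: contrapT => hj; apply: H; exists j => n jn hn; apply: hj.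
  by exists n.
have [Zw _] := (Hu 0%N).2; split => // r /andP[r0 rs].
have ucv : grid_floor T (u j) s @[j --> \oo] --> s.
  have uoo : u j @[j --> \oo] --> \oo.
    move=> A [N _ HN]; exists N => // j /= Nj; apply: HN => /=.
    exact: leq_trans Nj (Hu j).1.
  exact: (cvg_comp _ _ uoo (grid_floor_cvg sT')).
have gb j := grid_floor_bounds (u j) sT'.
apply: (@B_closed w (fun j => Num.min r (grid_floor T (u j) s))).
- by rewrite r0 (le_trans rs)// ltW.
- move=> j; have [h1 h2 _] := gb j; rewrite le_min r0 h1/= ge_min.
  by rewrite (le_trans rs (ltW sT)).
- apply/cvgrPdist_le => e e0; have H' : \forall j \near \oo, `|s - grid_floor T (u j) s| <= e.
    exact: ((cvgrPdist_le _ _).1 ucv e e0).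
  apply: filterS H' => j /=.
  have [_ h2 _] := gb j; rewrite ger0_norm ?subr_ge0// => h3.
  rewrite ger0_norm ?subr_ge0 ?ge_min ?lexx//; case: (leP r) => h; first by rewrite subrr ltW.
  by rewrite (le_trans _ h3)// lerD2r.
move=> j; have [_ h] := (Hu j).2; apply: h; have [h1 _ _] := gb j.
by rewrite le_min r0 h1 ge_min lexx orbT.
Qed.

End running.

Section expectation.
Context {R : realType} {d : measure_display} {Om : measurableType d} (P : probability Om R).

Definition ebar (f : Om -> R) : \bar R := (\int[P]_w (f w)%:E)%E.

Lemma ebarD (f g : Om -> R) : measurable_fun setT f -> measurable_fun setT g ->
  (forall w, 0 <= f w) -> (forall w, 0 <= g w) ->
  (ebar (fun w => (f w + g w)%R) = ebar f + ebar g)%E.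
Proof.
move=> mf mg f0 g0; rewrite /ebar; under eq_integral do rewrite EFinD.
by rewrite ge0_integralD//; [move=> w _; rewrite lee_fin|exact/measurable_EFinP|
   move=> w _; rewrite lee_fin|exact/measurable_EFinP].
Qed.

Lemma ebarZ (c : R) (f : Om -> R) : 0 <= c -> measurable_fun setT f -> (forall w, 0 <= f w) ->
  (ebar (fun w => (c * f w)%R) = c%:E * ebar f)%E.
Proof.
move=> c0 mf f0; rewrite /ebar; under eq_integral do rewrite EFinM.
by rewrite ge0_integralZl_EFin//; [move=> w _; rewrite lee_fin|exact/measurable_EFinP].
Qed.

Lemma ebar_cst (c : R) : ebar (fun=> c) = c%:E.
Proof. rewrite /ebar integral_cst//= (_ : P _ = 1%E) ?mule1//; exact: probability_setT. Qed.

Lemma le_ebar (f g : Om -> R) : measurable_fun setT f -> measurable_fun setT g ->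
  (forall w, 0 <= f w) -> (forall w, f w <= g w) -> (ebar f <= ebar g)%E.
Proof.
move=> mf mg f0 fg; apply: ge0_le_integral => //; try exact/measurable_EFinP.
  by move=> w _; rewrite lee_fin.
by move=> w _; rewrite lee_fin.
Qed.

Lemma ebar_ge0 (f : Om -> R) : (forall w, 0 <= f w) -> (0 <= ebar f)%E.
Proof. by move=> f0; apply: integral_ge0 => w _; rewrite lee_fin. Qed.

End expectation.
Arguments ebar {R d Om} P f%_ring_scope.

Section kernel.
Context {R : realType}.
Local Notation mu := (@lebesgue_measure R).
Local Notation "'RR'" := (measurableTypeR R).

Lemma kernel_affine (T p t c e b : R) (g : R -> R) (K := T `^ (1 - p) / (1 - p)) :
  0 <= p < 1 -> 0 <= t <= T -> 0 <= c -> 0 <= e -> 0 <= b ->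
  measurable_fun (`[0, t[%classic : set RR) g -> (forall s, 0 <= s < t -> 0 <= g s <= b) ->
  [/\ (\int[mu]_(s in `[0%R, t[) ((t - s) `^ (- p))%:E <= K%:E)%E,
      (\int[mu]_(s in `[0%R, t[) ((t - s) `^ (- p) * g s)%:E)%E =
        (fine (\int[mu]_(s in `[0%R, t[) ((t - s) `^ (- p) * g s)%:E)%E)%:E,
      0 <= fine (\int[mu]_(s in `[0%R, t[) ((t - s) `^ (- p) * g s)%:E)%E <= K * b &
      (\int[mu]_(s in `[0%R, t[) (c * ((t - s) `^ (- p) * (e + g s)))%:E <=
        (c * (K * e + fine (\int[mu]_(s in `[0%R, t[) ((t - s) `^ (- p) * g s)%:E)%E))%:E)%E].
Proof.
move=> p01 /andP[t0 tT] c0 e0 b0 mg gb; have /andP[p0 p1] := p01.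
have mD : measurable (`[0, t[%classic : set RR) by exact: measurable_itv.
have mk : measurable_fun (`[0, t[%classic : set RR) (fun s => (t - s) `^ (- p)).
  exact: measurable_powR_sub.
have g0 s : `[0, t[%classic s -> 0 <= g s <= b by move=> /= /[!in_itv]/=; exact: gb.
have kK : (\int[mu]_(s in `[0%R, t[) ((t - s) `^ (- p))%:E <= K%:E)%E.
  apply: (le_trans (integral_powR p01 t0)); rewrite lee_fin subr0 ler_wpM2r ?invr_ge0 ?subr_ge0 ?(ltW p1)//.
  by apply: ge0_ler_powR; rewrite ?nnegrE ?subr_ge0 ?(ltW p1)// (le_trans t0).
set I := (\int[mu]_(s in _) ((t - s) `^ (- p) * g s)%:E)%E.
have I0 : (0 <= I)%E.
  by apply: integral_ge0 => s /g0 /andP[gs _]; rewrite lee_fin mulr_ge0 ?powR_ge0.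
have IK : (I <= (K * b)%:E)%E.
  apply: (@le_trans _ _ (\int[mu]_(s in `[0%R, t[) (b%:E * ((t - s) `^ (- p))%:E))%E).
    apply: ge0_le_integral => //.
    - by move=> s /g0 /andP[gs _]; rewrite lee_fin mulr_ge0 ?powR_ge0.
    - by apply/measurable_EFinP; exact: measurable_funM.
    - by apply: measurable_funeM; exact/measurable_EFinP.
    by move=> s /g0 /andP[_ gs]; rewrite -EFinM lee_fin mulrC ler_wpM2r ?powR_ge0.
  rewrite ge0_integralZl_EFin; [|exact: mD|by move=> s _; rewrite lee_fin powR_ge0|exact/measurable_EFinP|exact: b0].
  by rewrite mulrC EFinM lee_wpmul2l.
have If : I = (fine I)%:E by rewrite fineK// ge0_fin_numE// (le_lt_trans IK)// ltry.
split => //; first by rewrite fine_ge0//= -lee_fin -If.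
have -> : (\int[mu]_(s in `[0%R, t[) (c * ((t - s) `^ (- p) * (e + g s)))%:E =
    \int[mu]_(s in `[0%R, t[) (c%:E * (e%:E * ((t - s) `^ (- p))%:E + ((t - s) `^ (- p) * g s)%:E)))%E.
  by apply: eq_integral => s _; rewrite -[(e%:E * _)%E]EFinM -EFinD -EFinM mulrDr [e * _]mulrC.
have mkg : measurable_fun (`[0, t[%classic : set RR) (fun s => ((t - s) `^ (- p) * g s)%:E).
  by apply/measurable_EFinP; exact: measurable_funM.
have mke : measurable_fun (`[0, t[%classic : set RR) (fun s => e%:E * ((t - s) `^ (- p))%:E)%E.
  by apply: measurable_funeM; exact/measurable_EFinP.
have h0 s : `[0, t[%classic s -> (0 <= e%:E * ((t - s) `^ (- p))%:E)%E.
  by move=> _; rewrite -EFinM lee_fin mulr_ge0 ?powR_ge0.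
have h1 s : `[0, t[%classic s -> (0 <= ((t - s) `^ (- p) * g s)%:E)%E.
  by move=> /g0 /andP[gs _]; rewrite lee_fin mulr_ge0 ?powR_ge0.
rewrite ge0_integralZl_EFin; [|exact: mD|by move=> s Ds; rewrite adde_ge0 ?h0 ?h1|exact: emeasurable_funD|exact: c0].
rewrite ge0_integralD; [|exact: mD|exact: h0|exact: mke|exact: h1|exact: mkg].
rewrite EFinM lee_wpmul2l// EFinD -If leeD2r//.
rewrite ge0_integralZl_EFin; [|exact: mD|by move=> s _; rewrite lee_fin powR_ge0|exact/measurable_EFinP|exact: e0].
by rewrite mulrC EFinM lee_wpmul2l.
Qed.

(** The shape of a time increment of a convolution: before [s] a difference of kernels, small by the
    factor [e]; after [s] the kernel itself over a short interval. It is used with [q] equal to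
    [theta] for the drift and [2 * theta] for the squared diffusion. *)
Lemma two_piece_integral (T p q s t c e : R) (K := T `^ (1 - p) / (1 - p)) :
  0 <= p < 1 -> 0 < q <= 1 -> 0 <= s -> s <= t -> t <= T -> 0 <= c -> 0 <= e ->
  measurable_fun (`[0, t[%classic : set RR)
    (fun r => if r < s then c * (e * (s - r) `^ (- p)) else c * (t - r) `^ (- (1 - q))) /\
  (\int[mu]_(r in `[0%R, t[) (if r < s then c * (e * (s - r) `^ (- p)) else c * (t - r) `^ (- (1 - q)))%:E <=
    (c * (e * K + (t - s) `^ q / q))%:E)%E.
Proof.
move=> p01 /andP[q0 q1] s0 st tT c0 e0; have /andP[p0 p1] := p01.
pose k (r : R) : R := if r < s then c * (e * (s - r) `^ (- p)) else c * (t - r) `^ (- (1 - q)).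
rewrite -/k; have DE := itv_splitU s0 st.
have m1 : measurable (`[0, s[%classic : set RR) by exact: measurable_itv.
have m2 : measurable (`[s, t[%classic : set RR) by exact: measurable_itv.
have k1 r : `[0, s[%classic r -> k r = c * e * (s - r) `^ (- p).
  by rewrite /= in_itv/= /k => /andP[_ ->]; rewrite mulrA.
have k2 r : `[s, t[%classic r -> k r = c * (t - r) `^ (- (1 - q)).
  by rewrite /= in_itv/= /k => /andP[sr _]; rewrite ltNge sr.
have mk1 : measurable_fun (`[0, s[%classic : set RR) k.
  apply: (@eq_measurable_fun _ _ RR _ _ (fun r : R => c * e * (s - r) `^ (- p))).
    by move=> r /set_mem/k1.
  by apply: measurable_funM => //; exact: measurable_powR_sub.
have mk2 : measurable_fun (`[s, t[%classic : set RR) k.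
  apply: (@eq_measurable_fun _ _ RR _ _ (fun r : R => c * (t - r) `^ (- (1 - q)))).
    by move=> r /set_mem/k2.
  by apply: measurable_funM => //; exact: measurable_powR_sub.
have mk : measurable_fun (`[0, t[%classic : set RR) k.
  by rewrite DE; apply/measurable_funU.
split => //; rewrite [X in (\int[mu]_(r in X) _)%E]DE ge0_integral_setU//; first last.
- rewrite disj_set2E; apply/eqP/seteqP; split => x //=; rewrite !in_itv/=.
  by move=> [/andP[_ h] /andP[]]; rewrite leNgt h.
- by move=> r _; rewrite lee_fin /k; case: ifP => _; rewrite ?mulr_ge0 ?powR_ge0.
- by rewrite -DE; exact/measurable_EFinP.
rewrite mulrDr EFinD; apply: leeD.
  have -> : (\int[mu]_(r in `[0%R, s[) (k r)%:E = \int[mu]_(r in `[0%R, s[) ((c * e)%:E * ((s - r) `^ (- p))%:E))%E.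
    by apply: eq_integral => r /set_mem/k1 kr; rewrite -EFinM -kr.
  rewrite ge0_integralZl_EFin; [|exact: m1|by move=> r _; rewrite lee_fin powR_ge0|
    by apply/measurable_EFinP; exact: measurable_powR_sub|exact: mulr_ge0].
  rewrite mulrA [leRHS]EFinM; apply: lee_wpmul2l; first by rewrite lee_fin mulr_ge0.
  apply: (le_trans (integral_powR p01 s0)); rewrite lee_fin subr0 ler_wpM2r ?invr_ge0 ?subr_ge0 ?(ltW p1)//.
  by apply: ge0_ler_powR; rewrite ?nnegrE ?subr_ge0 ?(ltW p1)// ?(le_trans st)// (le_trans s0) ?(le_trans st).
have -> : (\int[mu]_(r in `[s, t[) (k r)%:E = \int[mu]_(r in `[s, t[) (c%:E * ((t - r) `^ (- (1 - q)))%:E))%E.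
  by apply: eq_integral => r /set_mem/k2 kr; rewrite -EFinM -kr.
rewrite ge0_integralZl_EFin; [|exact: m2|by move=> r _; rewrite lee_fin powR_ge0|
  by apply/measurable_EFinP; exact: measurable_powR_sub|exact: c0].
rewrite EFinM lee_wpmul2l//.
have q01 : 0 <= 1 - q < 1 by apply/andP; split; lra.
apply: (le_trans (integral_powR q01 st)).
by rewrite (_ : 1 - (1 - q) = q)//; lra.
Qed.

Lemma measurable_fun_time (d : measure_display) (Om : measurableType d) (D : set R) (k : R -> \bar R) :
  measurable D -> measurable_fun (D : set RR) k ->
  measurable_fun (D `*` [set: Om]) (fun p : R * Om => k p.1).
Proof.
move=> mD mk; apply: (@measurable_comp _ _ _ (R * Om)%type RR _ D k (D `*` setT) fst) => //.
- by move=> _ [[s w] [/= Ds _] <-].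
by apply: measurable_funTS; exact: measurable_fst.
Qed.

End kernel.

Lemma addrDDD (G : zmodType) (a b c x y z : G) :
  a + b + c - (x + y + z) = (a - x) + (b - y) + (c - z).
Proof. by rewrite !opprD [LHS]addrACA [a + b + _]addrACA. Qed.

(** * Moment estimates while both paths stay in a ball *)

Section moments.
Context {R : realType} {d : measure_display} {Om : measurableType d} {P : probability Om R}.
Context {T : R} (T0 : 0 < T) {Fl : R -> set (set Om)} (Fl_normal : normal_filtration P T Fl).
Context {U : hilbertType R} {W : R -> U -> Om -> R} (W_wiener : cylindrical_wiener P T Fl W).
Context {V : hilbertType R} {I : choiceType} {A : set I} {bas : I -> V}.
Hypotheses (cA : countable A) (bas_onb : onb_family A bas).
Context {X : nat -> R -> Om -> V} (X_adapted : forall N, adapted T Fl (X N)).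
Hypothesis X_cont : forall N w, {within `[0, T], continuous (fun t => X N t w)}.
Context {f : nat -> R -> V -> V} {Phi : nat -> R -> V -> U -> V} {i0 : nat -> R -> Om -> V}.
Hypothesis mild : forall N t, 0 <= t <= T -> exists IF IB : Om -> V,
  [/\ {ae P, forall w, bochner_approx t (fun s => f N (t - s) (X N s w)) (IF w)},
      @ito_approx _ _ _ P Fl U W V t (fun s w u => Phi N (t - s) (X N s w) u) IB &
      {ae P, forall w, X N t w = i0 N t w + IF w + IB w}].
Context {Z : set Om} {rho p theta C : R} {eta : nat -> R}.
Hypothesis FZ : Fl 0 Z.
Hypothesis p01 : 0 <= p < 1.
Hypothesis theta01 : 0 < theta < 2^-1.
Hypothesis C0 : 0 <= C.
Hypothesis rho0 : 0 <= rho.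
Hypothesis eta0 : forall N, 0 <= eta N.
Hypothesis f_diff : forall N x y t, (0 < N)%N -> 0 < t <= T -> `|x| <= rho -> `|y| <= rho ->
  `|f 0%N t x - f N t y| <= C * (t `^ (- p) * (eta N + `|x - y|)).
Hypothesis Phi_diff : forall N x y t, (0 < N)%N -> 0 < t <= T -> `|x| <= rho -> `|y| <= rho ->
  (hs2 (fun u => Phi 0%N t x u - Phi N t y u)%R <=
   (C * (t `^ (- p) * (eta N ^+ 2 + `|x - y| ^+ 2)))%:E)%E.
Hypothesis i_diff : forall N t w, (0 < N)%N -> 0 <= t <= T -> Z w ->
  `|i0 0%N t w - i0 N t w| <= C * eta N.
Hypothesis f_time : forall N x s t, 0 < s -> s <= t -> t <= T -> `|x| <= rho ->
  `|f N t x - f N s x| <= C * ((t - s) `^ theta * s `^ (- p)).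
Hypothesis f_bound : forall N x t, 0 < t <= T -> `|x| <= rho ->
  `|f N t x| <= C * t `^ (- (1 - theta)).
Hypothesis Phi_time : forall N x s t, 0 < s -> s <= t -> t <= T -> `|x| <= rho ->
  (hs2 (fun u => Phi N t x u - Phi N s x u)%R <= (C * ((t - s) `^ (2 * theta) * s `^ (- p)))%:E)%E.
Hypothesis Phi_bound : forall N x t, 0 < t <= T -> `|x| <= rho ->
  (hs2 (Phi N t x) <= (C * t `^ (- (1 - 2 * theta)))%:E)%E.
Hypothesis i_time : forall N s t w, 0 <= s -> s <= t -> t <= T -> Z w ->
  `|i0 N t w - i0 N s w| <= C * (t - s) `^ theta.

Definition small N s : set Om := [set w | `|X 0%N s w| <= rho /\ `|X N s w| <= rho].
Definition cut N : R -> set Om := @running R d Om Z (small N).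
Local Notation E := (ebar P).

Lemma path_open_measurable N t : 0 <= t <= T -> open_measurable (X N t).
Proof.
move=> tT O oO; apply: (Fl_measurable Fl_normal tT); apply: (X_adapted N tT).
exact: sub_sigma_algebra.
Qed.

Lemma small_adapted N s : 0 <= s <= T -> Fl s (small N s).
Proof.
move=> sT; have sF := Fl_sigma_algebra Fl_normal sT.
have h M : Fl s [set w | `|X M s w| <= rho].
  apply: (X_adapted M sT (C := [set v | `|v| <= rho])).
  rewrite -[X in <<s _ >> X]setCK -setTD; apply: sigma_algebraCD.
  apply: sub_sigma_algebra; rewrite openC.
  apply: (@preimage_closed _ _ (fun v : V => `|v|) [set x | x <= rho]); last exact: closed_le.
  by move=> v _; exact: norm_continuous.
rewrite (_ : small N s = \bigcap_n (if n is 0%N then [set w | `|X 0%N s w| <= rho]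
    else [set w | `|X N s w| <= rho])).
  by apply: sigma_algebra_bigcap_nat => // -[|n].
apply/seteqP; split => w; first by move=> [h1 h2] [|n] _.
by move=> H; split; [exact: (H 0%N Logic.I)|exact: (H 1%N Logic.I)].
Qed.

Lemma path_cvg N w (x : nat -> R) s : 0 <= s <= T -> (forall n, 0 <= x n <= T) ->
  x n @[n --> \oo] --> s -> X N (x n) w @[n --> \oo] --> X N s w.
Proof.
move=> sT xT xs; have := cvg_path (@X_cont N w) sT xT xs; apply.
Qed.

Lemma small_closed N w (x : nat -> R) s : 0 <= s <= T -> (forall n, 0 <= x n <= T) ->
  x n @[n --> \oo] --> s -> (forall n, small N (x n) w) -> small N s w.
Proof.
move=> sT xT xs H.
have h M : (forall n, `|X M (x n) w| <= rho) -> `|X M s w| <= rho.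
  move=> HM; have c : `|X M (x n) w| @[n --> \oo] --> `|X M s w|.
    by apply: cvg_norm; exact: path_cvg.
  rewrite -(cvg_lim _ c)//; apply: limr_le; first by apply/cvg_ex; eexists; exact: c.
  exact: nearW.
by split; apply: h => n; case: (H n).
Qed.

Lemma cut_sub N r s : r <= s -> cut N s `<=` cut N r.
Proof. by move=> rs; exact: running_sub. Qed.

Lemma cut_small N s w : 0 <= s -> cut N s w -> small N s w.
Proof. by move=> s0 [_ H]; apply: H; rewrite s0 lexx. Qed.

Lemma cut_adapted N s : 0 <= s <= T -> Fl s (cut N s).
Proof.
by move=> sT; apply: (running_adapted Fl_normal FZ (small_adapted N) (@small_closed N)).
Qed.

Lemma cut_measurable N s : 0 <= s <= T -> measurable (cut N s).
Proof. by move=> sT; exact: (Fl_measurable Fl_normal sT (cut_adapted N sT)). Qed.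

Lemma path_dist_measurable M N s t : 0 <= s <= T -> 0 <= t <= T ->
  measurable_fun setT (fun w => `|X M s w - X N t w|).
Proof.
move=> sT tT; apply: (measurable_norm cA bas_onb) => i; under eq_fun do rewrite innerBr.
by apply: measurable_funB; apply: open_measurable_inner; exact: path_open_measurable.
Qed.

Definition cut_dist N s w : R := \1_(cut N s) w * `|X 0%N s w - X N s w|.

Lemma cut_dist_bounds N s w : 0 <= s -> 0 <= cut_dist N s w <= 2 * rho.
Proof.
move=> s0; rewrite /cut_dist indicE; have [/set_mem h|_] := boolP (w \in cut N s); last first.
  by rewrite mul0r lexx mulr_ge0.
rewrite mul1r normr_ge0/=; have [h1 h2] := cut_small s0 h.
by rewrite (le_trans (ler_normB _ _))// mulr_natl mulr2n lerD.
Qed.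

Lemma cut_dist_in N s w : cut N s w -> cut_dist N s w = `|X 0%N s w - X N s w|.
Proof. by move=> h; rewrite /cut_dist indicE mem_set// mul1r. Qed.

Lemma cut_dist_measurable N s : 0 <= s <= T -> measurable_fun setT (cut_dist N s).
Proof.
move=> sT; apply: measurable_funM; last exact: path_dist_measurable.
by apply: measurable_indic; exact: cut_measurable.
Qed.

Lemma cut_dist_joint N : measurable_fun (`[0, T[ `*` setT) (fun p : R * Om => cut_dist N p.1 p.2).
Proof.
apply: joint_measurable => //; first by move=> s sT; exact: cut_dist_measurable.
move=> s w /andP[s0 sT]; have sT' : 0 <= s <= T by rewrite s0 ltW.
have gT n : 0 <= grid_floor T n s <= T.
  by have [h1 h2 _] := grid_floor_bounds n sT'; rewrite h1 (le_trans h2)// ltW.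
apply: cvgM.
  by apply: (running_grid (@small_closed N)); rewrite s0.
by apply: cvg_norm; apply: cvgB; apply: path_cvg => //; exact: grid_floor_cvg.
Qed.

Let KT : R := T `^ (1 - p) / (1 - p).

Let KT0 : 0 < KT.
Proof. by case/andP: p01 => _ h; rewrite divr_gt0 ?powR_gt0// subr_gt0. Qed.

(** The drift is estimated path by path, whereas the stochastic integral [J] is only named: its size
    is accessible in mean, through the bound on [Psi]. The Lipschitz bounds at times before [t] are
    available because [cut N] decreases. *)
Lemma diff_pathwise N t : (0 < N)%N -> 0 <= t <= T -> exists (Psi : R -> Om -> U -> V) (J : Om -> V),
  [/\ @ito_approx _ _ _ P Fl U W V t Psi J,
      (forall s w, 0 <= s < t -> cut N s w -> (hs2 (Psi s w) <=
        (C * ((t - s) `^ (- p) * (eta N ^+ 2 + cut_dist N s w ^+ 2)))%:E)%E) &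
      {ae P, forall w, cut N t w -> `|X 0%N t w - X N t w| <=
        C * eta N + C * (KT * eta N + fine (\int[lebesgue_measure]_(s in `[0%R, t[)
           ((t - s) `^ (- p) * cut_dist N s w)%:E)%E) + `|J w| }].
Proof.
move=> N0 tT; have /andP[t0 tT'] := tT.
have [IF0 [IB0 [b0 it0 e0]]] := mild 0%N tT; have [IFN [IBN [bN itN eN]]] := mild N tT.
exists (fun s w u => Phi 0%N (t - s) (X 0%N s w) u - Phi N (t - s) (X N s w) u),
  (fun w => IB0 w - IBN w); split; first exact: ito_approxB.
  move=> s w /andP[s0 st] ws; have [h1 h2] := cut_small s0 ws.
  rewrite (cut_dist_in ws); apply: Phi_diff => //; rewrite subr_gt0 st/=.
  by rewrite (le_trans _ tT')// lerBlDr lerDl.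
apply: filterS2 (filterI b0 bN) (filterI e0 eN) => w [{}b0 {}bN] [{}e0 {}eN] wt; rewrite e0 eN.
have ws s : 0 <= s < t -> cut N s w by move=> /andP[_ st]; exact: (cut_sub (ltW st)).
have mh : measurable_fun (`[0, t[%classic : set (measurableTypeR R)) (fun s => cut_dist N s w).
  have mT : measurable_fun (`[0, T[%classic : set (measurableTypeR R)) (fun s => (cut_dist N s w)%:E).
    apply: (measurable_section (f := fun s w => (cut_dist N s w)%:E)) => //.
    by apply/measurable_EFinP; exact: cut_dist_joint.
  apply/measurable_EFinP; apply: measurable_funS mT => //.
  by move=> x /=; rewrite !in_itv/= => /andP[-> h]; exact: lt_le_trans tT'.
have hb s : 0 <= s < t -> 0 <= cut_dist N s w <= 2 * rho by move=> /andP[s0 _]; exact: cut_dist_bounds.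
have r20 : 0 <= 2 * rho by rewrite mulr_ge0.
have [_ _ _ kle] := kernel_affine p01 tT C0 (eta0 N) r20 mh hb.
have bB := bochner_approxB b0 bN.
have IFle : `|IF0 w - IFN w| <= C * (KT * eta N + fine (\int[lebesgue_measure]_(s in `[0%R, t[)
           ((t - s) `^ (- p) * cut_dist N s w)%:E)%E).
  rewrite -lee_fin; apply: le_trans kle.
  have k0 s : (0 <= (C * ((t - s) `^ (- p) * (eta N + `|cut_dist N s w|)))%:E)%E.
    by rewrite lee_fin !mulr_ge0 ?powR_ge0 ?addr_ge0.
  have -> : (\int[lebesgue_measure]_(s in `[0%R, t[) (C * ((t - s) `^ (- p) * (eta N + cut_dist N s w)))%:E =
      \int[lebesgue_measure]_(s in `[0%R, t[) (C * ((t - s) `^ (- p) * (eta N + `|cut_dist N s w|)))%:E)%E.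
    by apply: eq_integral => s /set_mem/= /[!in_itv]/= /hb /andP[h _]; rewrite ger0_norm.
  apply: (bochner_approx_le bB _ k0).
    apply/measurable_EFinP; apply: measurable_funM => //; apply: measurable_funM.
      by apply: measurable_powR_sub; exact: measurable_itv.
    by apply: measurable_funD => //; apply: measurableT_comp.
  move=> s st; have /andP[s0 st'] := st; have [h1 h2] := cut_small s0 (ws s st).
  rewrite lee_fin (cut_dist_in (ws s st)) normr_id; apply: f_diff => //; rewrite subr_gt0 st'/=.
  by rewrite (le_trans _ tT')// lerBlDr lerDl.
have -> : i0 0%N t w + IF0 w + IB0 w - (i0 N t w + IFN w + IBN w) =
    (i0 0%N t w - i0 N t w) + (IF0 w - IFN w) + (IB0 w - IBN w).
  exact: addrDDD.
rewrite (le_trans (ler_normD _ _))// lerD2r (le_trans (ler_normD _ _))// lerD//.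
by apply: i_diff => //; case: wt.
Qed.

(** [ito_moment] yields a Volterra inequality for [v], the moment of the distance restricted to
    [cut N t]: Jensen moves the powers inside the kernel integrals and Tonelli the expectation. The
    radius provides the a priori bound for Gronwall, but affects [L] only through [C]. *)
Lemma diff_moment n : exists2 L : R, 0 <= L & forall N t, (0 < N)%N -> 0 <= t <= T ->
  (ebar P (fun w => (\1_(cut N t) w * (`|X 0%N t w - X N t w| ^+ 2) ^+ n.+1)%R) <=
   (L * (eta N ^+ 2) ^+ n.+1)%:E)%E.
Proof.
have [C1 C10 HC] := ito_moment Fl_normal W_wiener (V := V) n.
pose m := n.+1; pose C2 := 2 * C ^+ 2 * (1 + KT) ^+ 2 + C * (1 + KT).
have KT1 : 0 <= 1 + KT by rewrite addr_ge0// ltW.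
have C20 : 0 <= C2 by rewrite addr_ge0// mulr_ge0// ?sqr_ge0// mulr_ge0// sqr_ge0.
pose C3 := C1 * (2 * (C2 ^+ m * 2 ^+ m)).
have C30 : 0 <= C3 by rewrite !mulr_ge0 ?exprn_ge0// ltW.
pose C4 := C3 * KT ^+ n; have C40 : 0 <= C4 by rewrite mulr_ge0// exprn_ge0// ltW.
have [L L0 HL] := singular_gronwall T0 p01 C40.
exists (L * C3); first exact: mulr_ge0.
move=> N t N0; move: t.
have hb s w : 0 <= s -> 0 <= cut_dist N s w <= 2 * rho by exact: cut_dist_bounds.
have r20 : 0 <= 2 * rho by rewrite mulr_ge0.
pose g s w := cut_dist N s w ^+ 2; pose G s w := g s w ^+ m.
have gb s w : 0 <= s -> 0 <= g s w <= (2 * rho) ^+ 2.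
  move=> s0; have /andP[h1 h2] := hb s w s0.
  by rewrite exprn_ge0//= lerXn2r ?nnegrE.
have Gb s w : 0 <= s -> 0 <= G s w <= ((2 * rho) ^+ 2) ^+ m.
  move=> s0; have /andP[h1 h2] := gb s w s0.
  by rewrite exprn_ge0//= lerXn2r ?nnegrE ?sqr_ge0.
have mgj : measurable_fun (`[0, T[ `*` setT) (fun p : R * Om => g p.1 p.2).
  by apply: measurable_funX; exact: cut_dist_joint.
have mGj : measurable_fun (`[0, T[ `*` setT) (fun p : R * Om => G p.1 p.2) by exact: measurable_funX.
have mG s : 0 <= s <= T -> measurable_fun setT (G s).
  by move=> sT; apply: measurable_funX; apply: measurable_funX; exact: cut_dist_measurable.
have GE t w : \1_(cut N t) w * (`|X 0%N t w - X N t w| ^+ 2) ^+ m = G t w.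
  rewrite /G /g /cut_dist indicE; case: (w \in _); rewrite ?mul1r ?mul0r// expr0n/= /m.
  by rewrite expr0n.
pose v t := fine (E (G t)).
have vE t : 0 <= t <= T -> E (G t) = (v t)%:E /\ 0 <= v t <= ((2 * rho) ^+ 2) ^+ m.
  move=> tT; have /andP[t0 _] := tT.
  have E0 : (0 <= E (G t))%E by apply: ebar_ge0 => w; case/andP: (Gb t w t0).
  have E1 : (E (G t) <= (((2 * rho) ^+ 2) ^+ m)%:E)%E.
    rewrite -(ebar_cst P); apply: le_ebar => //; first exact: mG.
      by move=> w; case/andP: (Gb t w t0).
    by move=> w; case/andP: (Gb t w t0).
  have Ef : E (G t) = (v t)%:E by rewrite fineK// ge0_fin_numE// (le_lt_trans E1)// ltry.
  by split => //; rewrite fine_ge0//= -lee_fin -Ef.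
suff key t : 0 <= t <= T -> v t <= L * (C3 * (eta N ^+ 2) ^+ m).
  move=> t tT; under [X in E X]eq_fun do rewrite GE.
  by have [-> _] := vE t tT; rewrite lee_fin -mulrA; exact: key.
apply: (HL v _ (((2 * rho) ^+ 2) ^+ m)).
- by rewrite mulr_ge0// exprn_ge0// sqr_ge0.
- have G0' s w : `[0, T[%classic s -> (0 <= (G s w)%:E)%E.
    by move=> _; rewrite lee_fin; apply: exprn_ge0; exact: sqr_ge0.
  have mGe : measurable_fun (`[0, T[ `*` setT) (fun q : R * Om => (G q.1 q.2)%:E).
    by apply/measurable_EFinP; exact: mGj.
  have [mE _] := measurable_integral_space P (measurable_itv _) mGe G0'.
  by apply: (measurableT_comp _ mE).
- by move=> r rT; case: (vE r rT).
move=> {}t tT; have /andP[t0 tT'] := tT.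
have [Psi [J [ito hPsi ae]]] := diff_pathwise N0 tT.
have sub : `[0, t[%classic `<=` `[0, T[%classic.
  by move=> x /=; rewrite !in_itv/= => /andP[-> h]; exact: lt_le_trans tT'.
have subT : (`[0, t[%classic `*` [set: Om]) `<=` (`[0, T[%classic `*` [set: Om]).
  by move=> [x w] [/= /sub h _].
have mDT : measurable (`[0, T[%classic `*` [set: Om] : set (R * Om)) by exact: measurableX.
have mkap : measurable_fun (`[0, t[ `*` setT) (fun q : R * Om => (t - q.1) `^ (- p)).
  apply/measurable_EFinP; apply: (measurable_fun_time (k := fun s => ((t - s) `^ (- p))%:E)) => //.
  by apply/measurable_EFinP; exact: measurable_powR_sub.
have mres (a : R -> Om -> R) : measurable_fun (`[0, T[ `*` setT) (fun p : R * Om => a p.1 p.2) ->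
    measurable_fun (`[0, t[ `*` setT) (fun p : R * Om => a p.1 p.2).
  by move=> ma; exact: measurable_funS mDT subT ma.
have mint (a : R -> Om -> R) : measurable_fun (`[0, T[ `*` setT) (fun p : R * Om => a p.1 p.2) ->
    (forall s w, 0 <= s -> 0 <= a s w) ->
    measurable_fun setT (fun w => fine (\int[lebesgue_measure]_(s in `[0%R, t[) ((t - s) `^ (- p) * a s w)%:E)%E).
  move=> ma a0; apply: measurableT_comp => //.
  apply: (measurable_integral_time (f := fun s w => ((t - s) `^ (- p) * a s w)%:E)) => //.
    by apply/measurable_EFinP; apply: measurable_funM; [exact: mkap|exact: mres].
  by move=> s w /= /[!in_itv]/= /andP[s0 _]; rewrite lee_fin mulr_ge0 ?powR_ge0 ?a0.
have msec (a : R -> Om -> R) w : measurable_fun (`[0, T[ `*` setT) (fun p : R * Om => a p.1 p.2) ->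
    measurable_fun (`[0, t[%classic : set (measurableTypeR R)) (fun s => a s w).
  move=> ma; apply/measurable_EFinP.
  apply: (measurable_section (f := fun s w => (a s w)%:E)) => //.
  by apply/measurable_EFinP; exact: mres.
have h0 s w : 0 <= s -> 0 <= cut_dist N s w by move=> s0; case/andP: (hb s w s0).
have g0 s w : 0 <= s -> 0 <= g s w by move=> _; exact: sqr_ge0.
have G0 s w : 0 <= s -> 0 <= G s w by move=> _; apply: exprn_ge0; exact: sqr_ge0.
have hbD w s : `[0, t[%classic s -> 0 <= cut_dist N s w <= 2 * rho.
  by rewrite /= in_itv/= => /andP[s0 _]; exact: hb.
have gbD w s : `[0, t[%classic s -> 0 <= g s w <= (2 * rho) ^+ 2.
  by rewrite /= in_itv/= => /andP[s0 _]; exact: gb.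
have hbI w s : 0 <= s < t -> 0 <= cut_dist N s w <= 2 * rho by move=> /andP[s0 _]; exact: hb.
have gbI w s : 0 <= s < t -> 0 <= g s w <= (2 * rho) ^+ 2 by move=> /andP[s0 _]; exact: gb.
have GbI w s : 0 <= s < t -> 0 <= G s w <= ((2 * rho) ^+ 2) ^+ m by move=> /andP[s0 _]; exact: Gb.
pose qh w := fine (\int[lebesgue_measure]_(s in `[0%R, t[) ((t - s) `^ (- p) * cut_dist N s w)%:E)%E.
pose qg w := fine (\int[lebesgue_measure]_(s in `[0%R, t[) ((t - s) `^ (- p) * g s w)%:E)%E.
pose qG w := fine (\int[lebesgue_measure]_(s in `[0%R, t[) ((t - s) `^ (- p) * G s w)%:E)%E.
have e20 : 0 <= eta N ^+ 2 by exact: sqr_ge0.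
have rr0 : 0 <= (2 * rho) ^+ 2 by exact: sqr_ge0.
have rm0 : 0 <= ((2 * rho) ^+ 2) ^+ m by exact: exprn_ge0.
have kh w := kernel_affine p01 tT C0 (eta0 N) r20 (msec _ w (cut_dist_joint N)) (hbI w).
have kg w := kernel_affine p01 tT C0 e20 rr0 (msec _ w mgj) (gbI w).
have kG w := kernel_affine p01 tT C0 e20 rm0 (msec _ w mGj) (GbI w).
have mD : measurable (`[0, t[%classic : set (measurableTypeR R)) by exact: measurable_itv.
have mk1 : measurable_fun (`[0, t[%classic : set (measurableTypeR R)) (fun s => (t - s) `^ (- p)).
  exact: measurable_powR_sub.
(* Jensen twice, with [KT] bounding the mass of the kernel: once for the square of the drift
   integral, then, in [j2], for the power [m]; everything ends up in [qG]. *)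
have j1 w : qh w ^+ 2 <= KT * qg w.
  have [k1 _ _ _] := kh w; have [_ kf _ _] := kg w.
  have := @kernel_jensen R `[0, t[%classic (fun s => (t - s) `^ (- p)) (fun s => cut_dist N s w)
    KT (2 * rho) 1 mD KT0 mk1 (msec _ w (cut_dist_joint N)) (fun s _ => powR_ge0 _ _) (hbD w) k1.
  by rewrite expr1 kf -EFinM lee_fin.
have j2 w : qg w ^+ m <= KT ^+ n * qG w.
  have [k1 _ _ _] := kh w; have [_ kf _ _] := kG w.
  have := @kernel_jensen R `[0, t[%classic (fun s => (t - s) `^ (- p)) (fun s => g s w)
    KT ((2 * rho) ^+ 2) n mD KT0 mk1 (msec _ w mgj) (fun s _ => powR_ge0 _ _) (gbD w) k1.
  by rewrite kf -EFinM lee_fin.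
have qh0 w : 0 <= qh w by have [_ _ /andP[h _] _] := kh w.
have qg0 w : 0 <= qg w by have [_ _ /andP[h _] _] := kg w.
have qG0 w : 0 <= qG w by have [_ _ /andP[h _] _] := kG w.
have mqh : measurable_fun setT qh by apply: mint => //; exact: cut_dist_joint.
have mqg : measurable_fun setT qg by exact: mint.
have mqG : measurable_fun setT qG by exact: mint.
pose a w := C * eta N + C * (KT * eta N + qh w).
pose kap w := C * (KT * eta N ^+ 2 + qg w).
have a0 w : 0 <= a w.
  by apply: addr_ge0; apply: mulr_ge0 => //; apply: addr_ge0 => //; apply: mulr_ge0 => //; exact: ltW.
have kap0 w : 0 <= kap w.
  by apply: mulr_ge0 => //; apply: addr_ge0 => //; apply: mulr_ge0 => //; exact: ltW.
have ma : measurable_fun setT a.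
  by apply: measurable_funD => //; apply: measurable_funM => //; exact: measurable_funD.
have mka : measurable_fun setT kap by apply: measurable_funM => //; exact: measurable_funD.
pose S w := eta N ^+ 2 + qg w; have S0 w : 0 <= S w by exact: addr_ge0.
have aS w : a w ^+ 2 <= C2 * S w.
  have := j1 w; have := qh0 w; have := qg0 w; have := eta0 N; rewrite /a /C2 /S.
  move: (qh w) (qg w) (eta N) => q1 q2 e e0 q20 q10 hq.
  have hK := KT0; have : 0 <= C * (1 + KT) * (e ^+ 2 + q2).
    by apply: mulr_ge0; [exact: mulr_ge0|exact: addr_ge0 (sqr_ge0 _) _].
  have : (C * e + C * (KT * e + q1)) ^+ 2 <= 2 * C ^+ 2 * (1 + KT) ^+ 2 * (e ^+ 2 + q2).
    have -> : C * e + C * (KT * e + q1) = C * ((1 + KT) * e + q1) by ring.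
    have -> : 2 * C ^+ 2 * (1 + KT) ^+ 2 * (e ^+ 2 + q2) = C ^+ 2 * (2 * ((1 + KT) ^+ 2 * (e ^+ 2 + q2))) by ring.
    rewrite exprMn ler_wpM2l ?sqr_ge0//.
    have h2 : q1 ^+ 2 <= (1 + KT) ^+ 2 * q2.
      rewrite (le_trans hq)// ler_wpM2r//.
      by have := sqr_ge0 KT; rewrite sqrrD expr1n; lra.
    by have := sqr_ge0 ((1 + KT) * e - q1); lra.
  by move=> h1 h2; rewrite [(_ + C * (1 + KT)) * _]mulrDl (le_trans h1)// lerDl.
have kS w : kap w <= C2 * S w.
  have : 0 <= 2 * C ^+ 2 * (1 + KT) ^+ 2 * S w.
    by apply: mulr_ge0 => //; apply: mulr_ge0; rewrite ?sqr_ge0// mulr_ge0// sqr_ge0.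
  have : kap w <= C * (1 + KT) * S w.
    rewrite /kap /S -mulrA ler_wpM2l// mulrDr !mulrDl !mul1r.
    have : 0 <= KT * qg w by rewrite mulr_ge0// ltW.
    by have := e20; lra.
  by rewrite /C2 mulrDl; lra.
have Sm w : S w ^+ m <= 2 ^+ m * ((eta N ^+ 2) ^+ m + KT ^+ n * qG w).
  rewrite /S (le_trans (expr_sum2_le _ _ _))// ler_wpM2l ?exprn_ge0//.
  by rewrite lerD2l; exact: j2.
pose B w := (C2 ^+ m * 2 ^+ m) * ((eta N ^+ 2) ^+ m + KT ^+ n * qG w).
have B0 w : 0 <= B w.
  apply: mulr_ge0; first by rewrite mulr_ge0 ?exprn_ge0.
  by apply: addr_ge0; rewrite ?exprn_ge0// mulr_ge0 ?exprn_ge0// ltW.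
have mB : measurable_fun setT B.
  by apply: measurable_funM => //; apply: measurable_funD => //; exact: measurable_funM.
have mono (x : Om -> R) : (forall w, 0 <= x w) -> (forall w, x w <= C2 * S w) -> forall w, x w ^+ m <= B w.
  move=> x0 xS w; apply: (@le_trans _ _ ((C2 * S w) ^+ m)).
    by rewrite lerXn2r ?nnegrE ?mulr_ge0.
  by rewrite exprMn /B -[X in _ <= X]mulrA ler_wpM2l ?exprn_ge0.
have EB : E B = ((C2 ^+ m * 2 ^+ m)%:E * (((eta N ^+ 2) ^+ m)%:E + (KT ^+ n)%:E * E qG))%E.
  rewrite ebarZ.
  - rewrite ebarD; first by rewrite ebar_cst ebarZ// exprn_ge0// ltW.
    + by [].
    + exact: measurable_funM.
    + by move=> w; rewrite exprn_ge0.
    + by move=> w; rewrite mulr_ge0 ?exprn_ge0// ltW.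
  - by rewrite mulr_ge0 ?exprn_ge0.
  - by apply: measurable_funD => //; exact: measurable_funM.
  - by move=> w; apply: addr_ge0; rewrite ?exprn_ge0// mulr_ge0 ?exprn_ge0// ltW.
have EqG : E qG = (\int[lebesgue_measure]_(s in `[0%R, t[) ((t - s) `^ (- p) * v s)%:E)%E.
  have -> : E qG = (\int[P]_w \int[lebesgue_measure]_(s in `[0%R, t[) ((t - s) `^ (- p) * G s w)%:E)%E.
    by apply: eq_integral => w _; have [_ kf _ _] := kG w; rewrite /qG -kf.
  have mkG : measurable_fun (`[0, t[ `*` setT) (fun q : R * Om => ((t - q.1) `^ (- p) * G q.1 q.2)%:E).
    by apply/measurable_EFinP; apply: measurable_funM; [exact: mkap|exact: mres].
  have kG0 s w : `[0, t[%classic s -> (0 <= ((t - s) `^ (- p) * G s w)%:E)%E.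
    by rewrite /= in_itv/= => /andP[s0 _]; rewrite lee_fin mulr_ge0 ?powR_ge0 ?G0.
  have [_ ->] := measurable_integral_space P (measurable_itv _) mkG kG0.
  apply: eq_integral => s /set_mem/= /[!in_itv]/= /andP[s0 st].
  have sT : 0 <= s <= T by rewrite s0 (le_trans (ltW st)).
  rewrite EFinM -(vE s sT).1 -/(ebar P (fun w => (t - s) `^ (- p) * G s w)) ebarZ ?powR_ge0//.
  - exact: mG.
  - by move=> w; exact: G0.
pose k s w : \bar R := (C * ((t - s) `^ (- p) * (eta N ^+ 2 + g s w)))%:E.
have k0 s w : (0 <= k s w)%E.
  by rewrite lee_fin; apply: mulr_ge0 => //; apply: mulr_ge0; [exact: powR_ge0|exact: addr_ge0 (sqr_ge0 _) (sqr_ge0 _)].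
have mk : measurable_fun (`[0%R, t[ `*` setT) (fun q : R * Om => k q.1 q.2).
  apply/measurable_EFinP; apply: measurable_funM => //; apply: measurable_funM; first exact: mkap.
  by apply: measurable_funD => //; exact: mres.
have H1 s : 0 <= s <= t -> Fl s (cut N s).
  by move=> /andP[s0 st]; apply: cut_adapted; rewrite s0 (le_trans st).
have H2 r s : 0 <= r -> r <= s -> s <= t -> cut N s `<=` cut N r by move=> _ rs _; exact: cut_sub.
have H3 w : 0 <= kap w <= C * (KT * eta N ^+ 2 + KT * (2 * rho) ^+ 2).
  have [_ _ /andP[_ h] _] := kg w.
  by rewrite kap0/= ler_wpM2l// lerD2l.
have H4 w : (\int[lebesgue_measure]_(s in `[0%R, t[) k s w <= (kap w)%:E)%E.
  by have [_ _ _ h] := kg w.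
have tT2 : measurable_fun setT (fun w => `|X 0%N t w - X N t w|) by exact: path_dist_measurable.
have H5 w : cut N t w -> `|X 0%N t w - X N t w| <= 2 * rho.
  by move=> wt; rewrite -(cut_dist_in wt); case/andP: (hb t w t0).
have := HC t Psi J tT ito (cut N) k kap (fun w => `|X 0%N t w - X N t w|) a
  (C * (KT * eta N ^+ 2 + KT * (2 * rho) ^+ 2)) (2 * rho) H1 H2 mk k0 hPsi mka H3 H4 tT2 ma
  (fun w => normr_ge0 _) a0 H5 ae.
rewrite -/m; under eq_integral do rewrite GE; rewrite -/(ebar P (G t)) (vE t tT).1 => H.
apply: (le_trans H).
have mcut : measurable_fun setT (\1_(cut N t) : Om -> R) by apply: measurable_indic; exact: cut_measurable.
have F1 : (ebar P (fun w => (\1_(cut N t) w * (a w ^+ 2) ^+ m)%R) <= E B)%E.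
  apply: le_ebar => //.
  - by apply: measurable_funM => //; apply: measurable_funX; exact: measurable_funX.
  - by move=> w; rewrite mulr_ge0// exprn_ge0// sqr_ge0.
  - move=> w; apply: (@le_trans _ _ ((a w ^+ 2) ^+ m)).
      by rewrite indicE; case: (_ \in _); rewrite ?mul1r ?mul0r ?exprn_ge0 ?sqr_ge0.
    by apply: (mono (fun w => a w ^+ 2)) => // w'; exact: sqr_ge0.
have F2 : (ebar P (fun w => (kap w ^+ m)%R) <= E B)%E.
  apply: le_ebar => //; first exact: measurable_funX.
    by move=> w; rewrite exprn_ge0.
  by apply: mono.
apply: (@le_trans _ _ (C1%:E * (E B + E B))%E).
  by apply: lee_wpmul2l; [rewrite lee_fin ltW|exact: leeD].
have Qb : (E qG <= (KT * ((2 * rho) ^+ 2) ^+ m)%:E)%E.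
  rewrite -(ebar_cst P); apply: le_ebar => // w; last by have [_ _ /andP[_ h] _] := kG w.
have Q0 : (0 <= E qG)%E by exact: ebar_ge0.
have [Q QE] : exists Q : R, E qG = Q%:E.
  by exists (fine (E qG)); rewrite fineK// ge0_fin_numE// (le_lt_trans Qb)// ltry.
rewrite -EqG EB QE -!(EFinM, EFinD) lee_fin /C4 /C3 -!/m.
by rewrite le_eqVlt; apply/orP; left; apply/eqP; ring.
Qed.

(** [cut N] confines both paths, so a single statement covers the exact solution and the [N]-th
    approximation on one common event. *)
Lemma time_pathwise N M s t : M = 0%N \/ M = N -> 0 <= s -> s <= t -> t <= T ->
  exists (Psi : R -> Om -> U -> V) (J : Om -> V),
  [/\ @ito_approx _ _ _ P Fl U W V t Psi J,
      (forall r w, 0 <= r < t -> cut N r w -> (hs2 (Psi r w) <=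
        (if r < s then C * ((t - s) `^ (2 * theta) * (s - r) `^ (- p))
         else C * (t - r) `^ (- (1 - 2 * theta)))%:E)%E) &
      {ae P, forall w, cut N t w -> `|X M t w - X M s w| <=
        C * (t - s) `^ theta + C * ((t - s) `^ theta * KT + (t - s) `^ theta / theta) + `|J w| }].
Proof.
move=> MN s0 st tT; have /andP[th0 th1] := theta01.
have Xrho r w : 0 <= r -> cut N r w -> `|X M r w| <= rho.
  by move=> r0 /(cut_small r0)[h1 h2]; case: MN => ->.
have t0 := le_trans s0 st; have sT := le_trans st tT.
have tT' : 0 <= t <= T by rewrite t0.
have sT' : 0 <= s <= T by rewrite s0.
have st' : 0 <= s <= t by rewrite s0.
have [IFt [IBt [bt itt et]]] := mild M tT'; have [IFs [IBs [bs its es]]] := mild M sT'.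
exists (fun r w u => Phi M (t - r) (X M r w) u - (if r < s then Phi M (s - r) (X M r w) u else 0)),
  (fun w => IBt w - IBs w); split.
- exact: ito_approxB itt (ito_approx_widen st' its).
- move=> r w /andP[r0 rt] wr; have h := Xrho r w r0 wr; have [rs|rs] := ltP r s.
    rewrite (_ : t - s = (t - r) - (s - r)); last by rewrite opprB addrA subrK.
    apply: Phi_time => //; rewrite ?subr_gt0 ?lerD2r//.
    by rewrite (le_trans _ tT)// lerBlDr lerDl.
  rewrite (_ : (fun u => _) = Phi M (t - r) (X M r w)); last by apply/funext => u; rewrite subr0.
  by apply: Phi_bound => //; rewrite subr_gt0 rt (le_trans _ tT)// lerBlDr lerDl.
apply: filterS2 (filterI bt bs) (filterI et es) => w [{}bt {}bs] [{}et {}es] wt; rewrite et es.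
have th01 : 0 < theta <= 1 by rewrite th0; lra.
have [mk kle] := two_piece_integral p01 th01 s0 st tT C0 (powR_ge0 (t - s) theta).
have bB := bochner_approxB bt (bochner_approx_widen st' bs).
have IFle : `|IFt w - IFs w| <= C * ((t - s) `^ theta * KT + (t - s) `^ theta / theta).
  rewrite -lee_fin; apply: le_trans kle.
  apply: (bochner_approx_le bB); first exact/measurable_EFinP.
    by move=> r; rewrite lee_fin; case: ifP => _; rewrite ?mulr_ge0 ?powR_ge0.
  move=> r /andP[r0 rt]; have h := Xrho r w r0 (cut_sub (ltW rt) wt).
  rewrite lee_fin; have [rs|rs] := ltP r s.
    rewrite (_ : t - s = (t - r) - (s - r)); last by rewrite opprB addrA subrK.
    apply: f_time => //; rewrite ?subr_gt0 ?lerD2r//.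
    by rewrite (le_trans _ tT)// lerBlDr lerDl.
  by rewrite subr0; apply: f_bound => //; rewrite subr_gt0 rt (le_trans _ tT)// lerBlDr lerDl.
rewrite addrDDD; apply: (le_trans (ler_normD _ _)); rewrite lerD2r.
apply: (le_trans (ler_normD _ _)); apply: lerD => //.
by apply: i_time => //; case: wt.
Qed.

(** On the ball the coefficients are bounded, so the quantities [a] and [kap] passed to [ito_moment]
    are deterministic and no Gronwall step occurs. *)
Lemma time_moment n : exists2 L : R, 0 <= L & forall N M s t, M = 0%N \/ M = N ->
  0 <= s -> s <= t -> t <= T ->
  (ebar P (fun w => (\1_(cut N t) w * (`|X M t w - X M s w| ^+ 2) ^+ n.+1)%R) <=
   (L * ((t - s) `^ (2 * theta)) ^+ n.+1)%:E)%E.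
Proof.
have [C1 C10 HC] := ito_moment Fl_normal W_wiener (V := V) n.
have /andP[th0 th1] := theta01; have K0 := KT0.
pose m := n.+1; pose Ca := C * (1 + KT + theta^-1); pose Ck := C * (KT + (2 * theta)^-1).
have Ca0 : 0 <= Ca by rewrite mulr_ge0// !addr_ge0// ?invr_ge0 ltW.
have Ck0 : 0 <= Ck by rewrite mulr_ge0// addr_ge0 ?(ltW K0)// invr_ge0 mulr_ge0// ltW.
exists (C1 * ((Ca ^+ 2) ^+ m + Ck ^+ m)).
  by rewrite mulr_ge0 ?(ltW C10)// addr_ge0 ?exprn_ge0 ?sqr_ge0.
move=> N M s t MN s0 st tT; have t0 := le_trans s0 st.
have tT' : 0 <= t <= T by rewrite t0.
have sT' : 0 <= s <= T by rewrite s0 (le_trans st).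
have [Psi [J [ito hPsi ae]]] := time_pathwise MN s0 st tT.
pose e1 := (t - s) `^ theta; pose e2 := (t - s) `^ (2 * theta).
have e10 : 0 <= e1 by exact: powR_ge0.
have e20 : 0 <= e2 by exact: powR_ge0.
have e12 : e1 ^+ 2 = e2.
  by rewrite /e1 /e2 mulrC powRrM -powR_mulrn ?powR_ge0.
have th01 : 0 < 2 * theta <= 1 by apply/andP; split; lra.
have [mk kle] := two_piece_integral p01 th01 s0 st tT C0 e20.
pose k (r : R) (w : Om) : \bar R := (if r < s then C * (e2 * (s - r) `^ (- p)) else C * (t - r) `^ (- (1 - 2 * theta)))%:E.
have mkj : measurable_fun (`[0%R, t[ `*` setT) (fun q : R * Om => k q.1 q.2).
  apply: (measurable_fun_time (k := fun r : R => (if r < s then C * (e2 * (s - r) `^ (- p)) else C * (t - r) `^ (- (1 - 2 * theta)))%:E)) => //.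
  exact/measurable_EFinP.
have k0 r w : (0 <= k r w)%E.
  by rewrite /k lee_fin; case: ifP => _; rewrite ?mulr_ge0 ?powR_ge0.
pose kap (w : Om) : R := Ck * e2; pose a (w : Om) : R := Ca * e1.
have H1 r : 0 <= r <= t -> Fl r (cut N r).
  by move=> /andP[r0 rt]; apply: cut_adapted; rewrite r0 (le_trans rt).
have H2 q r : 0 <= q -> q <= r -> r <= t -> cut N r `<=` cut N q by move=> _ qr _; exact: cut_sub.
have kap0 w : 0 <= kap w <= Ck * e2 by rewrite /kap lexx mulr_ge0.
have H4 w : (\int[lebesgue_measure]_(r in `[0%R, t[) k r w <= (kap w)%:E)%E.
  apply: (le_trans kle); rewrite lee_fin /kap /Ck -/e2 -/KT -[_ * _ * e2]mulrA ler_wpM2l//.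
  by rewrite le_eqVlt; apply/orP; left; apply/eqP; ring.
have Xrho r w : 0 <= r -> cut N r w -> `|X M r w| <= rho.
  by move=> r0 /(cut_small r0)[h1 h2]; case: MN => ->.
have H5 w : cut N t w -> `|X M t w - X M s w| <= 2 * rho.
  move=> wt; rewrite (le_trans (ler_normB _ _))// mulr_natl mulr2n lerD ?Xrho//.
  exact: cut_sub wt.
have ae' : {ae P, forall w, cut N t w -> `|X M t w - X M s w| <= a w + `|J w| }.
  apply: filterS ae => w H wt; apply: (le_trans (H wt)); rewrite lerD2r /a /Ca -/e1.
  by rewrite le_eqVlt; apply/orP; left; apply/eqP; ring.
have := HC t Psi J tT' ito (cut N) k kap (fun w => `|X M t w - X M s w|) a (Ck * e2) (2 * rho)
  H1 H2 mkj k0 hPsi (measurable_cst _) kap0 H4 (path_dist_measurable M M tT' sT') (measurable_cst _)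
  (fun w => normr_ge0 _) (fun w => mulr_ge0 Ca0 e10) H5 ae'.
rewrite -/m => H; apply: (le_trans H).
apply: (@le_trans _ _ (C1%:E * (((Ca ^+ 2 * e2) ^+ m)%:E + ((Ck * e2) ^+ m)%:E))%E).
  apply: lee_wpmul2l; first by rewrite lee_fin ltW.
  have mcut : measurable_fun setT (\1_(cut N t) : Om -> R) by apply: measurable_indic; exact: cut_measurable.
  apply: leeD; last first.
    apply: (@le_trans _ _ (ebar P (fun=> (Ck * e2) ^+ m))); [exact: lexx|by rewrite ebar_cst].
  rewrite -(ebar_cst P ((Ca ^+ 2 * e2) ^+ m)).
  change (ebar P (fun w => (\1_(cut N t) w * (a w ^+ 2) ^+ m)%R) <= ebar P (fun=> ((Ca ^+ 2 * e2) ^+ m)%R))%E.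
  apply: le_ebar => //.
  - exact: (measurable_funM mcut (measurable_cst (((Ca * e1) ^+ 2) ^+ m))).
  - by move=> w; rewrite mulr_ge0// exprn_ge0// sqr_ge0.
  - move=> w; rewrite /a [(Ca * e1) ^+ 2]exprMn e12 indicE; case: (_ \in _); rewrite ?mul1r ?mul0r//.
    by rewrite exprn_ge0// mulr_ge0// sqr_ge0.
by rewrite -EFinD -EFinM lee_fin !exprMn -mulrDl mulrA.
Qed.

Lemma dist2_measurable N s t : 0 <= t <= T -> 0 <= s <= T ->
  measurable_fun setT (fun w => `|(X 0%N t w - X N t w) - (X 0%N s w - X N s w)|).
Proof.
move=> sT tT; apply: (measurable_norm cA bas_onb) => i; under eq_fun do rewrite !innerBr.
by apply: measurable_funB; apply: measurable_funB; apply: open_measurable_inner; exact: path_open_measurable.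
Qed.

Lemma norm_sub_moment (x y : V) m :
  (`|x - y| ^+ 2) ^+ m <= 4 ^+ m * ((`|x| ^+ 2) ^+ m + (`|y| ^+ 2) ^+ m).
Proof.
apply: (@le_trans _ _ ((2 * `|x| ^+ 2 + 2 * `|y| ^+ 2) ^+ m)).
  rewrite lerXn2r ?nnegrE ?addr_ge0 ?mulr_ge0 ?sqr_ge0//.
  have h : `|x - y| ^+ 2 <= (`|x| + `|y|) ^+ 2 by rewrite lerXn2r ?nnegrE ?addr_ge0// ler_normB.
  by rewrite (le_trans h)//; have := sqr_ge0 (`|x| - `|y|); lra.
rewrite (le_trans (expr_sum2_le _ _ _)) ?mulr_ge0 ?sqr_ge0//.
have e4 : 2 ^+ m * 2 ^+ m = 4 ^+ m :> R by rewrite -exprMn -natrM.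
by rewrite ![(2 * _) ^+ m]exprMn -mulrDr mulrA e4.
Qed.

(** Two bounds for one moment: time regularity without a rate, by separating the two processes, and
    the rate without regularity, by separating the two times. A geometric mean of the two will carry
    a share of each. *)
Lemma stopped_increment_moment n : exists2 L : R, 0 <= L & forall N s t, (0 < N)%N ->
  0 <= s -> s <= t -> t <= T ->
  let e := ebar P (fun w => \1_(cut N t) w *
    (`|(X 0%N t w - X N t w) - (X 0%N s w - X N s w)| ^+ 2) ^+ n.+1) in
  (e <= (L * ((t - s) `^ (2 * theta)) ^+ n.+1)%:E)%E /\ (e <= (L * (eta N ^+ 2) ^+ n.+1)%:E)%E.
Proof.
have [L1 L10 H1] := diff_moment n; have [L2 L20 H2] := time_moment n; pose m := n.+1.
exists (4 ^+ m * (2 * L1 + 2 * L2)); first by rewrite mulr_ge0 ?exprn_ge0// addr_ge0// mulr_ge0.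
move=> N s t N0 s0 st tT e; have t0 := le_trans s0 st; have sT := le_trans st tT.
have tT' : 0 <= t <= T by rewrite t0.
have sT' : 0 <= s <= T by rewrite s0.
have ind0 q w : 0 <= (\1_(cut N q) w : R) by rewrite indicE.
have mcut q : 0 <= q <= T -> measurable_fun setT (\1_(cut N q) : Om -> R).
  by move=> qT; apply: measurable_indic; exact: cut_measurable.
have mM q M1 M2 r1 r2 : 0 <= q <= T -> 0 <= r1 <= T -> 0 <= r2 <= T ->
    measurable_fun setT (fun w => \1_(cut N q) w * (`|X M1 r1 w - X M2 r2 w| ^+ 2) ^+ m).
  move=> qT r1T r2T; apply: measurable_funM; first exact: mcut.
  by apply: measurable_funX; apply: measurable_funX; exact: path_dist_measurable.
have p0 q M1 M2 r1 r2 w : 0 <= \1_(cut N q) w * (`|X M1 r1 w - X M2 r2 w| ^+ 2) ^+ m.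
  by rewrite mulr_ge0// exprn_ge0// sqr_ge0.
have me : measurable_fun setT (fun w => \1_(cut N t) w *
    (`|(X 0%N t w - X N t w) - (X 0%N s w - X N s w)| ^+ 2) ^+ m).
  apply: measurable_funM; first exact: mcut.
  apply: measurable_funX; apply: measurable_funX.
  by apply: dist2_measurable.
have pe w : 0 <= \1_(cut N t) w * (`|(X 0%N t w - X N t w) - (X 0%N s w - X N s w)| ^+ 2) ^+ m.
  by rewrite mulr_ge0// exprn_ge0// sqr_ge0.
have L120 : 2 * L1 <= 2 * L1 + 2 * L2 by rewrite lerDl mulr_ge0.
have L210 : 2 * L2 <= 2 * L1 + 2 * L2 by rewrite lerDr mulr_ge0.
have ex0 (x : R) : 0 <= x -> 0 <= x ^+ m by move=> x0; rewrite exprn_ge0.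
split.
- apply: (@le_trans _ _ (ebar P (fun w => 4 ^+ m * (\1_(cut N t) w * (`|X 0%N t w - X 0%N s w| ^+ 2) ^+ m +
      \1_(cut N t) w * (`|X N t w - X N s w| ^+ 2) ^+ m)))).
    apply: le_ebar => //.
    + by apply: measurable_funM => //; apply: measurable_funD; apply: mM.
    + by move=> w; rewrite subrBB -mulrDr mulrCA ler_wpM2l// norm_sub_moment.
  rewrite ebarZ; [|exact: exprn_ge0|by apply: measurable_funD; apply: mM|by move=> w; exact: addr_ge0].
  rewrite ebarD; [|exact: mM|exact: mM|by []|by []].
  apply: (@le_trans _ _ ((4 ^+ m)%:E * ((L2 * ((t - s) `^ (2 * theta)) ^+ m)%:E + (L2 * ((t - s) `^ (2 * theta)) ^+ m)%:E))%E).
    apply: lee_wpmul2l; first by rewrite lee_fin exprn_ge0.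
    by apply: leeD; apply: H2 => //; [left|right].
  rewrite -EFinD -EFinM lee_fin -mulrA ler_wpM2l ?exprn_ge0//.
  by rewrite -mulrDl ler_wpM2r ?ex0 ?powR_ge0//; lra.
- apply: (@le_trans _ _ (ebar P (fun w => 4 ^+ m * (\1_(cut N t) w * (`|X 0%N t w - X N t w| ^+ 2) ^+ m +
      \1_(cut N s) w * (`|X 0%N s w - X N s w| ^+ 2) ^+ m)))).
    apply: le_ebar => //.
    + by apply: measurable_funM => //; apply: measurable_funD; apply: mM.
    move=> w; apply: (@le_trans _ _ (4 ^+ m * (\1_(cut N t) w * (`|X 0%N t w - X N t w| ^+ 2) ^+ m +
      \1_(cut N t) w * (`|X 0%N s w - X N s w| ^+ 2) ^+ m))).
      by rewrite -mulrDr mulrCA ler_wpM2l// norm_sub_moment.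
    rewrite ler_wpM2l ?exprn_ge0// lerD2l ler_wpM2r ?exprn_ge0 ?sqr_ge0//.
    rewrite !indicE ler_nat; case: (boolP (w \in cut N t)) => // /set_mem wt.
    by rewrite mem_set//; exact: cut_sub wt.
  rewrite ebarZ; [|exact: exprn_ge0|by apply: measurable_funD; apply: mM|by move=> w; exact: addr_ge0].
  rewrite ebarD; [|exact: mM|exact: mM|by []|by []].
  apply: (@le_trans _ _ ((4 ^+ m)%:E * ((L1 * (eta N ^+ 2) ^+ m)%:E + (L1 * (eta N ^+ 2) ^+ m)%:E))%E).
    apply: lee_wpmul2l; first by rewrite lee_fin exprn_ge0.
    by apply: leeD; apply: H1.
  rewrite -EFinD -EFinM lee_fin -mulrA ler_wpM2l ?exprn_ge0//.
  by rewrite -mulrDl ler_wpM2r ?ex0 ?sqr_ge0//; lra.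
Qed.

Lemma geometric_mean_ge_min (a b x : R) : 0 <= a -> 0 <= b -> 0 <= x <= 1 ->
  Num.min a b <= a `^ (1 - x) * b `^ x.
Proof.
move=> a0 b0 /andP[x0 x1]; pose c := Num.min a b.
have c0 : 0 <= c by rewrite le_min a0.
have -> : Num.min a b = c `^ (1 - x) * c `^ x.
  by rewrite -powRD ?subrK ?powRr1// oner_eq0.
by apply: ler_pM; rewrite ?powR_ge0//; apply: ge0_ler_powR; rewrite ?nnegrE ?subr_ge0 ?ge_min ?lexx ?orbT.
Qed.

Lemma increment_moment_interpolated n x : 0 <= x <= 1 -> exists2 L : R, 0 <= L &
  forall N s t, (0 < N)%N -> 0 <= s -> s <= t -> t <= T ->
  (ebar P (fun w => (\1_(cut N t) w * (`|(X 0%N t w - X N t w) - (X 0%N s w - X N s w)| ^+ 2) ^+ n.+1)%R) <=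
   (L * (((eta N ^+ 2) ^+ n.+1) `^ (1 - x) * (((t - s) `^ (2 * theta)) ^+ n.+1) `^ x))%:E)%E.
Proof.
move=> x01; have [L L0 H] := stopped_increment_moment n; exists L => // N s t N0 s0 st tT.
have [h1 h2] := H N s t N0 s0 st tT.
have a0 : 0 <= (eta N ^+ 2) ^+ n.+1 by rewrite exprn_ge0// sqr_ge0.
have b0 : 0 <= ((t - s) `^ (2 * theta)) ^+ n.+1 by rewrite exprn_ge0// powR_ge0.
apply: (@le_trans _ _ (L * Num.min ((eta N ^+ 2) ^+ n.+1) (((t - s) `^ (2 * theta)) ^+ n.+1))%:E).
  by rewrite minEle; case: ifP.
by rewrite lee_fin ler_wpM2l// geometric_mean_ge_min.
Qed.

End moments.

(** * Dyadic chaining *)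

Section chaining.
Context {R : realType} {V : hilbertType R} {T : R} (T0 : 0 < T).

Let h n : R := T / 2 ^+ n.
Let h0 n : 0 < h n. Proof. by rewrite divr_gt0// exprn_gt0. Qed.
Let hS n : h n = 2 * h n.+1.
Proof. by rewrite /h exprS; field; rewrite expf_neq0. Qed.

Definition dyadic_index n (t : R) : nat := Num.truncn (t / h n).

Lemma dyadic_index_itv n t : 0 <= t ->
  (dyadic_index n t)%:R * h n <= t /\ t < (dyadic_index n t).+1%:R * h n.
Proof.
move=> t0; have /truncn_itv/andP[h1 h2] : 0 <= t / h n by rewrite divr_ge0// ltW.
by split; [rewrite -ler_pdivlMr|rewrite -ltr_pdivrMr].
Qed.

Lemma dyadic_index_uniq n t k : 0 <= t -> k%:R * h n <= t -> t < k.+1%:R * h n -> dyadic_index n t = k.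
Proof.
move=> t0 h1 h2; apply/eqP; rewrite truncn_eq; last by rewrite divr_ge0// ltW.
by apply/andP; split; [rewrite ler_pdivlMr|rewrite ltr_pdivrMr].
Qed.

Section path.
Context {y : R -> V} (y_cont : {within `[0, T], continuous y}).
Context {q kap tau : R} (q01 : 0 < q < 1) (kap0 : 0 <= kap) (tau01 : 0 <= tau <= T).
Hypothesis incr : forall n i, i.+1%:R * h n <= tau ->
  `|y (i.+1%:R * h n) - y (i%:R * h n)| <= kap * q ^+ n.

Let fl n t := (dyadic_index n t)%:R * h n.

(** Halving the mesh keeps the dyadic floor of [t] or moves it by one new mesh width. *)
Lemma dyadic_step n t : 0 <= t <= tau -> `|y (fl n.+1 t) - y (fl n t)| <= kap * q ^+ n.+1.
Proof.
move=> /andP[t0 tt]; have /andP[q0 _] := q01.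
have [a1 a2] := dyadic_index_itv n t0; set k := dyadic_index n t in a1 a2.
have e1 : fl n t = (2 * k)%:R * h n.+1 by rewrite /fl hS natrM -/k; ring.
have [lt1|ge1] := ltP t ((2 * k).+1%:R * h n.+1).
  have ke : dyadic_index n.+1 t = (2 * k)%N.
    by apply: dyadic_index_uniq => //; rewrite natrM -mulrA mulrCA -hS.
  by rewrite e1 /fl ke subrr normr0 mulr_ge0// exprn_ge0// ltW.
have ke' : dyadic_index n.+1 t = (2 * k).+1.
  apply: dyadic_index_uniq => //; rewrite (_ : (2 * k).+2 = (2 * k.+1)%N); last by lia.
  by rewrite natrM -mulrA mulrCA -hS.
rewrite e1 /fl ke'; apply: incr; exact: le_trans tt.
Qed.

(** The steps form a geometric series, and the floors converge to [t], so continuity of the path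
    identifies the limit. *)
Lemma dyadic_limit n t : 0 <= t <= tau -> `|y t - y (fl n t)| <= kap * (q ^+ n / (1 - q)).
Proof.
move=> tt; have /andP[q0 q1] := q01; have /andP[t0 tt'] := tt; have /andP[_ tT] := tau01.
have q1' : 0 < 1 - q by rewrite subr_gt0.
have flT k : 0 <= fl k t <= T.
  have [a1 _] := dyadic_index_itv k t0; rewrite /fl mulr_ge0 ?(ltW (h0 _))//=.
  by rewrite (le_trans a1)// (le_trans tt').
have step j : `|y (fl (n + j) t) - y (fl n t)| <= kap * ((q ^+ n.+1 - q ^+ (n + j).+1) / (1 - q)).
  elim: j => [|j IH]; first by rewrite addn0 !subrr normr0 mul0r mulr0.
  rewrite -(subrK (y (fl (n + j) t)) (y (fl (n + j.+1) t))) -addrA.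
  rewrite (le_trans (ler_normD _ _))// addnS.
  have := dyadic_step (n + j) tt; move: IH; set A := `|_ - y (fl n t)|; set B := `|_ - _| => hA hB.
  rewrite (le_trans (lerD hB hA))// -mulrDr ler_wpM2l// le_eqVlt; apply/orP; left; apply/eqP.
  by rewrite [q ^+ (n + j).+2]exprS; field; rewrite gt_eqF.
have cfl : fl (n + j) t @[j --> \oo] --> t.
  apply/cvgrPdist_le => e e0; exists (Num.truncn (T / e)) => // j /= hj.
  have [a1 a2] := dyadic_index_itv (n + j) t0; rewrite /fl ger0_norm ?subr_ge0//.
  rewrite -natr1 mulrDl mul1r in a2; have : h (n + j) <= e.
    rewrite /h ler_pdivrMr ?exprn_gt0// mulrC -ler_pdivrMr//.
    rewrite (le_trans (ltW (truncnS_gt _)))//.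
    apply: (@le_trans _ _ (j.+1)%:R); first by rewrite ler_nat.
    rewrite -natrX ler_nat (leq_trans (ltn_expl j (ltnSn 1)))// leq_exp2l//.
    exact: leq_addl.
  by move: a2; lra.
have tT' : 0 <= t <= T by rewrite t0 (le_trans tt').
have cy := cvg_path y_cont tT' (fun j => flT (n + j)%N) cfl.
have cn : `|y (fl (n + j) t) - y (fl n t)| @[j --> \oo] --> `|y t - y (fl n t)|.
  by apply: cvg_norm; apply: cvgB => //; exact: cvg_cst.
rewrite -(cvg_lim _ cn)//; apply: limr_le; first by apply/cvg_ex; eexists; exact: cn.
apply: nearW => j; rewrite (le_trans (step j))// ler_wpM2l// ler_wpM2r ?invr_ge0 ?(ltW q1')//.
rewrite lerBlDr (@le_trans _ _ (q ^+ n))//; last by rewrite lerDl exprn_ge0// ltW.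
by rewrite exprS ler_piMl ?exprn_ge0 ?(ltW q0)// ltW.
Qed.

(** Times no further apart than the mesh have equal or adjacent floors; the path goes from [t] down
    to its floor, across, and up to [s], which accounts for the factor 3. *)
Lemma dyadic_chaining s t n : 0 <= s -> s <= t -> t <= tau -> t - s <= h n ->
  `|y t - y s| <= kap * (3 / (1 - q) * q ^+ n).
Proof.
move=> s0 st tt ts; have /andP[q0 q1] := q01; have t0 := le_trans s0 st.
have q1' : 0 < 1 - q by rewrite subr_gt0.
have A : `|y t - y (fl n t)| <= kap * (q ^+ n / (1 - q)) by apply: dyadic_limit; rewrite t0.
have B : `|y s - y (fl n s)| <= kap * (q ^+ n / (1 - q)).
  by apply: dyadic_limit; rewrite s0 (le_trans st).
have Cc : `|y (fl n t) - y (fl n s)| <= kap * (q ^+ n / (1 - q)).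
  apply: (@le_trans _ _ (kap * q ^+ n)); last first.
    by rewrite ler_wpM2l// ler_peMr ?exprn_ge0 ?(ltW q0)// invf_ge1// gerBl ltW.
  have [a1 a2] := dyadic_index_itv n s0; set k := dyadic_index n s in a1 a2.
  have [lt1|ge1] := ltP t (k.+1%:R * h n).
    have ke : dyadic_index n t = k by apply: dyadic_index_uniq => //; exact: le_trans a1 st.
    by rewrite /fl ke subrr normr0 mulr_ge0// exprn_ge0// ltW.
  have ke : dyadic_index n t = k.+1.
    apply: dyadic_index_uniq => //; rewrite -natr1 mulrDl mul1r.
    by move: a2 ts; lra.
  by rewrite /fl ke -/k; apply: incr; exact: le_trans tt.
have -> : y t - y s = (y t - y (fl n t)) + (y (fl n t) - y (fl n s)) - (y s - y (fl n s)).
  by rewrite addrA subrK opprB addrA subrK.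
rewrite (le_trans (ler_normB _ _))// (le_trans (lerD (ler_normD _ _) (lexx _)))//.
rewrite (le_trans (lerD (lerD A Cc) B))//.
by rewrite le_eqVlt; apply/orP; left; apply/eqP; field; rewrite gt_eqF.
Qed.

End path.

(** [K] does not depend on the path, on [kap] or on [tau]; uniformity in [N] and validity up to a
    random time rest on this. The level [n] is the least one whose next mesh falls below [t - s]. *)
Lemma holder_of_dyadic (e : R) : 0 < e -> exists2 K : R, 0 <= K &
  forall (y : R -> V) (kap tau : R), {within `[0, T], continuous y} -> 0 <= kap -> 0 <= tau <= T ->
  (forall n i, i.+1%:R * (T / 2 ^+ n) <= tau ->
    `|y (i.+1%:R * (T / 2 ^+ n)) - y (i%:R * (T / 2 ^+ n))| <= kap * (2 `^ (- e)) ^+ n) ->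
  forall s t, 0 <= s -> s <= t -> t <= tau -> `|y t - y s| <= kap * (K * (t - s) `^ e).
Proof.
move=> e0; pose q : R := 2 `^ (- e).
have q01 : 0 < q < 1.
  rewrite powR_gt0//= /q powRN invf_lt1 ?powR_gt0//.
  by rewrite /powR pnatr_eq0/= -[ltLHS]expR0 ltr_expR mulr_gt0// ln_gt0 ?ltr1n.
have /andP[q0 q1] := q01; have q1' : 0 < 1 - q by rewrite subr_gt0.
have K0 : 0 <= 3 / (1 - q) * (2 / T) `^ e by rewrite mulr_ge0 ?powR_ge0// divr_ge0// ltW.
exists (3 / (1 - q) * (2 / T) `^ e) => //.
move=> y kap tau cy kap0 tau01 incr s t s0 st tt.
have [ts|ts] := leP t s.
  have -> : t = s by apply/eqP; rewrite eq_le ts.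
  by rewrite subrr normr0 mulr_ge0// mulr_ge0// powR_ge0.
have ts0 : 0 < t - s by rewrite subr_gt0.
have tT : t - s <= T by have /andP[_ h1] := tau01; rewrite lerBlDr (le_trans tt)// (le_trans h1)// lerDl.
have ex : exists n, h n.+1 < t - s.
  exists (Num.truncn (T / (t - s))); rewrite /h ltr_pdivrMr ?exprn_gt0// mulrC -ltr_pdivrMr//.
  rewrite (lt_le_trans (truncnS_gt _))//.
  by rewrite -natrX ler_nat; exact: ltnW (ltn_expl _ (ltnSn 1)).
have [n hn nmin] := ex_minnP ex.
have tsn : t - s <= h n.
  case: n hn nmin => [|n] hn nmin; first by rewrite /h expr0 divr1.
  by rewrite leNgt; apply/negP => /nmin; rewrite ltnn.
have := dyadic_chaining cy q01 kap0 tau01 incr s0 st tt tsn.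
move=> H; apply: (le_trans H); rewrite ler_wpM2l// -[leRHS]mulrA ler_wpM2l//.
  by rewrite divr_ge0// ltW.
rewrite -powRM ?divr_ge0 ?(ltW T0) ?(ltW ts0)//.
have -> : q ^+ n = (2 ^+ n)^-1 `^ e.
  rewrite /q -powR_mulrn ?powR_ge0// -powRrM -powR_invn// -powRrM.
  by congr (_ `^ _); ring.
apply: ge0_ler_powR; rewrite ?nnegrE ?invr_ge0 ?exprn_ge0 ?mulr_ge0 ?invr_ge0 ?(ltW T0) ?(ltW ts0) ?(ltW e0)//.
have : T * (2 ^+ n)^-1 < 2 * (t - s).
  by move: hn; rewrite /h exprS invfM; lra.
by rewrite mulrAC ler_pdivlMr// mulrC => /ltW.
Qed.

End chaining.

(** * Bootstrap, summability and the Holder event *)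

(** A bootstrap: the supremum [si] of the times up to which the bound holds is itself such a time by
    continuity, and the self-improvement to a strict bound there would let the interval be
    prolonged. *)
Lemma first_exit (R : realType) (T rho : R) (phi : R -> R) :
  {within `[0, T], continuous phi} -> phi 0 <= rho ->
  (forall t, 0 <= t <= T -> (forall r, 0 <= r <= t -> phi r <= rho) -> phi t < rho) ->
  forall t, 0 <= t <= T -> phi t <= rho.
Proof.
move=> c phi0 H t1 /andP[t10 t1T]; rewrite leNgt; apply/negP => lt1.
pose S := [set t | 0 <= t <= t1 /\ forall r, 0 <= r <= t -> phi r <= rho].
have S0 : S 0.
  split; first by rewrite lexx.
  by move=> r /andP[r0 r0']; have -> : r = 0 by apply/eqP; rewrite eq_le r0 r0'.
have ubS : has_ubound S by exists t1 => t [/andP[]].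
have supS : has_sup S by split => //; exists 0.
pose si := sup S; have si0 : 0 <= si by exact: ub_le_sup.
have sit : si <= t1 by apply: ge_sup; [exists 0|move=> t [/andP[]]].
have siT : 0 <= si <= T by rewrite si0 (le_trans sit).
have ltsi r : 0 <= r -> r < si -> phi r <= rho.
  move=> r0 rs; have [t [_ St] rt] := @sup_adherent R S (si - r) (ltac:(by rewrite subr_gt0)) supS.
  by apply: St; rewrite r0/= ltW//; move: rt; rewrite -/si opprB addrCA subrr addr0.
have lesi r : 0 <= r <= si -> phi r <= rho.
  move=> /andP[r0]; rewrite le_eqVlt => /predU1P[->|]; last exact: ltsi.
  have [z|zn] := eqVneq si 0; first by rewrite z.
  have sip : 0 < si by rewrite lt_neqAle eq_sym zn.
  have xn n : 0 <= si - si / n.+2%:R <= T.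
    rewrite subr_ge0 ler_pdivrMr// ler_peMr ?ler1n//=.
    by rewrite (le_trans _ (le_trans sit t1T))// lerBlDr lerDl divr_ge0.
  have cx : si - si / n.+2%:R @[n --> \oo] --> si.
    apply/cvgrPdist_le => e e0; exists (Num.truncn (si / e)) => // n /= hn.
    rewrite opprB addrCA subrr addr0 ger0_norm ?divr_ge0// ler_pdivrMr// mulrC -ler_pdivrMr//.
    rewrite (le_trans (ltW (truncnS_gt _)))// ler_nat; exact: leqW.
  have cphi := cvg_path c siT xn cx.
  rewrite -(cvg_lim _ cphi)//; apply: limr_le; first by apply/cvg_ex; eexists; exact: cphi.
  apply: nearW => n; apply: ltsi; first by case/andP: (xn n).
  by rewrite ltrBlDr ltrDl divr_gt0.
have lt_si : phi si < rho by exact: H.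
have /subspace_continuousP/(_ si (ltac:(by rewrite /= in_itv)))/cvgrPdist_lt := c.
move=> /(_ (rho - phi si)) /(_ (ltac:(by rewrite subr_gt0))).
rewrite /= => -[e /= e0 He].
have si_t1 : si < t1.
  by rewrite lt_neqAle sit andbT; apply/eqP => E; move: lt_si; rewrite E ltNge (ltW lt1).
pose s' := Num.min (si + e / 2) t1.
have si_s' : si < s' by rewrite lt_min si_t1 ltrDl divr_gt0.
suff : S s' by move=> /(ub_le_sup ubS); rewrite leNgt si_s'.
split; first by rewrite (le_trans si0 (ltW si_s'))/= ge_min lexx orbT.
move=> r /andP[r0 rs']; have [rs|rs] := leP r si; first by apply: lesi; rewrite r0.
have rT : r <= T by rewrite (le_trans rs')// ge_min t1T orbT.
have := He r; rewrite /ball/= => /(_ _ _).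
have b : `|si - r| < e.
  rewrite distrC ger0_norm ?subr_ge0 ?(ltW rs)// ltrBlDl (le_lt_trans rs')//.
  by rewrite gt_min ltrD2l ltr_pdivrMr// ltr_pMr// ltr1n.
move=> /(_ b (ltac:(by rewrite /= in_itv/= r0))) h1.
by rewrite ltW//; have := ler_norm (- (phi si - phi r)); rewrite normrN; lra.
Qed.

Lemma nneseries_term_le (R : realType) (u : nat -> \bar R) k : (forall n, 0 <= u n)%E ->
  (u k <= \sum_(n <oo) u n)%E.
Proof.
move=> u0; apply: (le_trans _ (@nneseries_lim_ge R u predT 0%N k.+1 (fun n _ _ => u0 n))).
by rewrite big_nat_recr//= leeDr// sume_ge0.
Qed.

(** The double series has finite expectation, is therefore almost surely finite, and bounds each of
    its terms. The weights are chosen so that their partial sums are explicit: a geometric sum in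
    [n] and a telescoping one in [N]. *)
Lemma ae_bounded_of_summable (R : realType) (d : measure_display) (Om : measurableType d)
    (P : probability Om R) (f : nat -> nat -> Om -> R) (D : R) : 0 <= D ->
  (forall N n, measurable_fun setT (f N n)) -> (forall N n w, 0 <= f N n w) ->
  (forall N n, (\int[P]_w (f N n w)%:E <= (D * ((N.+1%:R * N.+2%:R)^-1 * 2^-1 ^+ n))%:E)%E) ->
  {ae P, forall w, exists K : R, forall N n, f N n w <= K}.
Proof.
move=> D0 mf f0 hf.
pose F N w := (\sum_(n <oo) (f N n w)%:E)%E; pose G w := (\sum_(N <oo) F N w)%E.
have F0 N w : (0 <= F N w)%E by apply: nneseries_ge0 => n _ _; rewrite lee_fin.
have G0 w : (0 <= G w)%E by apply: nneseries_ge0 => n _ _.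
have mF N : measurable_fun setT (F N).
  by apply: (ge0_emeasurable_sum (P := predT)) => [n w _ _|n _]; [rewrite lee_fin|exact/measurable_EFinP].
have mG : measurable_fun setT G.
  by apply: (ge0_emeasurable_sum (P := predT)) => [n w _ _|n _].
have iF N : (\int[P]_w F N w <= (2 * D * (N.+1%:R * N.+2%:R)^-1)%:E)%E.
  rewrite integral_nneseries//; last 2 first.
  - by move=> n; exact/measurable_EFinP.
  - by move=> n w _; rewrite lee_fin.
  apply: lime_le.
    by apply: is_cvg_nneseries => n _ _; apply: integral_ge0 => w _; rewrite lee_fin.
  apply: nearW => k; pose c := D * (N.+1%:R * N.+2%:R)^-1.
  have c0 : 0 <= c by rewrite mulr_ge0// invr_ge0.
  apply: (@le_trans _ _ (\sum_(0 <= n < k) (c * 2^-1 ^+ n)%:E)%E).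
    by apply: lee_sum => n _; rewrite /c -mulrA.
  rewrite sumEFin lee_fin -mulrA -/c.
  have -> : \sum_(0 <= n < k) c * 2^-1 ^+ n = c * (2 - 2 * 2^-1 ^+ k).
    elim: k => [|k IH]; first by rewrite big_nil expr0 mulr1 subrr mulr0.
    by rewrite big_nat_recr//= IH exprS; field.
  by rewrite [leRHS]mulrC ler_wpM2l// gerBl mulr_ge0// exprn_ge0// invr_ge0.
have iG : (\int[P]_w G w <= (2 * D)%:E)%E.
  rewrite integral_nneseries//.
  apply: lime_le; first by apply: is_cvg_nneseries => n _ _; exact: integral_ge0.
  apply: nearW => k.
  apply: (@le_trans _ _ (\sum_(0 <= N < k) (2 * D * (N.+1%:R * N.+2%:R)^-1)%:E)%E).
    by apply: lee_sum.
  rewrite sumEFin lee_fin.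
  have -> : \sum_(0 <= N < k) 2 * D * (N.+1%:R * N.+2%:R)^-1 = 2 * D * (1 - k.+1%:R^-1).
    elim: k => [|k IH]; first by rewrite big_nil invr1 subrr mulr0.
    rewrite big_nat_recr//= IH -[k.+2%:R]natr1; have : (k.+1%:R : R) != 0 by rewrite pnatr_eq0.
    have : (k.+1%:R + 1 : R) != 0 by rewrite natr1 pnatr_eq0.
    by move: (k.+1%:R : R) => x h1 h2; field; rewrite h1 h2.
  by rewrite ler_piMr ?mulr_ge0// gerBl invr_ge0.
have int : P.-integrable setT G.
  apply/integrableP; split => //; under eq_integral do rewrite gee0_abs//.
  by rewrite (le_lt_trans iG)// ltry.
have := integrable_ae measurableT int; apply: filterS => w /(_ Logic.I) Gf.
exists (fine (G w)) => N n; rewrite -lee_fin fineK//.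
apply: (le_trans _ (nneseries_term_le N (fun N => F0 N w))).
by apply: (nneseries_term_le (u := fun n => (f N n w)%:E)) => k; rewrite lee_fin.
Qed.

(** The bound is taken to be a natural number, so that finiteness of the supremum becomes a
    countable union of events. *)
Lemma holder_norm_bounded (R : realType) (V : normedModType R) (T delta : R) (y : nat -> R -> V)
    (c : nat -> R) : 0 <= T -> (forall N, (0 < N)%N -> 0 < c N) ->
  (ereal_sup [set (c N)%:E * holder_norm `[0%R, T] delta (y N) | N in [set N : nat | (0 < N)%N]] < +oo)%E <->
  exists M : nat, forall N, (0 < N)%N -> forall s t, 0 <= s <= T -> 0 <= t <= T ->
    c N * `|y N t| <= M%:R /\ c N * `|y N t - y N s| <= M%:R * `|t - s| `^ delta.
Proof.
move=> T0 c0; split; last first.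
  move=> [M HM]; apply: (@le_lt_trans _ _ (2 * M%:R)%:E); last by rewrite ltry.
  apply: ge_ereal_sup => _ [N /= N0 <-]; have cN := c0 N N0.
  apply: (@le_trans _ _ ((c N)%:E * (2 * (M%:R / c N))%:E)%E); last first.
    by rewrite -EFinM lee_fin mulrCA [c N * _]mulrC divfK// gt_eqF.
  have Mc : 0 <= M%:R / c N by rewrite divr_ge0// ltW.
  apply: lee_wpmul2l; first by rewrite lee_fin ltW.
  rewrite mulr_natl mulr2n EFinD; apply: leeD.
    apply: ge_ereal_sup => _ [[t /= /[!in_itv]/= tT <-]|->]; last by rewrite lee_fin.
    by rewrite lee_fin ler_pdivlMr// mulrC; case: (HM N N0 t t tT tT).
  apply: ge_ereal_sup => _ [[[t s] /= [/[!in_itv]/= tT sT ts] <-]|->]; last by rewrite lee_fin.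
  have ts0 : 0 < `|t - s| by rewrite normr_gt0 subr_eq0.
  rewrite -EFinM lee_fin ler_pdivrMr ?powR_gt0// mulrAC ler_pdivlMr// mulrC.
  by case: (HM N N0 s t sT tT).
move=> H; set S := ereal_sup _ in H.
have hS N : (0 < N)%N -> ((c N)%:E * holder_norm `[0%R, T] delta (y N) <= S)%E.
  by move=> N0; apply: ereal_sup_ubound; exists N.
have s10 N : (0 <= ereal_sup ([set `|y N x|%:E | x in `[0%R, T]%classic] `|` [set 0%E]))%E.
  by apply: ereal_sup_ubound; right.
have s20 N : (0 <= holder_seminorm `[0%R, T]%classic delta (fun x z => `|y N x - y N z|%:E))%E.
  by apply: ereal_sup_ubound; right.
have S0 : (0 <= S)%E.
  by apply: le_trans (hS 1%N isT); rewrite mule_ge0 ?lee_fin ?(ltW (c0 _ _))// adde_ge0.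
have [r rS] : exists r : R, S = r%:E by exists (fine S); rewrite fineK// ge0_fin_numE.
exists (Num.truncn r).+1 => N N0 s t sT tT; have cN := c0 N N0.
have rM : r <= (Num.truncn r).+1%:R by exact: ltW (truncnS_gt _).
have M0 : 0 <= (Num.truncn r).+1%:R :> R by [].
split.
  rewrite (le_trans _ rM)// -lee_fin -rS (le_trans _ (hS N N0))// EFinM.
  apply: lee_wpmul2l; first by rewrite lee_fin ltW.
  rewrite /holder_norm -[leLHS]adde0; apply: leeD => //.
  by apply: ereal_sup_ubound; left; exists t => //=; rewrite in_itv.
have [->|ts] := eqVneq t s; first by rewrite !subrr normr0 mulr0 mulr_ge0 ?powR_ge0.
have ts0 : 0 < `|t - s| by rewrite normr_gt0 subr_eq0.
rewrite -ler_pdivrMr ?powR_gt0// (le_trans _ rM)// -lee_fin -rS (le_trans _ (hS N N0))// -mulrA EFinM.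
apply: lee_wpmul2l; first by rewrite lee_fin ltW.
rewrite /holder_norm -[leLHS]add0e; apply: leeD => //.
apply: ereal_sup_ubound; left; exists (t, s); first by rewrite /= !in_itv.
by rewrite EFinM.
Qed.

(** For a continuous path, testing on countably many pairs of grid times is enough; this is the
    source of measurability of the event in the conclusion. *)
Lemma holder_bound_on_grid (R : realType) (V : normedModType R) (T delta c M : R) (y : R -> V) :
  0 <= T -> {within `[0, T], continuous y} -> 0 <= M ->
  (forall n j k, (j <= n.+1)%N -> (k <= n.+1)%N ->
    c * `|y (T * k%:R / n.+1%:R)| <= M /\
    c * `|y (T * k%:R / n.+1%:R) - y (T * j%:R / n.+1%:R)| <=
      M * `|T * k%:R / n.+1%:R - T * j%:R / n.+1%:R| `^ delta) ->
  forall s t, 0 <= s <= T -> 0 <= t <= T ->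
    c * `|y t| <= M /\ c * `|y t - y s| <= M * `|t - s| `^ delta.
Proof.
move=> T0 cy M0 H s t sT tT.
have gT (r : R) n : 0 <= r <= T -> 0 <= grid_floor T n r <= T.
  by move=> rT; have [h1 h2 _] := grid_floor_bounds n rT; have /andP[_ h] := rT; rewrite h1 (le_trans h2).
have cg r : 0 <= r <= T -> y (grid_floor T n r) @[n --> \oo] --> y r.
  by move=> rT; apply: (cvg_path cy rT (fun n => gT r n rT)); exact: grid_floor_cvg.
have Hg n : c * `|y (grid_floor T n t)| <= M /\
    c * `|y (grid_floor T n t) - y (grid_floor T n s)| <= M * `|grid_floor T n t - grid_floor T n s| `^ delta.
  have [k kn ->] := grid_floor_index n tT; have [j jn ->] := grid_floor_index n sT.
  exact: H.
split.
  have cv : c * `|y (grid_floor T n t)| @[n --> \oo] --> c * `|y t|.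
    by apply: cvgMr; apply: cvg_norm; exact: cg.
  rewrite -(cvg_lim _ cv)//; apply: limr_le; first by apply/cvg_ex; eexists; exact: cv.
  by apply: nearW => n; case: (Hg n).
(* Equal times are set apart because continuity of the power [delta], which may be zero, is used at
   positive arguments. *)
have [->|ts] := eqVneq t s; first by rewrite !subrr normr0 mulr0 mulr_ge0 ?powR_ge0.
have ts0 : 0 < `|t - s| by rewrite normr_gt0 subr_eq0.
have cl : c * `|y (grid_floor T n t) - y (grid_floor T n s)| @[n --> \oo] --> c * `|y t - y s|.
  by apply: cvgMr; apply: cvg_norm; apply: cvgB; exact: cg.
have cd : `|grid_floor T n t - grid_floor T n s| @[n --> \oo] --> `|t - s|.
  by apply: cvg_norm; apply: cvgB; exact: grid_floor_cvg.
have cp : {for `|t - s|, continuous (fun x : R => x `^ delta)}.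
  by apply: differentiable_continuous; apply/derivable1_diffP; case: (is_derive1_powR delta ts0).
have cr : M * `|grid_floor T n t - grid_floor T n s| `^ delta @[n --> \oo] --> M * `|t - s| `^ delta.
  by apply: cvgMr; exact: (cvg_comp _ _ cd cp).
apply: (ler_cvg_to cl cr); apply: nearW => n; by case: (Hg n).
Qed.

Lemma path_bounded (R : realType) (V : normedModType R) (T : R) (y : R -> V) : 0 <= T ->
  {within `[0, T], continuous y} -> exists B : R, forall t, 0 <= t <= T -> `|y t| <= B.
Proof.
move=> T0 cy; have cn : {within `[0, T], continuous (fun t => `|y t|)}.
  by move=> t; apply: cvg_norm; exact: cy.
have [c _ hc] := EVT_max T0 cn; exists `|y c| => t tT.
by apply: hc; rewrite in_itv.
Qed.

Lemma root_le_max (R : realType) (a K : R) n : 0 <= a -> a ^+ n.+1 <= K -> a <= Num.max 1 K.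
Proof.
move=> a0 aK; rewrite le_max; have [//|a1] := leP a 1.
by rewrite (le_trans _ aK)// exprS ler_peMr// exprn_ege1// ltW.
Qed.

Lemma powR_natr_gt0 (R : realType) (N : nat) (r : R) : (0 < N)%N -> 0 < N%:R `^ r :> R.
Proof. by move=> N0; rewrite powR_gt0// ltr0n. Qed.

(** * The almost sure rate in the abstract setting *)

Section rate.
Context {R : realType} {d : measure_display} {Om : measurableType d} {P : probability Om R}.
Context {T : R} (T0 : 0 < T) {Fl : R -> set (set Om)} (Fl_normal : normal_filtration P T Fl).
Context {U : hilbertType R} {W : R -> U -> Om -> R} (W_wiener : cylindrical_wiener P T Fl W).
Context {V : hilbertType R} {I : choiceType} {A : set I} {bas : I -> V}.
Hypotheses (cA : countable A) (bas_onb : onb_family A bas).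
Context {X : nat -> R -> Om -> V} (X_adapted : forall N, adapted T Fl (X N)).
Hypothesis X_cont : forall N w, {within `[0, T], continuous (fun t => X N t w)}.
Context {f : nat -> R -> V -> V} {Phi : nat -> R -> V -> U -> V} {i0 : nat -> R -> Om -> V}.
Hypothesis mild : forall N t, 0 <= t <= T -> exists IF IB : Om -> V,
  [/\ {ae P, forall w, bochner_approx t (fun s => f N (t - s) (X N s w)) (IF w)},
      @ito_approx _ _ _ P Fl U W V t (fun s w u => Phi N (t - s) (X N s w) u) IB &
      {ae P, forall w, X N t w = i0 N t w + IF w + IB w}].
Context {p theta iota : R}.
Hypothesis p01 : 0 <= p < 1.
Hypothesis theta01 : 0 < theta < 2^-1.
Hypothesis iota0 : 0 < iota.
Context {Z : nat -> set Om}.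
Hypothesis FZ : forall n, Fl 0 (Z n).
Hypothesis Z_ae : {ae P, forall w, exists n0, forall n, (n0 <= n)%N -> Z n w}.

Let eta (N : nat) : R := N%:R `^ (- (iota * theta)).

(* Regularity of the integrands on the ball of radius [rho]; the constant may
   depend on [rho]. *)
Hypothesis bounds : forall n : nat, let rho := n%:R in exists2 C : R, 0 <= C &
  [/\ (forall N x y t, (0 < N)%N -> 0 < t <= T -> `|x| <= rho -> `|y| <= rho ->
        `|f 0%N t x - f N t y| <= C * (t `^ (- p) * (eta N + `|x - y|)) /\
        (hs2 (fun u => Phi 0%N t x u - Phi N t y u)%R <=
           (C * (t `^ (- p) * (eta N ^+ 2 + `|x - y| ^+ 2)))%:E)%E),
      (forall N x s t, 0 < s -> s <= t -> t <= T -> `|x| <= rho ->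
        `|f N t x - f N s x| <= C * ((t - s) `^ theta * s `^ (- p)) /\
        (hs2 (fun u => Phi N t x u - Phi N s x u)%R <=
           (C * ((t - s) `^ (2 * theta) * s `^ (- p)))%:E)%E),
      (forall N x t, 0 < t <= T -> `|x| <= rho ->
        `|f N t x| <= C * t `^ (- (1 - theta)) /\
        (hs2 (Phi N t x) <= (C * t `^ (- (1 - 2 * theta)))%:E)%E),
      (forall N t w, (0 < N)%N -> 0 <= t <= T -> Z n w -> `|i0 0%N t w - i0 N t w| <= C * eta N) &
      (forall N s t w, 0 <= s -> s <= t -> t <= T -> Z n w ->
        `|i0 N t w - i0 N s w| <= C * (t - s) `^ theta)].

Let Y N t w := X 0%N t w - X N t w.
Let cutn n N := @cut R d Om V X (Z n) n%:R N.

Section exponents.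
Context {delta e : R} (delta0 : 0 <= delta < theta) (e0 : 0 < e) (e_lt : e < theta - delta).

(** [r] is the rate to be proved, [d1] the Holder exponent obtained by chaining, [d2] the one at
    which the two moment bounds are interpolated. The gap e/2 between [r + d2] and [theta] pays for
    the sum over [N], the gap e/4 between [d1] and [d2] for the sum over the dyadic points. *)
Let r := theta - delta - e.
Let d1 := delta + e / 4.
Let d2 := delta + e / 2.
Let q : R := 2 `^ (- d1).
Let grid n i : R := i%:R * (T / 2 ^+ n).

Let r0 : 0 < r. Proof. by rewrite /r subr_gt0. Qed.
Let d10 : 0 < d1. Proof. by case/andP: delta0 => h _; rewrite ltr_wpDl// divr_gt0. Qed.

Let grid01 n i : (i < 2 ^ n)%N -> [/\ 0 <= grid n i, grid n i <= grid n i.+1, grid n i.+1 <= T &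
  grid n i.+1 - grid n i = T / 2 ^+ n].
Proof.
move=> i2; have h0 : 0 < T / 2 ^+ n by rewrite divr_gt0// exprn_gt0.
split; first by rewrite mulr_ge0// ltW.
- by rewrite ler_wpM2r ?(ltW h0)// ler_nat.
- by rewrite /grid mulrCA ler_piMr ?(ltW T0)// ler_pdivrMr ?exprn_gt0// mul1r -natrX ler_nat.
- by rewrite /grid -mulrBl -natr1 addrAC subrr add0r mul1r.
Qed.

(** The powers of [k] combine to k^(- m iota e) and those of 2 to 2^(n (1 - m e / 2)); the two
    thresholds on [m] push these below k^(-2) and 2^(-n). *)
Let eta_pow (m k : nat) : (0 < k)%N -> 4 <= m%:R * e -> 2 <= m%:R * (iota * e) ->
  forall n, ((k%:R `^ (iota * r)) ^+ (2 * m) * (2 ^+ n * (2 `^ (d1 * n%:R)) ^+ (2 * m))) *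
    (((eta k ^+ 2) ^+ m) `^ (1 - d2 / theta) * (((T / 2 ^+ n) `^ (2 * theta)) ^+ m) `^ (d2 / theta)) <=
  (T `^ (2 * d2 * m%:R)) * ((k%:R ^+ 2)^-1 * 2^-1 ^+ n).
Proof.
move=> k0 h1 h2 n; have /andP[th0 _] := theta01; have tn0 : theta != 0 by rewrite gt_eqF.
have kp : 0 < k%:R :> R by rewrite ltr0n.
have T2 : T / 2 ^+ n = T * 2 `^ (- n%:R) by rewrite powR_invn.
have eE : ((eta k ^+ 2) ^+ m) `^ (1 - d2 / theta) = k%:R `^ (- (2 * m%:R * iota * (theta - d2))).
  rewrite /eta -exprM -powR_mulrn ?powR_ge0// -!powRrM natrM; congr (_ `^ _).
  by field.
have tE : (((T / 2 ^+ n) `^ (2 * theta)) ^+ m) `^ (d2 / theta) =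
    T `^ (2 * d2 * m%:R) * 2 `^ (- (n%:R * (2 * d2 * m%:R))).
  rewrite -powR_mulrn ?powR_ge0// -!powRrM T2 powRM ?(ltW T0) ?powR_ge0// -powRrM.
  by congr (_ `^ _ * _ `^ _); field.
have kE : (k%:R `^ (iota * r)) ^+ (2 * m) = k%:R `^ (2 * m%:R * iota * r).
  by rewrite -powR_mulrn ?powR_ge0// -powRrM natrM; congr (_ `^ _); ring.
have nE : 2 ^+ n * (2 `^ (d1 * n%:R)) ^+ (2 * m) = 2 `^ (n%:R * (1 + 2 * m%:R * d1)).
  have -> : 2 ^+ n = 2 `^ n%:R :> R by rewrite powR_mulrn.
  have -> : (2 `^ (d1 * n%:R)) ^+ (2 * m) = 2 `^ (d1 * n%:R * (2 * m)%:R) by rewrite [RHS]powRrM powR_mulrn ?powR_ge0.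
  by rewrite -powRD ?pnatr_eq0 ?implybT// natrM; congr (_ `^ _); ring.
rewrite eE tE kE nE.
have -> : k%:R `^ (2 * m%:R * iota * r) * 2 `^ (n%:R * (1 + 2 * m%:R * d1)) *
    (k%:R `^ (- (2 * m%:R * iota * (theta - d2))) * (T `^ (2 * d2 * m%:R) * 2 `^ (- (n%:R * (2 * d2 * m%:R))))) =
    T `^ (2 * d2 * m%:R) * ((k%:R `^ (2 * m%:R * iota * r) * k%:R `^ (- (2 * m%:R * iota * (theta - d2)))) *
     (2 `^ (n%:R * (1 + 2 * m%:R * d1)) * 2 `^ (- (n%:R * (2 * d2 * m%:R))))) by ring.
rewrite -!powRD ?(gt_eqF kp) ?pnatr_eq0 ?implybT//.
rewrite ler_wpM2l ?powR_ge0//; apply: ler_pM; rewrite ?powR_ge0//.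
  have -> : (k%:R ^+ 2)^-1 = k%:R `^ (- 2%:R) :> R by rewrite powR_invn// ltW.
  apply: ler_powR; first by rewrite ler1n.
  by rewrite /r /d2; lra.
have -> : 2^-1 ^+ n = 2 `^ (- n%:R) :> R by rewrite powR_invn// exprVn.
apply: ler_powR; first by rewrite ler1n.
have n0 : 0 <= n%:R :> R by [].
have : 0 <= n%:R * (m%:R * e / 2 - 2) by apply: mulr_ge0 => //; lra.
by rewrite /d1 /d2; lra.
Qed.

Lemma ae_increments (rho : nat) : {ae P, forall w, exists2 K : R, 0 <= K & forall N n i,
  (0 < N)%N -> (i < 2 ^ n)%N -> cutn rho N (grid n i.+1) w ->
  `|Y N (grid n i.+1) w - Y N (grid n i) w| <= K * N%:R `^ (- (iota * r)) * q ^+ n}.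
Proof.
have [C C0 [bd bt bb bi bs]] := bounds rho; have rho0 : 0 <= rho%:R :> R by [].
have /andP[th0 th1] := theta01; have /andP[dl0 dl1] := delta0.
have eta0 N : 0 <= eta N by exact: powR_ge0.
(* The least convenient choice for which [m'.+1] meets both thresholds of [eta_pow]. *)
pose m' := (Num.truncn (4 / e) + Num.truncn (2 / (iota * e)))%N.
have ie0 : 0 < iota * e by rewrite mulr_gt0.
have h1 : 4 <= m'.+1%:R * e.
  by rewrite -ler_pdivrMr// (le_trans (ltW (truncnS_gt _)))// ler_nat ltnS leq_addr.
have h2 : 2 <= m'.+1%:R * (iota * e).
  by rewrite -ler_pdivrMr// (le_trans (ltW (truncnS_gt _)))// ler_nat ltnS leq_addl.
have x01 : 0 <= d2 / theta <= 1.
  have d20 : 0 <= d2 by rewrite addr_ge0// divr_ge0// ltW.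
  have d2t : d2 <= theta by rewrite /d2; have := e_lt; have := e0; lra.
  by rewrite divr_ge0 ?(ltW th0)//= ler_pdivrMr// mul1r.
have [L L0 HL] := increment_moment_interpolated T0 Fl_normal W_wiener cA bas_onb X_adapted X_cont mild
  (FZ rho) p01 theta01 C0 rho0 eta0
  (fun N x y t N0 tT hx hy => (bd N x y t N0 tT hx hy).1)
  (fun N x y t N0 tT hx hy => (bd N x y t N0 tT hx hy).2) bi
  (fun N x s t s0 st tT hx => (bt N x s t s0 st tT hx).1)
  (fun N x t tT hx => (bb N x t tT hx).1)
  (fun N x s t s0 st tT hx => (bt N x s t s0 st tT hx).2)
  (fun N x t tT hx => (bb N x t tT hx).2) bs m' x01.
pose m := m'.+1; pose a N n : R := (N.+1%:R `^ (iota * r)) ^+ (2 * m) * (2 `^ (d1 * n%:R)) ^+ (2 * m).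
have a0 N n : 0 <= a N n by rewrite mulr_ge0// exprn_ge0// powR_ge0.
pose g N n i w := \1_(cutn rho N.+1 (grid n i.+1)) w *
  (`|Y N.+1 (grid n i.+1) w - Y N.+1 (grid n i) w| ^+ 2) ^+ m.
have g0 N n i w : 0 <= g N n i w by rewrite mulr_ge0 ?indicE// exprn_ge0// sqr_ge0.
have gT n i : (i < 2 ^ n)%N -> 0 <= grid n i <= T /\ 0 <= grid n i.+1 <= T.
  by move=> /(@grid01 n)[b1 b2 b3 _]; rewrite b1 b3 (le_trans b1 b2) (le_trans b2 b3).
have mg N n i : (i < 2 ^ n)%N -> measurable_fun setT (g N n i).
  move=> i2; have [h3 h4] := gT n i i2.
  apply: measurable_funM.
    apply: measurable_indic; exact: (cut_measurable Fl_normal X_adapted X_cont (FZ rho)).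
  do 2 apply: measurable_funX.
  exact: (dist2_measurable Fl_normal cA bas_onb X_adapted).
pose D := 2 * (L * T `^ (2 * d2 * m%:R)).
have D0 : 0 <= D by rewrite !mulr_ge0// powR_ge0.
(* The sum over the level bounds each of its increments, and [a] is the 2m-th power of the
   normalisation of a single increment, so a bound on [F] becomes the claim after taking a root. The
   index is shifted: [N] stands for the approximation [N.+1]. *)
pose F N n w := a N n * \sum_(i < 2 ^ n) g N n i w.
have F0 N n w : 0 <= F N n w by rewrite mulr_ge0// sumr_ge0.
have mS N n : measurable_fun setT (fun w => \sum_(i < 2 ^ n) g N n i w).
  by apply: measurable_sum => i; apply: mg.
have mF N n : measurable_fun setT (F N n) by exact: measurable_funM.
have HF N n : (\int[P]_w (F N n w)%:E <= (D * ((N.+1%:R * N.+2%:R)^-1 * 2^-1 ^+ n))%:E)%E.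
  have -> : (\int[P]_w (F N n w)%:E = (a N n)%:E * \sum_(i < 2 ^ n) \int[P]_w (g N n i w)%:E)%E.
    rewrite -/(ebar P (F N n)) /F ebarZ//; last by move=> w; rewrite sumr_ge0.
    congr (_ * _)%E; rewrite /ebar; under eq_integral do rewrite -sumEFin.
    by rewrite ge0_integral_sum// => [i|i w _]; [apply/measurable_EFinP; exact: mg|rewrite lee_fin].
  pose b : R := L * (((eta N.+1 ^+ 2) ^+ m) `^ (1 - d2 / theta) * (((T / 2 ^+ n) `^ (2 * theta)) ^+ m) `^ (d2 / theta)).
  apply: (@le_trans _ _ ((a N n)%:E * \sum_(i < 2 ^ n) b%:E)%E).
    apply: lee_wpmul2l; first by rewrite lee_fin.
    apply: lee_sum => i _.
    have [b1 b2 b3 b4] := grid01 (ltn_ord i).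
    by have := HL N.+1 (grid n i) (grid n i.+1) isT b1 b2 b3; rewrite b4.
  rewrite sumEFin sumr_const card_ord -EFinM lee_fin.
  have := eta_pow (ltn0Sn N) h1 h2 n; rewrite -/m /b /a /D; set B := (X in _ * X <= _) => hB.
  have -> : (N.+1%:R `^ (iota * r)) ^+ (2 * m) * (2 `^ (d1 * n%:R)) ^+ (2 * m) * (L * B *+ 2 ^ n) =
    L * ((N.+1%:R `^ (iota * r)) ^+ (2 * m) * (2 ^+ n * (2 `^ (d1 * n%:R)) ^+ (2 * m)) * B).
    have -> : L * B *+ 2 ^ n = L * B * 2 ^+ n by rewrite -[LHS]mulr_natr natrX.
    by ring.
  apply: (le_trans (ler_wpM2l L0 hB)).
  have xy : (N.+1%:R ^+ 2)^-1 <= 2 * (N.+1%:R * N.+2%:R)^-1 :> R.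
    rewrite ler_pdivlMr ?mulr_gt0 ?ltr0n// mulrC ler_pdivrMr ?exprn_gt0 ?ltr0n//.
    by rewrite -natrX -!natrM ler_nat expnS expn1 [X in (_ <= X)%N]mulnCA leq_mul2l mul2n -addnn addSnnS leq_addl orbT.
  have -> : 2 * (L * T `^ (2 * d2 * m%:R)) * ((N.+1%:R * N.+2%:R)^-1 * 2^-1 ^+ n) =
      L * (T `^ (2 * d2 * m%:R) * ((2 * (N.+1%:R * N.+2%:R)^-1) * 2^-1 ^+ n)) by ring.
  by rewrite ler_wpM2l// ler_wpM2l ?powR_ge0// ler_wpM2r ?exprn_ge0 ?invr_ge0.
have := ae_bounded_of_summable D0 mF F0 HF; apply: filterS => w [K HK].
exists (Num.max 1 K); first by rewrite le_max ler01.
move=> N n i N0 i2 wc; case: N N0 wc => // N _ wc.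
set z := (X in X <= _); have z0 : 0 <= z by rewrite /z.
pose c := N.+1%:R `^ (iota * r) * 2 `^ (d1 * n%:R).
have c0 : 0 < c by rewrite mulr_gt0 ?powR_natr_gt0// powR_gt0.
have : c * z <= Num.max 1 K.
  apply: (@root_le_max _ _ _ (2 * m).-1); first by rewrite mulr_ge0// ltW.
  rewrite prednK ?muln_gt0//; apply: le_trans (HK N n).
  rewrite /F (bigD1 (Ordinal i2))//= exprMn /c [(_ * _) ^+ (2 * m)]exprMn -/(a N n) ler_wpM2l//.
  rewrite /g indicE mem_set// mul1r -exprM lerDl sumr_ge0//.
move=> cz; have hz : z <= c^-1 * Num.max 1 K by rewrite ler_pdivlMl.
apply: (le_trans hz); rewrite le_eqVlt; apply/orP; left; apply/eqP.
have -> : q ^+ n = (2 `^ (d1 * n%:R))^-1 by rewrite /q -powR_mulrn ?powR_ge0// -powRrM mulNr powRN.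
by rewrite powRN /c invfM mulrC mulrA.
Qed.

(** At time zero both integrals of the mild equation run over an empty interval. The initial
    distance is thereby covered by the bound on [i0]. *)
Lemma ae_start : {ae P, forall w N, X N 0 w = i0 N 0 w}.
Proof.
apply/ae_foralln => N; have T00 : 0 <= (0 : R) <= T by rewrite lexx ltW.
have [IF [IB [b it E]]] := mild N T00; have z := ito_approx0 it.
apply: filterS2 (filterI b z) E => w [{}b {}z] ->; rewrite z addr0.
suff : IF w = 0 by move=> ->; rewrite addr0.
apply/eqP; rewrite -normr_le0 -lee_fin.
have ke : measurable_fun (`[0%R, 0%R[ : set (measurableTypeR R)) (cst 0%E : R -> \bar R) by [].
apply: (le_trans (bochner_approx_le b ke (fun _ => lexx _) _)).
  by move=> s /andP[h1 h2]; have := le_lt_trans h1 h2; rewrite ltxx.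
by rewrite integral0.
Qed.

Definition good (M : nat) N w := forall s t, 0 <= s <= T -> 0 <= t <= T ->
  N%:R `^ (iota * r) * `|Y N t w| <= M%:R /\
  N%:R `^ (iota * r) * `|Y N t w - Y N s w| <= M%:R * `|t - s| `^ delta.

Lemma good_mono M M' N w : (M <= M')%N -> good M N w -> good M' N w.
Proof.
move=> MM g s t sT tT; have [h1 h2] := g s t sT tT; have MM' : M%:R <= M'%:R :> R by rewrite ler_nat.
by split; [exact: le_trans h1 MM'|rewrite (le_trans h2)// ler_wpM2r ?powR_ge0].
Qed.

Lemma Y_cont N w : {within `[0, T], continuous (fun t => Y N t w)}.
Proof. by move=> t; apply: cvgB; exact: X_cont. Qed.

(** A deterministic statement about one path, with [M] uniform in [N]. The bounds at time zero and
    up to any [tau] at which the cut still holds feed the bootstrap; the full Holder bound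
    presupposes the cut at [T]. *)
Lemma chained_bounds (rho : nat) w : Z rho w -> (forall N, X N 0 w = i0 N 0 w) ->
  (exists2 K : R, 0 <= K & forall N n i, (0 < N)%N -> (i < 2 ^ n)%N -> cutn rho N (grid n i.+1) w ->
     `|Y N (grid n i.+1) w - Y N (grid n i) w| <= K * N%:R `^ (- (iota * r)) * q ^+ n) ->
  exists M : nat, [/\ (forall N, (0 < N)%N -> N%:R `^ (iota * r) * `|Y N 0 w| <= M%:R),
    (forall N tau, (0 < N)%N -> 0 <= tau <= T -> cutn rho N tau w ->
      N%:R `^ (iota * r) * `|Y N tau w| <= M%:R) & (forall N, (0 < N)%N -> cutn rho N T w -> good M N w)].
Proof.
move=> Zw X0 [K K0 HK]; have [C C0 [_ _ _ bi _]] := bounds rho.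
have [K1 K10 HK1] := @holder_of_dyadic R V T T0 d1 d10.
have /andP[dl0 dl1] := delta0.
pose Dn := C + K * (K1 * T `^ d1) + K * K1 * T `^ (d1 - delta).
have c1 : 0 <= K * (K1 * T `^ d1) by rewrite !mulr_ge0 ?powR_ge0.
have c2 : 0 <= K * K1 * T `^ (d1 - delta) by rewrite !mulr_ge0 ?powR_ge0.
pose M := (Num.truncn Dn).+1; have DM : Dn <= M%:R by exact: ltW (truncnS_gt _).
have Np N : (0 < N)%N -> 0 < N%:R `^ (iota * r) :> R by exact: powR_natr_gt0.
have inc N tau : (0 < N)%N -> 0 <= tau <= T -> cutn rho N tau w ->
    forall s t, 0 <= s -> s <= t -> t <= tau ->
    N%:R `^ (iota * r) * `|Y N t w - Y N s w| <= K * (K1 * (t - s) `^ d1).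
  move=> N0 tauT wc s t s0 st tt.
  have := HK1 (fun t => Y N t w) (K * N%:R `^ (- (iota * r))) tau (@Y_cont N w)
    (mulr_ge0 K0 (powR_ge0 _ _)) tauT.
  have /andP[_ tauT'] := tauT.
  have hyp n i : i.+1%:R * (T / 2 ^+ n) <= tau ->
      `|Y N (i.+1%:R * (T / 2 ^+ n)) w - Y N (i%:R * (T / 2 ^+ n)) w| <=
      K * N%:R `^ (- (iota * r)) * (2 `^ (- d1)) ^+ n.
    move=> hi; apply: HK => //; last by apply: cut_sub wc.
    have : i.+1%:R * (T / 2 ^+ n) <= T by exact: le_trans tauT'.
    by rewrite mulrCA -[X in _ <= X]mulr1 ler_pM2l// ler_pdivrMr ?exprn_gt0// mul1r -natrX ler_nat.
  move=> /(_ hyp s t s0 st tt) H.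
  rewrite -ler_pdivlMl ?Np//; apply: (le_trans H).
  by rewrite le_eqVlt; apply/orP; left; apply/eqP; rewrite powRN; ring.
have init N : (0 < N)%N -> N%:R `^ (iota * r) * `|Y N 0 w| <= C.
  move=> N0; have T00 : 0 <= (0 : R) <= T by rewrite lexx ltW.
  rewrite /Y !X0 (le_trans (ler_wpM2l (ltW (Np N N0)) (bi N 0 w N0 T00 Zw)))//.
  rewrite mulrCA ler_piMr// /eta -powRD; last by rewrite pnatr_eq0 -lt0n N0 implybT.
  rewrite -[leRHS](powRr0 N%:R); apply: ler_powR; first by rewrite ler1n.
  by rewrite -mulrBr mulr_ge0_le0 ?(ltW iota0)//; rewrite subr_le0 /r -addrA -opprD gerBl addr_ge0// ltW.
have norm N tau : (0 < N)%N -> 0 <= tau <= T -> cutn rho N tau w ->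
    N%:R `^ (iota * r) * `|Y N tau w| <= C + K * (K1 * T `^ d1).
  move=> N0 tauT wc; have /andP[tau0 tauT'] := tauT.
  have h := inc N tau N0 tauT wc 0 tau (lexx _) tau0 (lexx _).
  have -> : Y N tau w = (Y N tau w - Y N 0 w) + Y N 0 w by rewrite subrK.
  rewrite (le_trans (ler_wpM2l (ltW (Np N N0)) (ler_normD _ _)))// mulrDr [leRHS]addrC.
  rewrite lerD ?init// (le_trans h)// ler_wpM2l// ler_wpM2l// subr0.
  by apply: ge0_ler_powR; rewrite ?nnegrE ?(ltW d10) ?(ltW T0).
exists M; split; first by move=> N N0; rewrite (le_trans (init N N0))// (le_trans _ DM)// /Dn -addrA lerDl addr_ge0.
  by move=> N tau N0 tauT wc; rewrite (le_trans (norm N tau N0 tauT wc))// (le_trans _ DM)// lerDl.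
move=> N N0 wc s t sT tT; have TT : 0 <= T <= T by rewrite lexx ltW.
split.
  have /andP[_ tT'] := tT.
  rewrite (le_trans (norm N t N0 tT _)) ?(le_trans _ DM) ?lerDl//.
  by apply: cut_sub wc.
wlog st : s t sT tT / s <= t.
  move=> H; have [st|ts] := leP s t; first exact: H.
  by rewrite distrC [`|t - s|]distrC; apply: H => //; exact: ltW.
have /andP[s0 _] := sT; have /andP[t0 tT'] := tT.
rewrite (le_trans (inc N T N0 TT wc s t s0 st tT'))// ger0_norm ?subr_ge0//.
have [->|ts] := eqVneq t s.
  by rewrite subrr powR0 ?gt_eqF// !mulr0 mulr_ge0 ?powR_ge0.
have tsp : 0 < t - s by rewrite subr_gt0 lt_neqAle eq_sym ts.
(* The surplus of [d1] over [delta] is bounded by a power of [T]. *)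
have -> : (t - s) `^ d1 = (t - s) `^ (d1 - delta) * (t - s) `^ delta.
  by rewrite -powRD ?subrK// (gt_eqF tsp) implybT.
rewrite !mulrA ler_wpM2r ?powR_ge0// (le_trans _ DM)// (le_trans _ (_ : K * K1 * T `^ (d1 - delta) <= _))//.
  rewrite ler_wpM2l ?mulr_ge0//; apply: ge0_ler_powR; rewrite ?nnegrE ?(ltW tsp) ?(ltW T0)//.
    by rewrite /d1 addrAC subrr add0r divr_ge0// ltW.
  by rewrite lerBlDr (le_trans tT')// lerDl.
by rewrite /Dn lerDr addr_ge0.
Qed.

Lemma ae_good : {ae P, forall w, exists M, forall N, (0 < N)%N -> good M N w}.
Proof.
have H : {ae P, forall w (rho : nat), exists2 K : R, 0 <= K & forall N n i,
    (0 < N)%N -> (i < 2 ^ n)%N -> cutn rho N (grid n i.+1) w ->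
    `|Y N (grid n i.+1) w - Y N (grid n i) w| <= K * N%:R `^ (- (iota * r)) * q ^+ n}.
  by apply/ae_foralln => rho; exact: ae_increments.
apply: filterS2 (filterI H ae_start) Z_ae => w [{}H X0] [n0 Zw].
have T0' := ltW T0.
have good_of rho : (n0 <= rho)%N -> exists M : nat, [/\ (forall N, (0 < N)%N -> N%:R `^ (iota * r) * `|Y N 0 w| <= M%:R),
    (forall N tau, (0 < N)%N -> 0 <= tau <= T -> cutn rho N tau w ->
      N%:R `^ (iota * r) * `|Y N tau w| <= M%:R) & (forall N, (0 < N)%N -> cutn rho N T w -> good M N w)].
  by move=> nr; exact: chained_bounds (Zw rho nr) X0 (H rho).
(* For a single [N] the radius can be taken larger than both continuous paths ever reach, so the cut
   holds up to [T]; the resulting bound may depend on [N]. *)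
have each N : exists M, (0 < N)%N -> good M N w.
  have [B0 hB0] := path_bounded T0' (@X_cont 0%N w); have [B1 hB1] := path_bounded T0' (@X_cont N w).
  pose rho := (n0 + Num.truncn B0 + Num.truncn B1).+1.
  have [|M [_ _ hM]] := good_of rho; first by rewrite /rho -addnA leqW ?leq_addr.
  exists M => N0; apply: hM => //; split; first by apply: Zw; rewrite /rho -addnA leqW ?leq_addr.
  move=> s sT; split.
    by rewrite (le_trans (hB0 s sT))// (le_trans (ltW (truncnS_gt _)))// ler_nat /rho ltnS addnAC leq_addl.
  by rewrite (le_trans (hB1 s sT))// (le_trans (ltW (truncnS_gt _)))// ler_nat /rho ltnS leq_addl.
have /choice[Mf hMf] := each.
have [B0 hB0] := path_bounded T0' (@X_cont 0%N w).
(* This radius exceeds the range of [X 0] by at least one and is the same for all [N]. *)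
pose rho := (n0 + (Num.truncn B0).+2)%N.
have hB t : 0 <= t <= T -> `|X 0%N t w| <= rho%:R - 1.
  move=> tT; rewrite (le_trans (hB0 t tT))// (le_trans (ltW (truncnS_gt _)))//.
  by rewrite /rho addnS lerBrDr natr1 ler_nat ltnS leq_addl.
have [|M [hi h1 h2]] := good_of rho; first by rewrite /rho leq_addr.
have ir0 : 0 < iota * r by rewrite mulr_gt0.
(* From [N0] on, [M] is less than N^(iota r), so the distance of the two paths stays below the
   margin one as long as the cut holds; [first_exit] then extends the cut to all of [0, T]. *)
pose N0 := (Num.truncn (M%:R `^ (iota * r)^-1)).+1.
have large N : (N0 <= N)%N -> M%:R < N%:R `^ (iota * r) :> R.
  move=> hN; have : M%:R `^ (iota * r)^-1 < N%:R.
    by rewrite (lt_le_trans (truncnS_gt _))// ler_nat.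
  move=> h; have -> : M%:R = (M%:R `^ (iota * r)^-1) `^ (iota * r) :> R.
    by rewrite -powRrM mulVf ?powRr1// gt_eqF.
  by apply: gt0_ltr_powR; rewrite ?nnegrE ?powR_ge0.
have cutN N : (N0 <= N)%N -> cutn rho N T w.
  move=> hN; have N1 : (0 < N)%N by exact: leq_trans hN.
  have small_Y tau : 0 <= tau <= T -> cutn rho N tau w -> `|X N tau w| < rho%:R.
    move=> tauT wc; have y1 : `|Y N tau w| < 1.
      have := h1 N tau N1 tauT wc; have := large N hN; have := powR_natr_gt0 (iota * r) N1.
      move=> p0 p1 p2; rewrite -(ltr_pM2l p0) mulr1; exact: le_lt_trans p2 p1.
    have -> : X N tau w = X 0%N tau w - Y N tau w by rewrite /Y opprB addrCA subrr addr0.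
    rewrite (le_lt_trans (ler_normB _ _))//; have := hB tau tauT; lra.
  have Zr : Z rho w by apply: Zw; rewrite /rho leq_addr.
  have mk tau : 0 <= tau <= T -> (forall s, 0 <= s <= tau -> `|X N s w| <= rho%:R) -> cutn rho N tau w.
    move=> /andP[_ tauT] h; split => // s /andP[s0 st]; split; last by apply: h; rewrite s0.
    by rewrite (le_trans (hB s _)) ?gerBl// s0 (le_trans st).
  have T00 : 0 <= (0 : R) <= T by rewrite lexx.
  have X0le : `|X N 0 w| <= rho%:R.
    have y1 : `|Y N 0 w| <= 1.
      rewrite -(ler_pM2l (powR_natr_gt0 (iota * r) N1)) mulr1.
      exact: le_trans (hi N N1) (ltW (large N hN)).
    have -> : X N 0 w = X 0%N 0 w - Y N 0 w by rewrite /Y opprB addrCA subrr addr0.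
    rewrite (le_trans (ler_normB _ _))//; have := hB 0 T00; lra.
  have cn : {within `[0, T], continuous (fun t => `|X N t w|)}.
    by move=> t; apply: cvg_norm; exact: X_cont.
  have := first_exit cn X0le (fun t tT h => small_Y t tT (mk t tT h)) => hN'.
  by apply: mk; [rewrite lexx T0'|move=> s sT; exact: hN'].
exists (M + \sum_(i < N0) Mf i)%N => N N1.
have [NN|NN] := ltnP N N0.
  by apply: good_mono (hMf N N1); rewrite (bigD1 (Ordinal NN))//= addnCA leq_addr.
by apply: good_mono (h2 N N1 (cutN N NN)); exact: leq_addr.
Qed.

End exponents.

Theorem holder_rate (delta eps : R) : 0 <= delta < theta -> 0 < eps ->
  P [set w |
       (ereal_sup [set (N%:R `^ (iota * (theta - delta - eps)))%:E *
                       holder_norm `[0%R, T] delta (fun t => X 0%N t w - X N t w)%R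
                   | N in [set N : nat | (0 < N)%N]] < +oo)%E] = 1%E.
Proof.
move=> dl eps0; have /andP[dl0 dl1] := dl.
(* A large [eps] would make the rate exponent negative. A smaller loss [e] keeps it positive and
   implies the claim for [eps]. *)
pose e := Num.min eps ((theta - delta) / 2).
have e0 : 0 < e by rewrite lt_min eps0 divr_gt0// subr_gt0.
have e_lt : e < theta - delta by rewrite gt_min; apply/orP; right; lra.
have ee : e <= eps by rewrite ge_min lexx.
pose c N : R := N%:R `^ (iota * (theta - delta - eps)).
have c0 N : (0 < N)%N -> 0 < c N by exact: powR_natr_gt0.
set S := (X in P X).
have SE : S = \bigcup_M \bigcap_N [set w | (0 < N)%N -> forall s t, 0 <= s <= T -> 0 <= t <= T ->
    c N * `|Y N t w| <= M%:R /\ c N * `|Y N t w - Y N s w| <= M%:R * `|t - s| `^ delta].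
  apply/seteqP; split => w.
    move=> /(holder_norm_bounded delta (fun N t => Y N t w) (ltW T0) c0)[M HM].
    by exists M => // N _ N0; exact: HM.
  move=> [M _ HM]; apply/(holder_norm_bounded delta (fun N t => Y N t w) (ltW T0) c0).
  by exists M => N N0; exact: (HM N Logic.I N0).
have gT (k n : nat) : (k <= n.+1)%N -> 0 <= T * k%:R / n.+1%:R <= T.
  move=> kn; rewrite divr_ge0 ?mulr_ge0 ?(ltW T0)//= ler_pdivrMr// ler_pM2l// ler_nat//.
have mS : measurable S.
  rewrite SE; apply: bigcupT_measurable => M; apply: bigcapT_measurable => N.
  case: N => [|N].
    by rewrite (_ : [set w | _] = setT)//; apply/seteqP; split.
  pose B n j k := [set w | c N.+1 * `|Y N.+1 (T * k%:R / n.+1%:R) w| <= M%:R /\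
    c N.+1 * `|Y N.+1 (T * k%:R / n.+1%:R) w - Y N.+1 (T * j%:R / n.+1%:R) w| <=
      M%:R * `|T * k%:R / n.+1%:R - T * j%:R / n.+1%:R| `^ delta].
  rewrite (_ : [set w | _] = \bigcap_n \bigcap_j \bigcap_k
    (if (j <= n.+1)%N && (k <= n.+1)%N then B n j k else setT)); last first.
    apply/seteqP; split => w.
      move=> H n _ j _ k _; case: ifP => // /andP[jn kn].
      by apply: H => //; exact: gT.
    move=> H _; apply: (holder_bound_on_grid (ltW T0) (@Y_cont N.+1 w) (ler0n _ _)).
    move=> n j k jn kn; have := H n Logic.I j Logic.I k Logic.I; rewrite jn kn.
    exact.
  apply: bigcapT_measurable => n; apply: bigcapT_measurable => j; apply: bigcapT_measurable => k.
  case: ifP => // /andP[/gT jT /gT kT].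
  rewrite (_ : B n j k = [set w | c N.+1 * `|Y N.+1 (T * k%:R / n.+1%:R) w| <= M%:R] `&`
    [set w | c N.+1 * `|Y N.+1 (T * k%:R / n.+1%:R) w - Y N.+1 (T * j%:R / n.+1%:R) w| <=
      M%:R * `|T * k%:R / n.+1%:R - T * j%:R / n.+1%:R| `^ delta]); last by apply/seteqP; split.
  apply: measurableI; rewrite -[X in measurable X]setTI; apply: measurable_fun_le => //.
    by apply: measurable_funM => //; exact: (path_dist_measurable Fl_normal cA bas_onb X_adapted).
  by apply: measurable_funM => //; exact: (dist2_measurable Fl_normal cA bas_onb X_adapted).
have aeS : {ae P, forall w, S w}.
  have := ae_good dl e0 e_lt; apply: filterS => w [M HM]; rewrite SE; exists M => // N _ N0 s t sT tT.
  have [h1 h2] := HM N N0 s t sT tT.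
  have cc : c N <= N%:R `^ (iota * (theta - delta - e)).
    by apply: ler_powR; rewrite ?ler1n// ler_wpM2l ?(ltW iota0)// lerD2l lerN2.
  by split; [apply: le_trans h1|apply: le_trans h2]; rewrite ler_wpM2r.
have PS : P (~` S) = 0%E.
  have [A' [mA' A0 sA]] := aeS.
  by apply: (subset_measure0 _ mA' sA A0); exact: measurableC.
have := probability_setC P mS; rewrite PS => /eqP; rewrite eq_sym.
have Pfin : P S \is a fin_num by exact: fin_num_measure.
by rewrite sube_eq// add0e => /eqP <-.
Qed.

End rate.

Lemma hs_norm_ge0 (R : realType) (U V : hilbertType R) (L : U -> V) : (0 <= hs_norm L)%E.
Proof. exact: sqrte_ge0. Qed.

Lemma hs2_le_sqr (R : realType) (U V : hilbertType R) (L : U -> V) (c : R) :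
  (hs_norm L <= c%:E)%E -> (hs2 L <= (c ^+ 2)%:E)%E.
Proof.
move=> h; rewrite -sqre_hs_norm expe2 expr2 EFinM; have h0 := hs_norm_ge0 L.
exact: lee_pmul.
Qed.

Lemma holder_seminorm_lipschitz (R : realType) (M : normedModType R) (D : set M)
    (dV : M -> M -> \bar R) (x y : M) : D x -> D y -> x != y ->
  (dV x y * (`|x - y|^-1)%:E <= holder_seminorm D 1 dV)%E.
Proof.
move=> Dx Dy xy; apply: ereal_sup_ubound; left; exists (x, y) => //=.
by rewrite powRr1.
Qed.

Lemma lee_pdivr (R : realType) (a : \bar R) (c L : R) : 0 < c ->
  (a * (c^-1)%:E <= L%:E)%E -> (a <= (L * c)%:E)%E.
Proof.
move=> c0 h; rewrite EFinM -lee_pdivrMr// ; exact: h.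
Qed.

(** * Verification of the abstract bounds for the evolution equation *)

Section instance.
Context {R : realType} {Hr : R -> hilbertType R} {U : hilbertType R}.
Context {HH : set (Hr 0)} (onb : orthonormal_basis HH).
Context {lam : Hr 0 -> R} {c0 : R} (c0_gt0 : 0 < c0).
Hypothesis lamc : forall h, HH h -> lam h <= - c0.
Context {emb : forall r s : R, Hr r -> Hr s} (Hr_interp : interpolation_family emb HH lam).
Arguments emb : clear implicits.
Context {A : Hr 0 -> Hr 0}.
Hypothesis A_diag : forall v, diag_dom HH lam v -> has_sum HH (fun h => (lam h * inner h v) *: h) (A v).
Context {S : forall r : R, R -> Hr r -> Hr r}.
Arguments S : clear implicits.
Hypothesis S_semigroup : semigroup_family emb (diag_dom HH lam) A S.
Context {T iota gam alpha beta chi theta : R} (T0 : 0 < T) (iota0 : 0 < iota).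
Hypothesis alpha_itv : 0 <= alpha < 1.
Hypothesis beta_itv : 0 <= beta < 2^-1.
Hypothesis chi_itv : beta <= chi < 2^-1.
Hypothesis theta_itv : 0 < theta < Num.min (1 - alpha) (2^-1 - beta).
Context {HN : nat -> set (Hr 0)} (HN_sub : forall N, HN N `<=` HH) (HN0 : HN 0%N = HH).
Hypothesis HN_rate : (ereal_sup
     [set (N%:R `^ iota)%:E *
          ereal_sup ([set (`|lam h|^-1)%:E | h in HH `\` HN N] `|` [set 0%E])
      | N in [set N : nat | (0 < N)%N]] < +oo)%E.
Local Notation m := (Num.min 0 (gam - 1)).
Context {PH : nat -> Hr m -> Hr m} (PH_bounded : forall N, bounded_operator (PH N)).
Hypothesis PH_proj : forall N v, exists2 w, has_sum (HN N) (fun h => inner h v *: h) w &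
     PH N (emb 0 m v) = emb 0 m w.
Context {F : Hr gam -> Hr (gam - alpha)} {B : Hr gam -> U -> Hr (gam - beta)}.
Hypothesis B_hs : forall x, hilbert_schmidt (B x).
Hypothesis FB_lip : forall D : set (Hr gam), bounded_set D ->
     (holder_seminorm D 1 (fun x y => `|F x - F y|%:E) +
      holder_seminorm D 1 (fun x y => hs_norm (B x \- B y)%R) < +oo)%E.
Context {PU : nat -> U -> U} (PU_bounded : forall N, bounded_operator (PU N)).
Hypothesis PU_rate : forall D : set (Hr gam), D !=set0 -> bounded_set D ->
     (ereal_sup [set ereal_sup
        [set (hs_norm (B v \o PU N) +
              (N%:R `^ (iota * theta))%:E *
              hs_norm (fun u => emb (gam - beta)%R (gam - chi)%R
                                  (B v (PU 0%N u - PU N u)%R))) *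
             ((1 + `|v|)^-1)%:E
         | v in D]
      | N in [set N : nat | (0 < N)%N]] < +oo)%E.

Let th0 : 0 < theta. Proof. by case/andP: theta_itv. Qed.
Let th_alpha : theta < 1 - alpha. Proof. by case/andP: theta_itv => _; rewrite lt_min => /andP[]. Qed.
Let th_beta : theta < 2^-1 - beta. Proof. by case/andP: theta_itv => _; rewrite lt_min => /andP[]. Qed.
Let m_le0 : m <= 0. Proof. by rewrite ge_min lexx. Qed.
Let m_gam1 : m <= gam - 1. Proof. by rewrite ge_min lexx orbT. Qed.
Let m_gam : m <= gam. Proof. by rewrite (le_trans m_gam1)// gerBl. Qed.
Let lvl (a : R) : 0 <= a <= 1 -> m <= gam - a /\ gam - 1 <= gam - a <= gam.
Proof.
move=> /andP[a0 a1]; rewrite lerD2l lerN2 a1 gerBl a0; split => //.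
by rewrite (le_trans m_gam1)// lerD2l lerN2.
Qed.

(** One singularity exponent for all kernels: the drift with a gain of order [theta], the squared
    diffusion with the same gain, and the squared truncation error of the noise, which is controlled
    only in the weaker space of index [gam - chi]. *)
Definition decay : R := Num.max (alpha + theta) (Num.max (2 * (beta + theta)) (2 * chi)).
Let p := decay.
Lemma decay01 : 0 <= p < 1.
Proof.
have /andP[a0 a1] := alpha_itv; have /andP[b0 b1] := beta_itv; have /andP[b2 b3] := chi_itv.
have h1 := th_alpha; have h2 := th_beta; have h0 := th0.
rewrite /p /decay !le_max !gt_max; apply/andP; split; first by apply/orP; left; lra.
by apply/and3P; split; lra.
Qed.

Let pow_p (q t : R) : 0 < t <= T -> 0 <= q -> q <= p -> t `^ (- q) <= (1 + T) * t `^ (- p).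
Proof.
move=> tT q0 qp; rewrite (le_trans (powRN_le tT qp))// ler_wpM2r ?powR_ge0//.
by apply: powR_le_1D => //; have /andP[_ p1] := decay01; rewrite subr_ge0 qp/= lerBlDr (le_trans (ltW p1))// lerDl.
Qed.

Let p_alpha : alpha + theta <= p. Proof. by rewrite /p /decay le_max lexx. Qed.
Let p_beta : 2 * (beta + theta) <= p. Proof. by rewrite /p /decay !le_max lexx orbT. Qed.
Let p_chi : 2 * chi <= p. Proof. by rewrite /p /decay !le_max lexx !orbT. Qed.

Definition decay_rate (N : nat) : R := N%:R `^ (- (iota * theta)).
Let eta := decay_rate.
Let eta0 N : 0 <= eta N. Proof. exact: powR_ge0. Qed.

Local Notation sm N r t x := (@smoothing R Hr emb S m gam PH N r t x).

(** The assumed decay of 1/|lam h| over the discarded modes, raised to the power [theta]: the form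
    in which [smoothing_diff] consumes it. *)
Lemma spectral_rate : exists2 M : R, 0 <= M & forall N h, (0 < N)%N -> HH h -> ~ HN N h ->
  (- lam h) `^ (- theta) <= M * eta N.
Proof.
move: HN_rate; set s := ereal_sup _ => sfin.
have sN N h : (0 < N)%N -> HH h -> ~ HN N h -> ((N%:R `^ iota * `|lam h|^-1)%:E <= s)%E.
  move=> N0 Hh Nh; apply: le_trans (ereal_sup_ubound (_ : _ _)); last by exists N.
  rewrite EFinM; apply: lee_wpmul2l; first by rewrite lee_fin powR_ge0.
  by apply: ereal_sup_ubound; left; exists h.
exists (`|fine s| `^ theta); first exact: powR_ge0.
move=> N h N0 Hh Nh; have Np : 0 < N%:R `^ iota :> R by rewrite powR_gt0// ltr0n.
have lh : 0 < - lam h by rewrite oppr_gt0 (le_lt_trans (lamc Hh))// oppr_lt0.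
have h1 : N%:R `^ iota * (- lam h)^-1 <= `|fine s|.
  have h2 := sN N h N0 Hh Nh; have s0 : (0 <= s)%E.
    by apply: le_trans h2; rewrite lee_fin mulr_ge0 ?powR_ge0// invr_ge0.
  have sf : s \is a fin_num by rewrite ge0_fin_numE.
  have ln : `|lam h| = - lam h by rewrite ltr0_norm// -oppr_gt0.
  move: h2; rewrite -(fineK sf) lee_fin ln => h2.
  by rewrite (le_trans h2)// ler_norm.
have h3 : (- lam h)^-1 <= `|fine s| * (N%:R `^ iota)^-1 by rewrite ler_pdivlMr// mulrC.
have e (y a : R) : ((y `^ a)^-1) `^ theta = y `^ (- (a * theta)) by rewrite -powRN -powRrM mulNr.
have := e (- lam h) 1; rewrite powRr1 ?(ltW lh)// mul1r => <-.
rewrite /eta /decay_rate -e -powRM ?invr_ge0 ?(ltW Np)//.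
by apply: ge0_ler_powR; rewrite ?nnegrE ?invr_ge0 ?mulr_ge0 ?invr_ge0 ?(ltW lh) ?(ltW Np) ?(ltW th0).
Qed.

Let B_bop x : bounded_operator (B x). Proof. by case: (B_hs x). Qed.

Let BB_bop x y : bounded_operator (B x \- B y)%R.
Proof.
have [lx cx] := B_bop x; have [ly cy] := B_bop y; split.
  by move=> a u v /=; rewrite lx ly scalerBr opprD addrACA.
by move=> u; apply: cvgB; [exact: cx|exact: cy].
Qed.

Let ball_bounded n : bounded_set [set x : Hr gam | `|x| <= n%:R].
Proof.
exists n%:R; split; first exact: num_real.
by move=> r nr x /= xn; rewrite (le_trans xn)// ltW.
Qed.

Lemma lipschitz_on_ball n : exists2 L : R, 0 <= L & forall x y, `|x| <= n%:R -> `|y| <= n%:R ->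
  `|F x - F y| <= L * `|x - y| /\ (hs2 (B x \- B y)%R <= ((L * `|x - y|) ^+ 2)%:E)%E.
Proof.
pose D := [set x : Hr gam | `|x| <= n%:R].
have := FB_lip (@ball_bounded n); rewrite -/D.
set s1 := holder_seminorm D 1 (fun x y => `|F x - F y|%:E).
set s2 := holder_seminorm D 1 (fun x y => hs_norm (B x \- B y)%R) => s12.
have s10 : (0 <= s1)%E by apply: ereal_sup_ubound; right.
have s20 : (0 <= s2)%E by apply: ereal_sup_ubound; right.
have f1 : s1 \is a fin_num by rewrite ge0_fin_numE// (le_lt_trans _ s12)// leeDl.
have f2 : s2 \is a fin_num by rewrite ge0_fin_numE// (le_lt_trans _ s12)// leeDr.
have L10 : 0 <= fine s1 by exact: fine_ge0.
have L20 : 0 <= fine s2 by exact: fine_ge0.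
exists (fine s1 + fine s2); first exact: addr_ge0.
move=> x y Dx Dy; have [->|xy] := eqVneq x y.
  rewrite !subrr !normr0 !mulr0; split; first by [].
  by rewrite expr0n/= /hs2 esum1// => u _; rewrite /= subrr normr0 expr0n.
have xy0 : 0 < `|x - y| by rewrite normr_gt0 subr_eq0.
have h1 := @holder_seminorm_lipschitz R (Hr gam) D (fun x y => `|F x - F y|%:E) x y Dx Dy xy.
have h2 := @holder_seminorm_lipschitz R (Hr gam) D (fun x y => hs_norm (B x \- B y)%R) x y Dx Dy xy.
split.
  have : (`|F x - F y|%:E <= (fine s1 * `|x - y|)%:E)%E by apply: lee_pdivr => //; rewrite fineK.
  by rewrite lee_fin => h; rewrite (le_trans h)// ler_wpM2r// lerDl.
apply: hs2_le_sqr; apply: (@le_trans _ _ (fine s2 * `|x - y|)%:E).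
  by apply: lee_pdivr => //; rewrite fineK.
by rewrite lee_fin ler_wpM2r// lerDr.
Qed.

Lemma truncation_on_ball n : exists2 K : R, 0 <= K & forall N x, (0 < N)%N -> `|x| <= n%:R ->
  (hs2 (B x \o PU N) <= (K ^+ 2)%:E)%E /\
  (hs2 (fun u => emb (gam - beta)%R (gam - chi)%R (B x (PU 0%N u - PU N u)%R)) <= ((K * eta N) ^+ 2)%:E)%E.
Proof.
pose D := [set x : Hr gam | `|x| <= n%:R].
have D0 : D !=set0 by exists 0; rewrite /D /= normr0.
have := PU_rate D0 (@ball_bounded n); set s := ereal_sup _ => sfin.
pose a1 N x := hs_norm (B x \o PU N).
pose a2 N x := hs_norm (fun u => emb (gam - beta)%R (gam - chi)%R (B x (PU 0%N u - PU N u)%R)).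
have key N x : (0 < N)%N -> D x ->
    ((a1 N x + (N%:R `^ (iota * theta))%:E * a2 N x) * ((1 + `|x|)^-1)%:E <= s)%E.
  move=> N0 Dx; apply: (@le_trans _ _ (ereal_sup
        [set (hs_norm (B v \o PU N) +
              (N%:R `^ (iota * theta))%:E *
              hs_norm (fun u => emb (gam - beta)%R (gam - chi)%R
                                  (B v (PU 0%N u - PU N u)%R))) *
             ((1 + `|v|)^-1)%:E
         | v in D])%E).
    by apply: ereal_sup_ubound; exists x.
  by apply: ereal_sup_ubound; exists N.
have a10 N x : (0 <= a1 N x)%E by exact: hs_norm_ge0.
have a20 N x : (0 <= a2 N x)%E by exact: hs_norm_ge0.
have b0 N x : (0 <= (N%:R `^ (iota * theta))%:E * a2 N x)%E by rewrite mule_ge0// lee_fin powR_ge0.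
have s0 : (0 <= s)%E.
  have [x Dx] := D0; apply: le_trans (key 1%N x isT Dx).
  by rewrite mule_ge0 ?adde_ge0// lee_fin invr_ge0 addr_ge0.
have sf : s \is a fin_num by rewrite ge0_fin_numE.
pose K := fine s * (1 + n%:R); have K0 : 0 <= K by rewrite mulr_ge0 ?fine_ge0// addr_ge0.
exists K => // N x N0 xn; have x1 : 0 < 1 + `|x| by rewrite ltr_pwDl.
have h : (a1 N x + (N%:R `^ (iota * theta))%:E * a2 N x <= K%:E)%E.
  apply: (@le_trans _ _ (fine s * (1 + `|x|))%:E).
    by apply: lee_pdivr => //; rewrite fineK//; exact: key.
  by rewrite lee_fin ler_wpM2l ?fine_ge0// lerD2l.
split; apply: hs2_le_sqr; first by rewrite (le_trans _ h)// leeDl.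
have Np : 0 < N%:R `^ (iota * theta) :> R by rewrite powR_gt0// ltr0n.
rewrite /eta /decay_rate powRN; apply: lee_pdivr; first by rewrite invr_gt0.
by rewrite invrK muleC (le_trans _ h)// leeDr.
Qed.

Lemma ball_constants n : exists2 K : R, 0 <= K & forall x y, `|x| <= n%:R -> `|y| <= n%:R ->
  [/\ `|F x| <= K, `|F x - F y| <= K * `|x - y|, (forall N, hs2 (B x \o PU N) <= (K ^+ 2)%:E)%E,
      (hs2 ((B x \- B y)%R \o PU 0%N) <= ((K * `|x - y|) ^+ 2)%:E)%E &
      (forall N, (0 < N)%N -> hs2 (fun u => emb (gam - beta)%R (gam - chi)%R (B x (PU 0%N u - PU N u)%R)) <=
         ((K * eta N) ^+ 2)%:E)%E].
Proof.
have [L L0 HL] := lipschitz_on_ball n; have [K1 K10 HK1] := truncation_on_ball n.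
have [M0 M00 HM] := bop_bound (PU_bounded 0%N); have M0' := ltW M00.
have B0f : hs_norm (B 0) \is a fin_num by rewrite ge0_fin_numE ?hs_norm_ge0//; case: (B_hs 0).
pose k := fine (hs_norm (B 0)); have k0 : 0 <= k by apply: fine_ge0; exact: hs_norm_ge0.
pose K2 := 2 * (L * n%:R + k); have K20 : 0 <= K2 by rewrite mulr_ge0// addr_ge0// mulr_ge0.
pose K := `|F 0| + L * n%:R + L + M0 * K2 + M0 * L + K1.
have t1 : 0 <= L * n%:R by rewrite mulr_ge0.
have t2 : 0 <= M0 * K2 by rewrite mulr_ge0.
have t3 : 0 <= M0 * L by rewrite mulr_ge0.
have t4 : 0 <= `|F 0| by [].
have K0 : 0 <= K by rewrite /K; lra.
have n0 : `|0 : Hr gam| <= n%:R by rewrite normr0.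
have linPU := (PU_bounded 0%N).1.
exists K => // x y xn yn.
have [hF hB] := HL x y xn yn; have [hF0 hB0] := HL x 0 xn n0; rewrite subr0 in hF0 hB0.
have sq (a b : R) : 0 <= a -> a <= b -> ((a ^+ 2)%:E <= (b ^+ 2)%:E)%E.
  by move=> a0 ab; rewrite lee_fin lerXn2r ?nnegrE// (le_trans a0).
(* The truncation hypothesis speaks of positive [N]. For [N = 0] the bound follows from the
   Lipschitz bound around [B 0] and the boundedness of [PU 0]. *)
have hs0 N : (hs2 (B x \o PU N) <= (K ^+ 2)%:E)%E.
  case: N => [|N]; last first.
    have [h _] := HK1 N.+1 x isT xn; apply: (le_trans h); apply: sq => //.
    by rewrite /K; lra.
  have hBx : (hs2 (B x) <= (K2 ^+ 2)%:E)%E.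
    have -> : B x = fun u => (B x \- B 0) u + B 0 u by apply/funext => u; rewrite /= subrK.
    apply: (le_trans (hs2D _ _)).
    apply: (@le_trans _ _ (2%:E * (((L * n%:R) ^+ 2)%:E + (k ^+ 2)%:E))%E).
      apply: lee_wpmul2l => //; apply: leeD.
        by apply: (le_trans hB0); apply: sq; rewrite ?mulr_ge0// ler_wpM2l.
      by apply: hs2_le_sqr; rewrite fineK.
    rewrite -EFinD -EFinM lee_fin /K2.
    by have : 0 <= (L * n%:R) * k; [rewrite mulr_ge0|have := sqr_ge0 (L * n%:R); have := sqr_ge0 k; lra].
  apply: (le_trans (hs2_comp_le (B_bop x) linPU M0' HM)).
  apply: (@le_trans _ _ ((M0 ^+ 2)%:E * (K2 ^+ 2)%:E)%E).
    by apply: lee_wpmul2l => //; rewrite lee_fin sqr_ge0.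
  by rewrite -EFinM -exprMn; apply: sq => //; rewrite /K; lra.
split => //.
- have -> : F x = (F x - F 0) + F 0 by rewrite subrK.
  rewrite (le_trans (ler_normD _ _))//.
  have : `|F x - F 0| <= L * n%:R by rewrite (le_trans hF0)// ler_wpM2l.
  by rewrite /K; lra.
- by rewrite (le_trans hF)// ler_wpM2r// /K; lra.
- apply: (le_trans (hs2_comp_le (BB_bop x y) linPU M0' HM)).
  apply: (@le_trans _ _ ((M0 ^+ 2)%:E * ((L * `|x - y|) ^+ 2)%:E)%E).
    by apply: lee_wpmul2l => //; rewrite lee_fin sqr_ge0.
  rewrite -EFinM -exprMn; apply: sq; first by rewrite !mulr_ge0.
  by rewrite mulrA ler_wpM2r// /K; lra.
- move=> N N0; have [_ h] := HK1 N x N0 xn; apply: (le_trans h); apply: sq; first exact: mulr_ge0.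
  by rewrite ler_wpM2r// /K; lra.
Qed.

Let smB := smoothing_bound onb c0_gt0 lamc Hr_interp A_diag S_semigroup m_le0 m_gam HN_sub PH_bounded PH_proj.
Let smD := smoothing_diff onb c0_gt0 lamc Hr_interp A_diag S_semigroup m_le0 m_gam HN_sub HN0 PH_bounded PH_proj.
Let smT := smoothing_time onb c0_gt0 lamc Hr_interp A_diag S_semigroup m_le0 m_gam HN_sub PH_bounded PH_proj.
Let smL := smoothing_lin onb c0_gt0 lamc Hr_interp A_diag S_semigroup m_le0 m_gam HN_sub PH_bounded PH_proj.
Let sm0D := smoothing0_diff onb c0_gt0 lamc Hr_interp A_diag S_semigroup m_le0 m_gam HN_sub HN0 PH_bounded PH_proj.
Let sm0T := smoothing0_time onb c0_gt0 lamc Hr_interp A_diag S_semigroup m_le0 m_gam HN_sub PH_bounded PH_proj.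

Let gamB a : gam - (gam - a) = a. Proof. by rewrite opprB addrCA subrr addr0. Qed.

Let pow2 (t q : R) : (t `^ (- q)) ^+ 2 = t `^ (- (2 * q)).
Proof. by rewrite -powR_mulrn ?powR_ge0// -powRrM; congr (_ `^ _); ring. Qed.

Let weaken (a c c' b : R) : 0 <= b -> c <= c' -> a <= c * b -> a <= c' * b.
Proof. by move=> b0 cc h; rewrite (le_trans h)// ler_wpM2r. Qed.

Let alpha1 : 0 <= alpha <= 1. Proof. by case/andP: alpha_itv => -> /ltW ->. Qed.
Let beta1 : 0 <= beta <= 1. Proof. by case/andP: beta_itv => -> h; rewrite /=; lra. Qed.
Let chi1 : 0 <= chi <= 1.
Proof. by case/andP: chi_itv => h1 h2; case/andP: beta_itv => h3 _; apply/andP; split; lra. Qed.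
Let at1 : alpha + theta <= 1. Proof. by have := th_alpha; lra. Qed.
Let bt1 : beta + theta <= 1. Proof. by have := th_beta; lra. Qed.

(** This and the next two unfold to the terms of the mild equation, so the bounds proved for them
    apply there by conversion. *)
Definition drift N t (x : Hr gam) : Hr gam := sm N (gam - alpha) t (F x).
Definition diffusion N t (x : Hr gam) (u : U) : Hr gam := sm N (gam - beta) t (B x (PU N u)).
Definition start N t (x : Hr gam) : Hr gam := sm N gam t x.

Section radius.
Context {n : nat} {K : R} (K0 : 0 <= K).
Hypothesis HK : forall x y, `|x| <= n%:R -> `|y| <= n%:R ->
  [/\ `|F x| <= K, `|F x - F y| <= K * `|x - y|, (forall N, hs2 (B x \o PU N) <= (K ^+ 2)%:E)%E,
      (hs2 ((B x \- B y)%R \o PU 0%N) <= ((K * `|x - y|) ^+ 2)%:E)%E &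
      (forall N, (0 < N)%N -> hs2 (fun u => emb (gam - beta)%R (gam - chi)%R (B x (PU 0%N u - PU N u)%R)) <=
         ((K * eta N) ^+ 2)%:E)%E].
Context {M : R} (M0 : 0 <= M).
Hypothesis HM : forall N h, (0 < N)%N -> HH h -> ~ HN N h -> (- lam h) `^ (- theta) <= M * eta N.
Let T1 := 1 + T.
Let T10 : 0 <= T1. Proof. by rewrite addr_ge0// ltW. Qed.

Lemma drift_diff N x y t : (0 < N)%N -> 0 < t <= T -> `|x| <= n%:R -> `|y| <= n%:R ->
  `|drift 0 t x - drift N t y| <= (T1 * (M + 1) * K) * (t `^ (- p) * (eta N + `|x - y|)).
Proof.
move=> N0 tT xn yn; have /andP[t0 _] := tT; have [h1 h2 _ _ _] := HK xn yn.
have [l1 l2] := lvl alpha1; have /andP[a0 _] := alpha1.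
have -> : drift 0 t x - drift N t y = (drift 0 t x - drift N t x) + (drift N t x - drift N t y).
  by rewrite addrA subrK.
rewrite (le_trans (ler_normD _ _))//.
have e1 : `|drift 0 t x - drift N t x| <= M * eta N * (T1 * t `^ (- p)) * K.
  have := @smD N theta (M * eta N) (gam - alpha) t (F x) (ltW th0) (mulr_ge0 M0 (eta0 N)) l1 l2.
  rewrite gamB => /(_ at1 t0 (fun h => @HM N h N0)) h; apply: (le_trans h).
  apply: ler_pM => //; rewrite ?mulr_ge0 ?powR_ge0//.
  by rewrite ler_wpM2l ?mulr_ge0//; apply: pow_p => //; rewrite addr_ge0// ltW.
have e2 : `|drift N t x - drift N t y| <= (T1 * t `^ (- p)) * (K * `|x - y|).
  rewrite /drift -smL//; have := @smB N (gam - alpha) t (F x - F y) l1 l2 t0.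
  rewrite gamB => h; apply: (le_trans h); apply: ler_pM; rewrite ?powR_ge0//.
  by apply: pow_p => //; have := p_alpha; have := th0; lra.
rewrite (le_trans (lerD e1 e2))//.
have w0 : 0 <= T1 * t `^ (- p) * K by rewrite !mulr_ge0 ?powR_ge0.
have : 0 <= T1 * t `^ (- p) * K * (eta N + M * `|x - y|).
  by rewrite mulr_ge0// addr_ge0// mulr_ge0.
lra.
Qed.

(** Three errors: [G1] from the spectral projection, [G2] from the arguments of [B], [G3] from
    truncating the noise. For [G3] the smoothing starts from the embedded vector at level
    [gam - chi], where the rate is assumed, and [smoothing_emb] says that this changes nothing. *)
Lemma diffusion_diff N x y t : (0 < N)%N -> 0 < t <= T -> `|x| <= n%:R -> `|y| <= n%:R ->
  (hs2 (fun u => diffusion 0 t x u - diffusion N t y u)%R <=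
   ((4 * T1 * (M ^+ 2 + 1) * K ^+ 2) * (t `^ (- p) * (eta N ^+ 2 + `|x - y| ^+ 2)))%:E)%E.
Proof.
move=> N0 tT xn yn; have /andP[t0 _] := tT; have [_ _ h3 h4 _] := HK xn yn.
have [_ _ _ _ h5] := HK yn xn.
have [l1 l2] := lvl beta1; have [l3 l4] := lvl chi1.
have /andP[b0 _] := beta1; have /andP[c00 _] := chi1; have /andP[bc _] := chi_itv.
pose G1 u := diffusion 0 t x u - sm N (gam - beta) t (B x (PU 0%N u)).
pose G2 u := sm N (gam - beta) t ((B x \- B y)%R (PU 0%N u)).
pose G3 u := sm N (gam - beta) t (B y (PU 0%N u - PU N u)).
have linB z := (B_bop z).1.
have tel (a b c e : Hr gam) : a - e = (a - b) + ((b - c) + (c - e)).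
  by rewrite (_ : (b - c) + (c - e) = b - e) ?[RHS]addrA ?subrK// addrA subrK.
have -> : (fun u => diffusion 0 t x u - diffusion N t y u) = (fun u => G1 u + (G2 u + G3 u)).
  apply/funext => u.
  have g2 : G2 u = sm N (gam - beta) t (B x (PU 0%N u)) - sm N (gam - beta) t (B y (PU 0%N u)).
    by rewrite /G2; apply: smL.
  have g3 : G3 u = sm N (gam - beta) t (B y (PU 0%N u)) - sm N (gam - beta) t (B y (PU N u)).
    by rewrite /G3 (bopB (linB y)); apply: smL.
  by rewrite g2 g3; exact: tel.
have pp : 0 <= T1 * t `^ (- p) by rewrite mulr_ge0 ?powR_ge0.
have e1 : (hs2 G1 <= (M ^+ 2 * eta N ^+ 2 * (T1 * t `^ (- p)) * K ^+ 2)%:E)%E.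
  have c0' : 0 <= M * eta N * t `^ (- (beta + theta)) by rewrite !mulr_ge0 ?powR_ge0.
  apply: (le_trans (hs2_le (K := B x \o PU 0%N) c0' _)).
    move=> u; have := @smD N theta (M * eta N) (gam - beta) t (B x (PU 0%N u)) (ltW th0) (mulr_ge0 M0 (eta0 N)) l1 l2.
    by rewrite gamB => /(_ bt1 t0 (fun h => @HM N h N0)).
  apply: (@le_trans _ _ (((M * eta N * t `^ (- (beta + theta))) ^+ 2)%:E * (K ^+ 2)%:E)%E).
    by apply: lee_wpmul2l; [rewrite lee_fin sqr_ge0|exact: h3].
  rewrite -EFinM lee_fin ler_wpM2r ?sqr_ge0// !exprMn ler_wpM2l ?mulr_ge0 ?sqr_ge0// pow2.
  by apply: pow_p => //; rewrite mulr_ge0// addr_ge0// ltW.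
have e2 : (hs2 G2 <= ((T1 * t `^ (- p)) * (K * `|x - y|) ^+ 2)%:E)%E.
  apply: (le_trans (hs2_le (K := (B x \- B y)%R \o PU 0%N) (powR_ge0 t (- beta)) _)).
    by move=> u; have := @smB N (gam - beta) t ((B x \- B y)%R (PU 0%N u)) l1 l2 t0; rewrite gamB.
  apply: (@le_trans _ _ (((t `^ (- beta)) ^+ 2)%:E * ((K * `|x - y|) ^+ 2)%:E)%E).
    by apply: lee_wpmul2l; [rewrite lee_fin sqr_ge0|exact: h4].
  rewrite -EFinM lee_fin ler_wpM2r ?sqr_ge0// pow2.
  by apply: pow_p => //; [rewrite mulr_ge0|have := p_beta; have := th0; lra].
have e3 : (hs2 G3 <= ((T1 * t `^ (- p)) * (K * eta N) ^+ 2)%:E)%E.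
  apply: (le_trans (hs2_le (K := fun u => emb (gam - beta) (gam - chi) (B y (PU 0%N u - PU N u))) (powR_ge0 t (- chi)) _)).
    move=> u; have := @smB N (gam - chi) t (emb (gam - beta) (gam - chi) (B y (PU 0%N u - PU N u))) l3 l4 t0.
    rewrite gamB (smoothing_emb Hr_interp)//.
    by rewrite lerD2l lerN2.
  apply: (@le_trans _ _ (((t `^ (- chi)) ^+ 2)%:E * ((K * eta N) ^+ 2)%:E)%E).
    by apply: lee_wpmul2l; [rewrite lee_fin sqr_ge0|exact: h5].
  rewrite -EFinM lee_fin ler_wpM2r ?sqr_ge0// pow2.
  by apply: pow_p => //; rewrite mulr_ge0.
apply: (le_trans (hs2D _ _)).
apply: (@le_trans _ _ (2%:E * ((M ^+ 2 * eta N ^+ 2 * (T1 * t `^ (- p)) * K ^+ 2)%:E +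
   2%:E * (((T1 * t `^ (- p)) * (K * `|x - y|) ^+ 2)%:E + ((T1 * t `^ (- p)) * (K * eta N) ^+ 2)%:E)))%E).
  apply: lee_wpmul2l => //; apply: leeD => //; apply: (le_trans (hs2D _ _)).
  by apply: lee_wpmul2l => //; exact: leeD.
rewrite -!(EFinD, EFinM) lee_fin.
have w0 : 0 <= T1 * t `^ (- p) * K ^+ 2 by rewrite mulr_ge0// sqr_ge0.
have u1 : 0 <= T1 * t `^ (- p) * K ^+ 2 * (M ^+ 2 * eta N ^+ 2).
  by rewrite mulr_ge0// mulr_ge0 ?sqr_ge0.
have u2 : 0 <= T1 * t `^ (- p) * K ^+ 2 * (M ^+ 2 * `|x - y| ^+ 2).
  by rewrite mulr_ge0// mulr_ge0 ?sqr_ge0.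
lra.
Qed.

Lemma drift_time N x s t : 0 < s -> s <= t -> t <= T -> `|x| <= n%:R ->
  `|drift N t x - drift N s x| <= (T1 * K) * ((t - s) `^ theta * s `^ (- p)).
Proof.
move=> s0 st tT xn; have [h1 _ _ _ _] := HK xn xn; have [l1 l2] := lvl alpha1; have /andP[a0 _] := alpha1.
have st' : 0 < s <= t by rewrite s0.
have := @smT N theta (gam - alpha) t s (F x) (ltW th0) l1 l2; rewrite gamB => /(_ at1 st') h.
apply: (le_trans h).
have q1 : s `^ (- (alpha + theta)) <= T1 * s `^ (- p).
  by apply: pow_p; rewrite ?s0 ?(le_trans st)// ?addr_ge0// ltW.
have g0 : 0 <= (t - s) `^ theta by exact: powR_ge0.
apply: (@le_trans _ _ ((t - s) `^ theta * (T1 * s `^ (- p)) * K)).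
  by apply: ler_pM => //; rewrite ?mulr_ge0 ?powR_ge0// ler_wpM2l.
by rewrite le_eqVlt; apply/orP; left; apply/eqP; ring.
Qed.

Lemma diffusion_time N x s t : 0 < s -> s <= t -> t <= T -> `|x| <= n%:R ->
  (hs2 (fun u => diffusion N t x u - diffusion N s x u)%R <=
    ((T1 * K ^+ 2) * ((t - s) `^ (2 * theta) * s `^ (- p)))%:E)%E.
Proof.
move=> s0 st tT xn; have [_ _ h3 _ _] := HK xn xn; have [l1 l2] := lvl beta1; have /andP[b0 _] := beta1.
have st' : 0 < s <= t by rewrite s0.
have c0' : 0 <= (t - s) `^ theta * s `^ (- (beta + theta)) by rewrite mulr_ge0 ?powR_ge0.
apply: (le_trans (hs2_le (K := B x \o PU N) c0' _)).
  move=> u; have := @smT N theta (gam - beta) t s (B x (PU N u)) (ltW th0) l1 l2.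
  by rewrite gamB => /(_ bt1 st').
apply: (@le_trans _ _ ((((t - s) `^ theta * s `^ (- (beta + theta))) ^+ 2)%:E * (K ^+ 2)%:E)%E).
  by apply: lee_wpmul2l; [rewrite lee_fin sqr_ge0|exact: h3].
have q1 : s `^ (- (2 * (beta + theta))) <= T1 * s `^ (- p).
  by apply: pow_p; rewrite ?s0 ?(le_trans st)// ?mulr_ge0 ?addr_ge0// ltW.
have -> : (t - s) `^ (2 * theta) = ((t - s) `^ theta) ^+ 2.
  by rewrite -powR_mulrn ?powR_ge0// -powRrM mulrC.
rewrite -EFinM lee_fin exprMn pow2.
have g0 : 0 <= ((t - s) `^ theta) ^+ 2 by exact: sqr_ge0.
apply: (@le_trans _ _ (((t - s) `^ theta) ^+ 2 * (T1 * s `^ (- p)) * K ^+ 2)).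
  by rewrite ler_wpM2r ?sqr_ge0// ler_wpM2l.
by rewrite le_eqVlt; apply/orP; left; apply/eqP; ring.
Qed.

Let powT (t q r : R) : 0 < t <= T -> 0 <= r - q <= 1 -> t `^ (- q) <= T1 * t `^ (- r).
Proof.
move=> tT /andP[rq rq1]; have qr : q <= r by rewrite -subr_ge0.
rewrite (le_trans (powRN_le tT qr))// ler_wpM2r ?powR_ge0//.
by apply: powR_le_1D => //; rewrite rq.
Qed.

Lemma drift_bound N x t : 0 < t <= T -> `|x| <= n%:R ->
  `|drift N t x| <= (T1 * K) * t `^ (- (1 - theta)).
Proof.
move=> tT xn; have /andP[t0 _] := tT; have [h1 _ _ _ _] := HK xn xn.
have [l1 l2] := lvl alpha1; have /andP[a0 _] := alpha1; have h2 := th_alpha; have h3 := th0.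
have := @smB N (gam - alpha) t (F x) l1 l2 t0; rewrite gamB => h; apply: (le_trans h).
rewrite mulrAC; apply: ler_pM => //; first exact: powR_ge0.
by apply: powT => //; apply/andP; split; lra.
Qed.

Lemma diffusion_bound N x t : 0 < t <= T -> `|x| <= n%:R ->
  (hs2 (diffusion N t x) <= ((T1 * K ^+ 2) * t `^ (- (1 - 2 * theta)))%:E)%E.
Proof.
move=> tT xn; have /andP[t0 _] := tT; have [_ _ h3 _ _] := HK xn xn.
have [l1 l2] := lvl beta1; have /andP[b0 _] := beta1; have h2 := th_beta; have h4 := th0.
apply: (le_trans (hs2_le (K := B x \o PU N) (powR_ge0 t (- beta)) _)).
  by move=> u; have := @smB N (gam - beta) t (B x (PU N u)) l1 l2 t0; rewrite gamB.
apply: (@le_trans _ _ (((t `^ (- beta)) ^+ 2)%:E * (K ^+ 2)%:E)%E).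
  by apply: lee_wpmul2l; [rewrite lee_fin sqr_ge0|exact: h3].
rewrite -EFinM lee_fin pow2 [leRHS]mulrAC ler_wpM2r ?sqr_ge0//.
by apply: powT => //; apply/andP; split; lra.
Qed.

End radius.

Lemma instance_bounds n : exists2 C : R, 0 <= C &
  [/\ (forall N x y t, (0 < N)%N -> 0 < t <= T -> `|x| <= n%:R -> `|y| <= n%:R ->
        `|drift 0 t x - drift N t y| <= C * (t `^ (- p) * (eta N + `|x - y|)) /\
        (hs2 (fun u => diffusion 0 t x u - diffusion N t y u)%R <=
           (C * (t `^ (- p) * (eta N ^+ 2 + `|x - y| ^+ 2)))%:E)%E),
      (forall N x s t, 0 < s -> s <= t -> t <= T -> `|x| <= n%:R ->
        `|drift N t x - drift N s x| <= C * ((t - s) `^ theta * s `^ (- p)) /\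
        (hs2 (fun u => diffusion N t x u - diffusion N s x u)%R <=
           (C * ((t - s) `^ (2 * theta) * s `^ (- p)))%:E)%E),
      (forall N x t, 0 < t <= T -> `|x| <= n%:R ->
        `|drift N t x| <= C * t `^ (- (1 - theta)) /\
        (hs2 (diffusion N t x) <= (C * t `^ (- (1 - 2 * theta)))%:E)%E),
      (forall N t z, (0 < N)%N -> 0 <= t <= T -> `|z| <= n%:R ->
        `|start 0 t (emb (gam + theta) gam z) - start N t (emb (gam + theta) gam z)| <= C * eta N) &
      (forall N s t z, 0 <= s -> s <= t -> t <= T -> `|z| <= n%:R ->
        `|start N t (emb (gam + theta) gam z) - start N s (emb (gam + theta) gam z)| <= C * (t - s) `^ theta)].
Proof.
have [K K0 HK] := ball_constants n; have [M M0 HM] := spectral_rate.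
have T10 : 0 <= 1 + T by rewrite addr_ge0// ltW.
pose C1 := (1 + T) * (M + 1) * K; pose C2 := 4 * (1 + T) * (M ^+ 2 + 1) * K ^+ 2.
pose C3 := (1 + T) * K; pose C4 := (1 + T) * K ^+ 2; pose C5 := M * n%:R; pose C6 : R := n%:R.
have C10 : 0 <= C1 by rewrite !mulr_ge0// addr_ge0.
have C20 : 0 <= C2 by rewrite mulr_ge0 ?sqr_ge0// mulr_ge0 ?addr_ge0 ?sqr_ge0// mulr_ge0.
have C30 : 0 <= C3 by rewrite mulr_ge0.
have C40 : 0 <= C4 by rewrite mulr_ge0// sqr_ge0.
have C50 : 0 <= C5 by rewrite mulr_ge0.
have C60 : 0 <= C6 by [].
exists (C1 + C2 + C3 + C4 + C5 + C6); first by rewrite !addr_ge0.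
have pr (q t : R) (a : R) : 0 <= a -> 0 <= t `^ q * a by move=> a0; rewrite mulr_ge0 ?powR_ge0.
split.
- move=> N x y t N0 tT xn yn; split.
    have h : `|drift 0 t x - drift N t y| <= C1 * (t `^ (- p) * (eta N + `|x - y|)).
      by first [exact: (drift_diff K0 HK M0 HM)|exact: (drift_diff HK M0 HM)].
    by apply: (weaken _ _ h); [apply: pr; rewrite addr_ge0|lra].
  have h : (hs2 (fun u => diffusion 0 t x u - diffusion N t y u)%R <=
      (C2 * (t `^ (- p) * (eta N ^+ 2 + `|x - y| ^+ 2)))%:E)%E.
    by first [exact: (diffusion_diff K0 HK M0 HM)|exact: (diffusion_diff HK M0 HM)].
  apply: (le_trans h); rewrite lee_fin ler_wpM2r//.
    by apply: pr; rewrite addr_ge0 ?sqr_ge0.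
  by lra.
- move=> N x s t s0 st tT xn; split.
    have h : `|drift N t x - drift N s x| <= C3 * ((t - s) `^ theta * s `^ (- p)).
      by first [exact: (drift_time K0 HK)|exact: (drift_time HK)].
    by apply: (weaken _ _ h); [apply: pr; rewrite powR_ge0|lra].
  have h : (hs2 (fun u => diffusion N t x u - diffusion N s x u)%R <=
      (C4 * ((t - s) `^ (2 * theta) * s `^ (- p)))%:E)%E.
    by first [exact: (diffusion_time K0 HK)|exact: (diffusion_time HK)].
  apply: (le_trans h); rewrite lee_fin ler_wpM2r//.
    by apply: pr; rewrite powR_ge0.
  by lra.
- move=> N x t tT xn; split.
    have h : `|drift N t x| <= C3 * t `^ (- (1 - theta)).
      by first [exact: (drift_bound K0 HK)|exact: (drift_bound HK)].
    by apply: (weaken _ _ h); [exact: powR_ge0|lra].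
  have h : (hs2 (diffusion N t x) <= (C4 * t `^ (- (1 - 2 * theta)))%:E)%E.
    by first [exact: (diffusion_bound K0 HK)|exact: (diffusion_bound HK)].
  by apply: (le_trans h); rewrite lee_fin ler_wpM2r ?powR_ge0//; lra.
- move=> N t z N0 /andP[t0 _] zn.
  have := @sm0D N theta (M * eta N) t z (ltW th0) (mulr_ge0 M0 (eta0 N)) t0 (fun h => @HM N h N0).
  move=> h; apply: (@weaken _ C5); rewrite ?eta0//; first by lra.
  by rewrite (le_trans h)// /C5 [leRHS]mulrAC; apply: ler_wpM2l => //; exact: mulr_ge0.
- move=> N s t z s0 st tT zn.
  have th1 : 0 <= theta <= 1 by rewrite (ltW th0)/=; have := bt1; have /andP[b0 _] := beta1; lra.
  have st' : 0 <= s <= t by rewrite s0.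
  have h := @sm0T N theta t s z th1 st'.
  apply: (@weaken _ C6); rewrite ?powR_ge0//; first by lra.
  by rewrite (le_trans h)// mulrC ler_wpM2r ?powR_ge0.
Qed.

End instance.

Lemma eigenvalue_gap (R : realType) (I : Type) (D : set I) (lam : I -> R) :
  (ereal_sup [set (lam h)%:E | h in D] < 0)%E ->
  exists2 c : R, 0 < c & forall h, D h -> lam h <= - c.
Proof.
set s := ereal_sup _ => s0.
have le_s h : D h -> ((lam h)%:E <= s)%E by move=> Dh; apply: ereal_sup_ubound; exists h.
case: s s0 le_s => [r| |] //= s0 le_s.
  exists (- r); first by rewrite oppr_gt0 -lte_fin.
  by move=> h Dh; rewrite opprK -lee_fin; exact: le_s.
(* A supremum equal to -oo leaves no index, so any constant serves. *)
by exists 1 => // h /le_s; rewrite leeNy_eq.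
Qed.

Theorem corollary4p5
  (R : realType)
  (* H = Hr 0, its interpolation spaces, and U *)
  (Hr : R -> hilbertType R) (U : hilbertType R)
  (sepH : separable (Hr 0)) (sepU : separable U)
  (HH : set (Hr 0)) (HH_neq0 : HH !=set0) (HH_onb : orthonormal_basis HH)
  (T iota : R) (T_gt0 : 0 < T) (iota_gt0 : 0 < iota)
  (d : measure_display) (Om : measurableType d) (P : probability Om R)
  (Fl : R -> set (set Om)) (Fl_normal : normal_filtration P T Fl)
  (W : R -> U -> Om -> R) (W_wiener : cylindrical_wiener P T Fl W)
  (lam : Hr 0 -> R) (lam_lt0 : (ereal_sup [set (lam h)%:E | h in HH] < 0)%E)
  (A : Hr 0 -> Hr 0)
  (A_diag : forall v, diag_dom HH lam v ->
     has_sum HH (fun h => (lam h * inner h v) *: h) (A v))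
  (emb : forall r s : R, Hr r -> Hr s)
  (Hr_interp : interpolation_family emb HH lam)
  (S : forall r : R, R -> Hr r -> Hr r)
  (S_semigroup : semigroup_family emb (diag_dom HH lam) A S)
  (gam alpha beta chi : R)
  (alpha_itv : 0 <= alpha < 1) (beta_itv : 0 <= beta < 2^-1)
  (chi_itv : beta <= chi < 2^-1)
  (F : Hr gam -> Hr (gam - alpha)) (F_cont : continuous F)
  (B : Hr gam -> U -> Hr (gam - beta))
  (B_hs : forall x, hilbert_schmidt (B x))
  (B_cont : forall x, hs_norm (B y \- B x) @[y --> x] --> 0%E)
  (FB_lip : forall D : set (Hr gam), bounded_set D ->
     (holder_seminorm D 1 (fun x y => `|F x - F y|%:E) +
      holder_seminorm D 1 (fun x y => hs_norm (B x \- B y)%R) < +oo)%E)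
  (HN : nat -> set (Hr 0)) (HN_sub : forall N, HN N `<=` HH)
  (HN0 : HN 0%N = HH)
  (HN_rate : (ereal_sup
     [set (N%:R `^ iota)%:E *
          ereal_sup ([set (`|lam h|^-1)%:E | h in HH `\` HN N] `|` [set 0%E])
      | N in [set N : nat | (0 < N)%N]] < +oo)%E)
  (PH : nat -> Hr (Num.min 0 (gam - 1)) -> Hr (Num.min 0 (gam - 1)))
  (PH_bounded : forall N, bounded_operator (PH N))
  (PH_proj : forall N v, exists2 w, has_sum (HN N) (fun h => inner h v *: h) w &
     PH N (emb 0 (Num.min 0 (gam - 1)) v) = emb 0 (Num.min 0 (gam - 1)) w)
  (PU : nat -> U -> U) (PU_bounded : forall N, bounded_operator (PU N))
  (X : nat -> R -> Om -> Hr gam)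
  (X_adapted : forall N, adapted T Fl (X N))
  (X_cont : forall N w, {within `[0, T], continuous (fun t => X N t w)})
  (X_mild : forall N (t : R), 0 <= t <= T ->
     let m := Num.min 0 (gam - 1) in
     exists IF IB : Om -> Hr gam,
     [/\ {ae P, forall w, is_bochner_integral `[0, t[
            (fun s => restr emb gam
               (S m (t - s) (PH N (emb (gam - alpha) m (F (X N s w))))))
            (IF w)},
         is_ito_integral P Fl W t
            (fun s w u => restr emb gam
               (S m (t - s) (PH N (emb (gam - beta) m (B (X N s w) (PU N u))))))
            IB &
         {ae P, forall w, X N t w =
            restr emb gam (S m t (PH N (emb gam m (X 0%N 0 w)))) + IF w + IB w}])
  (theta : R) (theta_itv : 0 < theta < Num.min (1 - alpha) (2^-1 - beta))
  (X0_reg : P [set w | range (emb (gam + theta) gam) (X 0%N 0 w)] = 1%E)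
  (PU_rate : forall D : set (Hr gam), D !=set0 -> bounded_set D ->
     (ereal_sup [set ereal_sup
        [set (hs_norm (B v \o PU N) +
              (N%:R `^ (iota * theta))%:E *
              hs_norm (fun u => emb (gam - beta)%R (gam - chi)%R
                                  (B v (PU 0%N u - PU N u)%R))) *
             ((1 + `|v|)^-1)%:E
         | v in D]
      | N in [set N : nat | (0 < N)%N]] < +oo)%E) :
  forall delta eps : R, 0 <= delta < theta -> 0 < eps ->
    P [set w |
       (ereal_sup [set (N%:R `^ (iota * (theta - delta - eps)))%:E *
                       holder_norm `[0%R, T] delta (fun t => X 0%N t w - X N t w)%R
                   | N in [set N : nat | (0 < N)%N]] < +oo)%E] = 1%E.
Proof.
move=> delta eps dl eps0; pose m := Num.min 0 (gam - 1).
have [c0 c0_gt0 lamc] := eigenvalue_gap lam_lt0.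
have cHH : countable HH by apply: (orthonormal_countable sepH); exact: HH_onb.1.
have bonb := basis_onb HH_onb c0_gt0 lamc Hr_interp gam.
have /andP[th0] := theta_itv; rewrite lt_min => /andP[_ th1].
have /andP[b0 _] := beta_itv; have T00 : 0 <= (0 : R) <= T by rewrite lexx ltW.
have theta01 : 0 < theta < 2^-1 by rewrite th0/=; lra.
(* The constants for the initial term grow with the norm of the initial value in the smoother space.
   These events bound it by [n]; they belong to [Fl 0] by [closed_emb_ball], increase with [n], and
   exhaust an event of probability one. *)
pose Z n := [set w | exists2 z, X 0%N 0 w = emb (gam + theta) gam z & `|z| <= n%:R].
have FZ n : Fl 0 (Z n).
  apply: (X_adapted 0%N 0 T00 [set x | exists2 z, x = emb (gam + theta) gam z & `|z| <= n%:R]).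
  rewrite -[X in <<s _ >> X]setCK -setTD; apply: sigma_algebraCD.
  apply: sub_sigma_algebra; rewrite openC.
  exact: (closed_emb_ball HH_onb c0_gt0 lamc Hr_interp (ltW th0) (ler0n _ _)).
pose E := [set w | range (emb (gam + theta) gam) (X 0%N 0 w)].
have EZ : E = \bigcup_n Z n.
  apply/seteqP; split => w; last by move=> [n _ [z Xz _]]; exists z.
  move=> [z _ Xz]; exists (Num.truncn `|z|).+1 => //; exists z => //.
  exact: ltW (truncnS_gt _).
have mE : measurable E.
  by rewrite EZ; apply: bigcupT_measurable => n; exact: (Fl_measurable Fl_normal T00 (FZ n)).
have Z_ae : {ae P, forall w, exists n0, forall n, (n0 <= n)%N -> Z n w}.
  exists (~` E); split; first exact: measurableC.
    by rewrite probability_setC// X0_reg subee.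
  move=> w /= nZ Ew; apply: nZ; move: Ew => [z _ Xz].
  exists (Num.truncn `|z|).+1 => n hn; exists z => //.
  by rewrite (le_trans (ltW (truncnS_gt _)))// ler_nat.
pose f N t x := restr emb gam (S m t (PH N (emb (gam - alpha) m (F x)))).
pose Phi N t x u := restr emb gam (S m t (PH N (emb (gam - beta) m (B x (PU N u))))).
pose i0 N t w := restr emb gam (S m t (PH N (emb gam m (X 0%N 0 w)))).
have mild N t : 0 <= t <= T -> exists IF IB : Om -> Hr gam,
    [/\ {ae P, forall w, bochner_approx t (fun s => f N (t - s) (X N s w)) (IF w)},
      @ito_approx _ _ _ P Fl U W (Hr gam) t (fun s w u => Phi N (t - s) (X N s w) u) IB &
      {ae P, forall w, X N t w = i0 N t w + IF w + IB w}].
  move=> tT; have [IF [IB [b it e]]] := X_mild N t tT; exists IF, IB; split.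
  - by apply: filterS b => w; exact: is_bochner_integral_approx.
  - exact: is_ito_integral_approx it.
  - exact: e.
have bnd := instance_bounds HH_onb c0_gt0 lamc Hr_interp A_diag S_semigroup T_gt0 alpha_itv beta_itv
  chi_itv theta_itv HN_sub HN0 HN_rate PH_bounded PH_proj B_hs FB_lip PU_bounded PU_rate.
apply: (holder_rate T_gt0 Fl_normal W_wiener cHH bonb X_adapted X_cont mild
  (decay01 alpha_itv beta_itv chi_itv theta_itv) theta01 iota_gt0 FZ Z_ae _ dl eps0).
move=> n rho; have [C C0 [h1 h2 h3 h4 h5]] := bnd n; exists C => //; split => //.
- by move=> N t w N0 tT [z Xz zn]; rewrite /i0 Xz; exact: h4.
- by move=> N s t w s0 st tT [z Xz zn]; rewrite /i0 Xz; exact: h5.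
Qed.
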